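(* Let $(X_t)_{t\ge 0}$ be a regular jump Lévy process in $\mathbf{R}^d$ and let $V$ be a confining $X$-Kato class potential, with Feynman--Kac semigroup $\{T_t\}$, ground state eigenvalue $\lambda_0$ and ground state $\varphi_0$ (all as defined in the context). Then for every $\eta\ge0$ such that $\lambda_0+\eta>0$ there exist constants $C_8=C_8(X,V,\eta)$, $C_9=C_9(X,V,\eta)$ and a radius $R=R(X,V,\eta)>0$ such that $$C_8\,G^{V+\eta}_{B(x,1)}\mathbf{1}(x)\,\nu(x)\le\varphi_0(x)\le C_9\,G^{V+\eta}_{B(x,1)}\mathbf{1}(x)\,\nu(x),\qquad |x|\ge R.$$
   Context: Conventions. $(X_t)_{t\ge0}$ is a Lévy process in $\mathbf{R}^d$, $d\ge1$; $\mathbf{P}^x,\mathbf{E}^x$ refer to the process started at $x$. $B(x,r)$ is the open ball; $\mathbf{1}$ is the function identically $1$. $C, C_i$ denote positive constants; $C(X,a,\dots)$ depends only on the process (and the dimension $d$) and on the listed parameters, and similarly for radii. $f\asymp Cg$ means $C^{-1}g\le f\le Cg$. Regular jump Lévy process: a Lévy process satisfying (A1)--(A3). (A1) $(X_t)$ is symmetric, its Lévy measure is absolutely continuous with a strictly positive density $\nu$, and: (1) for every $0<r\le 1/2$ there is $C_1=C_1(X,r)\ge1$ with $\nu(x)\asymp C_1\nu(y)$ for $r\le|y|\le|x|\le|y|+1$; (2) there is $C_2=C_2(X)\ge1$ with $\nu(x)\le C_2\nu(y)$ for $1/2\le|y|\le|x|$; (3) there is $C_3=C_3(X)\ge1$ with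 $\int_{|z-x|>1/2,\,|z-y|>1/2}\nu(x-z)\nu(z-y)\,dz\le C_3\nu(x-y)$ for $|y-x|\ge1$. (A2) $(X_t)$ is strong Feller, equivalently it has transition densities $p(t,x,y)=p(t,y-x)$ for $t>0$; moreover there are $t_b>0$ and a constant $C(X,t_b)$ with $0<p(t_b,x)\le C(X,t_b)$ for all $x\in\mathbf{R}^d$. (A3) For all $0<p<q<R\le1$, $\sup_{x\in B(0,p)}\sup_{y\in B(0,q)^c}G_{B(0,R)}(x,y)<\infty$, where for a bounded open set $D$, $G_D(x,y)=\int_0^\infty p_D(t,x,y)\,dt$ for $x,y\in D$ (and $0$ otherwise), and $p_D$ is the transition density of the process killed upon exiting $D$. Potentials. A Borel function $V:\mathbf{R}^d\to\mathbf{R}$ belongs to $\mathcal{K}^X$ if $\lim_{t\to0}\sup_x\mathbf{E}^x[\int_0^t|V(X_s)|ds]=0$, and to $\mathcal{K}^X_{\mathrm{loc}}$ if $V\mathbf{1}_B\in\mathcal{K}^X$ for every ball $B$. $V$ is an $X$-Kato class potential if $V_-\in\mathcal{K}^X$ and $V_+\in\mathcal{K}^X_{\mathrm{loc}}$. It is confining if also $V(x)\to\infty$ as $|x|\to\infty$. Feynman--Kac semigroup: $T_tf(x)=\mathbf{E}^x[e^{-\int_0^tV(X_s)ds}f(X_t)]$, $t>0$. Whenever $(X_t)$ is a regular jump Lévy process and $V$ is a confining $X$-Kato class potential, $\{T_t\}$ is a strongly continuous semigroup of symmetric compact operators on $L^2(\mathbf{R}^d)$; there is an orthonormal basis $\{\varphi_n\}_{n\ge0}$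 of $L^2(\mathbf{R}^d)$ with $T_t\varphi_n=e^{-\lambda_nt}\varphi_n$, $t>0$, where $\lambda_0<\lambda_1\le\lambda_2\le\cdots\to\infty$; each $\varphi_n$ is (taken to be) bounded and continuous, and $\varphi_0$ (the ground state) is chosen strictly positive. $V$-Green operator: for a potential $V$, an open set $D$ with first exit time $\tau_D=\inf\{t\ge0:X_t\notin D\}$ and $f$ bounded or nonnegative Borel, $G^V_Df(x)=\mathbf{E}^x\big[\int_0^{\tau_D}e^{-\int_0^tV(X_s)ds}f(X_t)\,dt\big]$, $x\in D$; $G^{V+\eta}_D$ is the same with $V$ replaced by $V+\eta$. *)

(* Defs.v *)
From HB Require Import structures.
From mathcomp Require Import all_boot all_order all_algebra.
From mathcomp Require Import all_classical all_reals all_analysis.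
From mathcomp Require Import measurable_realfun.
Set Implicit Arguments. Unset Strict Implicit. Unset Printing Implicit Defensive.
Import Order.TTheory GRing.Theory Num.Theory.
Import numFieldNormedType.Exports.
Local Open Scope classical_set_scope.
Local Open Scope ring_scope.

(* Borel sigma-algebra of the entrywise topology. *)
Section borel_matrix.
Variables (R : realType) (m n : nat).
Local Notation G := (@open 'M[R]_(m, n)).
HB.instance Definition _ := @isMeasurable.Build default_measure_display 'M[R]_(m, n)
  <<s G >> (@sigma_algebra0 _ setT G) (@sigma_algebraC _ G)
  (@sigma_algebra_bigcup _ setT G).

Lemma open_measurable_mx (U : set 'M[R]_(m, n)) : open U -> measurable U.
Proof. exact: sub_sigma_algebra. Qed.

Lemma measurable_coord i j :
  measurable_fun [set: 'M[R]_(m, n)] (fun A => A i j : R).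
Proof.
apply: (measurability _ (RGenOpens.measurableE R)).
move=> _ [_ [x [y ->]] <-]; rewrite setTI; apply: open_measurable_mx.
apply: open_comp; last exact: interval_open.
by move=> A _; exact: coord_continuous.
Qed.

Definition rat_box (q : 'M[rat * rat]_(m, n)) : set 'M[R]_(m, n) :=
  [set A | forall i j, ball (ratr (q i j).1 : R) (ratr (q i j).2) (A i j)].

Lemma open_bigcup_rat_box (U : set 'M[R]_(m, n)) : open U ->
  U = \bigcup_(q in [set q | rat_box q `<=` U]) rat_box q.
Proof.
move=> oU; apply/seteqP; split => [A UA|A [q /= qU]]; last exact: qU.
have [P nP PU] : nbhs A U by exact: open_nbhs_nbhs.
have H i j : {cr : rat * rat | ball (ratr cr.1 : R) (ratr cr.2) (A i j) /\
    ball (ratr cr.1 : R) (ratr cr.2) `<=` P i j}.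
  apply/cid.
  have Aij : A i j \in (interior (P i j) : set R) by rewrite inE; exact: nP.
  have [c [r []]] := open_subball_rat (@open_interior _ (P i j)) Aij.
  rewrite inE => Bc BP; exists (c, r); split => // z /BP; exact: interior_subset.
exists (\matrix_(i, j) projT1 (cid (ex_intro _ _ (projT2 (H i j))))).
  by move=> B /= bB; apply: PU => i j; have := bB i j; rewrite mxE;
    case: cid => cr /= [_]; exact.
by move=> i j; rewrite mxE; case: cid => cr /= [].
Qed.

Lemma measurable_fun_mx d (T : measurableType d) (D : set T)
    (f : T -> 'M[R]_(m, n)) :
  (forall i j, measurable_fun D (fun t => f t i j)) -> measurable_fun D f.
Proof.
move=> mf mD; apply: (measurability (@open 'M[R]_(m, n))) => //.
move=> _ [U oU <-]; rewrite [U]open_bigcup_rat_box// bigcup_mkcond.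
rewrite preimage_bigcup setI_bigcupr; apply: countable_bigcupT_measurable.
  exact: countableP.
move=> q; case: ifPn => _; last by rewrite preimage_set0 setI0.
rewrite (_ : _ `&` _ = \bigcap_(ij : option ('I_m * 'I_n))
    if ij is Some ij then D `&` (fun t => f t ij.1 ij.2) @^-1`
      ball (ratr (q ij.1 ij.2).1 : R) (ratr (q ij.1 ij.2).2) else D).
  apply: fin_bigcap_measurable => [|[[i j]|] _ //]; first exact: finite_finset.
  apply: mf => //.
  exact: measurable_ball.
apply/seteqP; split => [t [Dt bt] [[i j]|] _|t H] //=.
split; first exact: (H None I).
by move=> i j; exact: (H (Some (i, j)) I).2.
Qed.
End borel_matrix.

(* Lebesgue measure on R^n, by induction on n: push the product of Lebesgue
   measures on R and R^n forward along (x, v) |-> x :: v. *)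
Section lebesgue_rV.
Variable R : realType.

Definition cons_rV n (xv : measurableTypeR R * 'rV[R]_n) : 'rV[R]_n.+1 :=
  \row_i oapp (xv.2 ord0) xv.1 (unlift ord0 i).

Lemma measurable_cons_rV n : measurable_fun setT (@cons_rV n).
Proof.
apply: measurable_fun_mx => i j.
rewrite (_ : (fun _ => _) = fun xv : measurableTypeR R * 'rV[R]_n =>
    oapp (xv.2 ord0) xv.1 (unlift ord0 j)); last first.
  by apply/funext => xv; rewrite mxE.
case: (unlift ord0 j) => [k|] /=; last exact: measurable_fst.
by apply: (measurableT_comp (measurable_coord ord0 k)) measurable_snd.
Qed.

Section step.
Variables (n : nat) (mu : {sigma_finite_measure set 'rV[R]_n -> \bar R}).

Definition lebesgue_rV_step : set 'rV[R]_n.+1 -> \bar R :=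
  pushforward (lebesgue_measure \x mu)%E (@cons_rV n).

Let mcons := @measurable_cons_rV n.

Let step0 : lebesgue_rV_step set0 = 0%E.
Proof. exact: measure0. Qed.

Let step_ge0 A : (0 <= lebesgue_rV_step A)%E.
Proof. exact: measure_ge0. Qed.

Let step_sigma_additive : semi_sigma_additive lebesgue_rV_step.
Proof. exact: measure_semi_sigma_additive. Qed.

HB.instance Definition _ := isMeasure.Build _ _ _
  lebesgue_rV_step step0 step_ge0 step_sigma_additive.

Let step_sigma_finite : sigma_finite setT lebesgue_rV_step.
Proof.
have /sigma_finiteP[F [TF ndF Foo]] := sigma_finiteT (@lebesgue_measure R).
have /sigma_finiteP[G [TG ndG Goo]] := sigma_finiteT mu.
have mhead : measurable_fun setT
    (fun v : 'rV[R]_n.+1 => v ord0 ord0 : measurableTypeR R).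
  exact: measurable_coord.
have mtail : measurable_fun setT
    (fun v : 'rV[R]_n.+1 => \row_j v ord0 (lift ord0 j) : 'rV[R]_n).
  apply: measurable_fun_mx => i j.
  rewrite (_ : (fun _ => _) = fun v : 'rV[R]_n.+1 => v ord0 (lift ord0 j)).
    exact: measurable_coord.
  by apply/funext => v; rewrite mxE.
exists (fun k => [set v : 'rV[R]_n.+1 | F k (v ord0 ord0)] `&`
                 [set v | G k (\row_j v ord0 (lift ord0 j))]).
  apply/seteqP; split => // v _.
  have [k _ Fk] : (\bigcup_i F i) (v ord0 ord0) by rewrite -TF.
  have [l _ Gl] : (\bigcup_i G i) (\row_j v ord0 (lift ord0 j)) by rewrite -TG.
  exists (maxn k l) => //; split.
    by have /subsetPset := ndF _ _ (leq_maxl k l); exact.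
  by have /subsetPset := ndG _ _ (leq_maxr k l); exact.
move=> k; have [mF Fk] := Foo k; have [mG Gk] := Goo k; split.
  apply: measurableI; rewrite -[X in measurable X]setTI.
    exact: mhead.
  exact: mtail.
rewrite /lebesgue_rV_step /pushforward (_ : _ @^-1` _ = F k `*` G k).
  by rewrite product_measure1E// lte_mul_pinfty// ge0_fin_numE.
apply/seteqP; split => -[x u] /=; rewrite mxE unlift_none /=;
  by rewrite (_ : \row_j _ = u)//; apply/rowP => j; rewrite !mxE liftK.
Qed.

HB.instance Definition _ :=
  Measure_isSigmaFinite.Build _ _ _ lebesgue_rV_step step_sigma_finite.
End step.

Fixpoint lebesgue_rV n : {sigma_finite_measure set 'rV[R]_n -> \bar R} :=
  if n is n'.+1 then lebesgue_rV_step (lebesgue_rV n') else \d_(0 : 'rV[R]_0).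

Lemma lebesgue_rV_box n (A : 'I_n -> set (measurableTypeR R)) :
  (forall i, measurable (A i)) ->
  lebesgue_rV n [set v | forall i, A i (v ord0 i)] =
  (\prod_(i < n) lebesgue_measure (A i))%E.
Proof.
elim: n A => [A _|n IH A mA] /=.
  by rewrite big_ord0 diracE mem_set// => -[].
have BE : [set v : 'rV[R]_n | forall i : 'I_n, A (lift ord0 i) (v ord0 i)] =
    \bigcap_(i : 'I_n) [set v | A (lift ord0 i) (v ord0 i)].
  by apply/seteqP; split => v /= Av i; [move=> _|]; exact: Av.
have mB : measurable
    [set v : 'rV[R]_n | forall i : 'I_n, A (lift ord0 i) (v ord0 i)].
  rewrite BE; apply: fin_bigcap_measurable => [|i _]; first exact: finite_finset.
  rewrite -[X in measurable X]setTI.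
  exact: (@measurable_coord R 1 n ord0 i measurableT _ (mA (lift ord0 i))).
rewrite big_ord_recl -(IH (fun i => A (lift ord0 i)))//.
rewrite /lebesgue_rV_step /pushforward -product_measure1E//.
congr (product_measure1 _ _ _); apply/seteqP; split => -[x v] /=.
  move=> Axv; split => [|i].
    by have := Axv ord0; rewrite mxE unlift_none.
  by have := Axv (lift ord0 i); rewrite mxE liftK.
by move=> [Ax Av] i; rewrite mxE; case: unliftP => [j ->|->] //=; exact: Av.
Qed.
End lebesgue_rV.

Section euclidean.
Variables (R : realType) (d : nat).
Implicit Types x y : 'rV[R]_d.

Definition dotv x y : R := \sum_i x ord0 i * y ord0 i.

(* The library's norm on 'rV[R]_d is the sup norm; the Euclidean one is
   needed here. *)
Definition enorm x : R := Num.sqrt (dotv x x).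

Definition eball x (r : R) : set 'rV[R]_d := [set y | enorm (y - x) < r].
End euclidean.

(* The process X is indexed by R, but only times t >= 0 are ever used.  X is
   the process under P^0; P^x and E^x are expressed through the translated
   process x + X, which has law P^x. *)
Section levy_process.
Context (disp : measure_display) (Omega : measurableType disp) (R : realType).
Context (d : nat) (P : probability Omega R) (X : R -> Omega -> 'rV[R]_d).
Local Notation Rd := 'rV[R]_d.

Definition increment (s t : R) (w : Omega) : Rd := X t w - X s w.

Definition independent_increments : Prop :=
  forall (n : nat) (t : nat -> R) (A : nat -> set Rd),
    0 <= t 0%N -> {homo t : i j / (i <= j)%N >-> i <= j} ->
    (forall i, measurable (A i)) ->
    P (\bigcap_(i < n) (increment (t i) (t i.+1) @^-1` A i)) =
    (\prod_(i < n) P (increment (t i) (t i.+1) @^-1` A i))%E.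

Definition stationary_increments : Prop :=
  forall (s t : R) (A : set Rd), 0 <= s -> 0 <= t -> measurable A ->
    P (increment s (s + t) @^-1` A) = P (X t @^-1` A).

Definition cadlag_paths : Prop := forall w,
  (forall t, 0 <= t -> X s w @[s --> t^'+] --> X t w) /\
  (forall t, 0 < t -> cvg (X s w @[s --> t^'-])).

Definition is_levy_process : Prop :=
  [/\ forall t, 0 <= t -> measurable_fun setT (X t),
      {ae P, forall w, X 0 w = 0},
      independent_increments,
      stationary_increments &
      cadlag_paths].

Definition symmetric_process : Prop :=
  forall (t : R) (A : set Rd), 0 <= t -> measurable A ->
    P ((fun w => - X t w) @^-1` A) = P (X t @^-1` A).

(* M is the Levy measure in the Levy-Khintchine representation
     E exp(i xi . X_t) = exp(- t psi(xi)),
     psi(xi) = - i b . xi + (xi . A xi) / 2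
       + \int (1 - exp(i xi . z) + i (xi . z) 1_{|z| < 1}) M(dz),
   written through the real and imaginary parts of both sides. *)
Definition is_levy_measure (M : {measure set Rd -> \bar R}) : Prop :=
  [/\ M [set 0] = 0%E,
      (\int[M]_z (Num.min 1 (enorm z ^+ 2))%:E < +oo)%E &
      exists (b : Rd) (A : 'M[R]_d),
        [/\ A^T = A,
            forall xi, 0 <= dotv (xi *m A) xi &
            forall (t : R) (xi : Rd), 0 <= t ->
              let re_psi := dotv (xi *m A) xi / 2
                + \int[M]_z (1 - cos (dotv xi z)) in
              let im_psi :=
                \int[M]_z (dotv xi z * \1_(eball 0 1) z - sin (dotv xi z))
                - dotv b xi in
              ('E_P[fun w => cos (dotv xi (X t w))] =
                 (expR (- (t * re_psi)) * cos (t * im_psi))%:E)%E /\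
              ('E_P[fun w => sin (dotv xi (X t w))] =
                 (- (expR (- (t * re_psi)) * sin (t * im_psi)))%:E)%E]].

Local Notation leb := (lebesgue_rV R d).

Definition is_levy_density (nu : Rd -> R) : Prop :=
  measurable_fun setT nu /\
  exists M : {measure set Rd -> \bar R}, is_levy_measure M /\
    forall A, measurable A -> M A = (\int[leb]_(x in A) (nu x)%:E)%E.

Definition assumption_A1 (nu : Rd -> R) : Prop :=
  [/\ symmetric_process,
      is_levy_density nu /\ (forall x, x != 0 -> 0 < nu x),
      forall r : R, 0 < r <= 1 / 2 -> exists2 C1 : R, 1 <= C1 &
        forall x y, r <= enorm y -> enorm y <= enorm x ->
          enorm x <= enorm y + 1 -> C1^-1 * nu y <= nu x <= C1 * nu y,
      exists2 C2 : R, 1 <= C2 &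
        forall x y, 1 / 2 <= enorm y -> enorm y <= enorm x ->
          nu x <= C2 * nu y &
      exists2 C3 : R, 1 <= C3 &
        forall x y, 1 <= enorm (y - x) ->
          (\int[leb]_(z in [set z | (1 / 2 < enorm (z - x))%R /\
                                    (1 / 2 < enorm (z - y))%R])
              (nu (x - z) * nu (z - y))%:E <= (C3 * nu (x - y))%:E)%E].

Definition strong_feller : Prop :=
  forall (t : R) (f : Rd -> R), 0 < t -> measurable_fun setT f ->
    (exists M, forall x, `|f x| <= M) ->
    continuous (fun x : Rd => \int[P]_w f (x + X t w)).

Definition is_transition_density (p : R -> Rd -> R) : Prop :=
  forall t : R, 0 < t ->
    [/\ measurable_fun setT (p t),
        forall x, 0 <= p t x &
        forall (x : Rd) (A : set Rd), measurable A ->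
          P [set w | A (x + X t w)] = (\int[leb]_(y in A) (p t (y - x))%:E)%E].

Definition assumption_A2 : Prop :=
  strong_feller /\
  exists2 p, is_transition_density p &
    exists tb C : R, 0 < tb /\ forall x, 0 < p tb x <= C.

(* First exit time from D of the process started at x; +oo if there is no
   exit. *)
Definition exit_time (D : set Rd) (x : Rd) (w : Omega) : \bar R :=
  ereal_inf [set t%:E | t in [set t : R | 0 <= t /\ ~ D (x + X t w)]].

(* Transition density on D of the process killed upon exiting D.  Symmetry and
   the Chapman-Kolmogorov equation, imposed at every point, select among the
   versions of the density the usual one, which may take the value +oo.
   The event {t < tau_D} need only be measurable for the completion of P, hence
   the integral of an indicator: integrals of nonnegative functions are suprema
   over simple functions below, so this is its completed probability. *)
Definition is_killed_density (D : set Rd) (pD : R -> Rd -> Rd -> \bar R) :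
    Prop :=
  [/\ measurable_fun [set z : (measurableTypeR R * Rd) * Rd |
          [/\ 0 < z.1.1, D z.1.2 & D z.2]]
        (fun z => pD z.1.1 z.1.2 z.2),
      forall t x y, 0 < t -> D x -> D y ->
        (0 <= pD t x y)%E /\ pD t x y = pD t y x,
      forall s t x y, 0 < s -> 0 < t -> D x -> D y ->
        pD (s + t) x y = (\int[leb]_(z in D) (pD s x z * pD t z y))%E &
      forall (t : R) (x : Rd) (A : set Rd), 0 < t -> D x -> measurable A ->
        (\int[P]_w (\1_[set w | A (x + X t w) /\ (t%:E < exit_time D x w)%E] w)%:E
         = \int[leb]_(y in D `&` A) pD t x y)%E].

Definition green_function (D : set Rd) (pD : R -> Rd -> Rd -> \bar R)
    (x y : Rd) : \bar R :=
  (if (x \in D) && (y \in D)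
   then \int[lebesgue_measure]_(t in `]0%R, +oo[) pD t x y else 0)%E.

Definition assumption_A3 : Prop :=
  forall p q r : R, 0 < p -> p < q -> q < r -> r <= 1 ->
    exists2 pD, is_killed_density (eball 0 r) pD &
      (ereal_sup [set green_function (eball 0 r) pD xy.1 xy.2 |
                  xy in eball 0%R p `*` ~` eball 0%R q] < +oo)%E.

Definition regular_jump_levy_process (nu : Rd -> R) : Prop :=
  [/\ is_levy_process, assumption_A1 nu, assumption_A2 & assumption_A3].

Implicit Types V : Rd -> R.

Definition kato_class V : Prop :=
  measurable_fun setT V /\
  ereal_sup (range (fun x : Rd =>
    \int[P]_w \int[lebesgue_measure]_(s in `[0%R, t]) `|V (x + X s w)|%:E)%E)
    @[t --> 0^'+] --> 0%E.

Definition kato_class_loc V : Prop :=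
  measurable_fun setT V /\
  forall (x : Rd) (r : R), 0 < r ->
    kato_class (fun y => V y * \1_(eball x r) y).

Definition X_kato_potential V : Prop :=
  [/\ measurable_fun setT V, kato_class V^\- & kato_class_loc V^\+].

Definition confining V : Prop :=
  forall M : R, exists r : R, forall x, r <= enorm x -> M <= V x.

(* exp(- \int_0^t V(x + X_s) ds) *)
Definition fk_weight V (x : Rd) (t : R) (w : Omega) : \bar R :=
  expeR (- \int[lebesgue_measure]_(s in `[0%R, t]) (V (x + X s w)%R)%:E)%E.

Definition feynman_kac V (t : R) (f : Rd -> R) (x : Rd) : \bar R :=
  (\int[P]_w (fk_weight V x t w * (f (x + X t w)%R)%:E))%E.

Definition green_operator V (D : set Rd) (f : Rd -> R) (x : Rd) : \bar R :=
  (\int[P]_w \int[lebesgue_measure]_(t in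
      [set t : R | (0 <= t)%R /\ t%:E < exit_time D x w])
    (fk_weight V x t w * (f (x + X t w)%R)%:E))%E.

Definition L2_dot (f g : Rd -> R) : R := \int[leb]_x (f x * g x).

Definition L2_orthonormal_basis (phi : nat -> Rd -> R) : Prop :=
  [/\ forall n, phi n \in Lfun leb 2%:E,
      forall m n, L2_dot (phi m) (phi n) = (m == n)%:R &
      forall f : Rd -> R, f \in Lfun leb 2%:E ->
        'N[leb]_2%:E[EFin \o
          (fun x => (f x - \sum_(k < n) L2_dot f (phi k) * phi k x)%R)]%E
        @[n --> \oo] --> 0%E].

Definition feynman_kac_eigenbasis V (lam : nat -> R) (phi : nat -> Rd -> R) :
    Prop :=
  [/\ L2_orthonormal_basis phi,
      forall n (t : R), 0 < t ->
        {ae leb, forall x,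
          feynman_kac V t (phi n) x = (expR (- (lam n * t)) * phi n x)%:E},
      [/\ lam 0%N < lam 1%N, forall n, (0 < n)%N -> lam n <= lam n.+1 &
          lam n @[n --> \oo] --> +oo],
      forall n, continuous (phi n) /\ exists M, forall x, `|phi n x| <= M &
      forall x, 0 < phi 0%N x].

End levy_process.

(* Main.v *)
(* Write U = V - lam_0 = U+ - U- and beta = lam_0 + eta > 0.  Because phi_0 is
   fixed by the Feynman-Kac semigroup of U, Duhamel's formula up to the exit time
   tau from a small ball around x, truncated at a short time T, reads
     phi_0(x) = beta E[int_0^tau e(t) phi_0(X_t) dt] + E[e(tau) phi_0(X_tau)],
   with e(t) = exp(- int_0^t (U + beta)(X_s) ds).  For |x| large U is nonnegative
   near x and g(x) = E[int_0^tau e(t) dt] is comparable with the V-Green operator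
   applied to 1.
   Lower bound: phi_0 dominates a bump near the origin; reaching it needs a jump of
   size about |x|, which happens at a rate comparable with nu(x).
   Upper bound: let kappa be nu away from 0 and 1 near 0.  If phi_0 <= S (kappa + s),
   the formula gives phi_0(x) <= C S (kappa(x) + s) g(x) for |x| large: short exits
   are controlled by Dynkin's formula for sum_i (1 - cos((z - x)_i)), long jumps by
   the bound kappa * (nu 1_far) <= C kappa that (A1) provides.  As g(x) -> 0, the
   supremum of phi_0 / (kappa + s) is bounded uniformly in s > 0, hence
   phi_0 <= C kappa, and one more application of the estimate concludes.
   Jumps enter only through the vague convergence of h^{-1} P(X_h in dz) to nu(z) dz
   off the origin, obtained from the characteristic function; exit times are
   evaluated at dyadic times, so only the simple Markov property is used. *)
Require Import Defs.
From HB Require Import structures.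
From mathcomp Require Import all_boot all_order all_algebra.
From mathcomp Require Import all_classical all_reals all_analysis.
From mathcomp Require Import measurable_realfun.
From mathcomp Require Import ring lra.
Set Implicit Arguments. Unset Strict Implicit. Unset Printing Implicit Defensive.
Import Order.TTheory GRing.Theory Num.Theory.
Import numFieldNormedType.Exports.
Local Open Scope classical_set_scope.
Local Open Scope ring_scope.

(** * Path space and the Markov property *)

Section path_space.
Context (R : realType) (d : nat).
Local Notation Rd := 'rV[R]_d.

(** Uniform integrability of the weight [exp(int U-)] comes from Khasminskii's lemma, which works
    over short times only; hence the truncation of exit times at a [T] that is small against the
    Kato bound of [U-]. Exit identities come from cutting the integral over [[0, tau + h]] in two
    ways, at [h] and at [tau]. The Markov property is applied under the time integral, on the event
    that the ball has not been left by time [t]; division by [h] and right-continuity turn the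
    window after [tau] into the value at the exit. This gives Duhamel's formula and Dynkin's
    inequality without domains of generators. Two radii occur. The lower bound uses the unit ball.
    The upper bound uses radius [1/3], because exits at a distance between [1/3] and 1 are charged
    to the cosine functional and only longer ones to the Levy density. The Green operator of the
    unit ball lies between the truncated quantity for radius [1/3] and a multiple of the one for
    radius 1, so each bound meets it from the right side. *)

Definition coord_sets : set (set (nat -> Rd)) :=
  [set B | exists i A, measurable A /\ B = (fun z => z i) @^-1` A].

(** Only countably many times are recorded, which keeps the sigma-algebra countably generated;
    right-continuity recovers all other times through [pos]. *)
Definition path := g_sigma_algebraType coord_sets.

Lemma measurable_path_coord i : measurable_fun setT (fun z : path => z i).
Proof.
by move=> _ A mA; rewrite setTI; apply: sub_sigma_algebra; exists i, A.
Qed.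

Lemma measurable_fun_path dT (T : measurableType dT) (D : set T) (f : T -> path) :
  (forall i, measurable_fun D (fun t => f t i)) -> measurable_fun D f.
Proof.
move=> mf mD; refine (@measurability _ _ T path D f coord_sets erefl _ mD).
by move=> _ [_ [i [A [mA ->]]] <-]; exact: mf.
Qed.

Definition cylinders : set (set path) :=
  [set B | exists n (A : nat -> set Rd), (forall i, measurable (A i)) /\
     B = [set z | forall i, (i < n)%N -> A i (z i)]].

Lemma cylinders_setI : setI_closed cylinders.
Proof.
move=> _ _ [n [A [mA ->]]] [m [B [mB ->]]].
exists (maxn n m), (fun i => (if (i < n)%N then A i else setT) `&`
  (if (i < m)%N then B i else setT)); split.
  by move=> i; apply: measurableI; case: ifP.
apply/seteqP; split => z /=.
  move=> [zA zB] i _; split; first by case: ifP => // /zA.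
  by case: ifP => // /zB.
move=> zAB; split => i im.
  by have := zAB i; rewrite im leq_max im /= => /(_ isT) [].
by have := zAB i; rewrite im leq_max im orbT /= => /(_ isT) [].
Qed.

Lemma cylinders_generate : @measurable _ path = <<s cylinders >>.
Proof.
apply/seteqP; split.
  apply: smallest_sub => [|_ [i [A [mA ->]]]]; first exact: smallest_sigma_algebra.
  apply: sub_sigma_algebra.
  exists i.+1, (fun j => if j == i then A else setT); split => [j|].
    by case: ifP.
  apply/seteqP; split => z /= zA.
    by move=> j _; case: eqP => // ->.
  by have := zA i (ltnSn i); rewrite eqxx.
apply: smallest_sub; first exact: sigma_algebra_measurable.
move=> _ [n [A [mA ->]]].
rewrite (_ : [set _ | _] = \bigcap_(i in `I_n) ((fun z : path => z i) @^-1` A i)).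
  apply: fin_bigcap_measurable => [|i _]; first exact: finite_II.
  by rewrite -[X in measurable X]setTI; exact: measurable_path_coord.
by apply/seteqP; split => z /= zA i; exact: zA.
Qed.

Lemma path_measure_unique (m1 m2 : {measure set path -> \bar R}) :
  (forall C, cylinders C -> m1 C = m2 C) -> (m1 setT < +oo)%E ->
  forall A, measurable A -> m1 A = m2 A.
Proof.
move=> m12 fm1; apply: (measure_unique cylinders (fun=> setT)) => //.
- exact: cylinders_generate.
- exact: cylinders_setI.
- by move=> _; exists 0%N, (fun=> setT); split => //; apply/seteqP; split.
- by apply/seteqP; split => // z _; exists 0%N.
Qed.

(* Coordinate [m] of a path is its value at the dyadic time [dtime m]. *)
Definition dtime (m : nat) : R :=
  if unpickle m is Some (n, k) then k%:R / 2 ^+ n else 0.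

Definition dindex (n k : nat) : nat := pickle (n, k).

Lemma dtimeE n k : dtime (dindex n k) = k%:R / 2 ^+ n.
Proof. by rewrite /dtime /dindex pickleK. Qed.

Lemma dtime_ge0 m : 0 <= dtime m.
Proof. by rewrite /dtime; case: unpickle => // -[n k]; rewrite divr_ge0// exprn_ge0. Qed.

Definition dy T (X : R -> T -> Rd) (w : T) : path := fun m => X (dtime m) w.

(** For [t >= 0], the first point of mesh [2^-n] strictly after [t]. Strictness allows limits along
    [t^'+], a filter that avoids [t] itself. *)
Definition approx_index (n : nat) (t : R) : nat :=
  dindex n (Num.truncn (2 ^+ n * t)).+1.

(** A limit superior is defined and measurable for every sequence [z]; on a right-continuous path it
    is the limit. An infinite value is sent to 0 by [fine]. *)
Definition pos (z : path) (t : R) : Rd :=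
  \row_j fine (limn_esup (fun n => (z (approx_index n t) ord0 j)%:E)).

Lemma measurable_pos :
  measurable_fun setT (fun tz : measurableTypeR R * path => pos tz.2 tz.1).
Proof.
apply: measurable_fun_mx => i j.
rewrite (_ : (fun _ => _) = fun tz : measurableTypeR R * path =>
    fine (limn_esup (fun n => (tz.2 (approx_index n tz.1) ord0 j)%:E))); last first.
  by apply/funext => tz; rewrite mxE.
apply: (measurableT_comp (fine_measurable measurableT)).
apply: measurable_fun_limn_esup => n.
apply/measurable_EFinP; apply: (measurableT_comp (measurable_coord _ _)).
(* The index depends on [t] through an integer whose level sets are intervals; on each of them [z]
   is read at a fixed coordinate. *)
move=> _ A mA; rewrite setTI.
rewrite (_ : _ @^-1` A = \bigcup_k ([set t : measurableTypeR R | Num.truncn (2 ^+ n * t) = k] `*`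
    ((fun z : path => z (dindex n k.+1)) @^-1` A))); last first.
  apply/seteqP; split => -[t z] /=.
    by move=> Az; exists (Num.truncn (2 ^+ n * t)).
  by move=> [k _ [/= <-]].
apply: bigcupT_measurable => k; apply: measurableX; last first.
  by rewrite -[X in measurable X]setTI; exact: measurable_path_coord.
apply: is_interval_measurable => x y /= xk yk z /andP[xz zy] /=.
apply/eqP; rewrite eqn_leq -{1}yk -{1}xk.
have h2 : (0 : R) <= 2 ^+ n by rewrite exprn_ge0.
by apply/andP; split; apply: le_truncn; rewrite ler_wpM2l.
Qed.

Lemma approx_index_gt n t : t < dtime (approx_index n t).
Proof.
rewrite dtimeE ltr_pdivlMr ?exprn_gt0// mulrC.
by have := truncnS_gt (2 ^+ n * t).
Qed.

Lemma approx_index_cvg t : 0 <= t -> dtime (approx_index n t) @[n --> \oo] --> t.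
Proof.
move=> t0; apply: (@squeeze_cvgr _ _ _ _ (fun=> t) (fun n => t + (2 ^+ n)^-1)).
- near=> n; rewrite (ltW (approx_index_gt _ _))/=.
  rewrite dtimeE ler_pdivrMr ?exprn_gt0// mulrDl mulVf ?expf_neq0//.
  by rewrite -natr1 lerD2r mulrC truncn_le// mulr_ge0// exprn_ge0.
- exact: cvg_cst.
- rewrite -[X in _ --> X]addr0; apply: cvgD; first exact: cvg_cst.
  have := @cvg_geometric R 1 (2^-1) _; rewrite /geometric /=.
  under eq_fun do rewrite mul1r exprVn.
  by apply; rewrite ger0_norm// invf_lt1// ltr1n.
Unshelve. all: by end_near. Qed.

Lemma pos_dy T (X : R -> T -> Rd) w t : 0 <= t ->
  X s w @[s --> t^'+] --> X t w -> pos (dy X w) t = X t w.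
Proof.
move=> t0 cX; apply/rowP => j; rewrite mxE.
suff h : (dy X w (approx_index n t) ord0 j)%:E @[n --> \oo] --> (X t w ord0 j)%:E.
  by rewrite is_cvg_limn_esupE ?(cvg_lim _ h)//; apply/cvg_ex; exists (X t w ord0 j)%:E.
have cXj : X s w ord0 j @[s --> t^'+] --> X t w ord0 j.
  apply: (@cvg_comp _ _ _ (X^~ w) (fun M : Rd => M ord0 j) _ _ _ cX).
  exact: coord_continuous.
apply: cvg_EFin; first exact: nearW.
apply: (cvg_comp (fun n => dtime (approx_index n t)) (fun s => X s w ord0 j) _ cXj).
move=> A /= [e /= e0 Ae].
have := approx_index_cvg t0 => /cvgrPdist_lt /(_ e e0).
apply: filterS => n tn.
by apply: Ae => //; exact: approx_index_gt.
Qed.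

End path_space.

(** * The simple Markov property on paths observed at dyadic times *)

Section markov.
Context (disp : measure_display) (Omega : measurableType disp) (R : realType).
Context (d : nat) (P : probability Omega R) (X : R -> Omega -> 'rV[R]_d).
Local Notation Rd := 'rV[R]_d.
Hypothesis lev : is_levy_process P X.

Lemma measurable_add_rV : measurable_fun setT (fun xy : Rd * Rd => xy.1 + xy.2).
Proof.
apply: measurable_fun_mx => i j.
rewrite (_ : (fun _ => _) = (fun xy : Rd * Rd => xy.1 i j + xy.2 i j)); last first.
  by apply/funext => xy; rewrite mxE.
by apply: measurable_funD; apply: (measurableT_comp (measurable_coord i j)).
Qed.

Lemma measurable_opp_rV : measurable_fun setT (fun x : Rd => - x).
Proof.
apply: measurable_fun_mx => i j.
rewrite (_ : (fun _ => _) = (fun x : Rd => - x i j)); last first.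
  by apply/funext => x; rewrite mxE.
by apply: measurable_funN; exact: measurable_coord.
Qed.

Lemma measurable_funD_rV dT (T : measurableType dT) (f g : T -> Rd) :
  measurable_fun setT f -> measurable_fun setT g -> measurable_fun setT (fun t => f t + g t).
Proof.
move=> mf mg.
rewrite (_ : (fun t => _) = (fun xy : Rd * Rd => xy.1 + xy.2) \o (fun t => (f t, g t)))//.
by apply: measurableT_comp; [exact: measurable_add_rV|exact: measurable_fun_pair].
Qed.

Lemma measurable_funB_rV dT (T : measurableType dT) (f g : T -> Rd) :
  measurable_fun setT f -> measurable_fun setT g -> measurable_fun setT (fun t => f t - g t).
Proof.
move=> mf mg; apply: measurable_funD_rV => //.
rewrite (_ : (fun t => _) = (fun x : Rd => - x) \o g)//.
by apply: measurableT_comp => //; exact: measurable_opp_rV.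
Qed.

Lemma measurable_levy t : 0 <= t -> measurable_fun setT (X t).
Proof. by case: lev => + _ _ _ _; apply. Qed.

Lemma measurable_dy : measurable_fun setT (dy X).
Proof. by apply: measurable_fun_path => i; apply: measurable_levy; exact: dtime_ge0. Qed.

(** The path of [ww.1] up to time [s], continued by the increments of the independent copy [ww.2].
    The [min] and [max] freeze each copy outside its own time range, so that one formula covers all
    [t]. *)
Definition catp (s t : R) (ww : Omega * Omega) : Rd :=
  X (Num.min t s) ww.1 + X (Num.max (t - s) 0) ww.2.

Lemma measurable_catp s t : 0 <= s -> 0 <= t -> measurable_fun setT (catp s t).
Proof.
move=> s0 t0; apply: measurable_funD_rV.
  apply: (measurableT_comp (measurable_levy _) measurable_fst).
  by rewrite le_min t0 s0.
apply: (measurableT_comp (measurable_levy _) measurable_snd).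
by rewrite le_max lexx orbT.
Qed.

Lemma measurable_dy_catp s : 0 <= s -> measurable_fun setT (dy (catp s)).
Proof.
by move=> s0; apply: measurable_fun_path => i; apply: measurable_catp => //; exact: dtime_ge0.
Qed.

Lemma stationary_incr s t A : 0 <= s -> s <= t -> measurable A ->
  P (increment X s t @^-1` A) = P (X (t - s) @^-1` A).
Proof.
case: lev => _ _ _ st _ s0 le_st mA.
by have := st s (t - s) A s0; rewrite subr_ge0 (addrC s) subrK => ->.
Qed.

(** No interval of the subdivision straddles [s], so every increment of the glued path comes from a
    single copy, the other one contributing 0. Independence within each copy, and stationarity for
    the shift by [s], then give the same product. *)
Lemma incr_law (u : nat -> R) (s : R) (n : nat) (A : nat -> set Rd) :
  0 <= u 0%N -> {homo u : i j / (i <= j)%N >-> i <= j} -> 0 <= s ->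
  (forall i, u i.+1 <= s \/ s <= u i) -> (forall i, measurable (A i)) ->
  (P \x P)%E [set ww | forall i, (i < n)%N -> A i (catp s (u i.+1) ww - catp s (u i) ww)] =
  P [set w | forall i, (i < n)%N -> A i (increment X (u i) (u i.+1) w)].
Proof.
move=> u0 ndu s0 us mA.
have u_ge0 i : 0 <= u i by apply: le_trans u0 _; exact: ndu.
case: lev => _ _ ind _ _.
pose b i := u i.+1 <= s.
(* In the copy that does not move during interval [i] the constraint becomes [setT], a factor 1 in
   the product. *)
pose A1 i := if b i then A i else setT.
pose A2 i := if b i then setT else A i.
have mA1 i : measurable (A1 i) by rewrite /A1; case: ifP.
have mA2 i : measurable (A2 i) by rewrite /A2; case: ifP.
pose u1 i := Num.min (u i) s; pose u2 i := Num.max (u i - s) 0.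
have u1_ge0 i : 0 <= u1 i by rewrite le_min u_ge0.
have u2_ge0 i : 0 <= u2 i by rewrite le_max lexx orbT.
have ndu1 : {homo u1 : i j / (i <= j)%N >-> i <= j}.
  by move=> i j ij; rewrite le_min !ge_min ndu//= lexx orbT.
have ndu2 : {homo u2 : i j / (i <= j)%N >-> i <= j}.
  by move=> i j ij; rewrite ge_max !le_max lerD2r ndu//= lexx orbT.
have bigcapE Q B : [set w | forall i, (i < n)%N -> B i (increment X (Q i) (Q i.+1) w)] =
    \bigcap_(i < n) (increment X (Q i) (Q i.+1) @^-1` B i).
  by apply/seteqP; split => w /= H i; exact: H.
have mincr Q B : (forall i, 0 <= Q i) -> (forall i, measurable (B i)) ->
    measurable (\bigcap_(i < n) (increment X (Q i) (Q i.+1) @^-1` B i)).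
  move=> Q0 mB; apply: fin_bigcap_measurable => [|i _]; first exact: finite_II.
  rewrite -[X in measurable X]setTI.
  by apply: measurable_funB_rV => //; exact: measurable_levy.
rewrite (_ : [set ww | _] =
    (\bigcap_(i < n) (increment X (u1 i) (u1 i.+1) @^-1` A1 i)) `*`
    (\bigcap_(i < n) (increment X (u2 i) (u2 i.+1) @^-1` A2 i))); last first.
  rewrite -!bigcapE; apply/seteqP.
  have key i ww : catp s (u i.+1) ww - catp s (u i) ww =
      increment X (u1 i) (u1 i.+1) ww.1 + increment X (u2 i) (u2 i.+1) ww.2.
    by rewrite /catp /increment -/(u1 _) -/(u1 _) -/(u2 _) -/(u2 _) opprD addrACA.
  have k1 i w : b i -> increment X (u2 i) (u2 i.+1) w = 0.
    move=> bi; rewrite /increment /u2 !max_r ?subrr// subr_le0//.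
    exact: (le_trans (ndu _ _ (leqnSn i)) bi).
  have k2 i w : ~~ b i -> increment X (u1 i) (u1 i.+1) w = 0.
    move=> bi; have [|sui] := us i; first by rewrite -/(b i) (negbTE bi).
    by rewrite /increment /u1 !min_r ?subrr// (le_trans sui)// ndu.
  split => [[w w'] /= H|[w w'] /= [H1 H2] i im].
    split => i im; have := H i im; rewrite key /A1 /A2 /=; case: ifPn => // bi.
      by rewrite k1// addr0.
    by rewrite k2// add0r.
  rewrite key /=; have := H1 i im; have := H2 i im; rewrite /A1 /A2; case: ifPn => bi.
    by rewrite k1// addr0.
  by rewrite k2// add0r.
rewrite [LHS]product_measure1E; [|exact: mincr|exact: mincr].
rewrite bigcapE ind//; transitivity
  ((\prod_(i < n) P (increment X (u1 i) (u1 i.+1) @^-1` A1 i)) *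
   \prod_(i < n) P (increment X (u2 i) (u2 i.+1) @^-1` A2 i))%E.
  by congr (_ * _)%E; exact: ind.
rewrite -big_split/=; apply: eq_bigr => i _.
rewrite /A1 /A2; case: ifPn => bi.
  have ui : u i <= s by apply: le_trans bi; exact: ndu.
  by rewrite preimage_setT probability_setT mule1 /u1 !min_l.
have [|sui] := us i; first by rewrite -/(b i) (negbTE bi).
rewrite preimage_setT probability_setT mul1e.
rewrite (stationary_incr (u_ge0 i) (ndu _ _ (leqnSn i)) (mA i)).
rewrite (stationary_incr (u2_ge0 i) (ndu2 _ _ (leqnSn i)) (mA i)).
have sui1 : s <= u i.+1 by apply: (le_trans sui); exact: ndu.
by rewrite /u2 !max_l ?subr_ge0// opprB addrA subrK.
Qed.


(* The grid [grid s N] refines the dyadic grid of mesh 2^-N by the point s. *)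
Definition grid (s : R) (N i : nat) : R :=
  let a := (i./2)%:R / 2 ^+ N in let a' := (i./2).+1%:R / 2 ^+ N in
  if odd i then Num.min (Num.max s a) a' else a.

Lemma grid_le s N i : grid s N i <= grid s N i.+1.
Proof.
rewrite /grid /= uphalf_half; case: (odd i) => /=.
  by rewrite add1n ge_min lexx orbT.
by rewrite add0n le_min le_max lexx orbT/= ler_pM2r ?invr_gt0 ?exprn_gt0// ler_nat leqnSn.
Qed.

Lemma grid_homo s N : {homo grid s N : i j / (i <= j)%N >-> i <= j}.
Proof. by apply: (homo_leq (@lexx _ _) le_trans) => i; exact: grid_le. Qed.

Lemma grid_split s N i : grid s N i.+1 <= s \/ s <= grid s N i.
Proof.
rewrite /grid /= uphalf_half; case: (odd i) => /=; rewrite ?add1n ?add0n.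
  set a' := _.+1%:R / _; have [sa|/ltW sa] := leP s a'; last by left.
  by right; rewrite le_min le_max lexx.
have [sa|/ltW sa] := leP s ((i./2)%:R / 2 ^+ N); first by right.
by left; rewrite ge_min lexx.
Qed.

Lemma grid_double s N k : grid s N k.*2 = k%:R / 2 ^+ N.
Proof. by rewrite /grid odd_double doubleK. Qed.

Lemma dtime_level (M : nat) : exists N (K : nat -> nat), forall m, (m < M)%N ->
  dtime R m = (K m)%:R / 2 ^+ N.
Proof.
elim: M => [|M [N [K NK]]]; first by exists 0%N, (fun=> 0%N).
have [n [k nk]] : exists n k, dtime R M = k%:R / 2 ^+ n.
  rewrite /dtime; case: unpickle => [[n k]|]; first by exists n, k.
  by exists 0%N, 0%N; rewrite mul0r.
exists (N + n)%N, (fun m => if (m < M)%N then (K m * 2 ^ n)%N else (k * 2 ^ N)%N).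
have p2 j : (2 : R) ^+ j != 0 by rewrite expf_neq0.
move=> m; rewrite ltnS leq_eqVlt => /predU1P[->|mM].
  by rewrite ltnn nk natrM natrX exprD (mulrC (2 ^+ N)) -mulf_div divff// mulr1.
by rewrite mM NK// natrM natrX exprD -mulf_div divff// mulr1.
Qed.


Lemma measurable_set1_rV (x : Rd) : measurable [set x].
Proof.
rewrite (_ : [set x] = \bigcap_(j : 'I_d) ((fun v : Rd => v ord0 j) @^-1` [set x ord0 j])).
  apply: fin_bigcap_measurable => [|j _]; first exact: finite_finset.
  by rewrite -[X in measurable X]setTI; exact: measurable_coord.
apply/seteqP; split => [v /= -> //|v /= vx].
by apply/rowP => j; exact: vx.
Qed.

Lemma measure_full dT (T : measurableType dT) (m : {measure set T -> \bar R}) (N A : set T) :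
  measurable N -> measurable A -> m (~` N) = 0%E -> m A = m (A `&` N).
Proof.
move=> mN mA N0; rewrite (measureDI m mA mN) [X in (X + _)%E](_ : _ = 0%E) ?add0e//.
apply/eqP; rewrite eq_le measure_ge0 andbT -N0 le_measure ?inE//.
- exact: measurableD.
- exact: measurableC.
Qed.

Lemma measurable_X0 : measurable [set w | X 0 w = 0].
Proof.
rewrite -[X in measurable X]setTI.
exact: (measurable_levy (lexx 0) measurableT (measurable_set1_rV 0)).
Qed.

Lemma X0_null : P (~` [set w | X 0 w = 0]) = 0%E.
Proof.
case: lev => _ [N [mN N0 sN]] _ _ _.
apply/eqP; rewrite eq_le measure_ge0 andbT -N0 le_measure ?inE//.
exact: measurableC measurable_X0.
Qed.

Lemma catp_X0_null :
  (P \x P)%E (~` ([set w | X 0 w = 0] `*` [set w | X 0 w = 0])) = 0%E.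
Proof.
have m0 := measurable_X0; have n0 := X0_null.
have mc : measurable (~` [set w | X 0 w = 0]) by exact: measurableC.
have m1 : measurable (~` [set w | X 0 w = 0] `*` [set: Omega]) by exact: measurableX.
have m2 : measurable ([set: Omega] `*` ~` [set w | X 0 w = 0]) by exact: measurableX.
apply/eqP; rewrite eq_le measure_ge0 andbT.
rewrite (_ : ~` _ = ~` [set w | X 0 w = 0] `*` setT `|` setT `*` ~` [set w | X 0 w = 0]).
  apply: le_trans (measureU2 _ m1 m2) _ => /=.
  rewrite !product_measure1E//.
  rewrite [X in (X * _ + _)%E](_ : _ = 0%E); last exact: n0.
  rewrite mul0e add0e [X in (_ * X)%E](_ : _ = 0%E); last exact: n0.
  by rewrite mule0.
apply/seteqP; split => [[w w'] /= H|[w w'] /= [[H _] []//|[_ H] []//]].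
by have [w0|w0] := pselect (X 0 w = 0); [right; split => // w0'; exact: H|left].
Qed.

(** On a cylinder only finitely many dyadic times matter. On a common dyadic grid refined by [s],
    the values at these times are sums of increments, whose joint law is [incr_law]; the start at 0
    holds off a null set. *)
Lemma cat_law (s : R) (A : set (path R d)) : 0 <= s -> measurable A ->
  P (dy X @^-1` A) = (P \x P)%E (dy (catp s) @^-1` A).
Proof.
move=> s0 mA.
have mdX := measurable_dy; have mdc := measurable_dy_catp s0.
suff lawE : forall B : set (path R d), measurable B ->
    pushforward P (dy X) B = pushforward (P \x P)%E (dy (catp s)) B.
  exact: lawE.
apply: path_measure_unique; last first.
  by rewrite [X in (X < _)%E](_ : _ = 1%E) ?ltry//; exact: (probability_setT P).
move=> _ [M [B [mB ->]]].
have [N [K NK]] := dtime_level M.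
(* [J] rebuilds the recorded values from increments; the index is doubled since each dyadic cell is
   cut in two by the additional point [s], possibly trivially. *)
pose J (xi : path R d) : path R d := fun m =>
  if (m < M)%N then \sum_(i < (K m).*2) xi i else 0.
have mJ : measurable_fun setT J.
  apply: measurable_fun_path => m; rewrite /J; case: (m < M)%N => //.
  elim: (K m).*2 => [|k IH].
    rewrite (_ : (fun _ => _) = cst 0)//.
    by apply/funext => z; rewrite big_ord0.
  rewrite (_ : (fun _ => _) = fun z : path R d => \sum_(i < k) z i + z k); last first.
    by apply/funext => z; rewrite big_ord_recr.
  by apply: measurable_funD_rV => //; exact: measurable_path_coord.
pose xi w : path R d := fun i => increment X (grid s N i) (grid s N i.+1) w.
pose xi' ww : path R d := fun i => catp s (grid s N i.+1) ww - catp s (grid s N i) ww.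
have gs0 : grid s N 0 = 0 by rewrite /grid /= mul0r.
have gge0 i : 0 <= grid s N i by rewrite -gs0; exact: grid_homo.
have mxi : measurable_fun setT xi.
  by apply: measurable_fun_path => i; apply: measurable_funB_rV; exact: measurable_levy.
have mxi' : measurable_fun setT xi'.
  by apply: measurable_fun_path => i; apply: measurable_funB_rV; exact: measurable_catp.
have lawxi : forall B : set (path R d), measurable B ->
    pushforward P xi B = pushforward (P \x P)%E xi' B.
  apply: path_measure_unique; last first.
    by rewrite [X in (X < _)%E](_ : _ = 1%E) ?ltry//; exact: (probability_setT P).
  move=> _ [n [D [mD ->]]]; rewrite /pushforward; apply/esym.
  exact: (incr_law n (gge0 0%N) (@grid_homo s N) s0 (grid_split s N) mD).
set C := [set z : path R d | _].
have mC : measurable C.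
  by rewrite cylinders_generate; apply: sub_sigma_algebra; exists M, B.
have mJC : measurable (J @^-1` C) by rewrite -[X in measurable X]setTI; exact: mJ.
have tel (f : nat -> Rd) n : \sum_(i < n) (f i.+1 - f i) = f n - f 0%N.
  by rewrite -(big_mkord xpredT (fun i => f i.+1 - f i)) telescope_sumr.
have dyJ w m : (m < M)%N -> X 0 w = 0 -> dy X w m = J (xi w) m.
  move=> mM w0; rewrite /dy /J mM (NK _ mM) -(grid_double s).
  by rewrite (tel (fun i => X (grid s N i) w)) gs0 w0 subr0.
have dyJ' ww m : (m < M)%N -> X 0 ww.1 = 0 -> X 0 ww.2 = 0 -> dy (catp s) ww m = J (xi' ww) m.
  move=> mM w0 w0'; rewrite /dy /J mM (NK _ mM) -(grid_double s).
  rewrite (tel (fun i => catp s (grid s N i) ww)) gs0.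
  by rewrite [X in _ - X]/catp min_l// sub0r max_r ?oppr_le0// w0 w0' addr0 subr0.
rewrite /pushforward.
have m0 := measurable_X0; have m00 := measurableX m0 m0.
have mp dT (T : measurableType dT) (f : T -> path R d) B' : measurable_fun setT f ->
    measurable B' -> measurable (f @^-1` B').
  by move=> mf mB'; rewrite -[X in measurable X]setTI; exact: mf.
transitivity (P (dy X @^-1` C `&` [set w | X 0 w = 0])).
  by apply: (measure_full (m := P) m0 _ X0_null); exact: mp.
transitivity (P (xi @^-1` (J @^-1` C) `&` [set w | X 0 w = 0])).
  by congr (P _); apply/seteqP; split => w /= [Cw w0]; split => // m mM; have := Cw m mM;
    rewrite dyJ.
transitivity (P (xi @^-1` (J @^-1` C))).
  by apply/esym; apply: (measure_full (m := P) m0 _ X0_null); exact: mp.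
transitivity ((P \x P)%E (xi' @^-1` (J @^-1` C))); first exact: lawxi.
transitivity ((P \x P)%E (xi' @^-1` (J @^-1` C) `&`
    ([set w | X 0 w = 0] `*` [set w | X 0 w = 0]))).
  by apply: (measure_full (m := (P \x P)%E) m00 _ catp_X0_null); exact: mp.
transitivity ((P \x P)%E (dy (catp s) @^-1` C `&`
    ([set w | X 0 w = 0] `*` [set w | X 0 w = 0]))).
  by congr ((P \x P)%E _); apply/seteqP; split => ww /= [Cw [w0 w0']]; split => // m mM;
    have := Cw m mM; rewrite dyJ'.
by apply/esym; apply: (measure_full (m := (P \x P)%E) m00 _ catp_X0_null); exact: mp.
Qed.

(** The past is the first copy and the future the second one, so an iterated integral on the product
    space takes the place of a conditional expectation. *)
Lemma markov (s : R) (F : path R d -> \bar R) : 0 <= s ->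
  measurable_fun setT F -> (forall z, 0 <= F z)%E ->
  (\int[P]_w F (dy X w) = \int[P]_w \int[P]_w' F (dy (catp s) (w, w')))%E.
Proof.
move=> s0 mF F0.
have mdX := measurable_dy; have mdc := measurable_dy_catp s0.
rewrite -[RHS](fubini_tonelli1 (fun ww => F (dy (catp s) ww))); last 2 first.
  exact: measurableT_comp.
  by move=> ww; exact: F0.
rewrite -[LHS](ge0_integral_pushforward mdX P measurableT mF) => [|z _]; last exact: F0.
rewrite -[RHS](ge0_integral_pushforward mdc (P \x P)%E measurableT mF) => [|z _]; last exact: F0.
apply: eq_measure_integral => /= A mA _; exact: cat_law.
Qed.

End markov.

(** * Integration and measurability tools *)

Section integration_tools.
Context {R : realType}.
Local Open Scope ereal_scope.
Local Notation leb := (@lebesgue_measure R).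

(** Measurability plays no part here: the integral of a nonnegative function is a supremum over the
    simple functions below it. *)
Lemma ge0_le_integralP dT (T : measurableType dT) (mu : {measure set T -> \bar R})
    (D : set T) (f g : T -> \bar R) :
  (forall x, D x -> 0 <= f x) -> (forall x, D x -> f x <= g x) ->
  \int[mu]_(x in D) f x <= \int[mu]_(x in D) g x.
Proof.
move=> f0 fg; rewrite !ge0_integralE//; last first.
  by move=> x Dx; apply: le_trans (fg x Dx); exact: f0.
apply: ereal_sup_le => _ [h hf <-]; exists h => // x.
apply: le_trans (hf x) _; rewrite !patchE; case: ifPn => // /[!inE]; exact: fg.
Qed.

Lemma lebesgue_measure_shift (c : R) (A : set (measurableTypeR R)) : measurable A ->
  leb ((fun t : R => (t + c)%R) @^-1` A) = leb A.
Proof.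
move=> mA.
have ms : measurable_fun setT ((fun t : R => (t + c)%R) : measurableTypeR R -> measurableTypeR R).
  exact: measurable_funD.
apply/esym; apply: (lebesgue_measure_unique (mu := pushforward leb
  ((fun t : R => (t + c)%R) : measurableTypeR R -> measurableTypeR R))) => //= _ [[a b]] _ <-.
rewrite /pushforward (_ : _ @^-1` _ = `]a - c, b - c]%classic)%R; last first.
  by apply/seteqP; split => t /=; rewrite !in_itv/= ltrBlDr lerBrDr.
rewrite !lebesgue_measure_itv/= !lte_fin ltrD2r; case: ifP => // _.
by rewrite -!EFinB opprB addrA subrK.
Qed.

Lemma ge0_integral_shiftT (c : R) (f : R -> \bar R) :
  measurable_fun setT (f : measurableTypeR R -> _) -> (forall t, 0 <= f t) ->
  \int[leb]_t f (t + c)%R = \int[leb]_t f t.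
Proof.
move=> mf f0.
have ms : measurable_fun setT ((fun t : R => (t + c)%R) : measurableTypeR R -> measurableTypeR R).
  exact: measurable_funD.
rewrite -[LHS](ge0_integral_pushforward ms leb measurableT mf)//.
by apply: eq_measure_integral => /= A mA _; exact: lebesgue_measure_shift.
Qed.

Lemma ge0_integral_shift (c a b : R) (f : R -> \bar R) :
  measurable_fun setT (f : measurableTypeR R -> _) -> (forall t, 0 <= f t) ->
  \int[leb]_(t in `[a, b]) f (t + c)%R = \int[leb]_(t in `[(a + c)%R, (b + c)%R]) f t.
Proof.
move=> mf f0; rewrite integral_mkcond [RHS]integral_mkcond.
rewrite -[RHS](ge0_integral_shiftT c).
- apply: eq_integral => t _; rewrite !patchE.
  by rewrite !mem_setE !in_itv/= !lerD2r.
- by apply/(measurable_restrictT f) => //; exact: measurable_funTS.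
- by move=> t; rewrite patchE; case: ifP.
Qed.

Lemma ge0_integral_itvD (a b c : R) (f : R -> \bar R) : (a <= b)%R -> (b <= c)%R ->
  measurable_fun setT (f : measurableTypeR R -> _) -> (forall t, 0 <= f t) ->
  \int[leb]_(t in `[a, c]) f t =
  \int[leb]_(t in `[a, b]) f t + \int[leb]_(t in `[b, c]) f t.
Proof.
move=> ab bc mf f0.
rewrite -[in X in _ + X](integral_itv_obnd_cbnd (r := b)); last exact: measurable_funTS.
rewrite -ge0_integral_setU//; last 2 first.
  exact: measurable_funTS.
  apply/disj_setPS => t [] /=; rewrite !in_itv/= => /andP[_ tb] /andP[bt _].
  by have := lt_le_trans bt tb; rewrite ltxx.
congr integral; apply/seteqP; split => t /=; rewrite !in_itv/=.
  move=> /andP[at_ tc]; have [tb|bt] := leP t b; first by left; rewrite at_.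
  by right; rewrite tc.
by move=> [/andP[-> tb]|/andP[bt ->]]; [rewrite (le_trans tb bc)|
  rewrite (le_trans ab (ltW bt))].
Qed.

(** Tonelli for the integrand times the indicator of [0 <= u <= p.1]. Joint measurability in the
    upper bound is what permits random upper bounds such as exit times. *)
Lemma measurable_integral0 dT (T : measurableType dT) (g : R * T -> \bar R) :
  measurable_fun setT (g : measurableTypeR R * T -> _) -> (forall x, 0 <= g x) ->
  measurable_fun setT (fun p : measurableTypeR R * T =>
    \int[leb]_(u in `[0%R, p.1]) g (u, p.2)).
Proof.
move=> mg g0.
pose G (q : (measurableTypeR R * T) * measurableTypeR R) : \bar R :=
  g (q.2, q.1.2) * (((0 <= q.2) && (q.2 <= q.1.1))%R%:R)%:E.
rewrite (_ : (fun _ => _) = fun p => \int[leb]_u G (p, u)); last first.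
  apply/funext => p; rewrite integral_mkcond; apply: eq_integral => u _.
  rewrite patchE /G /= mem_setE in_itv/=.
  by case: ifP => _; rewrite ?mule1 ?mule0.
apply: measurable_fun_fubini_tonelli_F; last by move=> q; rewrite mule_ge0.
apply: emeasurable_funM.
  have h : measurable_fun setT (fun q : (measurableTypeR R * T) * measurableTypeR R =>
    (q.2, q.1.2)).
    apply: measurable_fun_pair; first exact: measurable_snd.
    by apply: measurableT_comp measurable_fst; exact: measurable_snd.
  exact: (measurableT_comp mg h).
apply/measurable_EFinP.
rewrite (_ : (fun _ => _) = fun q : (measurableTypeR R * T) * measurableTypeR R =>
  if (0 <= q.2)%R && (q.2 <= q.1.1)%R then 1%R else 0%R); last first.
  by apply/funext => q; case: (_ && _).
apply: measurable_fun_ifT => //; apply: measurable_and.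
  by apply: measurable_fun_ler => //; exact: measurable_snd.
apply: measurable_fun_ler; first exact: measurable_snd.
by apply: measurableT_comp measurable_fst; exact: measurable_fst.
Qed.

(** Infinite limits are included because the integral of the positive part of the potential along a
    path may be infinite. *)
Lemma cvg_expeR (u : (\bar R)^nat) (l : \bar R) :
  u n @[n --> \oo] --> l -> expeR (u n) @[n --> \oo] --> expeR l.
Proof.
case: l => [l| |] ul.
- have [uf ul'] := (fine_cvgP _ _).1 ul.
  apply/fine_cvgP; split; first by apply: filterS uf => n; case: (u n).
  have h : (expR \o (fine \o u)) n @[n --> \oo] --> expR l.
    exact: (continuous_cvg _ (@continuous_expR R l) ul').
  apply: cvg_trans h; apply: near_eq_cvg.
  by apply: filterS uf => n /=; case: (u n).
- apply/cvgeyPge => A; move/cvgeyPge : ul => /(_ A); apply: filterS => n An.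
  apply: le_trans (expeR_ge1Dx (u n)); apply: (le_trans An).
  by rewrite leeDr.
- have h A : \forall n \near \oo, expeR (u n) <= (expR A)%:E.
    by move/cvgeNyPle : ul => /(_ A); apply: filterS => n An; rewrite -/(expeR A%:E) lee_expeR.
  apply/fine_cvgP; split.
    apply: filterS (h 0%R) => n hn; rewrite ge0_fin_numE ?expeR_ge0//.
    by rewrite (le_lt_trans hn) ?ltry.
  apply/cvgrPdist_le => e e0; have [A Ae] := expR_total e0.
  apply: filterS (h A) => n; rewrite Ae /= sub0r normrN => hn.
  have fn : expeR (u n) \is a fin_num.
    by rewrite ge0_fin_numE ?expeR_ge0// (le_lt_trans hn) ?ltry.
  by rewrite ger0_norm ?fine_ge0 ?expeR_ge0// -lee_fin fineK.
Qed.

Lemma measurable_expeR : measurable_fun setT (@expeR R).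
Proof.
rewrite (_ : @expeR R = fun x => maxe 0 (er_map expR x)).
  by apply: measurable_maxe => //; exact: (measurable_er_map (measurableTypeR R) (@measurable_expR R)).
apply/funext => -[r| |] /=.
- by rewrite max_r// lee_fin expR_ge0.
- by rewrite max_r// leey.
- by rewrite max_l// leNye.
Qed.

End integration_tools.

(* Reading every path off its values at dyadic times makes [X] jointly measurable
   and turns functionals of [X] into measurable functions on the path space. *)
Definition normalized_levy disp (Omega : measurableType disp) (R : realType) d
    (P : probability Omega R) (X : R -> Omega -> 'rV[R]_d) :=
  [/\ is_levy_process P X, forall w, X 0 w = 0 & forall t w, X t w = pos (dy X w) t].

(** * Additive functionals of the process *)

Section functionals.
Context (disp : measure_display) (Omega : measurableType disp) (R : realType).
Context (d : nat) (P : probability Omega R) (X : R -> Omega -> 'rV[R]_d).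
Local Notation Rd := 'rV[R]_d.
Local Notation leb := (@lebesgue_measure R).
Hypothesis norm_levy : normalized_levy P X.
Let lev : is_levy_process P X. Proof. by case: norm_levy. Qed.
Let X0 w : X 0 w = 0. Proof. by case: norm_levy. Qed.
Let Xpos t w : X t w = pos (dy X w) t. Proof. by case: norm_levy. Qed.

Lemma rcont t w : 0 <= t -> X s w @[s --> t^'+] --> X t w.
Proof. by move=> t0; case: lev => _ _ _ _ /(_ w)[+ _]; apply. Qed.

Lemma measurable_X : measurable_fun setT (fun tw : measurableTypeR R * Omega => X tw.1 tw.2).
Proof.
rewrite (_ : (fun _ => _) = (fun tz : measurableTypeR R * path R d => pos tz.2 tz.1) \o
    (fun tw => (tw.1, dy X tw.2))); last by apply/funext => tw; rewrite Xpos.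
apply: measurableT_comp; first exact: measurable_pos.
apply: measurable_fun_pair; first exact: measurable_fst.
by apply: measurableT_comp measurable_snd; exact: (measurable_dy lev).
Qed.

Lemma measurable_Xt t : measurable_fun setT (X t).
Proof. exact: (measurableT_comp measurable_X (pair1_measurable t)). Qed.

Lemma measurable_Xw w : measurable_fun setT (fun t : measurableTypeR R => X t w).
Proof. exact: (measurableT_comp measurable_X (pair2_measurable w)). Qed.

Lemma measurable_addX x t : measurable_fun setT (fun w => x + X t w).
Proof. by apply: measurable_funD_rV => //; exact: measurable_Xt. Qed.

Lemma measurable_addXw x w : measurable_fun setT (fun t : measurableTypeR R => x + X t w).
Proof. by apply: measurable_funD_rV => //; exact: measurable_Xw. Qed.

Lemma catp_le s t ww : t <= s -> catp X s t ww = X t ww.1.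
Proof. by move=> ts; rewrite /catp min_l// max_r ?subr_le0// X0 addr0. Qed.

Lemma catp_add s t ww : 0 <= t -> catp X s (s + t) ww = X s ww.1 + X t ww.2.
Proof. by move=> t0; rewrite /catp min_r ?lerDl// addrAC subrr add0r max_l. Qed.

(** Gluing preserves right-continuity, at [s] as well, so the glued path is recovered from its
    dyadic values. *)
Lemma pos_catp s t ww : 0 <= s -> 0 <= t -> pos (dy (catp X s) ww) t = catp X s t ww.
Proof.
move=> s0 t0; apply: pos_dy => //; have [ts|st] := ltP t s.
  have h : X u ww.1 @[u --> t^'+] --> catp X s t ww.
    by rewrite catp_le ?(ltW ts)//; exact: rcont.
  apply: cvg_trans h; apply: near_eq_cvg; near=> u.
  by rewrite catp_le//; near: u; apply: nbhs_right_le.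
have h : X s ww.1 + X (u - s) ww.2 @[u --> t^'+] --> catp X s t ww.
  rewrite -[in X in _ --> X](subrK s t) addrC catp_add ?subr_ge0//.
  apply: cvgD; first exact: cvg_cst.
  have ts0 : 0 <= t - s by rewrite subr_ge0.
  move=> A /(rcont (w := ww.2) ts0)[e /= e0 eA].
  exists e => //= u tu ltu; apply: eA => /=; last by rewrite ltrD2r.
  by rewrite opprB addrA subrK.
apply: cvg_trans h; apply: near_eq_cvg; near=> u.
have su : s <= u by apply: (le_trans st); near: u; exact: nbhs_right_ge.
by rewrite [in RHS](_ : u = s + (u - s)) ?catp_add ?subr_ge0// addrC subrK.
Unshelve. all: by end_near. Qed.

(** The Markov property is stated for functionals of the dyadic values, so integrals along a path
    come in two versions: [pI] on path space and [XI] on the probability space. *)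
Definition pI (g : Rd -> R) (y : Rd) (t : R) (z : path R d) : \bar R :=
  (\int[leb]_(u in `[0%R, t]) (g (y + pos z u))%:E)%E.

Definition XI (g : Rd -> R) (y : Rd) (t : R) (w : Omega) : \bar R :=
  (\int[leb]_(u in `[0%R, t]) (g (y + X u w))%:E)%E.

Lemma XIE g y t w : XI g y t w = (\int[leb]_(u in `[0%R, t]) (g (y + X u w))%:E)%E.
Proof. by []. Qed.

Lemma pI_dy g y t w : pI g y t (dy X w) = XI g y t w.
Proof. by apply: eq_integral => u _; rewrite Xpos. Qed.

Section nonneg_functional.
Variable g : Rd -> R.
Hypotheses (mg : measurable_fun setT g) (g0 : forall x, 0 <= g x).

Lemma pI_ge0 y t z : (0 <= pI g y t z)%E.
Proof. by apply: integral_ge0 => u _; rewrite lee_fin. Qed.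

Lemma XI_ge0 y t w : (0 <= XI g y t w)%E.
Proof. by apply: integral_ge0 => u _; rewrite lee_fin. Qed.

Lemma measurable_gX y w : measurable_fun setT (fun u : measurableTypeR R => (g (y + X u w))%:E).
Proof. by apply/measurable_EFinP; apply: (measurableT_comp mg); exact: measurable_addXw. Qed.

Lemma measurable_pI : measurable_fun setT
  (fun p : measurableTypeR R * (Rd * path R d) => pI g p.2.1 p.1 p.2.2).
Proof.
pose G (q : R * (Rd * path R d)) := (g (q.2.1 + pos q.2.2 q.1))%:E.
apply: (@measurable_integral0 _ _ _ G); last by move=> x; rewrite lee_fin.
apply/measurable_EFinP; apply: (measurableT_comp mg); apply: measurable_funD_rV.
  by apply: measurableT_comp measurable_snd; exact: measurable_fst.
have h : measurable_fun setT (fun q : measurableTypeR R * (Rd * path R d) => (q.1, q.2.2)).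
  apply: measurable_fun_pair; first exact: measurable_fst.
  by apply: measurableT_comp measurable_snd; exact: measurable_snd.
exact: (measurableT_comp (@measurable_pos R d) h).
Qed.

Lemma measurable_pI_path y t : measurable_fun setT (pI g y t).
Proof.
have h : measurable_fun setT (fun z : path R d => (t : measurableTypeR R, (y, z))).
  by apply: measurable_fun_pair => //; exact: measurable_fun_pair.
exact: (measurableT_comp measurable_pI h).
Qed.

Lemma measurable_XI : measurable_fun setT
  (fun p : measurableTypeR R * (Rd * Omega) => XI g p.2.1 p.1 p.2.2).
Proof.
have h : measurable_fun setT (fun p : measurableTypeR R * (Rd * Omega) => (p.1, (p.2.1, dy X p.2.2))).
  apply: measurable_fun_pair; first exact: measurable_fst.
  apply: measurable_fun_pair.
    by apply: measurableT_comp measurable_snd; exact: measurable_fst.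
  apply: (measurableT_comp (measurable_dy lev)).
  by apply: measurableT_comp measurable_snd; exact: measurable_snd.
rewrite (_ : (fun _ => _) = (fun p : measurableTypeR R * (Rd * path R d) => pI g p.2.1 p.1 p.2.2) \o
   (fun p => (p.1, (p.2.1, dy X p.2.2)))); last by apply/funext => p; rewrite /= pI_dy.
exact: (measurableT_comp measurable_pI h).
Qed.

Lemma measurable_XIw y t : measurable_fun setT (XI g y t).
Proof.
have h : measurable_fun setT (fun w : Omega => (t : measurableTypeR R, (y, w))).
  by apply: measurable_fun_pair => //; exact: measurable_fun_pair.
exact: (measurableT_comp measurable_XI h).
Qed.

Lemma measurable_XIyw t : measurable_fun setT (fun yw : Rd * Omega => XI g yw.1 t yw.2).
Proof.
have h : measurable_fun setT (fun yw : Rd * Omega => (t : measurableTypeR R, (yw.1, yw.2))).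
  by apply: measurable_fun_pair => //; apply: measurable_fun_pair.
exact: (measurableT_comp measurable_XI h).
Qed.

Lemma measurable_XItw y : measurable_fun setT
  (fun tw : measurableTypeR R * Omega => XI g y tw.1 tw.2).
Proof.
have h : measurable_fun setT (fun tw : measurableTypeR R * Omega => (tw.1, (y, tw.2))).
  by apply: measurable_fun_pair; [exact: measurable_fst|apply: measurable_fun_pair].
exact: (measurableT_comp measurable_XI h).
Qed.

Lemma XI_le y s t w : s <= t -> (XI g y s w <= XI g y t w)%E.
Proof.
move=> st; apply: ge0_subset_integral => //=.
- exact: measurable_funTS (measurable_gX y w).
- by move=> u _; rewrite lee_fin.
- by move=> u /=; rewrite !in_itv/= => /andP[-> us]; exact: le_trans us st.
Qed.

(** Up to [s] only the first copy moves; afterwards the second one restarts from the point reached,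
    and a shift of time brings its integral back to [[0, t]]. *)
Lemma pI_cat y s t ww : 0 <= s -> 0 <= t ->
  (pI g y (s + t) (dy (catp X s) ww) = XI g y s ww.1 + XI g (y + X s ww.1) t ww.2)%E.
Proof.
move=> s0 t0.
have -> : pI g y (s + t) (dy (catp X s) ww) =
    (\int[leb]_(u in `[0%R, (s + t)%R])
      (g (y + (X (Num.min u s) ww.1 + X (Num.max (u - s) 0) ww.2)))%:E)%E.
  apply: eq_integral => u; rewrite inE/= in_itv/= => /andP[u0 _].
  by rewrite pos_catp.
have mh : measurable_fun setT (fun u : measurableTypeR R =>
    (g (y + (X (Num.min u s) ww.1 + X (Num.max (u - s) 0) ww.2)))%:E).
  apply/measurable_EFinP; apply: (measurableT_comp mg); apply: measurable_funD_rV => //.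
  apply: measurable_funD_rV.
    apply: (measurableT_comp (measurable_Xw ww.1)).
    exact: measurable_minr.
  apply: (measurableT_comp (measurable_Xw ww.2)).
  by apply: measurable_maxr => //; exact: measurable_funB.
rewrite (ge0_integral_itvD s0 _ mh); [|by rewrite lerDl|by move=> u; rewrite lee_fin].
congr (_ + _)%E.
  apply: eq_integral => u; rewrite inE/= in_itv/= => /andP[_ us].
  by rewrite min_l// max_r ?subr_le0// X0 addr0.
have e := ge0_integral_shift s 0 t mh (fun u => g0 _ : (0%R <= (g _)%:E)%E).
rewrite add0r (addrC t) in e; rewrite -[LHS]e.
apply: eq_integral => u; rewrite inE/= in_itv/= => /andP[u0 _].
by rewrite min_r ?lerDr// addrK max_l// addrA.
Qed.

Lemma pI_cat_le y s t ww : 0 <= s -> t <= s ->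
  pI g y t (dy (catp X s) ww) = XI g y t ww.1.
Proof.
move=> s0 ts; apply: eq_integral => u; rewrite inE/= in_itv/= => /andP[u0 ut].
by rewrite pos_catp// catp_le// (le_trans ut ts).
Qed.

End nonneg_functional.

Lemma P_cst (c : \bar R) : (\int[P]_w c = c)%E.
Proof.
rewrite integral_cst// [X in (_ * X)%E](_ : _ = 1%E) ?mule1//; exact: probability_setT.
Qed.

Lemma measurable_expectation_XI (g : Rd -> R) t : measurable_fun setT g ->
  (forall x, 0 <= g x) -> measurable_fun setT (fun y => \int[P]_w XI g y t w)%E.
Proof.
move=> mg g0.
apply: (measurable_fun_fubini_tonelli_F (fun yw => XI g yw.1 t yw.2)).
  exact: measurable_XIyw.
by move=> ?; exact: XI_ge0.
Qed.

Lemma markov_XI (g : Rd -> R) y s t : measurable_fun setT g -> (forall x, 0 <= g x) ->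
  0 <= s -> 0 <= t ->
  (\int[P]_w XI g y (s + t) w =
   \int[P]_w XI g y s w + \int[P]_w \int[P]_w' XI g (y + X s w) t w')%E.
Proof.
move=> mg g0 s0 t0; under eq_integral do rewrite -pI_dy.
rewrite (markov lev s0 (F := pI g y (s + t))); [|exact: measurable_pI_path|by move=> ?; exact: pI_ge0].
transitivity (\int[P]_w (XI g y s w + \int[P]_w' XI g (y + X s w) t w'))%E.
  apply: eq_integral => w _.
  under eq_integral => w' _ do rewrite (pI_cat mg g0 y (w, w') s0 t0)/=.
  rewrite ge0_integralD//; [|by move=> *; exact: XI_ge0
      |by move=> *; exact: XI_ge0|exact: measurable_XIw].
  by rewrite P_cst.
have mI : measurable_fun setT (fun w => \int[P]_w' XI g (y + X s w) t w')%E.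
  exact: (measurableT_comp (measurable_expectation_XI t mg g0) (measurable_addX y s)).
rewrite ge0_integralD//; [by move=> *; exact: XI_ge0|exact: measurable_XIw
    |by move=> *; apply: integral_ge0 => *; exact: XI_ge0].
Qed.

(** A bound uniform in the starting point propagates by the Markov property: [n] periods of length
    [t1] cost at most [n * C]. *)
Lemma XI_expectation_lt (g : Rd -> R) (t1 C : R) : measurable_fun setT g ->
  (forall x, 0 <= g x) -> 0 < t1 -> (forall y, (\int[P]_w XI g y t1 w <= C%:E)%E) ->
  forall y t, (\int[P]_w XI g y t w < +oo)%E.
Proof.
move=> mg g0 t10 hC y t.
have step n : forall y, (\int[P]_w XI g y (n%:R * t1) w <= (n%:R * C)%:E)%E.
  elim: n => [|n IH] z.
    rewrite !mul0r; under eq_integral do rewrite /XI set_itv1 integral_set1.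
    by rewrite integral0.
  have n0 : 0 <= n%:R * t1 by rewrite mulr_ge0// ltW.
  rewrite -natr1 mulrDl mul1r addrC (markov_XI z mg g0 (ltW t10) n0).
  have -> : ((n%:R + 1) * C)%:E = (C%:E + (n%:R * C)%:E)%E by rewrite -EFinD; congr EFin; ring.
  apply: leeD; first exact: hC.
  apply: (@le_trans _ _ (\int[P]_w (n%:R * C)%:E)%E); last by rewrite P_cst.
  by apply: ge0_le_integralP => w _; [apply: integral_ge0 => *; exact: XI_ge0|exact: IH].
have [n tn] : exists n : nat, t <= n%:R * t1.
  exists (Num.truncn (t / t1)).+1; rewrite -ler_pdivrMr// ltW//; exact: truncnS_gt.
apply: (@le_lt_trans _ _ (\int[P]_w XI g y (n%:R * t1) w)%E); last first.
  by apply: le_lt_trans (step n y) _; rewrite ltry.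
by apply: ge0_le_integralP => w _; [exact: XI_ge0|exact: XI_le].
Qed.

Lemma measurable_exp_XI (g : Rd -> R) y t : measurable_fun setT g -> (forall x, 0 <= g x) ->
  measurable_fun setT (fun w => expeR (XI g y t w)).
Proof. by move=> mg g0; apply: (measurableT_comp measurable_expeR); exact: measurable_XIw. Qed.

Lemma markov_exp (g : Rd -> R) y s t : measurable_fun setT g -> (forall x, 0 <= g x) -> 0 <= s -> 0 <= t ->
  (\int[P]_w expeR (XI g y (s + t) w) =
   \int[P]_w (expeR (XI g y s w) * \int[P]_w' expeR (XI g (y + X s w) t w')))%E.
Proof.
move=> mg g0 s0 t0; under eq_integral do rewrite -pI_dy.
rewrite (markov lev s0 (F := fun z => expeR (pI g y (s + t) z))); last 2 first.
- by apply: (measurableT_comp measurable_expeR); exact: measurable_pI_path.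
- by move=> ?; exact: expeR_ge0.
apply: eq_integral => w _.
under eq_integral => w' _ do rewrite (pI_cat mg g0 y (w, w') s0 t0)/= expeRD.
rewrite ge0_integralZl//; last by rewrite expeR_ge0.
- exact: measurable_exp_XI.
- by move=> *; exact: expeR_ge0.
Qed.

End functionals.

(** * Khasminskii's lemma *)

Section khasminskii.
Context (disp : measure_display) (Omega : measurableType disp) (R : realType).
Context (d : nat) (P : probability Omega R) (X : R -> Omega -> 'rV[R]_d).
Local Notation Rd := 'rV[R]_d.
Local Notation leb := (@lebesgue_measure R).
Hypothesis norm_levy : normalized_levy P X.
Let lev : is_levy_process P X. Proof. by case: norm_levy. Qed.
Local Notation XI := (XI X).

(** From [exp(-a) >= 1 - a]; the range [a <= 1/3] is where [1 / (1 - a) <= 1 + 3a/2]. *)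
Lemma expR_le_bound (a : R) : 0 <= a -> a <= 1 / 3 -> expR a <= 1 + 3 / 2 * a.
Proof.
move=> a0 a3.
have h : 1 - a <= expR (- a) by have := expR_ge1Dx (- a).
have p := expR_gt0 a.
have e1 : expR a * expR (- a) = 1 by rewrite expRxMexpNx_1.
have h1 : expR a * (1 - a) <= 1 by have := ler_wpM2l (ltW p) h; rewrite e1.
nra.
Qed.

(** The exponential is not expanded; an a priori bound is absorbed instead. Since [g] is bounded,
    the supremum [m] of the exponential moments is finite; induction over small time steps bounds
    each moment by [1 + (3/2) m E XI]; then [E XI <= 1/2] forces [m <= 4], whence the constant 6. *)
Lemma khasminskii_bounded (g : Rd -> R) (N T0 : R) : measurable_fun setT g ->
  (forall x, 0 <= g x <= N) -> 0 < T0 -> (forall y, (\int[P]_w XI g y T0 w <= (1 / 2)%:E)%E) ->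
  forall y t, 0 <= t <= T0 ->
  (\int[P]_w expeR (XI g y t w) <= 1 + 6%:E * \int[P]_w XI g y t w)%E.
Proof.
move=> mg gN T00 hT.
have g0 x : 0 <= g x by case/andP: (gN x).
have N0 : 0 <= N by case/andP: (gN 0) => a b; exact: le_trans a b.
have XIN y t w : 0 <= t -> (XI g y t w <= (N * t)%:E)%E.
  move=> t0; apply: (@le_trans _ _ (\int[leb]_(u in `[0%R, t]) N%:E)%E).
    apply: ge0_le_integralP => u _; rewrite lee_fin//.
    by case/andP: (gN (y + X u w)).
  rewrite integral_cst//= lebesgue_measure_itv/= lte_fin; case: ltP => [t0'|t0'].
    by rewrite -EFinD subr0 -EFinM.
  by rewrite mule0 lee_fin mulr_ge0.
pose m := ereal_sup [set r | exists y t, 0 <= t <= T0 /\ r = (\int[P]_w expeR (XI g y t w))%E].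
have mub y t : 0 <= t <= T0 -> (\int[P]_w expeR (XI g y t w) <= m)%E.
  by move=> tT; apply: ereal_sup_ubound; exists y, t.
have m1 : (1 <= m)%E.
  apply: le_trans (mub 0 0 _); last by rewrite lexx ltW.
  rewrite -[X in (X <= _)%E](P_cst P); apply: ge0_le_integralP => // w _.
  by rewrite -expeR0 lee_expeR XI_ge0.
have mN : (m <= (expR (N * T0))%:E)%E.
  apply: ge_ereal_sup => _ [y [t [/andP[t0 tT] ->]]].
  rewrite -[X in (_ <= X)%E](P_cst P); apply: ge0_le_integralP => [w _|w _]; first exact: expeR_ge0.
  rewrite -/(expeR (N * T0)%:E) lee_expeR; apply: le_trans (XIN _ _ _ t0) _.
  by rewrite lee_fin ler_wpM2l.
have mfin : m \is a fin_num.
  by rewrite ge0_fin_numE ?(le_lt_trans mN) ?ltry//; exact: le_trans m1.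
pose r := fine m; have mr : m = r%:E by rewrite fineK.
have r1 : 1 <= r by rewrite -lee_fin -mr.
(* On the first step [exp(XI_h) <= 1 + (3/2) XI_h]. The remaining factor is bounded by [r] where it
   multiplies [XI_h], and by the induction hypothesis where it stands alone. *)
have main k h : 0 <= h -> N * h <= 1 / 3 -> k%:R * h <= T0 -> forall y,
    (\int[P]_w expeR (XI g y (k%:R * h)%R w) <=
     1 + (3 / 2 * r)%:E * \int[P]_w XI g y (k%:R * h)%R w)%E.
  move=> h0 Nh; elim: k => [|k IH] kT y.
    rewrite mul0r; under eq_integral do rewrite /XI set_itv1 integral_set1 expeR0.
    rewrite P_cst leeDl// mule_ge0//; first by rewrite lee_fin; nra.
    by apply: integral_ge0 => *; exact: XI_ge0.
  have kh0 : 0 <= k%:R * h by rewrite mulr_ge0.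
  have kT' : k%:R * h <= T0 by apply: le_trans kT; rewrite ler_wpM2r// ler_nat leqnSn.
  have hh : k.+1%:R * h = h + k%:R * h by rewrite -natr1 mulrDl mul1r addrC.
  rewrite hh (markov_exp norm_levy y mg g0 h0 kh0) (markov_XI norm_levy y mg g0 h0 kh0).
  pose F z := (\int[P]_w' XI g z (k%:R * h)%R w')%E.
  have F0 z : (0 <= F z)%E by apply: integral_ge0 => *; exact: XI_ge0.
  have mF : measurable_fun setT F by exact: (measurable_expectation_XI norm_levy).
  have mFX : measurable_fun setT (fun w => F (y + X h w)).
    exact: (measurableT_comp mF (measurable_addX norm_levy y h)).
  have c0 : 0 <= 3 / 2 * r by nra.
  apply: (@le_trans _ _ (\int[P]_w (1 + ((3 / 2 * r)%:E * F (y + X h w)%R +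
      (3 / 2 * r)%:E * XI g y h w)))%E).
    apply: ge0_le_integralP => [w _|w _].
      by rewrite mule_ge0 ?expeR_ge0// integral_ge0// => *; exact: expeR_ge0.
    have XIf : XI g y h w \is a fin_num.
      by rewrite ge0_fin_numE ?XI_ge0// (le_lt_trans (XIN _ _ _ h0))// ltry.
    have XI3 : fine (XI g y h w) <= 1 / 3.
      by rewrite -lee_fin fineK//; apply: le_trans (XIN _ _ _ h0) _; rewrite lee_fin.
    have XI0 : 0 <= fine (XI g y h w) by rewrite fine_ge0// XI_ge0.
    rewrite -(fineK XIf) -[expeR _]/((expR (fine (XI g y h w)))%:E).
    set G := (\int[P]_w' expeR _)%E.
    have Gr : (G <= r%:E)%E by rewrite -mr; apply: mub; rewrite kh0.
    have G0 : (0 <= G)%E by apply: integral_ge0 => *; exact: expeR_ge0.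
    have GF : (G <= 1 + (3 / 2 * r)%:E * F (y + X h w)%R)%E by exact: IH.
    have Gf : G \is a fin_num by rewrite ge0_fin_numE// (le_lt_trans Gr)// ltry.
    apply: (@le_trans _ _ (G + (3 / 2 * r)%:E * (fine (XI g y h w))%:E)%E); last first.
      by rewrite addeA leeD2r.
    rewrite -(fineK Gf) -!EFinM -EFinD lee_fin.
    have := expR_le_bound XI0 XI3; have : 0 <= fine G by rewrite fine_ge0.
    have : fine G <= r by rewrite -lee_fin fineK.
    by move=> *; nra.
  have m1' : measurable_fun setT (fun w => (3 / 2 * r)%:E * F (y + X h w)%R)%E.
    exact: measurable_funeM.
  have m2' : measurable_fun setT (fun w => (3 / 2 * r)%:E * XI g y h w)%E.
    by apply: measurable_funeM; exact: (measurable_XIw norm_levy).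
  rewrite ge0_integralD//; [|by move=> w _; rewrite adde_ge0// mule_ge0 ?lee_fin ?XI_ge0
      |exact: emeasurable_funD].
  rewrite P_cst leeD2l// ge0_integralD//; [|by move=> w _; rewrite mule_ge0 ?lee_fin
      |by move=> w _; rewrite mule_ge0 ?lee_fin ?XI_ge0].
  rewrite !ge0_integralZl_EFin//; [|by move=> *; exact: XI_ge0|exact: (measurable_XIw norm_levy)].
  rewrite addeC -ge0_muleDr//;
    by apply: integral_ge0 => *; first [exact: XI_ge0|exact: F0].
(* The number [K] of steps exceeds [3 * N * t], so that steps of length [t / K] satisfy the
   smallness condition of [main]. *)
have main2 y t : 0 <= t <= T0 ->
    (\int[P]_w expeR (XI g y t w) <= 1 + (3 / 2 * r)%:E * \int[P]_w XI g y t w)%E.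
  move=> /andP[t0 tT]; pose K := (Num.truncn (3 * N * t)).+1.
  have K0 : (0 : R) < K%:R by rewrite ltr0n.
  have Kt : K%:R * (t / K%:R) = t by rewrite mulrC divfK// gt_eqF.
  rewrite -Kt; apply: main; rewrite ?Kt//; first by rewrite divr_ge0// ltW.
  rewrite mulrA ler_pdivrMr//; have := truncnS_gt (3 * N * t); rewrite -/K; nra.
have r4 : r <= 4.
  suff : (m <= (1 + 3 / 4 * r)%:E)%E by rewrite mr lee_fin => ?; lra.
  apply: ge_ereal_sup => _ [y [t [tT ->]]].
  apply: le_trans (main2 y t tT) _; rewrite EFinD leeD2l//.
  apply: (@le_trans _ _ ((3 / 2 * r)%:E * (1 / 2)%:E)%E).
    apply: lee_pmul => //; [by rewrite lee_fin; nra|by apply: integral_ge0 => *; exact: XI_ge0|].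
    apply: le_trans (hT y); apply: ge0_le_integralP => w _; first exact: XI_ge0.
    by case/andP: tT => _ tT; exact: (XI_le norm_levy).
  by rewrite -EFinM lee_fin; lra.
move=> y t tT; apply: le_trans (main2 y t tT) _; rewrite leeD2l//.
apply: lee_wpmul2r; first by apply: integral_ge0 => *; exact: XI_ge0.
by rewrite lee_fin; lra.
Qed.

(** The constants for bounded [g] do not involve the bound, so truncation and monotone convergence
    remove it. *)
Lemma khasminskii (g : Rd -> R) (T0 : R) : measurable_fun setT g ->
  (forall x, 0 <= g x) -> 0 < T0 -> (forall y, (\int[P]_w XI g y T0 w <= (1 / 2)%:E)%E) ->
  forall y t, 0 <= t <= T0 ->
  (\int[P]_w expeR (XI g y t w) <= 1 + 6%:E * \int[P]_w XI g y t w)%E.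
Proof.
move=> mg g0 T00 hT y t tT.
pose gN (N : nat) x := Num.min (g x) N%:R.
have mgN N : measurable_fun setT (gN N) by exact: measurable_minr.
have gN0 N x : 0 <= gN N x by rewrite le_min g0 ler0n.
have gNg N x : gN N x <= g x by rewrite ge_min lexx.
have XIN N z s w : (XI (gN N) z s w <= XI g z s w)%E.
  by apply: ge0_le_integralP => u _; rewrite lee_fin.
have bound N : (\int[P]_w expeR (XI (gN N) y t w) <= 1 + 6%:E * \int[P]_w XI g y t w)%E.
  apply: le_trans (khasminskii_bounded (N := N%:R) (mgN N) _ T00 _ y tT) _ => [x|z|].
  - by rewrite gN0/= ge_min lexx orbT.
  - by apply: le_trans (hT z); apply: ge0_le_integralP => w _ //; exact: XI_ge0.
  - rewrite leeD2l// lee_wpmul2l//.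
    by apply: ge0_le_integralP => w _ //; exact: XI_ge0.
have ndXI w : {homo (fun N => XI (gN N) y t w) : i j / (i <= j)%N >-> (i <= j)%E}.
  move=> i j ij; apply: ge0_le_integralP => u _; rewrite lee_fin//.
  by rewrite le_min !ge_min lexx/= ler_nat ij orbT.
have cXI w : XI (gN N) y t w @[N --> \oo] --> XI g y t w.
  rewrite /XI; have -> : (\int[leb]_(u in `[0%R, t]) (g (y + X u w))%:E =
      \int[leb]_(u in `[0%R, t]) limn (fun N => (gN N (y + X u w))%:E))%E.
    apply: eq_integral => u _; apply/esym/cvg_lim => //.
    apply: cvg_EFin; first exact: nearW.
    apply: cvg_near_cst; near=> N; rewrite /= /gN min_l//.
    by near: N; exact: nbhs_infty_ger.
  apply: cvg_monotone_convergence => //.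
  - by move=> N; apply: measurable_funTS; exact: (measurable_gX norm_levy (mgN N)).
  - by move=> N u _; rewrite lee_fin.
  - move=> u _ i j ij; rewrite lee_fin.
    by rewrite le_min !ge_min lexx/= ler_nat ij orbT.
have lim : (\int[P]_w expeR (XI (gN N) y t w))%E @[N --> \oo] --> (\int[P]_w expeR (XI g y t w))%E.
  have -> : (\int[P]_w expeR (XI g y t w) = \int[P]_w limn (fun N => expeR (XI (gN N) y t w)))%E.
    by apply: eq_integral => w _; apply/esym/cvg_lim => //; apply: cvg_expeR; exact: cXI.
  apply: cvg_monotone_convergence => //.
  - by move=> N; exact: (measurable_exp_XI norm_levy).
  - by move=> N w _; exact: expeR_ge0.
  - by move=> w _ i j ij; rewrite lee_expeR; exact: ndXI.
rewrite -(cvg_lim _ lim)//; apply: lime_le; last exact: nearW.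
by apply/cvg_ex; eexists; exact: lim.
Unshelve. all: by end_near. Qed.

End khasminskii.

(** * Exit times *)

Section enorm_theory.
Context (R : realType) (d : nat).
Local Notation Rd := 'rV[R]_d.
Implicit Types x y z : Rd.

Lemma dotv_ge0 x : 0 <= dotv x x.
Proof. by apply: sumr_ge0 => i _; rewrite -expr2 sqr_ge0. Qed.

Lemma enorm_ge0 x : 0 <= enorm x. Proof. exact: sqrtr_ge0. Qed.

Lemma enorm_sqr x : enorm x ^+ 2 = dotv x x.
Proof. by rewrite sqr_sqrtr// dotv_ge0. Qed.

Lemma dotvC x y : dotv x y = dotv y x.
Proof. by apply: eq_bigr => i _; rewrite mulrC. Qed.

Lemma dotvDl x y z : dotv (x + y) z = dotv x z + dotv y z.
Proof. by rewrite /dotv -big_split; apply: eq_bigr => i _; rewrite mxE mulrDl. Qed.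

Lemma dotvZl (c : R) x y : dotv (c *: x) y = c * dotv x y.
Proof. by rewrite /dotv big_distrr /=; apply: eq_bigr => i _; rewrite mxE -mulrA. Qed.

Lemma dotvNl x y : dotv (- x) y = - dotv x y.
Proof. by rewrite -scaleN1r dotvZl mulN1r. Qed.

Lemma dotvDr x y z : dotv z (x + y) = dotv z x + dotv z y.
Proof. by rewrite dotvC dotvDl !(dotvC z). Qed.

Lemma dotvNr x y : dotv x (- y) = - dotv x y.
Proof. by rewrite dotvC dotvNl dotvC. Qed.

Lemma dotvZr (c : R) x y : dotv x (c *: y) = c * dotv x y.
Proof. by rewrite dotvC dotvZl dotvC. Qed.

Lemma dotv0l x : dotv 0 x = 0.
Proof. by rewrite -(scale0r x) dotvZl mul0r. Qed.

Lemma enormN x : enorm (- x) = enorm x.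
Proof. by rewrite /enorm dotvNl dotvNr opprK. Qed.

Lemma enormB x y : enorm (x - y) = enorm (y - x).
Proof. by rewrite -enormN opprB. Qed.

Lemma enorm0 : enorm (0 : Rd) = 0.
Proof. by rewrite /enorm dotv0l sqrtr0. Qed.

Lemma coord_le_enorm x i : `|x ord0 i| <= enorm x.
Proof.
rewrite -sqrtr_sqr ler_wsqrtr// /dotv (bigD1 i)//= -expr2 lerDl.
by apply: sumr_ge0 => j _; rewrite -expr2 sqr_ge0.
Qed.

Lemma enorm_eq0 x : enorm x = 0 -> x = 0.
Proof.
move=> x0; apply/rowP => i; rewrite mxE.
by apply/eqP; rewrite -normr_le0 -x0 coord_le_enorm.
Qed.

Lemma cauchy_schwarz x y : dotv x y <= enorm x * enorm y.
Proof.
have [y0|yn0] := eqVneq (enorm y) 0.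
  by rewrite (enorm_eq0 y0) dotvC dotv0l enorm0 mulr0.
have yp : 0 < enorm y by rewrite lt_def yn0 enorm_ge0.
have yy : 0 < dotv y y by rewrite -enorm_sqr exprn_gt0.
suff : dotv x y ^+ 2 <= (enorm x * enorm y) ^+ 2.
  move=> h; have [xy0|xy0] := leP 0 (dotv x y).
    by rewrite -ler_sqr ?nnegrE// mulr_ge0 ?enorm_ge0.
  by apply: (le_trans (ltW xy0)); rewrite mulr_ge0 ?enorm_ge0.
rewrite exprMn !enorm_sqr.
have := dotv_ge0 (dotv y y *: x - dotv x y *: y).
rewrite dotvDl !dotvDr !dotvNl !dotvNr !dotvZl !dotvZr (dotvC y x) => h.
have : 0 <= dotv y y * (dotv x x * dotv y y - dotv x y ^+ 2) by nra.
by rewrite pmulr_rge0// subr_ge0.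
Qed.

Lemma enormD x y : enorm (x + y) <= enorm x + enorm y.
Proof.
rewrite -ler_sqr ?nnegrE ?addr_ge0 ?enorm_ge0// sqrrD !enorm_sqr.
rewrite dotvDl !dotvDr (dotvC y x); have := cauchy_schwarz x y; nra.
Qed.

Lemma enorm_le_sum x : enorm x <= \sum_i `|x ord0 i|.
Proof.
rewrite -ler_sqr ?nnegrE ?enorm_ge0 ?sumr_ge0// enorm_sqr.
rewrite expr2 big_distrl /=; apply: ler_sum => i _.
rewrite -[leLHS]ger0_norm -?expr2 ?sqr_ge0// normrX expr2 ler_wpM2l//.
by rewrite (bigD1 i)//= lerDl sumr_ge0.
Qed.

Lemma cvg_sumr T (F : set_system T) {FF : Filter F} n (f : 'I_n -> T -> R) (l : 'I_n -> R) :
  (forall i, f i t @[t --> F] --> l i) ->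
  \sum_(i < n) f i t @[t --> F] --> \sum_(i < n) l i.
Proof.
move=> fl; elim: n f l fl => [|n IH] f l fl.
  rewrite big_ord0; under eq_fun do rewrite big_ord0; exact: cvg_cst.
rewrite big_ord_recr; under eq_fun do rewrite big_ord_recr/=.
by apply: cvgD => //; apply: IH => i.
Qed.

Lemma continuous_enorm : continuous (@enorm R d).
Proof.
move=> x; apply: (@continuous_comp _ _ _ (fun x => dotv x x) Num.sqrt).
  by apply: (cvg_sumr (F := nbhs x)) => i; apply: cvgM; exact: coord_continuous.
exact: sqrt_continuous.
Qed.

Lemma cvg_rV T (F : set_system T) {FF : Filter F} (f : T -> Rd) (l : Rd) :
  (forall j, f t ord0 j @[t --> F] --> l ord0 j) -> f t @[t --> F] --> l.
Proof.
move=> fl A [Q Qn QA]; have : \forall t \near F, forall j, Q ord0 j (f t ord0 j).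
  by apply: filter_forall => j; exact: fl (Qn ord0 j).
by apply: filterS => t Qt; apply: QA => i j; rewrite (ord1 i); exact: Qt.
Qed.

Lemma cvg_addl_rV T (F : set_system T) {FF : Filter F} (x : Rd) (f : T -> Rd) (l : Rd) :
  f t @[t --> F] --> l -> x + f t @[t --> F] --> x + l.
Proof.
move=> fl; apply: cvg_rV => j; rewrite mxE; under eq_fun do rewrite mxE.
apply: cvgD; first exact: cvg_cst.
apply: (@cvg_comp _ _ _ f (fun M : Rd => M ord0 j) _ _ _ fl).
exact: coord_continuous.
Qed.

Lemma continuous_measurable_rV (f : Rd -> R) : continuous f -> measurable_fun setT f.
Proof.
move=> cf; apply: (measurability _ (RGenOpens.measurableE R)).
move=> _ [_ [a [b ->]] <-]; rewrite setTI; apply: open_measurable_mx.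
by apply: open_comp; last exact: interval_open.
Qed.

Lemma measurable_enorm : measurable_fun setT (@enorm R d).
Proof. by apply: continuous_measurable_rV; exact: continuous_enorm. Qed.

Lemma open_eball x r : open (eball x r).
Proof.
have -> : eball x r = (fun y => enorm (y - x)) @^-1` [set t | t < r] by [].
apply: open_comp; last exact: open_lt.
move=> y _; apply: (@continuous_comp _ _ _ (fun y => y - x) (@enorm R d)).
  have h : (z - x) @[z --> y] --> y - x.
    under eq_fun do rewrite addrC; rewrite addrC.
    exact: (@cvg_addl_rV _ (nbhs y) _ _ id).
  exact: h.
exact: continuous_enorm.
Qed.

Lemma measurable_eball x r : measurable (eball x r).
Proof. by apply: open_measurable_mx; exact: open_eball. Qed.

Lemma open_enorm_lt r : open [set x : Rd | enorm x < r].
Proof.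
have -> : [set x : Rd | enorm x < r] = (@enorm R d) @^-1` [set t | t < r] by [].
by apply: open_comp; [move=> x _; exact: continuous_enorm|exact: open_lt].
Qed.

Lemma open_enorm_gt r : open [set x : Rd | r < enorm x].
Proof.
have -> : [set x : Rd | r < enorm x] = (@enorm R d) @^-1` [set t | r < t] by [].
by apply: open_comp; [move=> x _; exact: continuous_enorm|exact: open_gt].
Qed.

End enorm_theory.

(** * Averages and small integrals over intervals *)

Section interval_tools.
Context {R : realType}.
Local Notation leb := (@lebesgue_measure R).
Local Notation "'measR' f" := (measurable_fun setT (f : measurableTypeR R -> _)) (at level 10).

Lemma lebesgue_itvcc (a b : R) : a <= b -> leb `[a, b] = (b - a)%:E.
Proof.
rewrite le_eqVlt => /predU1P[->|ab]; rewrite lebesgue_measure_itv/= lte_fin.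
  by rewrite ltxx subrr.
by rewrite ab.
Qed.

(** Right-continuity at [s] is phrased as a two-sided bound on short windows because [G] may be
    infinite farther on; on such a window the average is squeezed between [l - e] and [l + e]. *)
Lemma cvg_average (G : R -> \bar R) (s l : R) (h : nat -> R) (hn : forall n, 0 < h n) :
  h n @[n --> \oo] --> 0 -> measR G -> (forall u, (0 <= G u)%E) ->
  (forall e, 0 < e -> \forall dl \near 0^'+, forall u, s <= u <= s + dl ->
    ((l - e)%:E <= G u <= (l + e)%:E)%E) ->
  ((h n)^-1%:E * \int[leb]_(u in `[s, (s + h n)%R]) G u)%E @[n --> \oo] --> l%:E.
Proof.
move=> h0 mG G0 near_l.
have key e : 0 < e -> \forall n \near \oo, ((l - e)%:E <=
    (h n)^-1%:E * \int[leb]_(u in `[s, (s + h n)%R]) G u <= (l + e)%:E)%E.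
  move=> e0; have [dl /= dl0 H] := near_l e e0.
  move/cvgrPdist_lt : h0 => /(_ dl dl0); apply: filterS => n.
  rewrite sub0r normrN gtr0_norm// => hdl.
  have {}H := H (h n) _ (hn n).
  have Hn : forall u, s <= u <= s + h n -> ((l - e)%:E <= G u <= (l + e)%:E)%E.
    by apply: H; rewrite /ball/= sub0r normrN gtr0_norm.
  have il (c : R) : ((h n)^-1%:E * \int[leb]_(u in `[s, (s + h n)%R]) c%:E)%E = c%:E.
    rewrite integral_cst//= lebesgue_itvcc ?lerDl ?ltW//.
    by rewrite -!EFinM addrAC subrr add0r mulrCA mulVf ?mulr1// gt_eqF.
  have hi : 0 <= (h n)^-1 by rewrite invr_ge0 ltW.
  apply/andP; split.
    have [le0|le0] := leP (l - e) 0.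
      apply: (@le_trans _ _ 0%E); first by rewrite lee_fin.
      by rewrite mule_ge0 ?lee_fin// integral_ge0.
    rewrite -[leLHS]il lee_wpmul2l ?lee_fin//.
    apply: ge0_le_integralP => u /=; first by move=> _; rewrite lee_fin ltW.
    by rewrite in_itv/= => /Hn/andP[].
  rewrite -[leRHS]il lee_wpmul2l ?lee_fin//.
  by apply: ge0_le_integralP => u /=; rewrite in_itv/= => /Hn/andP[].
apply/fine_cvgP; split.
  apply: filterS (key 1 ltr01) => n /andP[lo hi].
  by apply/fin_numP; split; apply/eqP => E; rewrite E in lo hi.
apply/cvgrPdist_le => e e0; apply: filterS (key e e0) => n /andP[lo hi].
have fn : ((h n)^-1%:E * \int[leb]_(u in `[s, (s + h n)%R]) G u)%E \is a fin_num.
  by apply/fin_numP; split; apply/eqP => E; rewrite E in lo hi.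
rewrite -(fineK fn) !lee_fin in lo hi.
by rewrite /= ler_norml; apply/andP; split; lra.
Qed.

Lemma small_integral (G : R -> \bar R) (s c : R) : 0 < c -> measR G ->
  (forall u, (0 <= G u)%E) -> (\int[leb]_(u in `[s, (s + c)%R]) G u < +oo)%E ->
  forall e, 0 < e -> \forall dl \near 0^'+,
    (\int[leb]_(u in `[s, (s + dl)%R]) G u <= e%:E)%E.
Proof.
move=> c0 mG G0 Gfin.
pose h (n : nat) : R := c / n.+1%:R.
have hp n : 0 < h n by rewrite divr_gt0.
have hc n : h n <= c by rewrite ler_pdivrMr// ler_peMr ?ler1n// ltW.
have lim0 : (\int[leb]_(u in `[s, (s + h n)%R]) G u)%E @[n --> \oo] --> 0%E.
  have -> : 0%E = (\int[leb]_(u in `[s, (s + c)%R]) (cst 0%E u))%E by rewrite integral0.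
  pose Gn n u := (G u * (u <= s + h n)%R%:R%:E)%E.
  have e n : (\int[leb]_(u in `[s, (s + h n)%R]) G u =
      \int[leb]_(u in `[s, (s + c)%R]) Gn n u)%E.
    rewrite integral_mkcond [RHS]integral_mkcond; apply: eq_integral => u _.
    rewrite !patchE !mem_setE !in_itv/= /Gn; have [su|] /= := leP s u; last by [].
    have [uh|uh] := leP u (s + h n).
      by rewrite (le_trans uh) ?lerD2l// mule1.
    by case: ifP; rewrite ?mule0.
  under eq_fun do rewrite e.
  have mGn n : measR (Gn n).
    apply: emeasurable_funM => //; apply/measurable_EFinP.
    rewrite (_ : (fun _ => _) = fun u : measurableTypeR R => if (u <= s + h n)%R then 1 else 0); last first.
      by apply/funext => u; case: (_ <= _).
    by apply: measurable_fun_ifT => //; exact: measurable_fun_ler.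
  (* The truncated integrands tend to 0 except at [u = s], where the indicator stays 1; a single
     point is negligible. *)
  have ae0 : {ae leb, forall u, `[s, (s + c)%R]%classic u -> Gn ^~ u @ \oo --> (cst 0%E : R -> \bar R) u}.
    exists [set s]; split => //; first by rewrite lebesgue_measure_set1.
    move=> u /= H; apply: contrapT => us; apply: H => suc.
    rewrite in_itv/= in suc; case/andP: suc => su uc.
    have {}us : s < u by rewrite lt_def su andbT; apply/eqP.
    apply: cvg_near_cst; near=> n.
    rewrite /Gn leNgt (_ : s + h n < u) ?mule0//.
    rewrite -ltrBrDl /h ltr_pdivrMr// mulrC -ltr_pdivrMr ?subr_gt0//.
    rewrite (@lt_le_trans _ _ n%:R)// ?ler_nat//; near: n; exact: nbhs_infty_gtr.
  have ig : leb.-integrable `[s, (s + c)%R]%classic G.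
    apply/integrableP; split; first exact: measurable_funTS.
    by under eq_integral do rewrite gee0_abs//.
  have dom : {ae leb, forall u n, `[s, (s + c)%R]%classic u -> (`|Gn n u| <= G u)%E}.
    apply/aeW => u n _; rewrite gee0_abs ?mule_ge0//.
    by rewrite /Gn; case: (u <= s + h n)%R; rewrite ?mule1 ?mule0.
  have mD : measurable (`[s, (s + c)%R]%classic : set (measurableTypeR R)) by [].
  by have [_ _] := dominated_convergence mD (fun n => measurable_funTS (mGn n))
    (measurable_cst _) ae0 ig dom.
move=> e e0.
have [n _ /(_ n (leqnn n)) /= Hn] : \forall n \near \oo,
    (\int[leb]_(u in `[s, (s + h n)%R]) G u <= e%:E)%E.
  move/fine_cvgP: lim0 => [fn /cvgrPdist_le/(_ e e0)].
  move: fn; apply: filterS2 => n fn; rewrite sub0r normrN.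
  by rewrite ger0_norm ?fine_ge0 ?integral_ge0// -lee_fin fineK.
near=> dl; apply: le_trans Hn; apply: ge0_subset_integral => //=.
- exact: measurable_funTS.
- move=> u /=; rewrite !in_itv/= => /andP[-> us]; apply: le_trans us _.
  by rewrite lerD2l; near: dl; exact: nbhs_right_le.
Unshelve. all: by end_near. Qed.

End interval_tools.

(** * Exit times on path space *)

Section exit_time_functional.
Context (R : realType) (d : nat).
Local Notation Rd := 'rV[R]_d.
Local Notation leb := (@lebesgue_measure R).
Local Notation path := (path R d).

(* The exit time of the ball of radius rho, truncated at T, observed at dyadic
   times only; it is not smaller than the true exit time of the open ball. *)
Definition exitT (rho T : R) (z : path) : R :=
  fine (einfs (fun m => (if enorm (z m) < rho then T else Num.min T (dtime R m))%:E) 0).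

(** A condition on the path up to time [t] alone, so that the Markov property at time [t] can be
    applied under it. *)
Definition alive (rho t : R) (z : path) : Prop :=
  forall m, dtime R m <= t -> enorm (z m) < rho.

Definition aliveI (rho t : R) (z : path) : R := (`[< alive rho t z >])%:R.

Lemma aliveI_ge0 rho t z : 0 <= aliveI rho t z. Proof. exact: ler0n. Qed.

Lemma measurable_aliveI rho : measurable_fun setT
  (fun tz : measurableTypeR R * path => aliveI rho tz.1 tz.2).
Proof.
rewrite (_ : (fun _ => _) = \1_(\bigcap_m ([set tz : measurableTypeR R * path | tz.1 < dtime R m] `|`
   [set tz : measurableTypeR R * path | enorm (tz.2 m) < rho]))); last first.
  apply/funext => tz; rewrite indicE /aliveI; congr (_%:R); congr nat_of_bool.
  apply/asboolP/idP => [al|].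
    rewrite inE => m _ /=; have [h|h] := ltP tz.1 (dtime R m); first by left.
    by right; exact: al.
  by rewrite inE => H m mt; have [|//] := H m I; rewrite /= ltNge mt.
apply: measurable_indic; apply: bigcapT_measurable => m; apply: measurableU.
  rewrite -[X in measurable X]setTI; apply: measurable_fun_ltr => //.
rewrite -[X in measurable X]setTI; apply: measurable_fun_ltr => //.
apply: (measurableT_comp (@measurable_enorm R d)).
apply: (measurableT_comp (measurable_path_coord m)); exact: measurable_snd.
Qed.

Section exit.
Variables (rho T : R).
Hypothesis T0 : 0 <= T.
Let u (z : path) m := if enorm (z m) < rho then T else Num.min T (dtime R m).

Let u_ge0 z m : 0 <= u z m.
Proof. by rewrite /u; case: ifP => // _; rewrite le_min T0 dtime_ge0. Qed.

Let u_leT z m : u z m <= T.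
Proof. by rewrite /u; case: ifP => // _; rewrite ge_min lexx. Qed.

Let exitE z : (exitT rho T z)%:E = einfs (fun m => (u z m)%:E) 0.
Proof.
rewrite fineK// ge0_fin_numE.
  apply: (@le_lt_trans _ _ (u z 0%N)%:E); last exact: ltry.
  by apply: ereal_inf_lbound; exists 0%N.
by apply: le_ereal_inf_tmp => _ [m _ <-]; rewrite lee_fin; exact: u_ge0.
Qed.

Lemma exitT_glb z t : (forall m, t <= u z m) -> t <= exitT rho T z.
Proof.
move=> tu; rewrite -lee_fin exitE; apply: le_ereal_inf_tmp => _ [m _ <-].
by rewrite lee_fin; exact: tu.
Qed.

Lemma exitT_lb z m : exitT rho T z <= u z m.
Proof. by rewrite -lee_fin exitE; apply: ereal_inf_lbound; exists m. Qed.

Lemma exitT_ge0 z : 0 <= exitT rho T z.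
Proof. exact: exitT_glb. Qed.

Lemma exitT_leT z : exitT rho T z <= T.
Proof. exact: le_trans (exitT_lb z 0%N) (u_leT _ _). Qed.

Lemma lt_exitT_alive z t : t < exitT rho T z -> alive rho t z.
Proof.
move=> te m mt; rewrite ltNge; apply/negP => h.
have := exitT_lb z m; rewrite /u ltNge h/= => h'.
have := le_lt_trans mt (lt_le_trans te h').
by rewrite lt_min ltxx andbF.
Qed.

Lemma alive_le_exitT z t : t <= T -> alive rho t z -> t <= exitT rho T z.
Proof.
move=> tT al; apply: exitT_glb => m; rewrite /u; case: ifPn => // h.
rewrite le_min tT/= leNgt; apply/negP => mt.
by move: h; rewrite (al m (ltW mt)).
Qed.

Lemma measurable_exitT : measurable_fun setT (exitT rho T).
Proof.
apply: (measurableT_comp (fine_measurable measurableT)).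
apply: measurable_fun_einfs => m; apply/measurable_EFinP.
apply: measurable_fun_ifT => //.
apply: measurable_fun_ltr => //.
exact: (measurableT_comp (@measurable_enorm R d) (measurable_path_coord m)).
Qed.

(** Trades the random upper bound for an indicator known at time [t], which lets the Markov property
    act inside the time integral. The two integrands can differ only when [t] equals the exit
    time. *)
Lemma alive_integral z (g : R -> \bar R) :
  measurable_fun setT (g : measurableTypeR R -> _) -> (forall t, (0 <= g t)%E) ->
  (\int[leb]_(t in `[0%R, T]) ((aliveI rho t z)%:E * g t) =
   \int[leb]_(t in `[0%R, exitT rho T z]) g t)%E.
Proof.
move=> mg g0.
have mal : measurable_fun setT (fun t : measurableTypeR R => ((aliveI rho t z)%:E * g t)%E).
  apply: emeasurable_funM => //; apply/measurable_EFinP.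
  exact: (measurableT_comp (measurable_aliveI rho) (pair2_measurable z)).
rewrite integral_mkcond -[RHS]integral_itv_bndo_bndc; last exact: measurable_funTS.
rewrite [RHS]integral_mkcond.
apply: ge0_ae_eq_integral => //.
- by apply: (measurable_restrictT _ _).1 => //; exact: measurable_funTS mal.
- by apply: (measurable_restrictT _ _).1 => //; exact: measurable_funTS mg.
- by move=> t _; rewrite patchE; case: ifP => // _; rewrite mule_ge0 ?lee_fin ?aliveI_ge0.
- by move=> t _; rewrite patchE; case: ifP.
exists [set exitT rho T z]; split => //; first exact: lebesgue_measure_set1.
move=> t /= H; apply: contrapT => tz; apply: H => _.
rewrite !patchE !mem_setE !in_itv/=; have [t0|//] := leP 0 t; rewrite /=.
have [te|] := ltP t (exitT rho T z).
  rewrite (le_trans (ltW te) (exitT_leT z)) /aliveI.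
  by rewrite (asboolT (lt_exitT_alive te)) mul1e.
move=> et0; have et : (exitT rho T z < t :> R).
  by rewrite lt_neqAle et0 andbT; apply/eqP => E; exact: tz (esym E).
case: ifP => // tT.
rewrite /aliveI asboolF ?mul0e// => al.
by have := lt_le_trans et (alive_le_exitT tT al); rewrite ltxx.
Qed.

End exit.

End exit_time_functional.

(** * Exit times along right-continuous paths *)

Section exit_paths.
Context (disp : measure_display) (Omega : measurableType disp) (R : realType).
Context (d : nat) (P : probability Omega R) (X : R -> Omega -> 'rV[R]_d).
Local Notation Rd := 'rV[R]_d.
Local Notation leb := (@lebesgue_measure R).
Hypothesis norm_levy : normalized_levy P X.
Let lev : is_levy_process P X. Proof. by case: norm_levy. Qed.
Let X0 w : X 0 w = 0. Proof. by case: norm_levy. Qed.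

Definition exit_at (rho T : R) (w : Omega) : R := exitT rho T (dy X w).

Lemma measurable_exit_at rho T : measurable_fun setT (exit_at rho T).
Proof. exact: (measurableT_comp (measurable_exitT rho T) (measurable_dy lev)). Qed.

Lemma alive_cat rho s ww : alive rho s (dy (catp X s) ww) <-> alive rho s (dy X ww.1).
Proof.
by split => al m ms; have := al m ms; rewrite /dy (catp_le norm_levy).
Qed.

Lemma aliveI_cat rho s ww : aliveI rho s (dy (catp X s) ww) = aliveI rho s (dy X ww.1).
Proof. by rewrite /aliveI; congr (_%:R); congr nat_of_bool; apply/asbool_equiv_eq/alive_cat. Qed.

Lemma dyadic_right t w (A : set Rd) : 0 <= t -> open A -> A (X t w) ->
  exists2 e, 0 < e & forall s, t <= s < t + e -> A (X s w).
Proof.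
move=> t0 oA At; have /= [e /= e0 eA] := rcont norm_levy (w := w) t0 (open_nbhs_nbhs (conj oA At)).
exists e => // s /andP[]; rewrite le_eqVlt => /predU1P[<- //|ts ste].
apply: eA => //=; rewrite distrC ger0_norm ?subr_ge0 ?(ltW ts)//.
by rewrite ltrBlDl.
Qed.

Lemma exists_dtime (s e : R) : 0 <= s -> 0 < e -> exists m, s < dtime R m < s + e.
Proof.
move=> s0 e0; have /cvgrPdist_lt /(_ e e0) [n _ /(_ n (leqnn n))] := approx_index_cvg s0.
move=> h; exists (approx_index n s); rewrite approx_index_gt/=.
move: h; rewrite distrC /= ger0_norm ?subr_ge0; last exact/ltW/approx_index_gt.
by rewrite ltrBlDl.
Qed.

(** A value outside the closed ball would persist on a short interval to the right, which contains a
    dyadic time before the exit. A limit of values in the open ball may lie on the sphere, hence the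
    weak inequality. *)
Lemma before_exit rho T t w : 0 <= T -> 0 <= t -> t < exit_at rho T w -> enorm (X t w) <= rho.
Proof.
move=> T0 t0 te; rewrite leNgt; apply/negP => h.
have oA : open [set x : Rd | rho < enorm x].
  exact: open_enorm_gt.
have [e e0 He] := dyadic_right t0 oA h.
have e'0 : 0 < Num.min e (exit_at rho T w - t) by rewrite lt_min e0 subr_gt0.
have [m /andP[tm]] := exists_dtime t0 e'0.
rewrite -ltrBlDl lt_min !ltrBlDl => /andP[mte mex].
rewrite addrC subrK in mex.
have := He _ (_ : t <= dtime R m < t + e); rewrite (ltW tm) mte => /(_ isT) /=.
by rewrite ltNge ltW//; apply: (lt_exitT_alive T0 mex).
Qed.

(** Otherwise right-continuity would keep the path in the open ball for a while after the exit time,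
    against its maximality. *)
Lemma at_exit rho T w : 0 <= T -> exit_at rho T w < T -> rho <= enorm (X (exit_at rho T w) w).
Proof.
move=> T0 sT; rewrite leNgt; apply/negP => h.
have s0 : 0 <= exit_at rho T w by exact: exitT_ge0.
have oA : open [set x : Rd | enorm x < rho].
  exact: open_enorm_lt.
have [e e0 He] := dyadic_right s0 oA h.
have lt_s : exit_at rho T w < Num.min T (exit_at rho T w + e / 2).
  by rewrite lt_min sT ltrDl divr_gt0.
suff : Num.min T (exit_at rho T w + e / 2) <= exit_at rho T w by rewrite leNgt lt_s.
apply: alive_le_exitT => //; first by rewrite ge_min lexx.
move=> m mle; have [ms|sm] := ltP (dtime R m) (exit_at rho T w).
  exact: (lt_exitT_alive T0 ms).
apply: He; rewrite sm/=; apply: (le_lt_trans mle).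
by rewrite gt_min; apply/orP; right; rewrite ltrD2l ltr_pdivrMr// ltr_pMr// ltr1n.
Qed.

Lemma exit_at_gt0 rho T w : 0 < rho -> 0 < T -> 0 < exit_at rho T w.
Proof.
move=> rho0 T0; rewrite lt_def exitT_ge0 ?(ltW T0)// andbT; apply/eqP => s0.
have := @at_exit rho T w (ltW T0); rewrite s0 => /(_ T0).
by rewrite X0 enorm0 leNgt rho0.
Qed.

End exit_paths.

(** * Markov formulas for the killed weight *)

Section markov_formulas.
Context (disp : measure_display) (Omega : measurableType disp) (R : realType).
Context (d : nat) (P : probability Omega R) (X : R -> Omega -> 'rV[R]_d).
Local Notation Rd := 'rV[R]_d.
Local Notation leb := (@lebesgue_measure R).
Hypothesis norm_levy : normalized_levy P X.
Let lev : is_levy_process P X. Proof. by case: norm_levy. Qed.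
Let X0 w : X 0 w = 0. Proof. by case: norm_levy. Qed.
Let Xpos t w : X t w = pos (dy X w) t. Proof. by case: norm_levy. Qed.

Lemma ae_fin (f : Omega -> \bar R) : measurable_fun setT f -> (forall w, (0 <= f w)%E) ->
  (\int[P]_w f w < +oo)%E -> {ae P, forall w, (f w < +oo)%E}.
Proof.
move=> mf f0 fi; have fint : P.-integrable setT f.
  by apply/integrableP; split => //; under eq_integral do rewrite gee0_abs//.
have := integrable_ae measurableT fint; apply: filterS => w /(_ I).
by rewrite ge0_fin_numE.
Qed.

Lemma integral_swap (T : R) (G : R * Omega -> \bar R) :
  measurable_fun setT (G : measurableTypeR R * Omega -> _) -> (forall x, (0 <= G x)%E) ->
  (\int[P]_w \int[leb]_(t in `[0%R, T]) G (t, w) =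
   \int[leb]_(t in `[0%R, T]) \int[P]_w G (t, w))%E.
Proof.
move=> mG G0.
pose G' (wt : Omega * measurableTypeR R) := (G (wt.2, wt.1) * (\1_(`[0, T]%classic : set R) wt.2)%:E)%E.
have mG' : measurable_fun setT G'.
  apply: emeasurable_funM.
    have h : measurable_fun setT (fun wt : Omega * measurableTypeR R => (wt.2, wt.1)).
      by apply: measurable_fun_pair; [exact: measurable_snd|exact: measurable_fst].
    exact: (measurableT_comp mG h).
  apply/measurable_EFinP.
  apply: (measurableT_comp (measurable_indic _)); last exact: measurable_snd.
  by [].
have e t w : G' (w, t) = if t \in `[0, T] then G (t, w) else 0%E.
  by rewrite /G' indicE mem_setE /=; case: ifPn => _; rewrite ?mule1 ?mule0.
transitivity (\int[P]_w \int[leb]_t G' (w, t))%E.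
  by apply: eq_integral => w _; rewrite integral_mkcond; apply: eq_integral => t _; rewrite e patchE mem_setE.
rewrite (fubini_tonelli G')//; last by move=> wt; rewrite mule_ge0 ?lee_fin.
rewrite [RHS]integral_mkcond; apply: eq_integral => t _.
rewrite patchE mem_setE; case: ifPn => tT.
  by apply: eq_integral => w _; rewrite e tT.
by rewrite integral0_eq// => w _; rewrite e (negbTE tT).
Qed.

(** The form in which [markov] is applied: [A] collects what is known at time [t], and [Psi] is the
    functional of the path restarted from [x + X t]. *)
Lemma markov_factor (x : Rd) (t : R) (F : path R d -> \bar R) (A : Omega -> \bar R)
    (Psi : Rd -> Omega -> \bar R) : 0 <= t ->
  measurable_fun setT F -> (forall z, (0 <= F z)%E) -> (forall w, (0 <= A w)%E) ->
  (forall y, measurable_fun setT (Psi y)) -> (forall y w, (0 <= Psi y w)%E) ->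
  (forall w w', F (dy (catp X t) (w, w')) = (A w * Psi (x + X t w)%R w')%E) ->
  (\int[P]_w F (dy X w) = \int[P]_w (A w * \int[P]_w' Psi (x + X t w)%R w'))%E.
Proof.
move=> t0 mF F0 A0 mPsi Psi0 FE; rewrite (markov lev t0 mF F0).
apply: eq_integral => w _; under eq_integral do rewrite FE.
by rewrite ge0_integralZl.
Qed.

(** The transition operator of the process over time [h], with values in the extended reals. *)
Definition Kop (h : R) (f : Rd -> R) (y : Rd) : \bar R := (\int[P]_w (f (y + X h w))%:E)%E.

Lemma measurable_fX (f : Rd -> R) t y : measurable_fun setT f ->
  measurable_fun setT (fun w => (f (y + X t w))%:E).
Proof.
move=> mf; apply/measurable_EFinP; apply: (measurableT_comp mf).
exact: measurable_addX norm_levy y t.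
Qed.

Lemma measurable_Kop h (f : Rd -> R) : measurable_fun setT f -> (forall x, 0 <= f x) ->
  measurable_fun setT (Kop h f).
Proof.
move=> mf f0.
apply: (measurable_fun_fubini_tonelli_F (fun yw : Rd * Omega => (f (yw.1 + X h yw.2))%:E)).
  apply/measurable_EFinP; apply: (measurableT_comp mf).
  apply: measurable_funD_rV; first exact: measurable_fst.
  exact: (measurableT_comp (measurable_Xt norm_levy h) measurable_snd).
by move=> yw; rewrite lee_fin.
Qed.

Lemma Kop_ge0 h (f : Rd -> R) y : (forall x, 0 <= f x) -> (0 <= Kop h f y)%E.
Proof. by move=> f0; apply: integral_ge0 => w _; rewrite lee_fin. Qed.

Lemma measurable_XtD c : measurable_fun setT
  (fun tw : measurableTypeR R * Omega => X (tw.1 + c) tw.2).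
Proof.
have h : measurable_fun setT (fun tw : measurableTypeR R * Omega =>
    ((tw.1 + c : measurableTypeR R), tw.2)).
  apply: measurable_fun_pair; last exact: measurable_snd.
  by apply: measurable_funD; [exact: measurable_fst|exact: measurable_cst].
exact: (measurableT_comp (measurable_X norm_levy) h).
Qed.

Lemma measurable_aliveX rho : measurable_fun setT
  (fun tw : measurableTypeR R * Omega => (aliveI rho tw.1 (dy X tw.2))%:E).
Proof.
apply/measurable_EFinP.
have h : measurable_fun setT (fun tw : measurableTypeR R * Omega => (tw.1, dy X tw.2)).
  apply: measurable_fun_pair; first exact: measurable_fst.
  exact: (measurableT_comp (measurable_dy lev) measurable_snd).
exact: (measurableT_comp (measurable_aliveI rho) h).
Qed.

Definition killed (Q : Rd -> R) (x : Rd) (t : R) (w : Omega) : \bar R := expeR (- XI X Q x t w).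

Lemma killed_ge0 Q x t w : (0 <= killed Q x t w)%E. Proof. exact: expeR_ge0. Qed.

Lemma killed_le1 Q x t w : (forall y, 0 <= Q y) -> (killed Q x t w <= 1)%E.
Proof.
by move=> Q0; rewrite -expeR0 /killed lee_expeR oppe_le0; exact: XI_ge0.
Qed.

Lemma measurable_killed (Q : Rd -> R) x : measurable_fun setT Q -> (forall y, 0 <= Q y) ->
  measurable_fun setT (fun tw : measurableTypeR R * Omega => killed Q x tw.1 tw.2).
Proof.
move=> mQ Q0; apply: (measurableT_comp measurable_expeR).
by apply: (measurableT_comp (@oppe_measurable _ _)); exact: (measurable_XItw norm_levy).
Qed.

Lemma measurable_killed_path (Q : Rd -> R) x t : measurable_fun setT Q -> (forall y, 0 <= Q y) ->
  measurable_fun setT (fun z : path R d => expeR (- pI Q x t z)).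
Proof.
move=> mQ Q0; apply: (measurableT_comp measurable_expeR).
by apply: (measurableT_comp (@oppe_measurable _ _)); exact: measurable_pI_path.
Qed.

Lemma measurable_pos_at t : measurable_fun setT (fun z : path R d => pos z t).
Proof. exact: (measurableT_comp (@measurable_pos R d) (pair1_measurable (t : measurableTypeR R))). Qed.

Lemma measurable_alive_at rho t : measurable_fun setT (fun z : path R d => (aliveI rho t z)%:E).
Proof.
apply/measurable_EFinP.
exact: (measurableT_comp (measurable_aliveI rho) (pair1_measurable (t : measurableTypeR R))).
Qed.

Section killed_markov.
Variables (rho h T : R) (x : Rd) (Q f : Rd -> R).
Hypotheses (h0 : 0 <= h) (mQ : measurable_fun setT Q) (Q0 : forall y, 0 <= Q y).
Hypotheses (mf : measurable_fun setT f) (f0 : forall y, 0 <= f y).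

Lemma killed_markov_at t : 0 <= t ->
  (\int[P]_w ((aliveI rho t (dy X w))%:E * (killed Q x t w * (f (x + X (t + h) w))%:E)) =
   \int[P]_w ((aliveI rho t (dy X w))%:E * (killed Q x t w * Kop h f (x + X t w)%R)))%E.
Proof.
move=> t0.
pose F (z : path R d) := ((aliveI rho t z)%:E * (expeR (- pI Q x t z) * (f (x + pos z (t + h)))%:E))%E.
transitivity (\int[P]_w F (dy X w))%E.
  by apply: eq_integral => w _; rewrite /F (pI_dy norm_levy) -Xpos.
rewrite (@markov_factor x t F (fun w => (aliveI rho t (dy X w))%:E * killed Q x t w)%E
   (fun y w' => (f (y + X h w'))%:E))//.
- by apply: eq_integral => w _; rewrite muleA.
- apply: emeasurable_funM; first exact: measurable_alive_at.
  apply: emeasurable_funM; first exact: measurable_killed_path.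
  apply/measurable_EFinP; apply: (measurableT_comp mf).
  by apply: measurable_funD_rV => //; exact: measurable_pos_at.
- by move=> z; rewrite !mule_ge0 ?expeR_ge0 ?lee_fin ?aliveI_ge0.
- by move=> w; rewrite mule_ge0 ?killed_ge0 ?lee_fin ?aliveI_ge0.
- by move=> y; exact: measurable_fX.
- by move=> y w; rewrite lee_fin.
- move=> w w'; rewrite /F (aliveI_cat norm_levy) (pI_cat_le norm_levy)//.
  rewrite (pos_catp norm_levy)//; last by rewrite addr_ge0.
  by rewrite catp_add//= muleA addrA.
Qed.

Lemma killed_markov :
  (\int[P]_w \int[leb]_(t in `[0%R, T])
     ((aliveI rho t (dy X w))%:E * (killed Q x t w * (f (x + X (t + h) w))%:E)) =
   \int[P]_w \int[leb]_(t in `[0%R, T])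
     ((aliveI rho t (dy X w))%:E * (killed Q x t w * Kop h f (x + X t w)%R)))%E.
Proof.
have mk := measurable_killed x mQ Q0; have ma := measurable_aliveX rho.
rewrite (integral_swap T (G := fun tw => ((aliveI rho tw.1 (dy X tw.2))%:E *
    (killed Q x tw.1 tw.2 * (f (x + X (tw.1 + h) tw.2))%:E))%E)); last 2 first.
- apply: emeasurable_funM => //; apply: emeasurable_funM => //.
  apply/measurable_EFinP; apply: (measurableT_comp mf).
  by apply: measurable_funD_rV => //; exact: measurable_XtD.
- by move=> tw; rewrite !mule_ge0 ?killed_ge0 ?lee_fin ?aliveI_ge0.
rewrite (integral_swap T (G := fun tw => ((aliveI rho tw.1 (dy X tw.2))%:E *
    (killed Q x tw.1 tw.2 * Kop h f (x + X tw.1 tw.2)%R))%E)); last 2 first.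
- apply: emeasurable_funM => //; apply: emeasurable_funM => //.
  apply: (measurableT_comp (measurable_Kop h mf f0)).
  by apply: measurable_funD_rV => //; exact: measurable_X norm_levy.
- by move=> tw; rewrite !mule_ge0 ?killed_ge0 ?Kop_ge0 ?lee_fin ?aliveI_ge0.
by apply: eq_integral => t; rewrite inE/= in_itv/= => /andP[t0 _]; exact: killed_markov_at.
Qed.

End killed_markov.
End markov_formulas.


(** * The ground state and Duhamel's formula *)

Lemma cvg_continuous_rV (R : realType) d (f : 'rV[R]_d -> R) T (F : set_system T)
    {FF : Filter F} (g : T -> 'rV[R]_d) (l : 'rV[R]_d) : continuous f ->
  g t @[t --> F] --> l -> f (g t) @[t --> F] --> f l.
Proof. by move=> cf gl; apply: (cvg_comp _ _ gl); exact: cf. Qed.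

Lemma cvg_harmonicS (R : realType) : (n.+2%:R^-1 : R) @[n --> \oo] --> (0 : R).
Proof.
rewrite (_ : (fun _ => _) = [sequence (@harmonic R) n.+1]_n)//.
by rewrite cvg_shiftS; exact: cvg_harmonic.
Qed.

Section eigenfunction.
Context (disp : measure_display) (Omega : measurableType disp) (R : realType).
Context (d : nat) (P : probability Omega R) (X : R -> Omega -> 'rV[R]_d).
Local Notation Rd := 'rV[R]_d.
Local Notation leb := (@lebesgue_measure R).
Hypothesis norm_levy : normalized_levy P X.
Let lev : is_levy_process P X. Proof. by case: norm_levy. Qed.
Let X0 w : X 0 w = 0. Proof. by case: norm_levy. Qed.
Let Xpos t w : X t w = pos (dy X w) t. Proof. by case: norm_levy. Qed.
Local Notation XI := (XI X).

Variables (Up Um phi : Rd -> R) (M T0 : R).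
Hypotheses (mUp : measurable_fun setT Up) (Up0 : forall x, 0 <= Up x).
Hypotheses (mUm : measurable_fun setT Um) (Um0 : forall x, 0 <= Um x).
Hypotheses (cphi : continuous phi) (phi0 : forall x, 0 <= phi x) (phiM : forall x, phi x <= M).
Hypotheses (T00 : 0 < T0) (kato : forall y, (\int[P]_w XI Um y T0 w <= (1 / 2)%:E)%E).
(** [Up] is only locally in the Kato class. For a short time after any given time it coincides along
    the path with one of these truncations, whose integrals are almost surely finite. *)
Definition cut (k : nat) (z : Rd) : R := Up z * \1_(eball 0 k%:R) z.
Hypothesis kato_loc : forall k y, (\int[P]_w XI (cut k) y T0 w < +oo)%E.

Lemma measurable_cut k : measurable_fun setT (cut k).
Proof. by apply: measurable_funM => //; apply: measurable_indic; exact: measurable_eball. Qed.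

Lemma cut_ge0 k x : 0 <= cut k x.
Proof. by rewrite mulr_ge0. Qed.

Lemma measurable_phi : measurable_fun setT phi.
Proof. exact: continuous_measurable_rV. Qed.

(** The weight [exp(- int (Up - Um))], written as a product because [int Up] may be infinite: the
    second factor, and with it the product, is then 0. *)
Definition Wt (y : Rd) (t : R) (w : Omega) : \bar R :=
  (expeR (XI Um y t w) * expeR (- XI Up y t w))%E.

Lemma Wt_ge0 y t w : (0 <= Wt y t w)%E.
Proof. by rewrite mule_ge0 ?expeR_ge0. Qed.

Lemma measurable_Wt x : measurable_fun setT
  (fun tw : measurableTypeR R * Omega => Wt x tw.1 tw.2).
Proof.
apply: emeasurable_funM; last exact: (measurable_killed norm_levy).
by apply: (measurableT_comp measurable_expeR); exact: (measurable_XItw norm_levy).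
Qed.

Lemma measurable_Wtyw t : measurable_fun setT (fun yw : Rd * Omega => Wt yw.1 t yw.2).
Proof.
apply: emeasurable_funM; apply: (measurableT_comp measurable_expeR).
  exact: (measurable_XIyw norm_levy).
by apply: (measurableT_comp (@oppe_measurable _ _)); exact: (measurable_XIyw norm_levy).
Qed.

Lemma measurable_Wtw y t : measurable_fun setT (Wt y t).
Proof. exact: (measurableT_comp (measurable_Wtyw t) (pair1_measurable y)). Qed.

Lemma Wt_le y t w : (Wt y t w <= expeR (XI Um y t w))%E.
Proof.
rewrite -[leRHS]mule1 /Wt lee_wpmul2l ?expeR_ge0//.
by rewrite -expeR0 lee_expeR oppe_le0; exact: XI_ge0.
Qed.

Lemma markov_Wt_at x s r w w' : 0 <= s -> 0 <= r ->
  (expeR (pI Um x (s + r) (dy (catp X s) (w, w'))) *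
   expeR (- pI Up x (s + r) (dy (catp X s) (w, w'))) = Wt x s w * Wt (x + X s w) r w')%E.
Proof.
move=> s0 r0; rewrite !(pI_cat norm_levy)//= oppeD; last first.
  by rewrite ge0_adde_def// inE XI_ge0.
rewrite expeRD [X in (_ * X)%E]expeRD; exact: muleACA.
Qed.

Lemma measurable_Wt_path x t : measurable_fun setT
  (fun z : path R d => expeR (pI Um x t z) * expeR (- pI Up x t z))%E.
Proof.
apply: emeasurable_funM; last exact: measurable_killed_path.
by apply: (measurableT_comp measurable_expeR); exact: measurable_pI_path.
Qed.

Lemma markov_Wt x s r : 0 <= s -> 0 <= r ->
  (\int[P]_w (Wt x (s + r) w * (phi (x + X (s + r) w))%:E) =
   \int[P]_w (Wt x s w * \int[P]_w' (Wt (x + X s w) r w' * (phi (x + X s w + X r w'))%:E)))%E.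
Proof.
move=> s0 r0.
pose F (z : path R d) := (expeR (pI Um x (s + r) z) * expeR (- pI Up x (s + r) z) *
  (phi (x + pos z (s + r)))%:E)%E.
transitivity (\int[P]_w F (dy X w))%E.
  by apply: eq_integral => w _; rewrite /F !(pI_dy norm_levy) -Xpos.
apply: (@markov_factor _ _ _ _ _ _ norm_levy x s F (Wt x s)
  (fun y w' => Wt y r w' * (phi (y + X r w'))%:E)%E) => //.
- apply: emeasurable_funM; first exact: measurable_Wt_path.
  apply/measurable_EFinP; apply: (measurableT_comp measurable_phi).
  by apply: measurable_funD_rV => //; exact: measurable_pos_at.
- by move=> z; rewrite !mule_ge0 ?expeR_ge0 ?lee_fin.
- exact: Wt_ge0.
- move=> y; apply: emeasurable_funM; first exact: measurable_Wtw.
  exact: (measurable_fX norm_levy r y measurable_phi).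
- by move=> y w; rewrite mule_ge0 ?Wt_ge0 ?lee_fin.
- move=> w w'; rewrite /F markov_Wt_at// (pos_catp norm_levy) ?addr_ge0//.
  by rewrite catp_add//= addrA -muleA.
Qed.

(** Almost every path is of this kind, and along such a path [bw] is finite and right-continuous
    before [T0]. *)
Definition nice (x : Rd) (w : Omega) : Prop :=
  (XI Um x T0 w < +oo)%E /\ forall k, (XI (cut k) x T0 w < +oo)%E.

Lemma ae_nice x : {ae P, forall w, nice x w}.
Proof.
have h1 : {ae P, forall w, (XI Um x T0 w < +oo)%E}.
  apply: ae_fin; [exact: (measurable_XIw norm_levy)|by move=> w; exact: XI_ge0|].
  by rewrite (le_lt_trans (kato x))// ltry.
have h2 : {ae P, forall w k, (XI (cut k) x T0 w < +oo)%E}.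
  apply: ae_foralln => k; apply: ae_fin; [|by move=> w; apply: XI_ge0 => y; exact: cut_ge0|exact: kato_loc].
  exact: (measurable_XIw norm_levy (measurable_cut k) (cut_ge0 k)).
by move: h1 h2; apply: filterS2.
Qed.


Hypothesis abs_cont : forall t (N : set Rd), 0 < t -> measurable N ->
  lebesgue_rV R d N = 0%E -> forall x, P [set w | N (x + X t w)] = 0%E.
Hypothesis eig_ae : forall t, 0 < t -> {ae lebesgue_rV R d, forall x,
  (\int[P]_w (Wt x t w * (phi (x + X t w))%:E) = (phi x)%:E)%E}.

Definition rest (g : Rd -> R) (x : Rd) (s u : R) (w : Omega) : \bar R :=
  (\int[leb]_(v in `[s, u]) (g (x + X v w))%:E)%E.

Lemma rest_ge0 g x s u w : (forall y, 0 <= g y) -> (0 <= rest g x s u w)%E.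
Proof. by move=> g0; apply: integral_ge0 => v _; rewrite lee_fin. Qed.

Lemma XI_split (g : Rd -> R) x s u w : measurable_fun setT g -> (forall y, 0 <= g y) ->
  0 <= s -> s <= u -> (XI g x u w = XI g x s w + rest g x s u w)%E.
Proof.
move=> mg g0 s0 su; apply: ge0_integral_itvD => //; last by move=> v; rewrite lee_fin.
exact: (measurable_gX norm_levy).
Qed.

Lemma rest_small (g : Rd -> R) x s w : measurable_fun setT g -> (forall y, 0 <= g y) ->
  0 <= s -> s < T0 -> (XI g x T0 w < +oo)%E ->
  forall e, 0 < e -> \forall dl \near 0^'+, (rest g x s (s + dl) w <= e%:E)%E.
Proof.
move=> mg g0 s0 sT gfin; apply: (small_integral (c := T0 - s)).
- by rewrite subr_gt0.
- exact: (measurable_gX norm_levy).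
- by move=> u; rewrite lee_fin.
rewrite addrC subrK; apply: le_lt_trans gfin.
by rewrite (XI_split x w mg g0 s0 (ltW sT)) leeDr// XI_ge0.
Qed.

(** Right-continuity keeps the path in a bounded ball for a while after [s], and there [Up] agrees
    with [cut k] for a suitable [k]. *)
Lemma rest_Up_small x s w : nice x w -> 0 <= s -> s < T0 ->
  forall e, 0 < e -> \forall dl \near 0^'+, (rest Up x s (s + dl) w <= e%:E)%E.
Proof.
move=> [_ nw] s0 sT e e0.
have [k hk] : exists k : nat, enorm (x + X s w) + 1 <= k%:R.
  exists (Num.truncn (enorm (x + X s w) + 1)).+1; exact/ltW/truncnS_gt.
have [c c0 Hc] : exists2 c, 0 < c & forall u, s <= u < s + c -> enorm (X u w - X s w) < 1.
  apply: (dyadic_right norm_levy (A := [set y | enorm (y - X s w) < 1])) => //.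
    exact: open_eball.
  by rewrite /= subrr enorm0.
have := rest_small (measurable_cut k) (cut_ge0 k) s0 sT (nw k) e0; apply: filter_app.
near=> dl; apply: le_trans; apply: ge0_le_integralP => u /=; first by rewrite lee_fin.
rewrite in_itv/= => /andP[su us]; rewrite lee_fin /cut indicE mem_set ?mulr1//.
rewrite /eball /= subr0.
apply: (@lt_le_trans _ _ (enorm (x + X s w) + 1)) => //.
have -> : x + X u w = (x + X s w) + (X u w - X s w) by rewrite [X u w - _]addrC addrA addrK.
apply: (le_lt_trans (enormD _ _)); rewrite ltrD2l; apply: Hc; rewrite su/=.
by apply: (le_lt_trans us); rewrite ltrD2l; near: dl; exact: nbhs_right_lt.
Unshelve. all: by end_near. Qed.

Variable beta : R.
Hypothesis beta0 : 0 < beta.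

(** The integrand of Duhamel's formula. Over short times the eigenfunction equation gives it the
    mean [exp(-beta u) phi(x)], so that only the discount makes the mean decrease. *)
Definition bw (x : Rd) (u : R) (w : Omega) : \bar R :=
  ((expR (- (beta * u)))%:E * (Wt x u w * (phi (x + X u w))%:E))%E.

Lemma bw_ge0 x u w : (0 <= bw x u w)%E.
Proof.
rewrite mule_ge0 ?lee_fin ?expR_ge0//.
by rewrite mule_ge0 ?Wt_ge0// lee_fin.
Qed.

Lemma measurable_bw x : measurable_fun setT
  (fun tw : measurableTypeR R * Omega => bw x tw.1 tw.2).
Proof.
apply: emeasurable_funM.
  apply/measurable_EFinP; apply: (measurableT_comp (@measurable_expR R)).
  apply: measurable_funN; apply: measurable_funM => //; exact: measurable_fst.
apply: emeasurable_funM; first exact: measurable_Wt.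
apply/measurable_EFinP; apply: (measurableT_comp measurable_phi).
by apply: measurable_funD_rV => //; exact: measurable_X norm_levy.
Qed.

Lemma bw_le x u w : 0 <= u -> u <= T0 -> (bw x u w <= M%:E * expeR (XI Um x T0 w))%E.
Proof.
move=> u0 uT.
have M0 : 0 <= M by exact: le_trans (phi0 0) (phiM 0).
apply: (@le_trans _ _ (1 * (expeR (XI Um x T0 w) * M%:E))%E); last by rewrite mul1e muleC.
apply: lee_pmul => //.
- by rewrite mule_ge0 ?Wt_ge0// lee_fin.
- by rewrite lee_fin -expR0 ler_expR oppr_le0 mulr_ge0// ltW.
- apply: lee_pmul; [exact: Wt_ge0|by rewrite lee_fin| |by rewrite lee_fin].
  apply: le_trans (Wt_le _ _ _) _; rewrite lee_expeR; exact: (XI_le norm_levy).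
Qed.

Lemma bw_fin x u w : nice x w -> 0 <= u -> u <= T0 -> bw x u w \is a fin_num.
Proof.
move=> [nw _] u0 uT; rewrite ge0_fin_numE ?bw_ge0//; apply: le_lt_trans (bw_le x w u0 uT) _.
have xf : XI Um x T0 w \is a fin_num by rewrite ge0_fin_numE// XI_ge0.
by rewrite -(fineK xf) -EFinM ltry.
Qed.

(** The weight at [s] factors out as the constant [C], and what follows [s] is governed by small
    integrals. The integral of [Up] before [s] may be infinite, in which case [C = 0]. *)
Lemma bw_right x s w : nice x w -> 0 <= s -> s < T0 -> forall e, 0 < e ->
  \forall dl \near 0^'+, forall u, s <= u <= s + dl ->
    ((fine (bw x s w) - e)%:E <= bw x u w <= (fine (bw x s w) + e)%:E)%E.
Proof.
move=> nw s0 sT e e0.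
have bf := bw_fin nw s0 (ltW sT).
pose m u := fine (rest Um x s u w); pose p u := fine (rest Up x s u w).
have [nwm _] := nw.
have m0 := rest_small mUm Um0 s0 sT nwm ltr01.
have p0 := rest_Up_small nw s0 sT ltr01.
pose b u := expR (- (beta * (u - s)) + m u - p u) * phi (x + X u w).
pose C := expR (- (beta * s)) * fine (Wt x s w).
have Wf : Wt x s w \is a fin_num.
  rewrite ge0_fin_numE ?Wt_ge0//; apply: le_lt_trans (Wt_le _ _ _) _.
  have xf : XI Um x s w \is a fin_num.
    rewrite ge0_fin_numE ?XI_ge0//; apply: le_lt_trans nwm; by apply: (XI_le norm_levy) => //; exact: ltW.
  by rewrite -(fineK xf) ltry.
have small e' : 0 < e' -> \forall dl \near 0^'+, forall u, s <= u <= s + dl ->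
    [/\ rest Um x s u w \is a fin_num, rest Up x s u w \is a fin_num,
        0 <= m u <= e' & 0 <= p u <= e'].
  move=> e'0; have := rest_small mUm Um0 s0 sT nwm e'0.
  have := rest_Up_small nw s0 sT e'0; apply: filter_app2; near=> dl => hp hm u /andP[su us].
  have le_rest (g : Rd -> R) : measurable_fun setT g -> (forall y, 0 <= g y) ->
      (rest g x s u w <= rest g x s (s + dl) w)%E.
    move=> mg g0; apply: ge0_subset_integral => //=.
    - exact: measurable_funTS (measurable_gX norm_levy mg x w).
    - by move=> v _; rewrite lee_fin.
    - by move=> v /=; rewrite !in_itv/= => /andP[-> vu]; exact: le_trans vu us.
  have hm' := le_trans (le_rest _ mUm Um0) hm; have hp' := le_trans (le_rest _ mUp Up0) hp.
  have fm : rest Um x s u w \is a fin_num.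
    by rewrite ge0_fin_numE ?rest_ge0// (le_lt_trans hm')// ltry.
  have fp : rest Up x s u w \is a fin_num.
    by rewrite ge0_fin_numE ?rest_ge0// (le_lt_trans hp')// ltry.
  by split => //; rewrite fine_ge0 ?rest_ge0//= -lee_fin fineK.
have bE u : s <= u -> rest Um x s u w \is a fin_num -> rest Up x s u w \is a fin_num ->
    bw x u w = (C * b u)%:E.
  move=> su fm fp; rewrite /bw /Wt (XI_split x w mUm Um0 s0 su) (XI_split x w mUp Up0 s0 su).
  rewrite oppeD; last by rewrite ge0_adde_def// inE ?XI_ge0 ?rest_ge0.
  rewrite (expeRD (XI Um x s w)) (expeRD (- XI Up x s w)%E).
  rewrite -(fineK fm) -(fineK fp) -/(m u) -/(p u).
  rewrite (_ : (_ * expeR (m u)%:E * _) = (Wt x s w * (expR (m u) * expR (- p u))%:E))%E; last first.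
    by rewrite /Wt EFinM !muleA; congr (_ * _)%E; rewrite -!muleA; congr (_ * _)%E; rewrite muleC.
  rewrite -(fineK Wf) -!EFinM; congr EFin; rewrite /C /b !expRD.
  rewrite (_ : - (beta * u) = - (beta * s) + - (beta * (u - s))); last by ring.
  by rewrite expRD; ring.
have bs : fine (bw x s w) = C * phi (x + X s w).
  by rewrite /bw -(fineK Wf) -!EFinM /= mulrA.
have cb : b u @[u --> s^'+] --> phi (x + X s w).
  rewrite -[X in _ --> X]mul1r; apply: cvgM; last first.
    have cX : x + X u w @[u --> s^'+] --> x + X s w.
      by apply: cvg_addl_rV; exact: (rcont norm_levy).
    exact: cvg_continuous_rV.
  rewrite -expR0; apply: (continuous_cvg _ (@continuous_expR R 0)).
  apply/cvgrPdist_le => e1 e10.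
  have e30 : 0 < e1 / 3 by rewrite divr_gt0.
  have [dl /= dl0 H] := small _ e30.
  near=> u.
  have us : s <= u by near: u; exact: nbhs_right_ge.
  have [_ _ /andP[h1 h2] /andP[h3 h4]] : [/\ rest Um x s u w \is a fin_num,
      rest Up x s u w \is a fin_num, 0 <= m u <= e1 / 3 & 0 <= p u <= e1 / 3].
    apply: (H (dl / 2)); rewrite /= ?sub0r ?normrN ?gtr0_norm ?divr_gt0//.
      by rewrite ltr_pdivrMr// ltr_pMr// ltr1n.
    by rewrite us /=; near: u; apply: nbhs_right_le; rewrite ltrDl divr_gt0.
  have h5 : u - s <= e1 / (3 * beta).
    rewrite lerBlDl; near: u; apply: nbhs_right_le; rewrite ltrDl divr_gt0//.
    by rewrite mulr_gt0.
  have h6 : beta * (u - s) <= e1 / 3.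
    move: h5; rewrite invfM mulrA ler_pdivlMr// mulrC; exact.
  have h7 : 0 <= beta * (u - s) by rewrite mulr_ge0 ?subr_ge0// ltW.
  by rewrite sub0r normrN ler_norml; apply/andP; split; lra.
have C0 : 0 <= C by rewrite mulr_ge0 ?expR_ge0 ?fine_ge0 ?Wt_ge0.
have cCb : C * b u @[u --> s^'+] --> fine (bw x s w).
  by rewrite bs; apply: cvgM => //; exact: cvg_cst.
have /= [d1 d10 H1] := small 1 ltr01.
move/cvgrPdist_le : cCb => /(_ e e0) [d2 /= d20 H2].
near=> dl => u /andP[su us].
have dl1 : dl < d1 by near: dl; exact: nbhs_right_lt.
have dl2 : dl < d2 by near: dl; exact: nbhs_right_lt.
have dl0 : 0 < dl by near: dl; exact: nbhs_right_gt.
have [fm fp _ _] : [/\ rest Um x s u w \is a fin_num,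
    rest Up x s u w \is a fin_num, 0 <= m u <= 1 & 0 <= p u <= 1].
  by apply: (H1 dl); rewrite /= ?sub0r ?normrN ?gtr0_norm ?su.
rewrite (bE u su fm fp) !lee_fin.
move: su; rewrite le_eqVlt => /predU1P[E|su].
  have h : fine (bw x s w) = C * b u.
    have fm' : rest Um x s s w \is a fin_num by rewrite {2}E.
    have fp' : rest Up x s s w \is a fin_num by rewrite {2}E.
    by rewrite (bE s (lexx s) fm' fp') E.
  by rewrite h; lra.
have := H2 u _ su; rewrite /= => /(_ _).
have -> : `|s - u| < d2.
  by rewrite distrC gtr0_norm ?subr_gt0// ltrBlDl (le_lt_trans us)// ltrD2l.
by move=> /(_ isT); rewrite ler_norml => /andP[h1 h2]; lra.
Unshelve. all: by end_near. Qed.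

(** Khasminskii's lemma enters here: this majorant of [bw] serves every dominated convergence over
    times up to [T0]. *)
Lemma bw_bound_integrable x : P.-integrable setT (fun w => M%:E * expeR (XI Um x T0 w))%E.
Proof.
have mE : measurable_fun setT (fun w => expeR (XI Um x T0 w)).
  exact: (measurable_exp_XI norm_levy).
apply: integrableZl => //; apply/integrableP; split => //.
under eq_integral do rewrite gee0_abs ?expeR_ge0//.
apply: le_lt_trans (khasminskii norm_levy mUm Um0 T00 kato x _) _; first by rewrite (ltW T00) lexx.
rewrite lte_add_pinfty ?ltry// lte_mul_pinfty//.
by rewrite (le_lt_trans (kato x))// ltry.
Qed.

Lemma bw_at0 x w : bw x 0 w = (phi x)%:E.
Proof.
rewrite /bw /Wt !XIE set_itv1 !integral_set1 oppe0 expeR0 !mul1e X0 addr0.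
by rewrite mulr0 oppr0 expR0 mul1e.
Qed.

Lemma measurable_bwu x u : measurable_fun setT (bw x u).
Proof. exact: (measurableT_comp (measurable_bw x) (pair1_measurable (u : measurableTypeR R))). Qed.

Lemma measurable_bw_path x w : measurable_fun setT (fun u : measurableTypeR R => bw x u w).
Proof. exact: (measurableT_comp (measurable_bw x) (pair2_measurable w)). Qed.

Lemma measurable_bw_shift x (sg : Omega -> R) : measurable_fun setT sg ->
  measurable_fun setT (fun tw : measurableTypeR R * Omega => bw x (tw.1 + sg tw.2) tw.2).
Proof.
move=> msg.
have h : measurable_fun setT (fun tw : measurableTypeR R * Omega =>
    ((tw.1 + sg tw.2 : measurableTypeR R), tw.2)).
  apply: measurable_fun_pair; last exact: measurable_snd.
  apply: measurable_funD; first exact: measurable_fst.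
  exact: (measurableT_comp msg measurable_snd).
exact: (measurableT_comp (measurable_bw x) h).
Qed.

Lemma measurable_bw_window x (sg : Omega -> R) c : measurable_fun setT sg ->
  measurable_fun setT (fun w => \int[leb]_(u in `[sg w, (sg w + c)%R]) bw x u w)%E.
Proof.
move=> msg.
rewrite (_ : (fun _ => _) = fun w => (\int[leb]_(u in `[0%R, c]) bw x (u + sg w) w)%E); last first.
  apply/funext => w.
  have := @ge0_integral_shift R (sg w) 0 c (fun u => bw x u w) (measurable_bw_path x w) (fun u => bw_ge0 x u w).
  by rewrite add0r (addrC c) => <-.
have h := measurable_integral0 (measurable_bw_shift x msg) (fun _ => bw_ge0 _ _ _).
exact: (measurableT_comp h (pair1_measurable (c : measurableTypeR R))).
Qed.

Lemma measurable_bw_upto x (sg : Omega -> R) : measurable_fun setT sg ->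
  measurable_fun setT (fun w => \int[leb]_(u in `[0%R, sg w]) bw x u w)%E.
Proof.
move=> msg; have h := measurable_integral0 (measurable_bw x) (fun _ => bw_ge0 _ _ _).
have k : measurable_fun setT (fun w => (sg w : measurableTypeR R, w)).
  by apply: measurable_fun_pair.
exact: (measurableT_comp h k).
Qed.

(** Right-continuity along almost every path, then dominated convergence; the random time [sg]
    enters through its measurability only. *)
Lemma cvg_bw_average x (sg : Omega -> R) (c0 : R) : measurable_fun setT sg ->
  (forall w, 0 <= sg w) -> 0 < c0 -> (forall w, sg w + c0 <= T0) ->
  (((c0 / n.+1%:R)^-1)%:E *
    \int[P]_w \int[leb]_(u in `[sg w, (sg w + c0 / n.+1%:R)%R]) bw x u w)%E @[n --> \oo] -->
  (\int[P]_w bw x (sg w) w)%E.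
Proof.
move=> msg sg0 c00 sgT.
have h0 n : 0 < c0 / n.+1%:R by rewrite divr_gt0.
have hc n : c0 / n.+1%:R <= c0 by rewrite ler_pdivrMr// ler_peMr ?ler1n// ltW.
pose F n w := (((c0 / n.+1%:R)^-1)%:E * \int[leb]_(u in `[sg w, (sg w + c0 / n.+1%:R)%R]) bw x u w)%E.
have mw n := measurable_bw_window x (c0 / n.+1%:R) msg.
have w0 n w : (0 <= \int[leb]_(u in `[sg w, (sg w + c0 / n.+1%:R)%R]) bw x u w)%E.
  by apply: integral_ge0 => u _; exact: bw_ge0.
have i0 n : (0 <= ((c0 / n.+1%:R)^-1)%:E)%E by rewrite lee_fin invr_ge0 ltW.
rewrite (_ : (fun _ => _) = fun n => (\int[P]_w F n w)%E); last first.
  by apply/funext => n; rewrite ge0_integralZl.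
have mF n : measurable_fun setT (F n) by apply: emeasurable_funM.
have mlim : measurable_fun setT (fun w => bw x (sg w) w).
  have k : measurable_fun setT (fun w => (sg w : measurableTypeR R, w)).
    by apply: measurable_fun_pair.
  exact: (measurableT_comp (measurable_bw x) k).
have [] := @dominated_convergence _ _ _ P setT measurableT F (fun w => bw x (sg w) w)
  (fun w => M%:E * expeR (XI Um x T0 w))%E mF mlim _ (bw_bound_integrable x) _.
- have := ae_nice x; apply: filterS => w nw _.
  have sT : sg w < T0 by apply: lt_le_trans (sgT w); rewrite ltrDl.
  have bf := bw_fin nw (sg0 w) (ltW sT).
  rewrite -(fineK bf); apply: (cvg_average (h := fun n => c0 / n.+1%:R)) => //.
  + rewrite -[X in _ --> X](mulr0 c0); apply: cvgM; [exact: cvg_cst|exact: cvg_harmonic].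
  + exact: measurable_bw_path.
  + by move=> u; exact: bw_ge0.
  + exact: bw_right.
- apply: aeW => w n _; rewrite gee0_abs ?mule_ge0//.
  have -> : (M%:E * expeR (XI Um x T0 w) = ((c0 / n.+1%:R)^-1)%:E *
      ((M%:E * expeR (XI Um x T0 w)) * (c0 / n.+1%:R)%:E))%E.
    by rewrite muleCA -EFinM mulVf ?mule1// gt_eqF.
  apply: lee_wpmul2l => //; apply: (@le_trans _ _ (\int[leb]_(u in `[sg w, (sg w + c0 / n.+1%:R)%R])
     (M%:E * expeR (XI Um x T0 w)))%E).
    apply: ge0_le_integralP => u /=; first by move=> _; exact: bw_ge0.
    rewrite in_itv/= => /andP[su us]; apply: bw_le; first exact: le_trans su.
    by apply: (le_trans us); apply: le_trans (sgT w); rewrite lerD2l.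
  by rewrite integral_cst//= lebesgue_itvcc ?lerDl ?(ltW (h0 n))// addrAC subrr add0r.
by [].
Qed.

(** The equation is given for almost every starting point. By the Markov property at a short time
    [s n], at which the law of the process charges no null set, the left-hand side equals the mean
    of weight times [phi] at time [s n]; as [s n] tends to 0 this tends to [phi x] for the given
    [x]. *)
Lemma eig x t : 0 < t -> t <= T0 -> (\int[P]_w (Wt x t w * (phi (x + X t w))%:E) = (phi x)%:E)%E.
Proof.
move=> t0 tT.
set L := (\int[P]_w _)%E.
(* The denominator [n.+2] keeps [s n] strictly below [t], so that a positive time remains. *)
pose s n := t / n.+2%:R.
have s0 n : 0 < s n by rewrite divr_gt0.
have st n : s n < t by rewrite ltr_pdivrMr// ltr_pMr// ltr1n.
have LE n : L = (\int[P]_w (Wt x (s n) w * (phi (x + X (s n) w))%:E))%E.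
  rewrite {1}/L (_ : t = s n + (t - s n)); last by rewrite addrC subrK.
  rewrite markov_Wt ?subr_ge0 ?ltW//.
  have ts0 : 0 < t - s n by rewrite subr_gt0.
  have [N [mN N0 HN]] := eig_ae ts0.
  have mPsi : measurable_fun setT (fun y => \int[P]_w' (Wt y (t - s n) w' * (phi (y + X (t - s n) w'))%:E))%E.
    apply: (measurable_fun_fubini_tonelli_F (fun yw : Rd * Omega =>
       Wt yw.1 (t - s n) yw.2 * (phi (yw.1 + X (t - s n) yw.2))%:E)%E).
      apply: emeasurable_funM; first exact: measurable_Wtyw.
      apply/measurable_EFinP; apply: (measurableT_comp measurable_phi).
      apply: measurable_funD_rV; first exact: measurable_fst.
      exact: (measurableT_comp (measurable_Xt norm_levy _) measurable_snd).
    by move=> yw; rewrite mule_ge0 ?Wt_ge0 ?lee_fin.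
  apply: ge0_ae_eq_integral => //.
  - apply: emeasurable_funM; first exact: measurable_Wtw.
    apply: (measurableT_comp mPsi); exact: (measurable_addX norm_levy).
  - apply: emeasurable_funM; first exact: measurable_Wtw.
    exact: (measurable_fX norm_levy _ _ measurable_phi).
  - move=> w _; rewrite mule_ge0 ?Wt_ge0//; apply: integral_ge0 => w' _.
    by rewrite mule_ge0 ?Wt_ge0 ?lee_fin.
  - by move=> w _; rewrite mule_ge0 ?Wt_ge0 ?lee_fin.
  exists [set w | N (x + X (s n) w)]; split.
  - by rewrite -[X in measurable X]setTI; apply: (measurable_addX norm_levy).
  - exact: abs_cont.
  - move=> w /= H; apply: HN => /= e; apply: H => _; by rewrite e.
(* The discount factor, which tends to 1, is inserted because right-continuity is available for
   [bw]. *)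
have c1 : ((expR (- (beta * s n)))%:E * L)%E @[n --> \oo] --> L.
  rewrite -[X in _ --> X]mul1e; apply: cvgeM; [by rewrite /mule_def; case: (L) => //=; rewrite oner_eq0| |exact: cvg_cst].
  have e0 : (1%:E : \bar R) = (expR (- (beta * 0)))%:E by rewrite mulr0 oppr0 expR0.
  rewrite e0; apply: cvg_EFin; first by apply: nearW.
  apply: continuous_cvg; first exact: continuous_expR.
  apply: cvgN; apply: cvgM; first exact: cvg_cst.
  rewrite -(mulr0 t); apply: cvgM; first exact: cvg_cst.
  exact: cvg_harmonicS.
have c2 : ((expR (- (beta * s n)))%:E * L)%E @[n --> \oo] --> (\int[P]_w bw x 0 w)%E.
  rewrite (_ : (fun _ => _) = fun n => (\int[P]_w bw x (s n) w)%E); last first.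
    apply/funext => n; rewrite (LE n) -ge0_integralZl//.
    + apply: emeasurable_funM; first exact: measurable_Wtw.
      exact: (measurable_fX norm_levy _ _ measurable_phi).
    + by move=> w _; rewrite mule_ge0 ?Wt_ge0 ?lee_fin.
  have [] := @dominated_convergence _ _ _ P setT measurableT (fun n => bw x (s n)) (bw x 0)
    (fun w => M%:E * expeR (XI Um x T0 w))%E (fun n => measurable_bwu x (s n)) (measurable_bwu x 0)
    _ (bw_bound_integrable x) _ => //.
  - have := ae_nice x; apply: filterS => w nw _.
    have bf := bw_fin nw (lexx _) (ltW T00).
    rewrite -(fineK bf); apply/fine_cvgP; split.
      by apply: nearW => n; apply: (bw_fin nw); rewrite ltW//; apply: lt_le_trans tT.
    apply/cvgrPdist_le => e e0; have [dl /= dl0 H] := bw_right nw (lexx _) T00 e0.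
    have : s n @[n --> \oo] --> (0:R).
      rewrite -(mulr0 t); apply: cvgM; first exact: cvg_cst.
      exact: cvg_harmonicS.
    move/cvgrPdist_lt => /(_ _ dl0); apply: filterS => n.
    rewrite sub0r normrN gtr0_norm// => sdl.
    have := H (s n) _ (s0 n) (s n); rewrite /= sub0r normrN gtr0_norm// add0r lexx ltW//.
    move=> /(_ sdl isT); rewrite -(fineK (bw_fin nw (ltW (s0 n)) (ltW (lt_le_trans (st n) tT)))).
    by rewrite !lee_fin => /andP[h1 h2]; rewrite ler_norml; apply/andP; split; lra.
  - by apply: aeW => w n _; rewrite gee0_abs ?bw_ge0//; apply: bw_le; [exact/ltW|exact: ltW (lt_le_trans (st n) tT)].
rewrite (cvg_unique _ c1 c2)//.
under eq_integral do rewrite bw_at0.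
exact: (P_cst P).
Qed.

Section exit_identity.
Variables (rho T c0 : R).
Hypotheses (T_gt0 : 0 < T) (c00 : 0 < c0) (TcT0 : T + c0 <= T0).
Local Notation tau := (exit_at X rho T).

Definition occupation (x : Rd) : \bar R := (\int[P]_w \int[leb]_(u in `[0%R, tau w]) bw x u w)%E.

Let tau_leT w : tau w <= T. Proof. exact/exitT_leT/ltW. Qed.
Let tau_ge0 w : 0 <= tau w. Proof. exact/exitT_ge0/ltW. Qed.

Lemma occupation_ge0 x : (0 <= occupation x)%E.
Proof. by apply: integral_ge0 => w _; apply: integral_ge0 => u _; exact: bw_ge0. Qed.

Lemma occupation_fin x : (occupation x \is a fin_num)%E.
Proof.
rewrite ge0_fin_numE ?occupation_ge0//.
have /integrableP[_ fi] := bw_bound_integrable x.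
have TT : T <= T0 by apply: le_trans TcT0; rewrite lerDl ltW.
apply: (@le_lt_trans _ _ (T%:E * \int[P]_w (M%:E * expeR (XI Um x T0 w)))%E).
  have M0 : 0 <= M by exact: le_trans (phi0 0) (phiM 0).
  have mE : measurable_fun setT (fun w => M%:E * expeR (XI Um x T0 w))%E.
    by apply: emeasurable_funM => //; exact: (measurable_exp_XI norm_levy).
  rewrite -ge0_integralZl//; last 2 first.
  - by move=> w _; rewrite mule_ge0 ?expeR_ge0 ?lee_fin.
  - by rewrite lee_fin ltW.
  apply: ge0_le_integralP => w _.
    by apply: integral_ge0 => u _; exact: bw_ge0.
  apply: (@le_trans _ _ (\int[leb]_(u in `[0%R, tau w]) (M%:E * expeR (XI Um x T0 w)))%E).
    apply: ge0_le_integralP => u /=; first by move=> _; exact: bw_ge0.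
    rewrite in_itv/= => /andP[u0 ut]; apply: bw_le => //.
    by apply: (le_trans ut); exact: le_trans TT.
  rewrite integral_cst//= lebesgue_itvcc// subr0 muleC lee_wpmul2r ?lee_fin//.
  by rewrite mule_ge0 ?expeR_ge0 ?lee_fin.
rewrite lte_mul_pinfty ?lee_fin ?(ltW T_gt0)//; apply: le_lt_trans fi.
by apply: ge0_le_integralP => w _; rewrite ?lee_abs// mule_ge0 ?expeR_ge0 ?lee_fin// (le_trans (phi0 0)).
Qed.

(** At each time [t], on the event of being alive, the Markov property and the eigenfunction
    equation over a period [h] turn the mean of [bw] at [t + h] into [exp(-beta h)] times its mean
    at [t]. *)
Lemma occupation_shift x h : 0 <= h -> h <= c0 ->
  (\int[P]_w \int[leb]_(u in `[h, (tau w + h)%R]) bw x u w = (expR (- (beta * h)))%:E * occupation x)%E.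
Proof.
move=> h0 hc.
have mbh := measurable_bw_shift x (measurable_cst h).
transitivity (\int[P]_w \int[leb]_(t in `[0%R, T]) ((aliveI rho t (dy X w))%:E * bw x (t + h) w))%E.
  apply: eq_integral => w _; rewrite (@alive_integral _ _ rho _ (ltW T_gt0)); last 2 first.
  - exact: (measurableT_comp mbh (pair2_measurable w)).
  - by move=> t; exact: bw_ge0.
  have := @ge0_integral_shift R h 0 (tau w) (fun u => bw x u w) (measurable_bw_path x w) (fun u => bw_ge0 x u w).
  by rewrite add0r => <-.
have aE : (occupation x = \int[P]_w \int[leb]_(t in `[0%R, T]) ((aliveI rho t (dy X w))%:E * bw x t w))%E.
  apply: eq_integral => w _; rewrite (@alive_integral _ _ rho _ (ltW T_gt0))//; last first.
    by move=> t; exact: bw_ge0.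
  exact: measurable_bw_path.
have ma := measurable_aliveX norm_levy rho.
rewrite (integral_swap P T (G := fun tw => ((aliveI rho tw.1 (dy X tw.2))%:E *
    bw x (tw.1 + h) tw.2)%E)); last 2 first.
- by apply: emeasurable_funM.
- by move=> tw; rewrite mule_ge0 ?bw_ge0 ?lee_fin ?aliveI_ge0.
rewrite aE (integral_swap P T (G := fun tw => ((aliveI rho tw.1 (dy X tw.2))%:E *
    bw x tw.1 tw.2)%E)); last 2 first.
- exact: (emeasurable_funM ma (measurable_bw x)).
- by move=> tw; rewrite mule_ge0 ?bw_ge0 ?lee_fin ?aliveI_ge0.
have mat t : measurable_fun setT (fun w => (aliveI rho t (dy X w))%:E).
  exact: (measurableT_comp ma (pair1_measurable (t : measurableTypeR R))).
rewrite -ge0_integralZl; last 4 first.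
- exact: measurable_itv.
- have := @measurable_fun_fubini_tonelli_F _ _ _ _ _ P (fun tw : measurableTypeR R * Omega =>
    ((aliveI rho tw.1 (dy X tw.2))%:E * bw x tw.1 tw.2)%E).
  move=> H; apply: measurable_funTS; apply: H.
  - exact: (emeasurable_funM ma (measurable_bw x)).
  - by move=> tw; rewrite mule_ge0 ?bw_ge0 ?lee_fin ?aliveI_ge0.
- by move=> t _; apply: integral_ge0 => w _; rewrite mule_ge0 ?bw_ge0 ?lee_fin ?aliveI_ge0.
- by rewrite lee_fin expR_ge0.
apply: eq_integral => t; rewrite inE/= in_itv/= => /andP[t0 tT].
rewrite -ge0_integralZl; last 4 first.
- exact: measurableT.
- exact: (emeasurable_funM (mat t) (measurable_bwu x t)).
- by move=> w _; rewrite mule_ge0 ?bw_ge0 ?lee_fin ?aliveI_ge0.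
- by rewrite lee_fin expR_ge0.
pose F (z : path R d) := ((aliveI rho t z)%:E * ((expR (- (beta * (t + h))))%:E *
  (expeR (pI Um x (t + h) z) * expeR (- pI Up x (t + h) z) * (phi (x + pos z (t + h)))%:E)))%E.
transitivity (\int[P]_w F (dy X w))%E.
  by apply: eq_integral => w _; rewrite /F !(pI_dy norm_levy) -Xpos.
transitivity (\int[P]_w ((aliveI rho t (dy X w))%:E * ((expR (- (beta * (t + h))))%:E * Wt x t w) *
    (phi (x + X t w))%:E))%E; last first.
  apply: eq_integral => w _; rewrite /bw mulrDr (addrC (beta * t)) opprD expRD EFinM -!muleA muleCA; by congr (_ * _)%E.
have sub w : (\int[P]_w' (Wt (x + X t w)%R h w' * (phi (x + X t w + X h w')%R)%:E) = (phi (x + X t w)%R)%:E)%E.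
  move: h0; rewrite le_eqVlt => /predU1P[<-|h0].
    under eq_integral => w' _.
      have := bw_at0 (x + X t w) w'; rewrite /bw mulr0 oppr0 expR0 mul1e => ->; over.
    exact: (P_cst P).
  apply: (eig _ h0); apply: (le_trans hc); apply: le_trans TcT0; rewrite lerDr; exact: ltW.
under [RHS]eq_integral do rewrite -sub.
apply: (@markov_factor _ _ _ _ _ _ norm_levy x t F
  (fun w => (aliveI rho t (dy X w))%:E * ((expR (- (beta * (t + h))))%:E * Wt x t w))%E
  (fun y w' => Wt y h w' * (phi (y + X h w'))%:E)%E t0).
- apply: emeasurable_funM; first exact: measurable_alive_at.
  apply: emeasurable_funM; first exact: measurable_cst.
  apply: emeasurable_funM; first exact: measurable_Wt_path.
  apply/measurable_EFinP; apply: (measurableT_comp measurable_phi).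
  by apply: measurable_funD_rV => //; exact: measurable_pos_at.
- by move=> z; rewrite !mule_ge0 ?expeR_ge0 ?lee_fin ?aliveI_ge0 ?expR_ge0.
- move=> w; apply: mule_ge0; first by rewrite lee_fin aliveI_ge0.
  by apply: mule_ge0; [rewrite lee_fin expR_ge0|exact: Wt_ge0].
- move=> y; apply: emeasurable_funM; first exact: measurable_Wtw.
  exact: (measurable_fX norm_levy _ _ measurable_phi).
- by move=> y w; rewrite mule_ge0 ?Wt_ge0 ?lee_fin.
- move=> w w'; rewrite /F (aliveI_cat norm_levy) (markov_Wt_at _ _ _ t0 h0).
  rewrite (pos_catp norm_levy _ t0) ?addr_ge0// (catp_add _ _ _ h0) /= addrA.
  by rewrite -!muleA.
Qed.

Lemma cvg_discount (J : \bar R) : J \is a fin_num ->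
  (((c0 / n.+1%:R)^-1)%:E * ((1 - expR (- (beta * (c0 / n.+1%:R))))%:E * J))%E @[n --> \oo] -->
  (beta%:E * J)%E.
Proof.
move=> Jf; under eq_fun do rewrite muleA -EFinM.
apply: cvgeM; [exact: mule_def_fin| |exact: cvg_cst].
apply: cvg_EFin; first by apply: nearW.
apply: (@squeeze_cvgr _ _ _ _ (fun n : nat => beta - beta ^+ 2 * (c0 * n.+1%:R^-1)) (fun=> beta)).
- near=> n; set h := c0 / n.+1%:R.
  have h0 : 0 < h by rewrite divr_gt0.
  have bh : 0 < beta * h by rewrite mulr_gt0.
  change (beta - beta ^+ 2 * h <= h^-1 * (1 - expR (- (beta * h))) <= beta).
  rewrite [h^-1 * _]mulrC ler_pdivlMr// ler_pdivrMr//; apply/andP; split; last first.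
    by have := @expR_ge1Dx R (- (beta * h)); lra.
  have e1 : expR (- (beta * h)) <= (1 + beta * h)^-1.
    rewrite expRN lef_pV2 ?posrE ?expR_gt0 ?expR_ge1Dx//; lra.
  have e2 : (1 + beta * h)^-1 <= 1 - beta * h + (beta * h) ^+ 2.
    rewrite -[leLHS]mul1r ler_pdivrMr; last by lra.
    by have := mulr_gt0 bh (mulr_gt0 bh bh); nra.
  rewrite -/h; lra.
- rewrite -[X in _ --> X]subr0; apply: cvgB; first exact: cvg_cst.
  rewrite -(mulr0 (beta ^+ 2)); apply: cvgM; first exact: cvg_cst.
  rewrite -(mulr0 c0); apply: cvgM; [exact: cvg_cst|exact: cvg_harmonic].
- exact: cvg_cst.
Unshelve. all: by end_near. Qed.

(** Both sides are the integral over [[0, tau + h]], cut once at [h] and once at [tau]. *)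
Lemma window_split x h : 0 <= h ->
  (\int[P]_w \int[leb]_(u in `[0%R, (0 + h)%R]) bw x u w +
   \int[P]_w \int[leb]_(u in `[h, (tau w + h)%R]) bw x u w =
   occupation x + \int[P]_w \int[leb]_(u in `[tau w, (tau w + h)%R]) bw x u w)%E.
Proof.
move=> h0; have mtau := measurable_exit_at norm_levy rho T.
have w0 a b w : (0 <= \int[leb]_(u in `[a, b]) bw x u w)%E.
  by apply: integral_ge0 => u _; exact: bw_ge0.
have mw := measurable_bw_window x h.
have mh : measurable_fun setT (fun w => \int[leb]_(u in `[h, (tau w + h)%R]) bw x u w)%E.
  rewrite (_ : (fun _ => _) = fun w => (\int[leb]_(u in `[0%R, tau w]) bw x (u + h) w)%E).
    have k : measurable_fun setT (fun w => (tau w : measurableTypeR R, w)).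
      by apply: measurable_fun_pair.
    exact: (measurableT_comp (measurable_integral0 (measurable_bw_shift x (measurable_cst h))
       (fun _ => bw_ge0 _ _ _)) k).
  apply/funext => w.
  have := @ge0_integral_shift R h 0 (tau w) (fun u => bw x u w) (measurable_bw_path x w) (fun u => bw_ge0 x u w).
  by rewrite add0r => <-.
apply: (etrans (esym (@ge0_integralD _ _ _ P setT measurableT _ _ (fun w _ => w0 _ _ w)
  (mw (cst (0 : R)) (measurable_cst _)) (fun w _ => w0 _ _ w) mh))).
apply: (etrans _ (@ge0_integralD _ _ _ P setT measurableT _ _ (fun w _ => w0 _ _ w)
  (measurable_bw_upto x mtau) (fun w _ => w0 _ _ w) (mw tau mtau))).
apply: eq_integral => w _; rewrite add0r.
have bg0 u := bw_ge0 x u w; have mb := measurable_bw_path x w.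
rewrite -(ge0_integral_itvD h0 _ mb bg0) ?lerDr//.
by rewrite -(ge0_integral_itvD (tau_ge0 w) _ mb bg0)// lerDl.
Qed.

(* Discounting over a window of length [h] costs [beta h] times the occupation; the
   windows at [0] and at the exit time give the two remaining terms as [h -> 0]. *)
Lemma exit_identity x :
  ((phi x)%:E = beta%:E * occupation x + \int[P]_w bw x (tau w) w)%E.
Proof.
pose h n := c0 / n.+1%:R.
have h0 n : 0 < h n by rewrite divr_gt0.
have hc n : h n <= c0 by rewrite ler_pdivrMr// ler_peMr ?ler1n// ltW.
have Jf := occupation_fin x.
pose A n := (\int[P]_w \int[leb]_(u in `[0%R, (0 + h n)%R]) bw x u w)%E.
pose B n := (\int[P]_w \int[leb]_(u in `[tau w, (tau w + h n)%R]) bw x u w)%E.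
have cA : (((h n)^-1)%:E * A n)%E @[n --> \oo] --> (phi x)%:E.
  have c0T (w : Omega) : cst (0 : R) w + c0 <= T0 by rewrite add0r; apply: le_trans TcT0; rewrite lerDr ltW.
  have := @cvg_bw_average x (cst 0) c0 (measurable_cst _) (fun _ => lexx _) c00 c0T.
  rewrite (_ : (\int[P]_w bw x (cst 0%R w) w = (phi x)%:E)%E); last first.
    under eq_integral do rewrite bw_at0.
    exact: (P_cst P).
  by [].
have mtau := measurable_exit_at norm_levy rho T.
have cB : (((h n)^-1)%:E * B n)%E @[n --> \oo] --> (\int[P]_w bw x (tau w) w)%E.
  apply: (@cvg_bw_average x tau c0 mtau tau_ge0 c00) => w.
  apply: le_trans TcT0; rewrite lerD2r; exact: tau_leT.
have AB n : (A n = (1 - expR (- (beta * h n)))%:E * occupation x + B n)%E.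
  have e : (A n + (expR (- (beta * h n)))%:E * occupation x = occupation x + B n)%E.
    have <- := occupation_shift x (ltW (h0 n)) (hc n).
    exact: (window_split x (ltW (h0 n))).
  move: e; rewrite -(fineK Jf) -EFinM => e.
  rewrite EFinB muleBl// mul1e -addeAC -EFinM -e -addeA.
  by rewrite subee// adde0.
apply: (cvg_unique _ cA) => //.
have -> : (fun n => ((h n)^-1)%:E * A n)%E = (fun n => ((h n)^-1)%:E *
   ((1 - expR (- (beta * (c0 / n.+1%:R))))%:E * occupation x) + ((h n)^-1)%:E * B n)%E.
  apply/funext => n; rewrite AB ge0_muleDr//.
    rewrite mule_ge0 ?occupation_ge0// lee_fin subr_ge0 -expR0 ler_expR oppr_le0.
    by rewrite mulr_ge0 ?ltW.
  by apply: integral_ge0 => w _; apply: integral_ge0 => u _; exact: bw_ge0.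
apply: cvgeD => //; last exact: cvg_discount.
rewrite ge0_adde_def// inE.
  by rewrite mule_ge0 ?occupation_ge0// lee_fin ltW.
by apply: integral_ge0 => w _; exact: bw_ge0.
Qed.

End exit_identity.

End eigenfunction.

(** * Dynkin's formula and the Levy system up to the exit time *)

Lemma lee_cvg_le (R : realType) (u v : (\bar R)^nat) (a b : \bar R) :
  u n @[n --> \oo] --> a -> v n @[n --> \oo] --> b -> (forall n, (u n <= v n)%E) -> (a <= b)%E.
Proof.
move=> ua vb uv; rewrite -(cvg_lim _ ua)// -(cvg_lim _ vb)//; apply: lee_lim.
- by apply/cvg_ex; exists a.
- by apply/cvg_ex; exists b.
- exact: nearW.
Qed.

Section dynkin.
Context (disp : measure_display) (Omega : measurableType disp) (R : realType).
Context (d : nat) (P : probability Omega R) (X : R -> Omega -> 'rV[R]_d).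
Local Notation Rd := 'rV[R]_d.
Local Notation leb := (@lebesgue_measure R).
Hypothesis norm_levy : normalized_levy P X.
Let X0 w : X 0 w = 0. Proof. by case: norm_levy. Qed.
Local Notation XI := (XI X).

Variables (Up : Rd -> R) (beta rho T c0 : R).
Hypotheses (mUp : measurable_fun setT Up) (Up0 : forall x, 0 <= Up x).
Hypotheses (beta0 : 0 < beta) (T_gt0 : 0 < T) (c00 : 0 < c0).
Hypothesis kato_loc : forall k y, (\int[P]_w XI (cut Up k) y (T + c0) w < +oo)%E.
Local Notation tau := (exit_at X rho T).
Local Notation Q := (fun y => Up y + beta).
Local Notation h n := (c0 / n.+1%:R).

Let tau_leT w : tau w <= T. Proof. exact/exitT_leT/ltW. Qed.
Let tau_ge0 w : 0 <= tau w. Proof. exact/exitT_ge0/ltW. Qed.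
Let mtau : measurable_fun setT tau. Proof. exact: (measurable_exit_at norm_levy). Qed.
Let h0 n : 0 < h n. Proof. by rewrite divr_gt0. Qed.
Let hc n : h n <= c0. Proof. by rewrite ler_pdivrMr// ler_peMr ?ler1n// ltW. Qed.
Let mQ : measurable_fun setT Q. Proof. by apply: measurable_funD. Qed.
Let Q0 y : 0 <= Q y. Proof. by rewrite addr_ge0// ltW. Qed.

Lemma cvg_step : h n @[n --> \oo] --> 0.
Proof. rewrite -(mulr0 c0); apply: cvgM; [exact: cvg_cst|exact: cvg_harmonic]. Qed.

Lemma XI0 y t w : (XI (cst 0%R) y t w = 0)%E.
Proof. by rewrite !XIE integral0. Qed.

Lemma XI_addc x t w : 0 <= t -> (XI Q x t w = XI Up x t w + (beta * t)%:E)%E.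
Proof.
move=> t0; rewrite !XIE; under eq_integral do rewrite EFinD.
rewrite ge0_integralD//.
- by rewrite integral_cst//= lebesgue_itvcc// subr0.
- by move=> u _; rewrite lee_fin.
- by apply: measurable_funTS; exact: (measurable_gX norm_levy).
- by move=> u _; rewrite lee_fin ltW.
Qed.

(** With [Um = 0] everything built around [phi] that does not use the eigenfunction equation applies
    to a bounded continuous nonnegative [f]. *)
Lemma bw_killed f x u w : 0 <= u ->
  (bw X Up (cst 0%R) f beta x u w = killed X Q x u w * (f (x + X u w))%:E)%E.
Proof.
move=> u0; rewrite /bw /Wt XI0 expeR0 mul1e /killed XI_addc//.
move: (XI Up x u w) => a; rewrite oppeD ?fin_num_adde_defl// expeRD.
by rewrite -muleA [RHS]muleCA.
Qed.

(** The truncated analogue of the Green operator applied to 1: potential [Up + beta], ball of radius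
    [rho], time stopped at [T]. *)
Definition kgreen (x : Rd) : \bar R := (\int[P]_w \int[leb]_(t in `[0%R, tau w]) killed X Q x t w)%E.

Lemma kgreen_ge0 x : (0 <= kgreen x)%E.
Proof. by apply: integral_ge0 => w _; apply: integral_ge0 => u _; exact: killed_ge0. Qed.

Lemma measurable_killedt x w : measurable_fun setT (fun t : measurableTypeR R => killed X Q x t w).
Proof. exact: (measurableT_comp (measurable_killed norm_levy x mQ Q0) (pair2_measurable w)). Qed.

Lemma measurable_killed_at_exit x : measurable_fun setT (fun w => killed X Q x (tau w) w).
Proof.
have k : measurable_fun setT (fun w => (tau w : measurableTypeR R, w)).
  by apply: measurable_fun_pair.
exact: (measurableT_comp (measurable_killed norm_levy x mQ Q0) k).
Qed.

Lemma killed_decr x s t w : s <= t -> (killed X Q x t w <= killed X Q x s w)%E.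
Proof. by move=> st; rewrite lee_expeR leeN2; exact: (XI_le norm_levy). Qed.

Section weighted.
Variables (x : Rd) (g : nat -> Rd -> \bar R) (Cb c : R).
Hypotheses (mg : forall n, measurable_fun setT (g n)) (g0 : forall n y, (0 <= g n y)%E).
Hypothesis gC : forall n y, enorm (y - x) <= rho -> (g n y <= Cb%:E)%E.
Hypothesis gc : forall y, enorm (y - x) <= rho -> g n y @[n --> \oo] --> c%:E.
Local Notation G n := (fun tw : measurableTypeR R * Omega =>
    (killed X Q x tw.1 tw.2 * g n (x + X tw.1 tw.2)%R)%E).

Let mG n : measurable_fun setT (G n).
Proof.
apply: emeasurable_funM; first exact: (measurable_killed norm_levy x mQ Q0).
apply: (measurableT_comp (mg n)).
by apply: measurable_funD_rV => //; exact: (measurable_X norm_levy).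
Qed.

Let G0 n tw : (0 <= G n tw)%E.
Proof. by rewrite mule_ge0 ?killed_ge0. Qed.

Lemma measurable_weighted n :
  measurable_fun setT (fun w => \int[leb]_(t in `[0%R, tau w]) (killed X Q x t w * g n (x + X t w)%R))%E.
Proof.
have k : measurable_fun setT (fun w => (tau w : measurableTypeR R, w)).
  by apply: measurable_fun_pair.
exact: (measurableT_comp (measurable_integral0 (mG n) (G0 n)) k).
Qed.

Let near_ball w t : t < tau w -> 0 <= t -> enorm (x + X t w - x) <= rho.
Proof.
by move=> tt t0; rewrite addrAC subrr add0r; exact: (before_exit norm_levy (ltW T_gt0) t0 tt).
Qed.

Let Cb0 : 0 <= rho -> 0 <= Cb.
Proof. by move=> r0; rewrite -lee_fin; apply: le_trans (g0 0 x) (gC _ _); rewrite subrr enorm0. Qed.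

(** At [tau] itself the path may already be outside the ball, where [g n] is not controlled; the end
    point is negligible. *)
Let itvo w (f : R -> \bar R) : measurable_fun setT (f : measurableTypeR R -> _) ->
  (\int[leb]_(t in `[0%R, tau w]) f t = \int[leb]_(t in `[0%R, tau w[) f t)%E.
Proof. by move=> mf; rewrite integral_itv_bndo_bndc//; exact: measurable_funTS. Qed.

Lemma cvg_kgreen : 0 <= rho ->
  (\int[P]_w \int[leb]_(t in `[0%R, tau w]) (killed X Q x t w * g n (x + X t w)%R))%E @[n --> \oo] -->
  (c%:E * kgreen x)%E.
Proof.
move=> r0; have Cb0' := Cb0 r0.
have mGt n w := measurableT_comp (mG n) (pair2_measurable w).
have mk := measurable_killedt x.
have c0' : 0 <= c.
  have xx : enorm (x - x) <= rho by rewrite subrr enorm0.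
  by rewrite -lee_fin; apply: (lee_cvg_le (cvg_cst 0%E) (gc xx)).
have mkt : measurable_fun setT (fun w => \int[leb]_(t in `[0%R, tau w]) killed X Q x t w)%E.
  have k : measurable_fun setT (fun w => (tau w : measurableTypeR R, w)).
    by apply: measurable_fun_pair.
  exact: (measurableT_comp (measurable_integral0 (measurable_killed norm_levy x mQ Q0) (fun _ => killed_ge0 _ _ _ _ _)) k).
have k0 w : (0 <= \int[leb]_(t in `[0%R, tau w]) killed X Q x t w)%E.
  by apply: integral_ge0 => u _; exact: killed_ge0.
have lim w : (\int[leb]_(t in `[0%R, tau w]) (killed X Q x t w * g n (x + X t w)%R))%E @[n --> \oo] -->
    (c%:E * \int[leb]_(t in `[0%R, tau w]) killed X Q x t w)%E.
  rewrite (itvo _ (mk w)) -ge0_integralZl//; last 2 first.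
  - exact: measurable_funTS (mk w).
  - by move=> t _; exact: killed_ge0.
  under eq_fun do rewrite (itvo _ (mGt _ w)).
  have [] := @dominated_convergence _ _ _ leb `[0, tau w[%classic (measurable_itv _)
     (fun n t => killed X Q x t w * g n (x + X t w)%R)%E (fun t => c%:E * killed X Q x t w)%E
     (cst Cb%:E) (fun n => measurable_funTS (mGt n w)) _ _ _ _ => //.
  - by apply: emeasurable_funM => //; exact: measurable_funTS (mk w).
  - apply: aeW => t /=; rewrite in_itv/= => /andP[t0 tt].
    rewrite muleC; apply: cvgeM; [|exact: cvg_cst|exact: gc (near_ball tt t0)].
    apply: mule_def_fin => //; rewrite ge0_fin_numE ?killed_ge0//.
    by apply: (@le_lt_trans _ _ 1%E); rewrite ?killed_le1 ?ltry.
  - apply/integrableP; split; first exact: measurable_cst.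
    rewrite /= integral_cst//= lebesgue_measure_itv/=; case: ifP => _; rewrite ?mule0 ?ltry//.
  - apply: aeW => t n /=; rewrite in_itv/= => /andP[t0 tt].
    rewrite gee0_abs ?mule_ge0 ?killed_ge0// -[leRHS]mul1e.
    by apply: lee_pmul; rewrite ?killed_ge0 ?killed_le1//; exact: gC (near_ball tt t0).
rewrite /kgreen -ge0_integralZl//.
have [] := @dominated_convergence _ _ _ P setT measurableT
   (fun n w => \int[leb]_(t in `[0%R, tau w]) (killed X Q x t w * g n (x + X t w)%R))%E
   (fun w => c%:E * \int[leb]_(t in `[0%R, tau w]) killed X Q x t w)%E
   (cst (Cb * T)%:E) measurable_weighted _ _ _ _ => //.
- by apply: emeasurable_funM.
- by apply: aeW => w _; exact: lim.
- apply/integrableP; split; first exact: measurable_cst.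
  by rewrite (P_cst P) ltry.
- apply: aeW => w n _; rewrite gee0_abs; last first.
    by apply: integral_ge0 => t _; exact: (G0 n (t, w)).
  rewrite (itvo _ (mGt _ w)); apply: (@le_trans _ _ (\int[leb]_(t in `[0%R, tau w[) Cb%:E)%E).
    apply: ge0_le_integralP => t /=; first by move=> _; exact: (G0 n (t, w)).
    rewrite in_itv/= => /andP[t0 tt]; rewrite -[leRHS]mul1e.
    by apply: lee_pmul; rewrite ?killed_ge0 ?killed_le1//; exact: gC (near_ball tt t0).
  rewrite -itvo ?integral_cst//= lebesgue_itvcc// subr0 -EFinM lee_fin.
  by rewrite ler_wpM2l.
Qed.
End weighted.

Variables (f : Rd -> R) (Mf : R) (x : Rd).
Hypotheses (cf : continuous f) (f0 : forall y, 0 <= f y) (fM : forall y, f y <= Mf).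
Hypothesis rho0 : 0 <= rho.

Let mf : measurable_fun setT f. Proof. exact: continuous_measurable_rV. Qed.
Let Z : Rd -> R := cst 0.
Let mZ : measurable_fun setT Z. Proof. exact: measurable_cst. Qed.
Let Z0 y : 0 <= Z y. Proof. by []. Qed.
Let Tc0 : 0 < T + c0. Proof. by rewrite addr_gt0. Qed.
Let katoZ y : (\int[P]_w XI Z y (T + c0) w <= (1 / 2)%:E)%E.
Proof. by under eq_integral do rewrite XI0; rewrite integral0 lee_fin. Qed.
Local Notation bf := (bw X Up Z f beta).

Let cvg_avg (sg : Omega -> R) := @cvg_bw_average _ _ _ _ _ _ norm_levy _ _ _ _ _ mUp Up0 mZ Z0 cf f0 fM Tc0
  katoZ kato_loc _ beta0 x sg c0.

Lemma measurable_exit_value : measurable_fun setT (fun w => f (x + X (tau w) w)).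
Proof.
have k : measurable_fun setT (fun w => (tau w : measurableTypeR R, w)).
  by apply: measurable_fun_pair.
apply: (measurableT_comp mf); apply: measurable_funD_rV => //.
exact: (measurableT_comp (measurable_X norm_levy) k).
Qed.

(** The domain of the generator is replaced by the one-sided bound [P_h f <= f + h g_n] on the
    closed ball. Cutting [[0, tau + h]] at [h] and at [tau] bounds the window after the exit by the
    window at 0, whose average tends to [f x = 0], plus the gains [h g_n] accumulated before the
    exit. *)
Lemma dynkin (g : nat -> Rd -> \bar R) (Cb c : R) : f x = 0 ->
  (forall n, measurable_fun setT (g n)) -> (forall n y, 0 <= g n y)%E ->
  (forall n y, enorm (y - x) <= rho -> (g n y <= Cb%:E)%E) ->
  (forall y, enorm (y - x) <= rho -> g n y @[n --> \oo] --> c%:E) ->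
  (forall n y, enorm (y - x) <= rho ->
     (Kop P X (h n) f y <= (f y)%:E + (h n)%:E * g n y)%E) ->
  (\int[P]_w (killed X Q x (tau w) w * (f (x + X (tau w) w))%:E) <= c%:E * kgreen x)%E.
Proof.
move=> fx0 mg g0 gC gc Kg.
pose A n := (\int[P]_w \int[leb]_(u in `[0%R, (0 + h n)%R]) bf x u w)%E.
pose B n := (\int[P]_w \int[leb]_(u in `[tau w, (tau w + h n)%R]) bf x u w)%E.
pose S n := (\int[P]_w \int[leb]_(u in `[h n, (tau w + h n)%R]) bf x u w)%E.
pose J := occupation P X Up Z f beta rho T x.
pose W n := (\int[P]_w \int[leb]_(t in `[0%R, tau w]) (killed X Q x t w * g n (x + X t w)%R))%E.
have bf0 u w : (0 <= bf x u w)%E by exact: bw_ge0.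
have mbw w : measurable_fun setT (fun u : measurableTypeR R => bf x u w).
  exact: (measurable_bw_path norm_levy mUp Up0 mZ Z0 cf).
have split_n n : (A n + S n = J + B n)%E.
  exact: (window_split norm_levy mUp Up0 mZ Z0 cf f0 beta rho T_gt0 x (ltW (h0 n))).
have Jf : J \is a fin_num.
  exact: (occupation_fin norm_levy Up0 mZ Z0 f0 fM Tc0 katoZ beta0 rho T_gt0 c00 (lexx _)).
have near_ball w t : t < tau w -> 0 <= t -> enorm (x + X t w - x) <= rho.
  by move=> tt t0; rewrite addrAC subrr add0r; exact: (before_exit norm_levy (ltW T_gt0) t0 tt).
have mkf : measurable_fun setT (fun tw : measurableTypeR R * Omega =>
    (killed X Q x tw.1 tw.2 * (f (x + X tw.1 tw.2))%:E)%E).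
  apply: emeasurable_funM; first exact: (measurable_killed norm_levy x mQ Q0).
  apply/measurable_EFinP; apply: (measurableT_comp mf).
  by apply: measurable_funD_rV => //; exact: (measurable_X norm_levy).
(* Killing between [t] and [t + h] is dropped, which only increases the integral; the Markov
   property at [t] and the bound on [Kop] do the rest. *)
have Sle n : (S n <= J + (h n)%:E * W n)%E.
  pose K := (\int[P]_w \int[leb]_(t in `[0%R, T]) ((aliveI rho t (dy X w))%:E *
      (killed X Q x t w * Kop P X (h n) f (x + X t w)%R)))%E.
  have SK : (S n <= K)%E.
    rewrite /K -(killed_markov norm_levy rho T x (ltW (h0 n)) mQ Q0 mf f0).
    apply: ge0_le_integralP => w _; first by apply: integral_ge0 => u _.
    rewrite (alive_integral rho (ltW T_gt0)); last 2 first.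
    - apply: emeasurable_funM; first exact: measurable_killedt.
      apply/measurable_EFinP; apply: (measurableT_comp mf).
      apply: measurable_funD_rV => //.
      exact: (measurableT_comp (measurable_XtD norm_levy (h n)) (pair2_measurable w)).
    - by move=> t; rewrite mule_ge0 ?killed_ge0 ?lee_fin.
    have := @ge0_integral_shift R (h n) 0 (tau w) (fun u => bf x u w) (mbw w) (fun u => bf0 u w).
    rewrite add0r => <-; apply: ge0_le_integralP => t /=; first by [].
    rewrite in_itv/= => /andP[t0 tt]; rewrite bw_killed ?addr_ge0// ?(ltW (h0 n))//.
    by apply: lee_wpmul2r; [rewrite lee_fin|apply: killed_decr; rewrite lerDl ltW].
  apply: (le_trans SK).
  rewrite /J /occupation /W -ge0_integralZl//; last 3 first.
  - exact: measurable_weighted.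
  - by move=> w _; apply: integral_ge0 => t _; rewrite mule_ge0 ?killed_ge0.
  - by rewrite lee_fin ltW.
  have mocc : measurable_fun setT (fun w => \int[leb]_(u in `[0%R, tau w]) bf x u w)%E.
    exact: (measurable_bw_upto norm_levy mUp Up0 mZ Z0 cf f0).
  rewrite -(@ge0_integralD _ _ _ P setT measurableT)//; last 3 first.
  - by move=> w _; exact: integral_ge0.
  - by move=> w _; rewrite mule_ge0 ?lee_fin ?(ltW (h0 n))//; apply: integral_ge0 => t _; rewrite mule_ge0 ?killed_ge0.
  - by apply: emeasurable_funM => //; exact: measurable_weighted.
  apply: ge0_le_integralP => w _.
    by apply: integral_ge0 => t _; rewrite !mule_ge0 ?killed_ge0 ?Kop_ge0 ?lee_fin ?aliveI_ge0.
  have mkw (k : Rd -> \bar R) : measurable_fun setT k ->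
      measurable_fun setT (fun t : measurableTypeR R => killed X Q x t w * k (x + X t w)%R)%E.
    move=> mk; apply: emeasurable_funM; first exact: measurable_killedt.
    by apply: (measurableT_comp mk); exact: (measurable_addXw norm_levy).
  rewrite (alive_integral rho (ltW T_gt0)); last 2 first.
  - by apply: mkw; exact: measurable_Kop.
  - by move=> t; rewrite mule_ge0 ?killed_ge0 ?Kop_ge0.
  rewrite -ge0_integralZl//; last 3 first.
  - by apply: measurable_funTS; exact: mkw.
  - by move=> t _; rewrite mule_ge0 ?killed_ge0.
  - by rewrite lee_fin ltW.
  rewrite -ge0_integralD//; last 3 first.
  - exact: measurable_funTS.
  - by move=> t _; rewrite !mule_ge0 ?killed_ge0 ?lee_fin ?(ltW (h0 n)).
  - by apply: emeasurable_funM => //; apply: measurable_funTS; exact: mkw.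
  rewrite -integral_itv_bndo_bndc; last first.
    by apply: measurable_funTS; apply: mkw; exact: measurable_Kop.
  rewrite -[leRHS]integral_itv_bndo_bndc; last first.
    apply: emeasurable_funD; first exact: measurable_funTS (mbw w).
    by apply: emeasurable_funM => //; apply: measurable_funTS; exact: mkw.
  apply: ge0_le_integralP => t /=; first by move=> _; rewrite mule_ge0 ?killed_ge0 ?Kop_ge0.
  rewrite in_itv/= => /andP[t0 tt]; rewrite bw_killed//.
  rewrite (muleCA (h n)%:E) -ge0_muleDr ?lee_fin//; last first.
    by rewrite mule_ge0// lee_fin ltW.
  by apply: lee_wpmul2l; [exact: killed_ge0|exact: Kg (near_ball w t tt t0)].
have BA n : (((h n)^-1)%:E * B n <= ((h n)^-1)%:E * A n + W n)%E.
  have e : (J + B n <= J + (A n + (h n)%:E * W n))%E.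
    have AS := leeD2l (A n) (Sle n).
    by rewrite -split_n; apply: (le_trans AS); rewrite (addeCA (A n)); exact: lexx.
  have {}e : (B n <= A n + (h n)%:E * W n)%E by move: e; rewrite leeD2lE.
  have W0 : (0 <= W n)%E.
    by apply: integral_ge0 => w _; apply: integral_ge0 => t _; rewrite mule_ge0 ?killed_ge0.
  have A0 : (0 <= A n)%E by apply: integral_ge0 => w _; exact: integral_ge0.
  apply: (@le_trans _ _ (((h n)^-1)%:E * (A n + (h n)%:E * W n))%E).
    by apply: lee_wpmul2l => //; rewrite lee_fin invr_ge0 ltW.
  rewrite ge0_muleDr//; last by rewrite mule_ge0// lee_fin ltW.
  by rewrite (muleA _ _ (W n)) -EFinM mulVf ?mul1e// gt_eqF.
have cA : (((h n)^-1)%:E * A n)%E @[n --> \oo] --> (0 : \bar R)%E.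
  have c0T (w : Omega) : cst (0 : R) w + c0 <= T + c0 by rewrite lerD2r ltW.
  have := cvg_avg (measurable_cst (0:R)) (fun _ => lexx _) c00 c0T.
  rewrite (_ : (\int[P]_w bf x (cst 0%R w) w = 0)%E)//.
  by apply: integral0_eq => w _; rewrite (bw_at0 norm_levy) fx0.
have cB : (((h n)^-1)%:E * B n)%E @[n --> \oo] --> (\int[P]_w bf x (tau w) w)%E.
  by apply: (cvg_avg mtau tau_ge0 c00) => w; rewrite lerD2r.
under eq_integral do rewrite -bw_killed//.
rewrite -[leRHS]add0e; apply: (lee_cvg_le cB _ BA).
apply: cvgeD; [exact: fin_num_adde_defr|exact: cA|exact: (cvg_kgreen mg g0 gC gc rho0)].
Qed.

(** The integrals over [[0, (t - h)_+]] increase to the one over [[0, t)]; monotone convergence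
    covers an infinite integral as well. *)
Lemma killed_left w t : 0 < t ->
  killed X Q x (Num.max 0 (t - h n)) w @[n --> \oo] --> killed X Q x t w.
Proof.
move=> t0; apply: cvg_expeR; apply: cvgeN.
have Xc : XI Q x t w = (\int[leb]_u limn (fun n =>
    ((Q (x + X u w))%:E * (\1_(`[0, Num.max 0 (t - h n)]%classic) u)%:E)%E))%E.
  rewrite !XIE -integral_itv_bndo_bndc; last first.
    exact: measurable_funTS (measurable_gX norm_levy mQ x w).
  rewrite integral_mkcond; apply: eq_integral => u _; apply/esym/cvg_lim => //.
  rewrite patchE mem_setE in_itv/=.
  have [u0|u0] := leP 0 u; last first.
    rewrite (_ : (fun _ => _) = cst 0%E); first exact: cvg_cst.
    by apply/funext => n; rewrite indicE mem_setE in_itv/= leNgt u0/= mule0.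
  have [ut|tu] /= := ltP u t; last first.
    rewrite (_ : (fun _ => _) = cst 0%E); first exact: cvg_cst.
    apply/funext => n; rewrite indicE mem_setE in_itv/= u0/= leNgt gt_max.
    by rewrite (lt_le_trans t0 tu)/= (lt_le_trans _ tu) ?mule0// ltrBlDr ltrDl.
  apply: cvg_near_cst; have /cvgrPdist_lt /(_ (t - u)) := cvg_step.
  rewrite subr_gt0 => /(_ ut); apply: filterS => n.
  rewrite sub0r normrN gtr0_norm// => hu.
  by rewrite indicE mem_setE in_itv/= u0/= le_max; apply/esym/eqP; rewrite (_ : (u <= t - h n) = true) ?orbT ?mule1 ?eqxx// lerBrDl -lerBrDr ltW.
rewrite Xc.
have mono n : XI Q x (Num.max 0 (t - h n)) w = (\int[leb]_u
    ((Q (x + X u w))%:E * (\1_(`[0, Num.max 0 (t - h n)]%classic) u)%:E))%E.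
  rewrite !XIE integral_mkcond; apply: eq_integral => u _.
  by rewrite patchE indicE; case: ifP => _; rewrite ?mule1 ?mule0.
under eq_fun do rewrite mono.
apply: cvg_monotone_convergence => //.
- move=> n; apply: emeasurable_funM; first exact: (measurable_gX norm_levy mQ x w).
  by apply/measurable_EFinP; apply: measurable_indic.
- by move=> n u _; rewrite mule_ge0 ?lee_fin.
- move=> u _ m n mn; rewrite lee_wpmul2l ?lee_fin// !indicE !mem_setE !in_itv/= ler_nat.
  case: (0 <= u) => //=; rewrite !le_max; case: (u <= 0) => //=.
  have : h n <= h m by rewrite ler_pM2l// lef_pV2 ?posrE// ler_nat.
  move=> hnm; case: (leP u (t - h m)) => // um; rewrite (le_trans um)//.
  by rewrite lerD2l lerN2.
Qed.

Hypotheses (T1 : 0 < rho).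

(** As [f] vanishes on the ball, the position at time [t + h], for [t < tau], contributes only if
    the ball has been left by then, which places [t] within [h] of the exit. By the Markov property
    these contributions are at least [g n] integrated against the weight; they are at most an
    average of [f] over the window after [tau]. *)
Lemma levy_system_lower (c : R) (g : nat -> Rd -> \bar R) (Cb : R) :
  0 <= Mf -> (forall y, enorm (y - x) <= rho -> f y = 0) ->
  (forall n, measurable_fun setT (g n)) -> (forall n y, 0 <= g n y)%E ->
  (forall n y, enorm (y - x) <= rho -> (g n y <= Cb%:E)%E) ->
  (forall y, enorm (y - x) <= rho -> g n y @[n --> \oo] --> c%:E) ->
  (forall n y, enorm (y - x) <= rho ->
     ((h n)%:E * g n y <= Kop P X (h n) f y)%E) ->
  (c%:E * kgreen x <= \int[P]_w (killed X Q x (tau w) w * (f (x + X (tau w) w))%:E))%E.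
Proof.
move=> Mf0 fz mg g0 gC gc Kg.
(* The weight is taken at [(tau - h)_+]: it dominates the weights of the last window before the exit
   and tends to the weight at [tau]. *)
pose D (n : nat) (w : Omega) := (killed X Q x (Num.max 0 (tau w - h n))%R w *
  (((h n)^-1)%:E * \int[leb]_(u in `[tau w, (tau w + h n)%R]) (f (x + X u w))%:E))%E.
have mfX w : measurable_fun setT (fun u : measurableTypeR R => (f (x + X u w))%:E).
  exact: (measurable_gX norm_levy mf x w).
have hi0 n : (0 <= ((h n)^-1)%:E)%E by rewrite lee_fin invr_ge0 ltW.
have F0 w a b : (0 <= \int[leb]_(u in `[a, b]) (f (x + X u w))%:E)%E.
  by apply: integral_ge0 => u _; rewrite lee_fin.
have avg_le n w : (((h n)^-1)%:E * \int[leb]_(u in `[tau w, (tau w + h n)%R]) (f (x + X u w))%:E <= Mf%:E)%E.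
  apply: (@le_trans _ _ (((h n)^-1)%:E * \int[leb]_(u in `[tau w, (tau w + h n)%R]) Mf%:E)%E).
    by apply: lee_wpmul2l => //; apply: ge0_le_integralP => u _; rewrite lee_fin.
  rewrite integral_cst//= lebesgue_itvcc ?lerDl ?(ltW (h0 n))// addrAC subrr add0r.
  rewrite muleCA -EFinM mulVf; last by rewrite (gt_eqF (h0 n)).
  by rewrite mulr1.
have mD n : measurable_fun setT (D n).
  apply: emeasurable_funM.
    have k : measurable_fun setT (fun w => (Num.max 0 (tau w - h n) : measurableTypeR R, w)).
      apply: measurable_fun_pair => //; apply: measurable_maxr => //.
      by apply: measurable_funB.
    exact: (measurableT_comp (measurable_killed norm_levy x mQ Q0) k).
  apply: emeasurable_funM => //.
  rewrite (_ : (fun _ => _) = fun w => (\int[leb]_(u in `[0%R, h n]) (f (x + X (u + tau w) w))%:E)%E).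
    have mG : measurable_fun setT (fun tw : measurableTypeR R * Omega => (f (x + X (tw.1 + tau tw.2) tw.2))%:E).
      apply/measurable_EFinP; apply: (measurableT_comp mf); apply: measurable_funD_rV => //.
      have k : measurable_fun setT (fun tw : measurableTypeR R * Omega =>
          ((tw.1 + tau tw.2 : measurableTypeR R), tw.2)).
        apply: measurable_fun_pair; last exact: measurable_snd.
        apply: measurable_funD; first exact: measurable_fst.
        exact: (measurableT_comp mtau measurable_snd).
      exact: (measurableT_comp (measurable_X norm_levy) k).
    have G0 tw : (0 <= (f (x + X (tw.1 + tau tw.2) tw.2))%:E)%E by rewrite lee_fin.
    exact: (measurableT_comp (measurable_integral0 mG G0) (pair1_measurable (h n : measurableTypeR R))).
  apply/funext => w.
  have e0 u : (0 <= (f (x + X u w))%:E)%E by rewrite lee_fin.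
  have := @ge0_integral_shift R (tau w) 0 (h n) (fun u => (f (x + X u w))%:E) (mfX w) e0.
  by rewrite add0r (addrC (h n)) => <-.
have limD : (\int[P]_w D n w)%E @[n --> \oo] -->
    (\int[P]_w (killed X Q x (tau w) w * (f (x + X (tau w) w))%:E))%E.
  have [] := @dominated_convergence _ _ _ P setT measurableT D
    (fun w => killed X Q x (tau w) w * (f (x + X (tau w) w))%:E)%E (cst Mf%:E) mD _ _ _ _ => //.
  - apply: emeasurable_funM; first exact: measurable_killed_at_exit.
    by apply/measurable_EFinP; exact: measurable_exit_value.
  - apply: aeW => w _; apply: cvgeM.
    + apply: mule_def_fin => //; rewrite ge0_fin_numE ?killed_ge0//.
      by apply: (@le_lt_trans _ _ 1%E); rewrite ?killed_le1 ?ltry.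
    + by apply: killed_left; exact: (exit_at_gt0 norm_levy).
    + apply: (cvg_average (h := fun n => h n)) => //; first exact: cvg_step.
        by move=> u; rewrite lee_fin.
      move=> e e0.
      have cX : f (x + X u w) @[u --> (tau w)^'+] --> f (x + X (tau w) w).
        apply: cvg_continuous_rV => //; apply: cvg_addl_rV; exact: (rcont norm_levy).
      move/cvgrPdist_le : cX => /(_ e e0) [dl /= dl0 H].
      near=> dl' => u /andP[tu ud].
      rewrite !lee_fin; move: tu; rewrite le_eqVlt => /predU1P[<-|tu]; first by apply/andP; split; lra.
      have := H u _ tu; rewrite /= distrC gtr0_norm ?subr_gt0//.
      have dd : dl' < dl by near: dl'; exact: nbhs_right_lt.
      have -> : u - tau w < dl by apply: le_lt_trans dd; rewrite lerBlDl.
      by move=> /(_ isT); rewrite ler_norml => /andP[h1 h2]; apply/andP; split; lra.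
  - by apply/integrableP; split; [exact: measurable_cst|rewrite (P_cst P) ltry].
  - apply: aeW => w n _; rewrite gee0_abs ?mule_ge0 ?killed_ge0// -[leRHS]mul1e.
    by apply: lee_pmul; rewrite ?mule_ge0 ?killed_ge0 ?killed_le1.
apply: (lee_cvg_le (cvg_kgreen mg g0 gC gc rho0) limD) => n.
have near_ball w t : t < tau w -> 0 <= t -> enorm (x + X t w - x) <= rho.
  by move=> tt t0; rewrite addrAC subrr add0r; exact: (before_exit norm_levy (ltW T_gt0) t0 tt).
pose K := (\int[P]_w \int[leb]_(t in `[0%R, T]) ((aliveI rho t (dy X w))%:E *
      (killed X Q x t w * Kop P X (h n) f (x + X t w)%R)))%E.
have mkw w (k : Rd -> \bar R) : measurable_fun setT k ->
    measurable_fun setT (fun t : measurableTypeR R => killed X Q x t w * k (x + X t w)%R)%E.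
  move=> mk; apply: emeasurable_funM; first exact: measurable_killedt.
  by apply: (measurableT_comp mk); exact: (measurable_addXw norm_levy).
have mal (k : Rd -> \bar R) : measurable_fun setT k -> (forall y, 0 <= k y)%E ->
    measurable_fun setT (fun w => \int[leb]_(t in `[0%R, T]) ((aliveI rho t (dy X w))%:E *
      (killed X Q x t w * k (x + X t w)%R)))%E.
  move=> mk k0.
  have mG : measurable_fun setT (fun tw : measurableTypeR R * Omega => (aliveI rho tw.1 (dy X tw.2))%:E *
      (killed X Q x tw.1 tw.2 * k (x + X tw.1 tw.2)%R))%E.
    apply: emeasurable_funM; first exact: (measurable_aliveX norm_levy).
    apply: emeasurable_funM; first exact: (measurable_killed norm_levy x mQ Q0).
    apply: (measurableT_comp mk).
    by apply: measurable_funD_rV => //; exact: (measurable_X norm_levy).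
  have G0 tw : (0 <= (aliveI rho tw.1 (dy X tw.2))%:E *
      (killed X Q x tw.1 tw.2 * k (x + X tw.1 tw.2)%R))%E.
    by rewrite !mule_ge0 ?killed_ge0 ?lee_fin ?aliveI_ge0.
  exact: (measurableT_comp (measurable_integral0 mG G0) (pair1_measurable (T : measurableTypeR R))).
apply: (@le_trans _ _ (((h n)^-1)%:E * K)%E).
  rewrite /K -ge0_integralZl//; last 2 first.
  - by apply: mal; [exact: measurable_Kop|move=> y; exact: Kop_ge0].
  - move=> w _; apply: integral_ge0 => t _.
    by rewrite !mule_ge0 ?killed_ge0 ?Kop_ge0 ?lee_fin ?aliveI_ge0.
  apply: ge0_le_integralP => w _.
    by apply: integral_ge0 => t _; rewrite mule_ge0 ?killed_ge0.
  rewrite (alive_integral rho (ltW T_gt0)); last 2 first.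
  - by apply: mkw; exact: measurable_Kop.
  - by move=> t; rewrite mule_ge0 ?killed_ge0 ?Kop_ge0.
  rewrite -ge0_integralZl//; last 2 first.
  - by apply: measurable_funTS; apply: mkw; exact: measurable_Kop.
  - by move=> t _; rewrite mule_ge0 ?killed_ge0 ?Kop_ge0.
  rewrite -integral_itv_bndo_bndc; last by apply: measurable_funTS; exact: mkw.
  rewrite -[leRHS]integral_itv_bndo_bndc; last first.
    apply: emeasurable_funM => //.
    by apply: measurable_funTS; apply: mkw; exact: measurable_Kop.
  apply: ge0_le_integralP => t /=; first by move=> _; rewrite mule_ge0 ?killed_ge0.
  rewrite in_itv/= => /andP[t0 tt]; rewrite muleCA.
  apply: lee_wpmul2l; first exact: killed_ge0.
  have := Kg n _ (near_ball w t tt t0).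
  move=> /(lee_wpmul2l (hi0 n)); rewrite muleA -EFinM mulVf ?mul1e// (gt_eqF (h0 n))//.
rewrite /K -(killed_markov norm_levy rho T x (ltW (h0 n)) mQ Q0 mf f0).
rewrite -ge0_integralZl//; last 2 first.
- have mG : measurable_fun setT (fun tw : measurableTypeR R * Omega => (aliveI rho tw.1 (dy X tw.2))%:E *
      (killed X Q x tw.1 tw.2 * (f (x + X (tw.1 + h n) tw.2))%:E))%E.
    apply: emeasurable_funM; first exact: (measurable_aliveX norm_levy).
    apply: emeasurable_funM; first exact: (measurable_killed norm_levy x mQ Q0).
    apply/measurable_EFinP; apply: (measurableT_comp mf).
    by apply: measurable_funD_rV => //; exact: (measurable_XtD norm_levy (h n)).
  have G0 tw : (0 <= (aliveI rho tw.1 (dy X tw.2))%:E *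
      (killed X Q x tw.1 tw.2 * (f (x + X (tw.1 + h n) tw.2))%:E))%E.
    by rewrite !mule_ge0 ?killed_ge0 ?lee_fin ?aliveI_ge0.
  exact: (measurableT_comp (measurable_integral0 mG G0) (pair1_measurable (T : measurableTypeR R))).
- move=> w _; apply: integral_ge0 => t _.
  by rewrite !mule_ge0 ?killed_ge0 ?lee_fin ?aliveI_ge0.
apply: ge0_le_integralP => w _.
  rewrite mule_ge0//; apply: integral_ge0 => t _.
  by rewrite !mule_ge0 ?killed_ge0 ?lee_fin ?aliveI_ge0.
have mfXh : measurable_fun setT (fun t : measurableTypeR R => (f (x + X (t + h n) w))%:E).
  apply/measurable_EFinP; apply: (measurableT_comp mf).
  apply: measurable_funD_rV => //.
  exact: (measurableT_comp (measurable_XtD norm_levy (h n)) (pair2_measurable w)).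
rewrite (alive_integral rho (ltW T_gt0)); last 2 first.
- by apply: emeasurable_funM => //; exact: measurable_killedt.
- by move=> t; rewrite mule_ge0 ?killed_ge0 ?lee_fin.
rewrite /D muleCA; apply: lee_wpmul2l => //.
set m := Num.max 0 (tau w - h n).
have zero : (\int[leb]_(u in `[0%R, tau w]) (f (x + X u w))%:E = 0)%E.
  rewrite -integral_itv_bndo_bndc; last exact: measurable_funTS (mfX w).
  apply: integral0_eq => u; rewrite /= in_itv/= => /andP[u0 ut].
  by rewrite fz//; exact: near_ball.
apply: (@le_trans _ _ (\int[leb]_(t in `[0%R, tau w]) (killed X Q x m w * (f (x + X (t + h n) w))%:E))%E).
  apply: ge0_le_integralP => t /=; first by move=> _; rewrite mule_ge0 ?killed_ge0 ?lee_fin.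
  rewrite in_itv/= => /andP[t0 tt].
  have [th|th] := ltP (t + h n) (tau w).
    by rewrite (fz (x + X (t + h n) w)) ?mule0//; apply: near_ball => //; rewrite addr_ge0// ltW.
  apply: lee_wpmul2r; first by rewrite lee_fin.
  by apply: killed_decr; rewrite ge_max t0/= lerBlDr.
rewrite ge0_integralZl//; last 3 first.
- exact: measurable_funTS mfXh.
- by move=> t _; rewrite lee_fin.
- exact: killed_ge0.
apply: lee_wpmul2l; first exact: killed_ge0.
have e0 u : (0 <= (f (x + X u w))%:E)%E by rewrite lee_fin.
have := @ge0_integral_shift R (h n) 0 (tau w) (fun u => (f (x + X u w))%:E) (mfX w) e0.
rewrite add0r => ->.
apply: (@le_trans _ _ (\int[leb]_(u in `[0%R, (tau w + h n)%R]) (f (x + X u w))%:E)%E).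
  apply: ge0_subset_integral => //=.
  - exact: measurable_funTS (mfX w).
  - by move=> u /=; rewrite !in_itv/= => /andP[hu ->]; rewrite (le_trans (ltW (h0 n)) hu).
rewrite (ge0_integral_itvD (tau_ge0 w) _ (mfX w) e0) ?lerDl ?(ltW (h0 n))//.
by rewrite zero add0e.
Unshelve. all: by end_near. Qed.

End dynkin.

(** * Small-time asymptotics of the process *)

Section trigonometry.
Variable R : realType.
Implicit Types x y t : R.

Lemma normr_sin_le x : `|sin x| <= `|x|.
Proof.
wlog x0 : x / 0 <= x => [H|].
  by have [/H//|/ltW x0] := leP 0 x; rewrite -normrN -sinN -[leRHS]normrN H ?oppr_ge0.
have [|c _] := @MVT_segment R sin cos 0 x x0.
  exact: continuous_subspaceT (@continuous_sin R).
rewrite sin0 !subr0 => ->; rewrite normrM ler_piMl// cos_max//.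
Qed.

Lemma one_sub_cosE x : 1 - cos x = 2 * sin (x / 2) ^+ 2.
Proof.
have {1}-> : x = x / 2 + x / 2 by lra.
by have := cos2Dsin2 (x / 2); rewrite cosD !expr2; lra.
Qed.

Lemma one_sub_cos_ge0 x : 0 <= 1 - cos x.
Proof. by rewrite subr_ge0 cos_le1. Qed.

Lemma one_sub_cos_le x : 1 - cos x <= x ^+ 2 / 2.
Proof.
rewrite one_sub_cosE; have : sin (x / 2) ^+ 2 <= (x / 2) ^+ 2.
  rewrite -(real_normK (num_real (sin _))) -(real_normK (num_real (x / 2))).
  by rewrite lerXn2r// ?nnegrE ?normr_ge0 ?normr_sin_le.
rewrite expr_div_n; lra.
Qed.

Lemma sub_sin_le x : `|x - sin x| <= `|x| ^+ 3.
Proof.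
wlog x0 : x / 0 <= x => [H|].
  have [/H//|/ltW x0] := leP 0 x.
  by have := H (- x); rewrite oppr_ge0 sinN -opprD !normrN => /(_ x0).
have [|c] := @MVT_segment R sin cos 0 x x0.
  exact: continuous_subspaceT (@continuous_sin R).
rewrite in_itv/= => /andP[c0 cx]; rewrite sin0 !subr0 => ->.
have -> : x - cos c * x = x * (1 - cos c) by ring.
rewrite normrM (ger0_norm (one_sub_cos_ge0 _)) exprS ler_wpM2l//.
apply: le_trans (one_sub_cos_le c) _; rewrite ger0_norm//.
have : c ^+ 2 <= x ^+ 2 by rewrite lerXn2r// nnegrE.
by have := sqr_ge0 c; lra.
Qed.

(** The integral is [1 - sin t / t]. Averaging over frequencies is what converts a characteristic
    function into a bound on large values. *)
Lemma avg_cos t : 2 <= `|t| ->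
  ((1 / 2)%:E <= \int[@lebesgue_measure R]_(u in `[0%R, 1%R]) (1 - cos (u * t))%:E)%E.
Proof.
move=> t2; have t0 : t != 0 by apply/eqP => t0; move: t2; rewrite t0 normr0; lra.
pose F (u : R) := u - t^-1 * sin (t * u).
have dF (u : R) : is_derive u 1 F (1 - cos (u * t)).
  have -> : 1 - cos (u * t) = 1 - t^-1 *: (t *: cos (t * u)).
    by rewrite scalerA mulVf// scale1r mulrC.
  apply: is_deriveB; apply: (@is_deriveZ _ _ _ (fun u => sin (t * u)) t^-1).
  have h : is_derive u 1 ( *%R t) t.
    by rewrite -[X in is_derive _ _ _ X]mulr1; exact: (is_deriveZ t (is_derive_id u 1)).
  by rewrite [X in is_derive _ _ _ X]mulrC; exact: (is_derive1_comp (is_derive_sin (t * u)) h).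
have cF : continuous F.
  move=> u; apply: differentiable_continuous; apply/derivable1_diffP.
  by have := dF u; case.
rewrite (@continuous_FTC2 R _ F) ?ltr01//.
- rewrite /F mulr1 mulr0 sin0 mulr0 -EFinB !subr0 lee_fin.
  have : `|t^-1 * sin t| <= 1 / 2.
    rewrite mulrC normrM normfV ler_pdivrMr ?normr_gt0//.
    have := sin_max t; lra.
  by rewrite ler_norml => /andP[_]; lra.
- apply: continuous_subspaceT => u; apply: cvgB; first exact: cvg_cst.
  apply: (continuous_comp (f := fun u : R => u * t)); last exact: continuous_cos.
  by apply: cvgM; [exact: cvg_id|exact: cvg_cst].
- split.
  + by move=> u _; have := dF u; case.
  + exact: cvg_at_right_filter (cF 0).
  + exact: cvg_at_left_filter (cF 1).
- by move=> u _; rewrite derive1E; have := dF u; case => _ ->.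
Qed.

End trigonometry.

Lemma one_sub_expR (R : realType) (u : R) : 0 <= u -> u - u ^+ 2 <= 1 - expR (- u) <= u.
Proof.
move=> u0; have u1 : 0 < 1 + u by rewrite ltr_pwDl.
have e1 : expR (- u) <= (1 + u)^-1 by rewrite expRN lef_pV2 ?posrE ?expR_gt0 ?expR_ge1Dx.
have e2 : (1 + u)^-1 <= 1 - u + u ^+ 2.
  rewrite -[leLHS]mul1r ler_pdivrMr//.
  have -> : (1 - u + u ^+ 2) * (1 + u) = 1 + u ^+ 3 by ring.
  by rewrite lerDl exprn_ge0.
by have := expR_ge1Dx (- u); move=> e3; apply/andP; split; lra.
Qed.

(** * Small-time means and the Levy-Khintchine exponent *)

Section levy_khintchine.
Context (disp : measure_display) (Omega : measurableType disp) (R : realType).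
Context (d : nat) (P : probability Omega R) (X : R -> Omega -> 'rV[R]_d).
Local Notation Rd := 'rV[R]_d.
Hypothesis mX : forall t, measurable_fun setT (X t).
Implicit Types (f g : Rd -> R) (z xi : Rd).
Variables (M : {measure set Rd -> \bar R}) (A : 'M[R]_d).
Definition trunc_sq (z : Rd) : R := Num.min 1 (enorm z ^+ 2).
Hypothesis M_fin : (\int[M]_z (trunc_sq z)%:E < +oo)%E.
(** The real part of the characteristic exponent; for a symmetric process the imaginary part
    vanishes. *)
Definition levy_symbol (xi : Rd) : R := dotv (xi *m A) xi / 2 + \int[M]_z (1 - cos (dotv xi z)).
Local Notation psi := levy_symbol.
Hypothesis A_pos : forall xi, 0 <= dotv (xi *m A) xi.
Hypothesis Ecos : forall (t : R) (xi : Rd), 0 <= t ->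
  \int[P]_w cos (dotv xi (X t w)) = expR (- (t * psi xi)).
Hypothesis Esin : forall (t : R) (xi : Rd), 0 <= t -> \int[P]_w sin (dotv xi (X t w)) = 0.
Variable c0 : R.
Hypothesis c00 : 0 < c0.
Local Notation h n := (c0 / n.+1%:R).
Let h0 n : 0 < h n. Proof. by rewrite divr_gt0. Qed.

Lemma trunc_sq_ge0 z : 0 <= trunc_sq z.
Proof. by rewrite le_min ler01 sqr_ge0. Qed.

Lemma trunc_sq_le1 z : trunc_sq z <= 1.
Proof. by rewrite ge_min lexx. Qed.

Lemma measurable_trunc_sq : measurable_fun setT trunc_sq.
Proof.
apply: measurable_minr => //; apply: measurable_funX; exact: measurable_enorm.
Qed.

Lemma trunc_sq_integrable : M.-integrable setT (EFin \o trunc_sq).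
Proof.
apply/integrableP; split; first by apply/measurable_EFinP; exact: measurable_trunc_sq.
by under eq_integral do rewrite /= ger0_norm ?trunc_sq_ge0//.
Qed.

(** [min(1, |z|^2)] is integrable against the Levy measure, so test functions of this class have a
    finite Levy integral and a finite mean under the process. *)
Definition dominated (f : Rd -> R) : Prop :=
  measurable_fun setT f /\ exists C, 0 <= C /\ forall z, `|f z| <= C * trunc_sq z.

Lemma dominatedD f g : dominated f -> dominated g -> dominated (fun z => f z + g z).
Proof.
move=> [mf [C [C0 fC]]] [mg [D [D0 gD]]]; split; first exact: measurable_funD.
exists (C + D); split => [|z]; first exact: addr_ge0.
by rewrite mulrDl (le_trans (ler_normD _ _))// lerD.
Qed.

Lemma dominatedZ (c : R) f : dominated f -> dominated (fun z => c * f z).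
Proof.
move=> [mf [C [C0 fC]]]; split; first exact: measurable_funM.
exists (`|c| * C); split => [|z]; first exact: mulr_ge0.
by rewrite normrM -mulrA ler_wpM2l.
Qed.

Lemma dominated_le f g : measurable_fun setT f -> dominated g -> (forall z, `|f z| <= g z) -> dominated f.
Proof.
move=> mf [_ [C [C0 gC]]] fg; split => //; exists C; split => // z.
by apply: le_trans (fg z) _; exact: le_trans (ler_norm _) (gC z).
Qed.

Lemma trunc_sqN z : trunc_sq (- z) = trunc_sq z.
Proof. by rewrite /trunc_sq enormN. Qed.

Lemma dominatedN f : dominated f -> dominated (fun z => f (- z)).
Proof.
move=> [mf [C [C0 fC]]]; split; last by exists C; split => // z; rewrite -trunc_sqN.
exact: (measurableT_comp mf (@measurable_opp_rV R d)).
Qed.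

Lemma dominated_integrable f : dominated f -> M.-integrable setT (EFin \o f).
Proof.
move=> [mf [C [C0 fC]]].
apply: (@le_integrable _ _ _ M setT measurableT _ (EFin \o (fun z => C * trunc_sq z))).
- exact/measurable_EFinP.
- by move=> z _; rewrite /= lee_fin (le_trans (fC z))// ler_norm.
- exact: integrableZl trunc_sq_integrable.
Qed.

Lemma dominated_bounded f : dominated f -> forall t, P.-integrable setT (EFin \o (fun w => f (X t w))).
Proof.
move=> [mf [C [C0 fC]]] t; apply: measurable_bounded_integrable => //.
- by rewrite (le_lt_trans (probability_le1 P measurableT))// ltry.
- exact: measurableT_comp mf (mX t).
exists C; split; first exact: num_real.
move=> K CK w _ /=; apply: le_trans (fC _) _; apply: (@le_trans _ _ (C * 1)).
  by rewrite ler_wpM2l// trunc_sq_le1.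
by rewrite mulr1 ltW.
Qed.

Definition scaled_mean n (f : Rd -> R) : R := (h n)^-1 * \int[P]_w f (X (h n) w).
Local Notation I := scaled_mean.

Let hi0 n : 0 <= (h n)^-1. Proof. by rewrite invr_ge0 ltW. Qed.

Lemma scaled_meanD n f g : dominated f -> dominated g -> I n (fun z => f z + g z) = I n f + I n g.
Proof. move=> df dg; rewrite /I -mulrDr; congr (_ * _).
exact: (RintegralD measurableT (dominated_bounded df _) (dominated_bounded dg _)). Qed.

Lemma scaled_meanZ n (c : R) f : dominated f -> I n (fun z => c * f z) = c * I n f.
Proof. move=> df; rewrite /I mulrCA; congr (_ * _).
exact: (RintegralZl _ measurableT (dominated_bounded df _)). Qed.

Lemma scaled_mean_le n f g : dominated f -> dominated g -> (forall z, f z <= g z) -> I n f <= I n g.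
Proof.
move=> df dg fg; apply: ler_wpM2l; first exact: hi0.
by apply: (le_Rintegral measurableT (dominated_bounded df _) (dominated_bounded dg _)) => w _; exact: fg.
Qed.

Lemma scaled_mean_close n f g (k : Rd -> R) : dominated f -> dominated g -> dominated k ->
  (forall z, `|f z - g z| <= k z) -> `|I n f - I n g| <= I n k.
Proof.
move=> df dg dk fgk; have h1 : I n f <= I n g + I n k.
  rewrite -scaled_meanD//; apply: scaled_mean_le => //; first exact: dominatedD.
  by move=> z; have := fgk z; rewrite ler_norml => /andP[h1 h2]; lra.
have h2 : I n g <= I n f + I n k.
  rewrite -scaled_meanD//; apply: scaled_mean_le => //; first exact: dominatedD.
  by move=> z; have := fgk z; rewrite ler_norml => /andP[h3 h4]; lra.
by rewrite ler_norml; apply/andP; split; lra.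
Qed.

(** [levy_symbol] integrates only even functions of [z], so it carries no information on the odd
    part of [M]; limits are therefore expressed through even parts. *)
Definition even_part (f : Rd -> R) z : R := (f z + f (- z)) / 2.

Lemma dominated_even f : dominated f -> dominated (even_part f).
Proof.
move=> df; rewrite (_ : even_part f = fun z => 2^-1 * (f z + f (- z))).
  by apply: dominatedZ; apply: dominatedD => //; exact: dominatedN.
by apply/funext => z; rewrite /even_part mulrC.
Qed.

Definition levy_mean (f : Rd -> R) : R := \int[M]_z even_part f z.
Local Notation J := levy_mean.

Lemma levy_meanD f g : dominated f -> dominated g -> J (fun z => f z + g z) = J f + J g.
Proof.
move=> df dg; have i f' (df' : dominated f') := dominated_integrable (dominated_even df').
apply: etrans (RintegralD measurableT (i _ df) (i _ dg)).
by apply: eq_Rintegral => z _; rewrite /even_part; lra.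
Qed.

Lemma levy_meanZ (c : R) f : dominated f -> J (fun z => c * f z) = c * J f.
Proof.
move=> df; apply: etrans (RintegralZl c measurableT (dominated_integrable (dominated_even df))).
by apply: eq_Rintegral => z _; rewrite /even_part; lra.
Qed.

Lemma levy_mean_close f g (k : Rd -> R) : dominated f -> dominated g -> dominated k ->
  (forall z, `|f z - g z| <= k z) -> `|J f - J g| <= J k.
Proof.
move=> df dg dk fgk.
have i f' : dominated f' -> M.-integrable setT (EFin \o (even_part f')).
  by move=> df'; exact/dominated_integrable/dominated_even.
have iB := integrableB measurableT (i _ df) (i _ dg).
rewrite /J -(RintegralB measurableT (i _ df) (i _ dg)).
apply: le_trans (le_normr_Rintegral measurableT iB) _.
apply: (le_Rintegral measurableT _ (i _ dk)); last first.
  move=> z _; rewrite /even_part; have := fgk z; have := fgk (- z).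
  rewrite !ler_norml => /andP[h1 h2] /andP[h3 h4].
  by apply/andP; split; lra.
exact: (integrable_norm iB).
Qed.

Definition vague_conv f : Prop := dominated f /\ I n f @[n --> \oo] --> J f.

Lemma vague_convD f g : vague_conv f -> vague_conv g -> vague_conv (fun z => f z + g z).
Proof.
move=> [df cf] [dg cg]; split; first exact: dominatedD.
by rewrite levy_meanD//; under eq_fun do rewrite scaled_meanD//; exact: cvgD.
Qed.

Lemma vague_convZ (c : R) f : vague_conv f -> vague_conv (fun z => c * f z).
Proof.
move=> [df cf]; split; first exact: dominatedZ.
rewrite levy_meanZ//; under eq_fun do rewrite scaled_meanZ//.
by apply: cvgM => //; exact: cvg_cst.
Qed.

Lemma dominated0 : dominated (fun=> 0).
Proof.
split; first exact: measurable_cst.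
by exists 0; split => // z; rewrite normr0 mul0r.
Qed.

Lemma vague_conv0 : vague_conv (fun=> 0).
Proof.
split; first exact: dominated0.
have -> : J (fun=> 0) = 0.
  rewrite /J; under eq_Rintegral do rewrite /even_part addr0 mul0r.
  by rewrite Rintegral_cst// mul0r.
rewrite (_ : (fun _ => _) = fun=> 0); first exact: cvg_cst.
by apply/funext => n; rewrite /I Rintegral_cst// mul0r mulr0.
Qed.

Lemma vague_conv_sum (T : Type) (s : seq T) (F : T -> Rd -> R) :
  (forall i, vague_conv (F i)) -> vague_conv (fun z => \sum_(i <- s) F i z).
Proof.
move=> vF; elim: s => [|i s IH].
  by rewrite (_ : (fun _ => _) = fun=> 0); [exact: vague_conv0|apply/funext => z; rewrite big_nil].
rewrite (_ : (fun _ => _) = fun z => F i z + \sum_(i <- s) F i z).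
  exact: vague_convD.
by apply/funext => z; rewrite big_cons.
Qed.

(** An error of size [e * K] is harmless when [K] belongs to the class itself: its small-time means
    converge and are therefore eventually bounded. *)
Lemma vague_conv_closure f (K : Rd -> R) : dominated f -> vague_conv K ->
  (forall e, 0 < e -> exists2 p, vague_conv p & forall z, `|f z - p z| <= e * K z) -> vague_conv f.
Proof.
move=> df [dK cK] Hf; split => //; apply/cvgrPdist_le => e e0.
pose a := `|J K| + 1.
have a0 : 0 < a by rewrite ltr_wpDl.
have e'0 : 0 < e / (3 * a) by rewrite divr_gt0// mulr_gt0.
have [p [dp cp] fp] := Hf _ e'0.
have dk : dominated (fun z => e / (3 * a) * K z) by exact: dominatedZ.
have Jfp := levy_mean_close df dp dk fp; rewrite levy_meanZ// in Jfp.
have e3 : e / (3 * a) * a = e / 3 by field; rewrite gt_eqF.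
have Ja : e / (3 * a) * J K <= e / 3.
  by rewrite -e3 ler_wpM2l ?(ltW e'0)//; have := ler_norm (J K); rewrite /a; lra.
have e30 : 0 < e / 3 by rewrite divr_gt0.
move/cvgrPdist_le : cp => /(_ _ e30) cp.
move/cvgrPdist_le : cK => /(_ _ ltr01) cK.
near=> n.
have Ifp := scaled_mean_close n df dp dk fp; rewrite scaled_meanZ// in Ifp.
have h1 : `|J p - I n p| <= e / 3 by near: n.
have h2 : `|J K - I n K| <= 1 by near: n.
have Ia : e / (3 * a) * I n K <= e / 3.
  rewrite -e3 ler_wpM2l ?(ltW e'0)//; have := ler_norm (J K); rewrite /a.
  by move: h2; rewrite ler_norml => /andP[]; lra.
move: Jfp Ifp h1; rewrite !ler_norml => /andP[? ?] /andP[? ?] /andP[? ?].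
by apply/andP; split; lra.
Unshelve. all: by end_near. Qed.

Lemma measurable_dotv (xi : Rd) : measurable_fun setT (dotv xi : Rd -> R).
Proof.
rewrite /dotv; apply: measurable_sum => i; apply: measurable_funM => //.
exact: measurable_coord.
Qed.

Lemma dominated_one_sub_cos xi : dominated (fun z => 1 - cos (dotv xi z)).
Proof.
split.
  apply: measurable_funB => //.
  apply: (measurableT_comp (f := cos)); last exact: measurable_dotv.
  by apply: continuous_measurable_fun; exact: continuous_cos.
exists (2 + enorm xi ^+ 2); split => [|z]; first by rewrite addr_ge0// sqr_ge0.
rewrite ger0_norm ?one_sub_cos_ge0// /trunc_sq; have [h1|h1] := leP 1 (enorm z ^+ 2).
  rewrite mulr1; have := cos_geN1 (dotv xi z); have := sqr_ge0 (enorm xi); lra.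
apply: le_trans (one_sub_cos_le _) _.
have : dotv xi z ^+ 2 <= enorm xi ^+ 2 * enorm z ^+ 2.
  rewrite -exprMn -(real_normK (num_real (dotv _ _))) lerXn2r// ?nnegrE ?mulr_ge0 ?enorm_ge0//.
  by rewrite ler_norml -lerNl -dotvNl -[enorm xi]enormN cauchy_schwarz enormN cauchy_schwarz.
by have := sqr_ge0 (enorm z); have := sqr_ge0 (dotv xi z); lra.
Qed.

Lemma levy_symbol_ge0 xi : 0 <= psi xi.
Proof.
rewrite addr_ge0 ?divr_ge0//; apply: Rintegral_ge0 => z _; exact: one_sub_cos_ge0.
Qed.

Lemma mean_one_sub_cos t xi : 0 <= t ->
  \int[P]_w (1 - cos (dotv xi (X t w))) = 1 - expR (- (t * psi xi)).
Proof.
move=> t0; rewrite -(Ecos xi t0).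
have ic : P.-integrable setT (EFin \o (fun w => cos (dotv xi (X t w)))).
  have [m _] := dominated_one_sub_cos xi.
  apply: measurable_bounded_integrable => //.
  - by rewrite (le_lt_trans (probability_le1 P measurableT))// ltry.
  - apply: (measurableT_comp (f := cos)).
      by apply: continuous_measurable_fun; exact: continuous_cos.
    exact: (measurableT_comp (measurable_dotv xi) (mX t)).
  exists 1; split; first exact: num_real.
  by move=> K K1 w _ /=; apply: le_trans (cos_max _) _; exact: ltW.
have i1 : P.-integrable setT (EFin \o cst 1).
  apply: measurable_bounded_integrable; [by []| |exact: measurable_cst|exact: bounded_cst].
  by rewrite (le_lt_trans (probability_le1 P measurableT))// ltry.
apply: (etrans (RintegralB measurableT i1 ic)).
congr (_ - _); rewrite Rintegral_cst// mul1r.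
by rewrite [X in fine X](_ : _ = 1%E)//; exact: probability_setT.
Qed.

Lemma cvg_one_sub_cos xi : I n (fun z => 1 - cos (dotv xi z)) @[n --> \oo] --> psi xi.
Proof.
have a0 := levy_symbol_ge0 xi; set a := psi xi in a0 *.
apply: (@squeeze_cvgr _ _ _ _ (fun n : nat => a - a ^+ 2 * h n) (fun=> a)).
- apply: nearW => n; rewrite /I mean_one_sub_cos ?(ltW (h0 n))// -/a.
  have /one_sub_expR /andP[l1 l2] : 0 <= h n * a by rewrite mulr_ge0// ltW.
  rewrite [(h n)^-1 * _]mulrC ler_pdivlMr// ler_pdivrMr// [a * h n]mulrC l2 andbT.
  by apply: le_trans l1; rewrite le_eqVlt; apply/orP; left; apply/eqP; ring.
- rewrite -[X in _ --> X]subr0 -(mulr0 (a ^+ 2)); apply: cvgB; first exact: cvg_cst.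
  apply: cvgM; [exact: cvg_cst|rewrite -(mulr0 c0)].
  by apply: cvgM; [exact: cvg_cst|exact: cvg_harmonic].
- exact: cvg_cst.
Qed.

Definition Bq (xi : Rd) : R := dotv (xi *m A) xi.

Lemma parallelogram x y : Bq (x + y) + Bq (x - y) = 2 * Bq x + 2 * Bq y.
Proof.
rewrite /Bq mulmxDl mulmxBl !(dotvDl, dotvNl, dotvDr, dotvNr); ring.
Qed.

(** The coefficients of a product of two symmetric second differences in the directions [a] and [b],
    at frequency [g]. On cosines they produce the two factors [1 - cos]; a quadratic form is
    annihilated by them, by the parallelogram law, and this removes the Gaussian part. *)
Let nine (a b g : Rd) : seq (R * Rd) :=
  [:: (- 1, g); (1/2, g + a); (1/2, g - a); (1/2, g + b); (1/2, g - b);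
      (- (1/4), g + a + b); (- (1/4), g + a - b); (- (1/4), g - a + b); (- (1/4), g - a - b)].

Let sumD (s : seq (R * Rd)) z := \sum_(p <- s) p.1 * (1 - cos (dotv p.2 z)).
Let sumS (s : seq (R * Rd)) z := \sum_(p <- s) (- p.1) * sin (dotv p.2 z).

Let nineD (a b g z : Rd) : sumD (nine a b g) z =
  (1 - cos (dotv a z)) * (1 - cos (dotv b z)) * cos (dotv g z).
Proof.
rewrite /sumD /nine !big_cons big_nil /= !(dotvDl, dotvNl).
by rewrite !(cosD, sinD, cosN, sinN); field.
Qed.

Let nineS (a b g z : Rd) : sumS (nine a b g) z =
  (1 - cos (dotv a z)) * (1 - cos (dotv b z)) * sin (dotv g z).
Proof.
rewrite /sumS /nine !big_cons big_nil /= !(dotvDl, dotvNl).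
by rewrite !(cosD, sinD, cosN, sinN); field.
Qed.

Let nineB (a b g : Rd) : \sum_(p <- nine a b g) p.1 * Bq p.2 = 0.
Proof.
rewrite /nine !big_cons big_nil /=.
have h1 := parallelogram g a; have h2 := parallelogram g b.
by have h3 := parallelogram (g + a) b; have h4 := parallelogram (g - a) b; lra.
Qed.

Let dom_sumD s : dominated (sumD s).
Proof.
elim: s => [|p s IH].
  by rewrite (_ : sumD _ = fun=> 0); [exact: dominated0|apply/funext => z; rewrite /sumD big_nil].
rewrite (_ : sumD _ = fun z => p.1 * (1 - cos (dotv p.2 z)) + sumD s z).
  by apply: dominatedD => //; apply: dominatedZ; exact: dominated_one_sub_cos.
by apply/funext => z; rewrite /sumD big_cons.
Qed.

Let cvg_sumD s : I n (sumD s) @[n --> \oo] -->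
  (\sum_(p <- s) p.1 * Bq p.2) / 2 + \int[M]_z sumD s z.
Proof.
elim: s => [|p s IH].
  rewrite big_nil mul0r add0r (_ : sumD [::] = fun=> 0); last by apply/funext => z; rewrite /sumD big_nil.
  rewrite Rintegral_cst// mul0r (_ : (fun _ => _) = fun=> 0); first exact: cvg_cst.
  by apply/funext => n; rewrite /I Rintegral_cst// mul0r mulr0.
have dp : dominated (fun z => p.1 * (1 - cos (dotv p.2 z))).
  by apply: dominatedZ; exact: dominated_one_sub_cos.
rewrite (_ : sumD _ = fun z => p.1 * (1 - cos (dotv p.2 z)) + sumD s z); last first.
  by apply/funext => z; rewrite /sumD big_cons.
rewrite (RintegralD measurableT (dominated_integrable dp) (dominated_integrable (dom_sumD s))).
rewrite (RintegralZl _ measurableT (dominated_integrable (dominated_one_sub_cos _))).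
under eq_fun do rewrite (scaled_meanD _ dp (dom_sumD s)) (scaled_meanZ _ _ (dominated_one_sub_cos _)).
rewrite big_cons mulrDl addrACA; apply: cvgD => //.
rewrite -mulrA -mulrDr; apply: cvgM; first exact: cvg_cst.
exact: cvg_one_sub_cos.
Qed.

Let mean_sumS s n : \int[P]_w sumS s (X (h n) w) = 0.
Proof.
have ib f : measurable_fun setT f -> (exists K, forall z, `|f z| <= K) ->
    P.-integrable setT (EFin \o (fun w => f (X (h n) w))).
  move=> mf [K fK]; apply: measurable_bounded_integrable => //.
  - by rewrite (le_lt_trans (probability_le1 P measurableT))// ltry.
  - exact: measurableT_comp mf (mX _).
  by exists K; split; [exact: num_real|move=> L KL w _; exact: le_trans (fK _) (ltW KL)].
have ms xi : measurable_fun setT (fun z : Rd => sin (dotv xi z)).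
  apply: (measurableT_comp (f := sin)); last exact: measurable_dotv.
  by apply: continuous_measurable_fun; exact: continuous_sin.
have H : measurable_fun setT (sumS s) /\ exists K, forall z, `|sumS s z| <= K.
  elim: s => [|p s [ms' [K IH]]].
    rewrite (_ : sumS _ = fun=> 0); last by apply/funext => z; rewrite /sumS big_nil.
    by split; [exact: measurable_cst|exists 0 => z; rewrite normr0].
  rewrite (_ : sumS _ = fun z => - p.1 * sin (dotv p.2 z) + sumS s z); last first.
    by apply/funext => z; rewrite /sumS big_cons.
  split; first by apply: measurable_funD => //; exact: measurable_funM.
  exists (`|p.1| + K) => z; apply: (le_trans (ler_normD _ _)); apply: lerD => //.
  by rewrite normrM normrN ler_piMr// sin_max.
move: H; elim: s => [|p s IH] _.
  under eq_Rintegral do rewrite /sumS big_nil.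
  by rewrite Rintegral_cst// mul0r.
under eq_Rintegral do rewrite /sumS big_cons.
have Hs : measurable_fun setT (sumS s) /\ exists K, forall z, `|sumS s z| <= K.
  elim: s {IH} => [|q s [ms' [K IH]]].
    rewrite (_ : sumS _ = fun=> 0); last by apply/funext => z; rewrite /sumS big_nil.
    by split; [exact: measurable_cst|exists 0 => z; rewrite normr0].
  rewrite (_ : sumS _ = fun z => - q.1 * sin (dotv q.2 z) + sumS s z); last first.
    by apply/funext => z; rewrite /sumS big_cons.
  split; first by apply: measurable_funD => //; exact: measurable_funM.
  exists (`|q.1| + K) => z; apply: (le_trans (ler_normD _ _)); apply: lerD => //.
  by rewrite normrM normrN ler_piMr// sin_max.
have i1 : P.-integrable setT (EFin \o (fun w => - p.1 * sin (dotv p.2 (X (h n) w)))).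
  apply: (ib (fun z => - p.1 * sin (dotv p.2 z))); first exact: measurable_funM.
  by exists `|p.1| => z; rewrite normrM normrN ler_piMr// sin_max.
rewrite (RintegralD measurableT i1 (ib (sumS s) Hs.1 Hs.2)) (IH Hs) addr0.
have i2 : P.-integrable setT (EFin \o (fun w => sin (dotv p.2 (X (h n) w)))).
  by apply: (ib (fun z => sin (dotv p.2 z))) => //; exists 1 => z; exact: sin_max.
by rewrite (RintegralZl _ measurableT i2) Esin ?mulr0// ltW.
Qed.

(** The cosine part is a combination of functions [1 - cos], whose means converge to the exponent,
    without Gaussian contribution. The sine part is odd and both its means and its limit are 0. The
    phase [th] mixes the two. *)
Lemma vague_conv3 (a b g : Rd) (th : R) :
  vague_conv (fun z => (1 - cos (dotv a z)) * (1 - cos (dotv b z)) * cos (dotv g z + th)).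
Proof.
pose E z := (1 - cos (dotv a z)) * (1 - cos (dotv b z)) * cos (dotv g z).
pose O z := (1 - cos (dotv a z)) * (1 - cos (dotv b z)) * sin (dotv g z).
have EE : E = sumD (nine a b g) by apply/funext => z; rewrite nineD.
have OE : O = sumS (nine a b g) by apply/funext => z; rewrite nineS.
have dE : dominated E by rewrite EE.
have mc f : measurable_fun setT f -> measurable_fun setT (fun z : Rd => cos (f z)).
  by move=> mf; apply: (measurableT_comp (f := cos)) mf; apply: continuous_measurable_fun; exact: continuous_cos.
have ms f : measurable_fun setT f -> measurable_fun setT (fun z : Rd => sin (f z)).
  by move=> mf; apply: (measurableT_comp (f := sin)) mf; apply: continuous_measurable_fun; exact: continuous_sin.
have dO : dominated O.
  apply: (@dominated_le _ (fun z => 2 * (1 - cos (dotv a z)))).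
  - apply: measurable_funM; last by apply: ms; exact: measurable_dotv.
    by apply: measurable_funM; apply: measurable_funB => //; apply: mc; exact: measurable_dotv.
  - by apply: dominatedZ; exact: dominated_one_sub_cos.
  move=> z; rewrite /O !normrM !(ger0_norm (one_sub_cos_ge0 _)).
  have h1 := one_sub_cos_ge0 (dotv a z); have h2 := one_sub_cos_ge0 (dotv b z).
  have h3 := cos_geN1 (dotv b z); have h4 := sin_max (dotv g z).
  rewrite [leRHS]mulrC -mulrA ler_wpM2l// -[leRHS]mulr1.
  by apply: ler_pM => //; lra.
have vE : vague_conv E.
  split => //; have := @cvg_sumD (nine a b g); rewrite nineB mul0r add0r -EE.
  suff -> : \int[M]_z E z = J E by [].
  apply: eq_Rintegral => z _; rewrite /even_part /E.
  have dN x : dotv x (- z) = - dotv x z.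
    by rewrite /dotv -sumrN; apply: eq_bigr => i _; rewrite mxE mulrN.
  by rewrite !dN !cosN; lra.
have vO : vague_conv O.
  split => //; rewrite (_ : (fun _ => _) = fun=> 0); last first.
    by apply/funext => n; rewrite /I OE mean_sumS mulr0.
  have -> : J O = 0.
    rewrite /J; under eq_Rintegral => z _.
      have dN x : dotv x (- z) = - dotv x z.
        by rewrite /dotv -sumrN; apply: eq_bigr => i _; rewrite mxE mulrN.
      rewrite /even_part /O !dN !cosN sinN mulrN subrr mul0r; over.
    by rewrite Rintegral_cst// mul0r.
  exact: cvg_cst.
rewrite (_ : (fun _ => _) = fun z => cos th * E z + (- sin th) * O z).
  by apply: vague_convD; exact: vague_convZ.
by apply/funext => z; rewrite /E /O cosD; ring.
Qed.

Definition tail (L : R) (z : Rd) : R := (L <= enorm z)%R%:R.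

Lemma dominated_tail L : 0 < L -> dominated (tail L).
Proof.
move=> L0; split.
  rewrite (_ : tail L = \1_[set z | L <= enorm z]).
    apply: measurable_indic; rewrite -[X in measurable X]setTI.
    by apply: measurable_fun_ler => //; exact: measurable_enorm.
  by apply/funext => z; rewrite indicE /tail; congr (_%:R); congr nat_of_bool; apply/idP/idP; rewrite inE.
exists (1 + (L ^+ 2)^-1); split => [|z].
  by rewrite addr_ge0// invr_ge0 sqr_ge0.
rewrite /tail; have [Lz|_] := leP L (enorm z); last first.
  by rewrite normr0 mulr_ge0 ?trunc_sq_ge0// addr_ge0// invr_ge0 sqr_ge0.
rewrite normr1 mulrDl mul1r /trunc_sq; have [h1|h1] := leP 1 (enorm z ^+ 2).
  by rewrite lerDl mulr1 invr_ge0 sqr_ge0.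
have : 1 <= (L ^+ 2)^-1 * enorm z ^+ 2.
  rewrite mulrC ler_pdivlMr ?exprn_gt0// mul1r lerXn2r// ?nnegrE ?enorm_ge0// ltW//.
by have := sqr_ge0 (enorm z); lra.
Qed.

(** A bound for the exponent on the whole segment of frequencies [u * dl] in direction [i],
    [0 <= u <= 1], that becomes small at low frequencies. *)
Definition freq_bound (i : 'I_d) (dl : R) : R :=
  dl ^+ 2 * Bq (delta_mx ord0 i) / 2 + \int[M]_z Num.min 2 (dl ^+ 2 * enorm z ^+ 2 / 2).

Lemma dominated_min (dl : R) : dominated (fun z => Num.min 2 (dl ^+ 2 * enorm z ^+ 2 / 2)).
Proof.
have e0 (z : Rd) := sqr_ge0 (enorm z); have d0 := sqr_ge0 dl.
split.
  apply: measurable_minr => //; apply: measurable_funM => //; apply: measurable_funM => //.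
  by apply: measurable_funX; exact: measurable_enorm.
exists (2 + dl ^+ 2); split => [|z]; first by lra.
have p0 := mulr_ge0 d0 (e0 z).
rewrite ger0_norm; last by rewrite le_min; apply/andP; split; lra.
rewrite ge_min /trunc_sq; have [h1|h1] := leP 1 (enorm z ^+ 2).
  by rewrite mulr1; apply/orP; left; lra.
by apply/orP; right; rewrite mulrDl; have := e0 z; lra.
Qed.

Lemma dotv_delta (c : R) i z : dotv (c *: delta_mx ord0 i) z = c * z ord0 i.
Proof.
rewrite dotvZl /dotv (bigD1 i)//= big1 ?addr0 ?mxE ?eqxx ?mul1r// => j ji.
by rewrite mxE (negbTE ji) andbF mul0r.
Qed.

Lemma levy_symbol_freq i (dl u : R) : 0 <= u <= 1 ->
  psi ((u * dl) *: delta_mx ord0 i) <= freq_bound i dl.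
Proof.
move=> /andP[u0 u1].
have uu : (u * dl) ^+ 2 <= dl ^+ 2.
  by rewrite exprMn ler_piMl ?sqr_ge0// expr_le1.
rewrite /levy_symbol /freq_bound; apply: lerD.
  rewrite ler_pM2r ?invr_gt0// -scalemxAl dotvZl dotvZr mulrA -expr2.
  by rewrite ler_wpM2r.
apply: le_Rintegral => //.
- exact/dominated_integrable/dominated_one_sub_cos.
- exact/dominated_integrable/dominated_min.
move=> z _; rewrite le_min dotv_delta; apply/andP; split.
  by have := cos_geN1 (u * dl * z ord0 i); lra.
apply: le_trans (one_sub_cos_le _) _; rewrite ler_pM2r ?invr_gt0// exprMn.
apply: ler_pM; rewrite ?sqr_ge0//.
rewrite -(real_normK (num_real (z _ _))) lerXn2r// ?nnegrE ?enorm_ge0//.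
exact: coord_le_enorm.
Qed.

Definition coord_tail (i : 'I_d) (dl : R) (z : Rd) : R := (2 <= `|dl * z ord0 i|)%R%:R.

Lemma measurable_coord_tail i dl : measurable_fun setT (coord_tail i dl).
Proof.
rewrite (_ : coord_tail i dl = \1_[set z | 2 <= `|dl * z ord0 i|]).
  apply: measurable_indic; rewrite -[X in measurable X]setTI.
  apply: measurable_fun_ler => //; apply: (measurableT_comp (@normr_measurable R setT)).
  by apply: measurable_funM => //; exact: measurable_coord.
by apply/funext => z; rewrite indicE /coord_tail; congr (_%:R); congr nat_of_bool; apply/idP/idP; rewrite inE.
Qed.

Lemma dominated_coord_tail i dl : 0 < dl -> dominated (coord_tail i dl).
Proof.
move=> dl0; apply: (@dominated_le _ (tail (2 / dl))).
- exact: measurable_coord_tail.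
- by apply: dominated_tail; rewrite divr_gt0.
move=> z; rewrite /coord_tail /tail; case: (leP 2 `|dl * z ord0 i|) => [h1|_]; last by rewrite normr0 ler0n.
rewrite normr1 ler_pdivrMr//; suff -> : 2 <= enorm z * dl by [].
apply: le_trans h1 _; rewrite normrM (gtr0_norm dl0) mulrC ler_pM2r//.
exact: coord_le_enorm.
Qed.

(** The truncation inequality for characteristic functions: [avg_cos] on the event, exchange of the
    integrals, then [1 - exp(-h psi) <= h psi]. *)
Lemma coord_tail_le i dl n : 0 < dl -> I n (coord_tail i dl) <= 2 * freq_bound i dl.
Proof.
move=> dl0; have dt := dominated_coord_tail i dl0.
rewrite /I mulrC ler_pdivrMr//.
have i1 := dominated_bounded dt (h n).
have mXi : measurable_fun setT (fun w => X (h n) w ord0 i).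
  exact: (measurableT_comp (measurable_coord ord0 i) (mX _)).
rewrite -lee_fin fineK; last exact: integrable_fin_num.
have -> : (2 * freq_bound i dl * h n)%:E = (2%:E * (freq_bound i dl * h n)%:E)%E :> \bar R.
  by rewrite -mulrA EFinM.
have mc : measurable_fun setT (fun tw : measurableTypeR R * Omega => (1 - cos (tw.1 * (dl * X (h n) tw.2 ord0 i)))%:E).
  apply/measurable_EFinP; apply: measurable_funB => //.
  apply: (measurableT_comp (f := cos)); first by apply: continuous_measurable_fun; exact: continuous_cos.
  apply: measurable_funM; first exact: measurable_fst.
  apply: measurable_funM => //; exact: (measurableT_comp mXi measurable_snd).
have c_ge0 tw : (0 <= (1 - cos (tw.1 * (dl * X (h n) tw.2 ord0 i)))%:E)%E.
  by rewrite lee_fin one_sub_cos_ge0.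
apply: (@le_trans _ _ (2%:E * \int[P]_w \int[@lebesgue_measure R]_(u in `[0%R, 1%R])
    (1 - cos (u * (dl * X (h n) w ord0 i)))%:E)%E).
  rewrite -ge0_integralZl//; last 2 first.
  - exact: (measurableT_comp (measurable_integral0 mc c_ge0) (pair1_measurable (1 : measurableTypeR R))).
  - by move=> w _; apply: integral_ge0 => u _; exact: (c_ge0 (u, w)).
  apply: ge0_le_integralP => w _; first by rewrite lee_fin ler0n.
  rewrite /coord_tail; case: (leP 2 `|dl * X (h n) w ord0 i|) => h1; last first.
    by rewrite mule_ge0//; apply: integral_ge0 => u _; exact: (c_ge0 (u, w)).
  have /(lee_wpmul2l (_ : (0 <= 2%:E :> \bar R)%E)) := avg_cos h1.
  by rewrite -EFinM mulrC divfK// => ->.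
apply: lee_wpmul2l; first by rewrite lee_fin.
rewrite (integral_swap P 1 (G := fun tw => (1 - cos (tw.1 * (dl * X (h n) tw.2 ord0 i)))%:E))//.
apply: (@le_trans _ _ (\int[@lebesgue_measure R]_(u in `[0%R, 1%R]) (freq_bound i dl * h n)%:E)%E).
  apply: ge0_le_integralP => u /=; first by move=> _; apply: integral_ge0 => w _; exact: (c_ge0 (u, w)).
  rewrite in_itv/= => u01.
  under eq_integral do rewrite mulrA -dotv_delta.
  have dc := dominated_bounded (dominated_one_sub_cos ((u * dl) *: delta_mx ord0 i)) (h n).
  rewrite -(fineK (integrable_fin_num measurableT dc)) lee_fin.
  rewrite -[leLHS]/(\int[P]_w (1 - cos (dotv ((u * dl) *: delta_mx ord0 i) (X (h n) w)))).
  rewrite mean_one_sub_cos ?(ltW (h0 n))//.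
  have /one_sub_expR /andP[_] : 0 <= h n * psi ((u * dl) *: delta_mx ord0 i).
    by rewrite mulr_ge0 ?levy_symbol_ge0 ?(ltW (h0 n)).
  move=> l2; apply: le_trans l2 _.
  by rewrite mulrC ler_pM2r// levy_symbol_freq.
by rewrite integral_cst//= lebesgue_itvcc// subr0 mule1.
Qed.

Lemma cvg_freq_bound i : freq_bound i k.+1%:R^-1 @[k --> \oo] --> 0.
Proof.
rewrite -[X in _ --> X]addr0; have c1 : (k.+1%:R^-1 : R) ^+ 2 @[k --> \oo] --> (0 : R).
  by have := cvgM (@cvg_harmonic R) (@cvg_harmonic R); rewrite mulr0; exact.
apply: cvgD.
  rewrite -[X in _ --> X](mul0r (2^-1)); apply: cvgM; last exact: cvg_cst.
  rewrite -[X in _ --> X](mul0r (Bq (delta_mx ord0 i))); apply: cvgM => //; exact: cvg_cst.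
have dm := dominated_min 1.
have [] := @dominated_convergence _ _ _ M setT measurableT
   (fun k z => (Num.min 2 (k.+1%:R^-1 ^+ 2 * enorm z ^+ 2 / 2))%:E) (cst 0%E)
   (fun z => (Num.min 2 (1 ^+ 2 * enorm z ^+ 2 / 2))%:E) _ _ _ _ _ => //.
- by move=> k; apply/measurable_EFinP; have [] := dominated_min k.+1%:R^-1.
- apply: aeW => z _; apply: cvg_EFin; first exact: nearW.
  apply: (@squeeze_cvgr _ _ _ _ (fun=> 0) (fun k : nat => k.+1%:R^-1 ^+ 2 * (enorm z ^+ 2 / 2))).
  + apply: nearW => k; rewrite /comp /=.
    have p : 0 <= k.+1%:R^-1 ^+ 2 * enorm z ^+ 2 / 2 :> R.
      by rewrite divr_ge0// mulr_ge0 ?sqr_ge0.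
    apply/andP; split; first by rewrite le_min p ler0n.
    by rewrite ge_min; apply/orP; right; rewrite [leRHS]mulrA lexx.
  + exact: cvg_cst.
  + rewrite -[X in _ --> X](mul0r (enorm z ^+ 2 / 2)); apply: cvgM => //; exact: cvg_cst.
- exact: dominated_integrable dm.
- apply: aeW => z k _; rewrite gee0_abs; last first.
    by rewrite lee_fin le_min ler0n/= divr_ge0// mulr_ge0 ?sqr_ge0.
  rewrite lee_fin le_min !ge_min lexx /=; apply/orP; right.
  rewrite ler_pM2r ?invr_gt0// ler_wpM2r ?sqr_ge0// lerXn2r ?nnegrE ?invr_ge0//.
  by rewrite invf_le1// ler1n.
move=> _ _; rewrite integral0 => /fine_cvgP[_]; exact.
Qed.

(** If every [dl * |z_i|] were below 2, summation over the coordinates would give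
    [dl * |z| < 2 d]. *)
Lemma tail_le_coord L dl z : 0 < dl -> L * dl >= 2 * d%:R -> 0 < L ->
  tail L z <= \sum_i coord_tail i dl z.
Proof.
move=> dl0 Ld L0; have c_ge0 i : 0 <= coord_tail i dl z by exact: ler0n.
rewrite /tail; case: (leP L (enorm z)) => [Lz|_]; last exact: sumr_ge0.
have [i hi] : exists i, 2 <= `|dl * z ord0 i|.
  apply/not_existsP => H.
  have : enorm z * dl < 2 * d%:R.
    have d0 : (0 < d)%N.
      case: (posnP d) => // dz; have : enorm z <= \sum_(i < d) `|z ord0 i| by exact: enorm_le_sum.
      rewrite big1; first by move=> /(le_trans Lz); rewrite leNgt L0.
      by move=> [m mi]; exfalso; rewrite dz in mi.
    apply: le_lt_trans (ler_wpM2r (ltW dl0) (enorm_le_sum z)) _.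
    rewrite mulr_suml (_ : 2 * d%:R = \sum_(i < d) 2); last by rewrite sumr_const card_ord mulr_natr.
    apply: ltr_sum; last first.
      by move=> i _; have /negP := H i; rewrite -ltNge normrM (gtr0_norm dl0) mulrC.
    by apply/hasP; exists (Ordinal d0); rewrite ?mem_index_enum.
  by rewrite ltNge (le_trans Ld)// ler_wpM2r// ltW.
by rewrite (bigD1 i)//= /coord_tail hi lerDl sumr_ge0.
Qed.

Lemma tail_mean_le L dl n : 0 < dl -> L * dl >= 2 * d%:R -> 0 < L ->
  I n (tail L) <= \sum_i 2 * freq_bound i dl.
Proof.
move=> dl0 Ld L0.
have H (s : seq 'I_d) : dominated (fun z => \sum_(i <- s) coord_tail i dl z) /\
    I n (fun z => \sum_(i <- s) coord_tail i dl z) <= \sum_(i <- s) 2 * freq_bound i dl.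
  elim: s => [|i s [ds Is]].
    rewrite (_ : (fun _ => _) = fun=> 0); last by apply/funext => z; rewrite big_nil.
    split; first exact: dominated0.
    by rewrite big_nil /I Rintegral_cst// mul0r mulr0.
  have dt := dominated_coord_tail i dl0.
  rewrite (_ : (fun _ => _) = fun z => coord_tail i dl z + \sum_(i <- s) coord_tail i dl z); last first.
    by apply/funext => z; rewrite big_cons.
  split; first exact: dominatedD.
  by rewrite scaled_meanD// big_cons lerD//; exact: coord_tail_le.
have [ds Is] := H (index_enum 'I_d).
apply: le_trans Is; apply: scaled_mean_le => //; first exact: dominated_tail.
by move=> z; exact: tail_le_coord.
Qed.

Lemma tail_mean_bounded L : 0 < L -> exists C, forall n, I n (tail L) <= C.
Proof.
move=> L0; pose dl := 2 * (d%:R + 1) / L.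
exists (\sum_i 2 * freq_bound i dl) => n; apply: tail_mean_le => //.
  by rewrite divr_gt0// mulr_gt0// ltr_wpDl.
by rewrite [L * dl]mulrC /dl divfK ?gt_eqF//; lra.
Qed.

Lemma levy_mean_tail_le L L' : 0 < L -> L <= L' -> J (tail L') <= J (tail L).
Proof.
move=> L0 LL; have L'0 := lt_le_trans L0 LL.
have i f' (df' : dominated f') := dominated_integrable (dominated_even df').
apply: (le_Rintegral measurableT (i _ (dominated_tail L'0)) (i _ (dominated_tail L0))) => z _.
rewrite /even_part /tail enormN; case: (leP L' (enorm z)) => h1.
  by rewrite (le_trans LL h1).
by rewrite /= addr0 mul0r divr_ge0// addr_ge0.
Qed.

Lemma cvg_levy_mean_tail : J (tail k.+1%:R) @[k --> \oo] --> 0.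
Proof.
have d1 : dominated (tail 1) by exact: dominated_tail.
have dk k : dominated (tail k.+1%:R) by exact: dominated_tail.
have [] := @dominated_convergence _ _ _ M setT measurableT
   (fun k z => (even_part (tail k.+1%:R) z)%:E) (cst 0%E)
   (fun z => (even_part (tail 1) z)%:E) _ _ _ _ _ => //.
- by move=> k; apply/measurable_EFinP; have [] := dominated_even (dk k).
- apply: aeW => z _; apply: cvg_near_cst; near=> k.
  rewrite /even_part /tail enormN leNgt (_ : (enorm z < k.+1%:R) = true).
    by rewrite /= addr0 mul0r.
  near: k; exists (Num.truncn (enorm z)) => // k /= zk.
  by apply: lt_le_trans (truncnS_gt _) _; rewrite ler_nat.
- exact: dominated_integrable (dominated_even d1).
- apply: aeW => z k _; rewrite gee0_abs; last first.
    by rewrite lee_fin /even_part /tail divr_ge0// addr_ge0.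
  rewrite lee_fin /even_part /tail enormN; case: (leP k.+1%:R (enorm z)) => h1.
    by rewrite (le_trans _ h1)// ler1n.
  by rewrite /= addr0 mul0r divr_ge0// addr_ge0.
by move=> _ _; rewrite integral0 => /fine_cvgP[_]; exact.
Unshelve. all: by end_near. Qed.

(** Tightness: the bound of [tail_mean_le] is uniform in [n] and small at low frequencies, at the
    price of a large [L]. *)
Lemma tail_small e : 0 < e -> exists L, [/\ 0 < L, forall n, I n (tail L) <= e & J (tail L) <= e].
Proof.
move=> e0.
have c1 : \sum_(i < d) 2 * freq_bound i k.+1%:R^-1 @[k --> \oo] --> 0.
  have e00 : \sum_(i < d) 2 * (0 : R) = 0 by rewrite big1// => i _; rewrite mulr0.
  rewrite -[X in _ --> X]e00.
  apply: (cvg_sumr (F := \oo)) => i; apply: cvgM; [exact: cvg_cst|exact: cvg_freq_bound].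
move/cvgrPdist_le : c1 => /(_ e e0) [k _ /(_ k (leqnn k))].
rewrite sub0r normrN => /(le_trans (ler_norm _)) Hk.
have /cvgrPdist_le /(_ e e0) [m _ /(_ m (leqnn m))] := cvg_levy_mean_tail.
rewrite sub0r normrN => /(le_trans (ler_norm _)) Hm.
exists (Num.max m.+1%:R ((2 * d%:R + 1) * k.+1%:R)).
have L0 : 0 < Num.max m.+1%:R ((2 * d%:R + 1) * k.+1%:R) :> R by rewrite lt_max ltr0n.
split => // [n|]; last by apply: le_trans Hm; apply: levy_mean_tail_le => //; rewrite le_max lexx.
apply: le_trans Hk; apply: tail_mean_le => //.
rewrite ler_pdivlMr//; apply: (@le_trans _ _ ((2 * d%:R + 1) * k.+1%:R)).
  by rewrite ler_pM2r//; lra.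
by rewrite le_max lexx orbT.
Qed.

End levy_khintchine.

(** * Bernstein means and their variance *)

Section bernstein.
Variable R : realType.
Implicit Types (x c : R) (f g : nat -> R).

(* The Bernstein mean of [f] at [x], i.e. [E f(S_N)] for a binomial [S_N]. *)
Fixpoint bern (N : nat) x f : R :=
  if N is N'.+1 then (1 - x) * bern N' x f + x * bern N' x (fun k => f k.+1) else f 0%N.

Lemma bernD N x f g : bern N x (fun k => f k + g k) = bern N x f + bern N x g.
Proof. by elim: N f g => //= N IH f g; rewrite !IH; ring. Qed.

Lemma bernZ N x c f : bern N x (fun k => c * f k) = c * bern N x f.
Proof. by elim: N f => //= N IH f; rewrite !IH; ring. Qed.

Lemma bern_cst N x c : bern N x (fun=> c) = c.
Proof. by elim: N => //= N ->; ring. Qed.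

Lemma bern_le N x f g : 0 <= x <= 1 -> (forall k, (k <= N)%N -> f k <= g k) ->
  bern N x f <= bern N x g.
Proof.
move=> /andP[x0 x1]; elim: N f g => [|N IH] f g fg /=; first exact: fg.
by apply: lerD; rewrite ler_wpM2l ?subr_ge0// IH// => k kN; apply: fg => //; exact: leqW.
Qed.

Lemma bern_norm N x f : 0 <= x <= 1 -> `|bern N x f| <= bern N x (fun k => `|f k|).
Proof.
move=> x01; rewrite ler_norml -[X in X <= _ <= _]mulN1r -bernZ.
by rewrite !bern_le// => k _; rewrite ?mulN1r ?ler_norm// lerNl -normrN ler_norm.
Qed.

(** The recursion splits off one Bernoulli trial, whose success moves the centre from [c] to
    [c - 1]; a general [c] keeps the induction closed. *)
Lemma bern_var N x c :
  bern N x (fun k => (k%:R - c) ^+ 2) = N%:R * x * (1 - x) + (N%:R * x - c) ^+ 2.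
Proof.
elim: N c => [|N IH] c /=; first by ring.
rewrite IH (_ : (fun k => (k.+1%:R - c) ^+ 2) = (fun k => (k%:R - (c - 1)) ^+ 2)); last first.
  by apply/funext => k; rewrite -natr1; congr (_ ^+ 2); ring.
by rewrite IH -natr1; ring.
Qed.

(** The nodes [2k/N - 1] subdivide [[-1, 1]]; their binomial variance is [4x(1 - x)/N]. *)
Lemma bern_grid N x : 0 <= x <= 1 -> (0 < N)%N ->
  bern N x (fun k => (2 * k%:R / N%:R - 1 - (2 * x - 1)) ^+ 2) <= N%:R^-1.
Proof.
move=> /andP[x0 x1] N0; have N0' : N%:R != 0 :> R by rewrite pnatr_eq0 -lt0n.
rewrite (_ : (fun k => _) = fun k => (2 / N%:R) ^+ 2 * (k%:R - N%:R * x) ^+ 2); last first.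
  by apply/funext => k; field.
rewrite bernZ bern_var subrr expr0n/= addr0.
have -> : (2 / N%:R) ^+ 2 * (N%:R * x * (1 - x)) = N%:R^-1 * (4 * x * (1 - x)) by field.
rewrite ler_piMr ?invr_ge0//; have := sqr_ge0 (2 * x - 1); lra.
Qed.

End bernstein.

Section heine.
Context (R : realType) (d : nat).
Local Notation Rd := 'rV[R]_d.

(** Only [v] is confined to the box: the near-covering form of compactness yields one [dl] valid for
    every [v] in it and every [w] nearby, inside or outside. *)
Lemma uniform_continuity_box (g : Rd -> R) (K e : R) : continuous g -> 0 < e ->
  exists2 dl, 0 < dl & forall v w : Rd, (forall i, `|v ord0 i| <= K) ->
    (forall i, `|w ord0 i - v ord0 i| < dl) -> `|g w - g v| <= e.
Proof.
move=> cg e0.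
have cK : compact [set v : Rd | forall i, `[- K, K]%classic (v ord0 i)].
  exact: (@rV_compact _ d (fun=> `[- K, K]%classic) (fun i => @segment_compact R (- K) K)).
move/compact_near_coveringP : cK.
move=> /(_ R (0^'+) (fun dl v => forall w : Rd,
   (forall i, `|w ord0 i - v ord0 i| < dl) -> `|g w - g v| <= e) _).
have near_cover : forall x : Rd, [set v : Rd | forall i, `[- K, K]%classic (v ord0 i)] x ->
    \forall x' \near x & dl \near 0^'+, forall w : Rd,
    (forall i, `|w ord0 i - (x' : Rd) ord0 i| < dl) -> `|g w - g (x' : Rd)| <= e.
  move=> x _.
  have /cvgrPdist_le /(_ (e / 2)) := cg x; rewrite divr_gt0// => /(_ isT).
  move=> /nbhs_ballP[eta /= eta0 H].
  exists (ball x (eta / 2), [set dl : R | 0 < dl < eta / 2]) => /=.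
    split; first by apply: nbhsx_ballx; rewrite divr_gt0.
    near=> dl; apply/andP; split; first by near: dl; exact: nbhs_right_gt.
    by near: dl; apply: nbhs_right_lt; rewrite divr_gt0.
  move=> [x' dl] /= [bx /andP[dl0 dle]] w wx.
  have hx' : `|g x - g x'| <= e / 2.
    by apply: H; apply: le_ball bx; rewrite ler_pdivrMr// ler_pMr// ler1n.
  have hw : `|g x - g w| <= e / 2.
    apply: H; split => // i j; rewrite /ball/= (ord1 i).
    have b1 : `|x ord0 j - x' ord0 j| < eta / 2 by case: bx => _ /(_ ord0 j).
    have b2 := wx j.
    rewrite (splitr eta); apply: le_lt_trans (ler_distD (x' ord0 j) _ _) _.
    by rewrite ltrD// distrC (lt_trans b2).
  have -> : g w - g x' = (g x - g x') - (g x - g w) by ring.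
  by apply: le_trans (ler_normB _ _) _; rewrite (splitr e) lerD.
move=> /(_ near_cover) [dl /= dl0 H].
exists (dl / 2); first by rewrite divr_gt0.
move=> v w vK wv; apply: (H (dl / 2)) => //=.
- by rewrite sub0r normrN gtr0_norm ?divr_gt0// ltr_pdivrMr// ltr_pMr// ltr1n.
- by rewrite divr_gt0.
- by move=> i; rewrite in_itv/= -ler_norml.
Unshelve. all: by end_near. Qed.

End heine.

(** * Trigonometric polynomials and Bernstein approximation *)

Section trigonometric.
Context (R : realType) (d : nat).
Local Notation Rd := 'rV[R]_d.
Implicit Types (p q : Rd -> R).

(** Trigonometric polynomials; the phase [a] accounts for sines. *)
Inductive trig : (Rd -> R) -> Prop :=
| trig_cos (xi : Rd) (a : R) : trig (fun z => cos (dotv xi z + a))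
| trig_add p q : trig p -> trig q -> trig (fun z => p z + q z)
| trig_scale (c : R) p : trig p -> trig (fun z => c * p z).

Lemma trig_cst c : trig (fun=> c).
Proof.
rewrite (_ : (fun=> c) = fun z : Rd => c * cos (dotv 0 z + 0)).
  by apply: trig_scale; exact: trig_cos.
by apply/funext => z; rewrite dotv0l addr0 cos0 mulr1.
Qed.

Lemma trig_mul p q : trig p -> trig q -> trig (fun z => p z * q z).
Proof.
move=> tp tq; elim: tp => {p} [xi a|p1 p2 _ IH1 _ IH2|c p _ IH].
- elim: tq => {q} [eta b|q1 q2 _ IH1 _ IH2|c q _ IH].
  + rewrite (_ : (fun _ => _) = fun z => 2^-1 * (cos (dotv (xi + eta) z + (a + b)) +
       cos (dotv (xi - eta) z + (a - b)))).
      by apply: trig_scale; apply: trig_add; exact: trig_cos.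
    apply/funext => z; rewrite !dotvDl dotvNl.
    have -> : dotv xi z + dotv eta z + (a + b) = (dotv xi z + a) + (dotv eta z + b) by ring.
    have -> : dotv xi z - dotv eta z + (a - b) = (dotv xi z + a) - (dotv eta z + b) by ring.
    by rewrite [cos (_ + a + _)]cosD cosB; field.
  + rewrite (_ : (fun _ => _) = fun z => cos (dotv xi z + a) * q1 z + cos (dotv xi z + a) * q2 z).
      exact: trig_add.
    by apply/funext => z; rewrite mulrDr.
  + rewrite (_ : (fun _ => _) = fun z => c * (cos (dotv xi z + a) * q z)).
      exact: trig_scale.
    by apply/funext => z; rewrite mulrCA.
- rewrite (_ : (fun _ => _) = fun z => p1 z * q z + p2 z * q z).
    exact: trig_add.
  by apply/funext => z; rewrite mulrDl.
- rewrite (_ : (fun _ => _) = fun z => c * (p z * q z)).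
    exact: trig_scale.
  by apply/funext => z; rewrite mulrA.
Qed.

(** A Bernstein mean is a recursion of sums and products, so closure under products suffices and no
    polynomial is expanded. *)
Lemma trig_bern N (x : Rd -> R) (G : nat -> Rd -> R) : trig x -> (forall k, trig (G k)) ->
  trig (fun z => bern N (x z) (fun k => G k z)).
Proof.
move=> tx; elim: N G => [|N IH] G tG /=; first exact: tG.
apply: trig_add; apply: trig_mul => //; [|exact: IH|exact: (IH (fun k => G k.+1))].
rewrite (_ : (fun z => 1 - x z) = fun z => 1 + (-1) * x z).
  by apply: trig_add; [exact: trig_cst|exact: trig_scale].
by apply/funext => z; rewrite mulN1r.
Qed.

Definition upd (v : Rd) (i : 'I_d) (a : R) : Rd := \row_j if j == i then a else v ord0 j.

Section approximation.
Variables (g : Rd -> R) (L : R) (N : nat).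
Hypothesis N0 : (0 < N)%N.
Let s (z : Rd) (i : 'I_d) : R := sin (z ord0 i / L).
Let grid k : R := 2 * k%:R / N%:R - 1.

(** One Bernstein mean per coordinate, in the variable [(1 + sin(z_i / L)) / 2] of [[0, 1]]; [v]
    holds the nodes chosen so far. *)
Fixpoint bern_multi (l : seq 'I_d) (v z : Rd) : R :=
  if l is i :: l' then
    bern N ((1 + s z i) / 2) (fun k => bern_multi l' (upd v i (grid k)) z)
  else g v.

Lemma trig_bern_multi l (v : Rd) : trig (bern_multi l v).
Proof.
elim: l v => [|i l IH] v /=; first exact: trig_cst.
apply: trig_bern => [|k]; last exact: IH.
rewrite (_ : (fun _ => _) = fun z => 2^-1 + 2^-1 * cos (dotv (L^-1 *: delta_mx ord0 i) z + - (pi / 2))).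
  by apply: trig_add; [exact: trig_cst|apply: trig_scale; exact: trig_cos].
apply/funext => z; rewrite dotv_delta cosB cos_pihalf mulr0 add0r sin_pihalf mulr1 /s.
by rewrite [z _ _ / L]mulrC; ring.
Qed.

Lemma bern_multi_indep l (v v' z : Rd) : (forall j, j \notin l -> v ord0 j = v' ord0 j) ->
  bern_multi l v z = bern_multi l v' z.
Proof.
elim: l v v' => [|i l IH] v v' vv /=.
  by congr g; apply/rowP => j; exact: vv.
congr bern; apply/funext => k; apply: IH => j jl; rewrite !mxE; case: eqP => // /eqP ji.
by apply: vv; rewrite in_cons negb_or ji.
Qed.

Variables (e C : R).
Hypotheses (C0 : 0 <= C) (gH : forall (v : Rd) i a, (forall j, `|v ord0 j| <= 1) -> `|a| <= 1 ->
  `|g (upd v i a) - g v| <= e + C * (a - v ord0 i) ^+ 2).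

(** The modulus of continuity has the form [e + C (a - v_i)^2], so one coordinate costs [e] plus [C]
    times a variance, and the costs of the coordinates add up. *)
Lemma bern_multi_close l (v z : Rd) : uniq l -> (forall j, `|v ord0 j| <= 1) ->
  (forall j, j \in l -> v ord0 j = s z j) ->
  `|bern_multi l v z - g v| <= (size l)%:R * (e + C / N%:R).
Proof.
elim: l v => [|i l IH] v /=; first by rewrite subrr normr0 mul0r.
move=> /andP[il ul] v1 vs.
set x := (1 + s z i) / 2.
have x01 : 0 <= x <= 1.
  have := sin_max (z ord0 i / L); rewrite ler_norml -/(s z i) /x => /andP[? ?].
  by apply/andP; split; lra.
have grid1 k : (k <= N)%N -> `|grid k| <= 1.
  move=> kN; have N0' : 0 < N%:R :> R by rewrite ltr0n.
  have h1 : 0 <= k%:R / N%:R :> R by rewrite divr_ge0.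
  have h2 : k%:R / N%:R <= 1 :> R by rewrite ler_pdivrMr// mul1r ler_nat.
  by rewrite /grid -mulrA ler_norml; apply/andP; split; lra.
have -> : g v = bern N x (fun=> g v) by rewrite bern_cst.
have -> : bern N x (fun k => bern_multi l (upd v i (grid k)) z) - bern N x (fun=> g v) =
    bern N x (fun k => bern_multi l (upd v i (grid k)) z + (-1) * g v).
  by rewrite bernD bernZ mulN1r.
apply: le_trans (bern_norm _ _ x01) _.
have v2x : v ord0 i = 2 * x - 1 by rewrite vs ?mem_head// /x; field.
apply: (@le_trans _ _ (bern N x (fun k => ((size l)%:R * (e + C / N%:R) + e) +
    C * (2 * k%:R / N%:R - 1 - (2 * x - 1)) ^+ 2))).
  apply: bern_le => // k kN.
  have u1 j : `|upd v i (grid k) ord0 j| <= 1 by rewrite mxE; case: ifP => // _; exact: grid1.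
  have h1 : `|bern_multi l (upd v i (grid k)) z - g (upd v i (grid k))| <= (size l)%:R * (e + C / N%:R).
    apply: IH => // j jl; rewrite mxE; case: eqP => [ji|_]; first by rewrite -ji jl in il.
    by apply: vs; rewrite in_cons jl orbT.
  have h2 := gH i v1 (grid1 k kN).
  rewrite mulN1r.
  have -> : bern_multi l (upd v i (grid k)) z - g v =
    (bern_multi l (upd v i (grid k)) z - g (upd v i (grid k))) + (g (upd v i (grid k)) - g v) by ring.
  apply: le_trans (ler_normD _ _) _; rewrite -addrA lerD//.
  by move: h2; rewrite v2x.
rewrite bernD bern_cst bernZ.
have := ler_wpM2l C0 (bern_grid x01 N0); rewrite -natr1; lra.
Qed.
End approximation.

End trigonometric.

(** * Vague convergence to the Levy measure *)

Section vague_convergence.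
Context (disp : measure_display) (Omega : measurableType disp) (R : realType).
Context (d : nat) (P : probability Omega R) (X : R -> Omega -> 'rV[R]_d).
Local Notation Rd := 'rV[R]_d.
Hypothesis mX : forall t, measurable_fun setT (X t).
Variables (M : {measure set Rd -> \bar R}) (A : 'M[R]_d).
Hypothesis M_fin : (\int[M]_z (trunc_sq z)%:E < +oo)%E.
Hypothesis A_pos : forall xi, 0 <= dotv (xi *m A) xi.
Hypothesis Ecos : forall (t : R) (xi : Rd), 0 <= t ->
  \int[P]_w cos (dotv xi (X t w)) = expR (- (t * levy_symbol M A xi)).
Hypothesis Esin : forall (t : R) (xi : Rd), 0 <= t -> \int[P]_w sin (dotv xi (X t w)) = 0.
Variable c0 : R.
Hypothesis c00 : 0 < c0.
Local Notation vague_conv := (vague_conv P X M c0).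
Local Notation I := (scaled_mean P X c0).
Local Notation J := (levy_mean M).

(** Bounded and periodic in [z]; multiplied by [L] it is close to [z] on bounded sets when [L] is
    large. *)
Definition sinv (L : R) (z : Rd) : Rd := \row_i sin (z ord0 i / L).

Lemma measurable_sinv L : measurable_fun setT (sinv L).
Proof.
apply: measurable_fun_mx => i j; under eq_fun do rewrite mxE.
apply: (measurableT_comp (f := sin)).
  by apply: continuous_measurable_fun; exact: continuous_sin.
by apply: measurable_funM => //; exact: measurable_coord.
Qed.

Lemma normr_sinv L z i : `|sinv L z ord0 i| <= 1.
Proof. by rewrite mxE sin_max. Qed.

Lemma enorm_sinv L z : 0 < L -> L * enorm (sinv L z) <= enorm z.
Proof.
move=> L0; have e0 x := @enorm_ge0 R d x.
rewrite -ler_sqr ?nnegrE ?mulr_ge0 ?(ltW L0)// exprMn !enorm_sqr /dotv big_distrr /=.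
apply: ler_sum => i _; rewrite !mxE -!expr2 -exprMn.
have h : `|L * sin (z ord0 i / L)| <= `|z ord0 i|.
  rewrite normrM (gtr0_norm L0) -ler_pdivlMl//.
  by apply: le_trans (normr_sin_le _) _; rewrite normrM normfV (gtr0_norm L0) mulrC.
by rewrite -[leLHS](real_normK (num_real _)) -[leRHS](real_normK (num_real _)) lerXn2r// nnegrE.
Qed.

(** Since [sin(z_i / L)^2 = (1 - cos(2 z_i / L)) / 2], the factor [|s|^4] is a sum of products of
    two terms [1 - cos], the form treated by [vague_conv3]. *)
Lemma vague_conv_sin4 L p : trig p -> vague_conv (fun z => enorm (sinv L z) ^+ 4 * p z).
Proof.
elim=> {p} [xi a|p q _ vp _ vq|c p _ vp].
- pose b (i : 'I_d) : Rd := (2 / L) *: delta_mx ord0 i.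
  have hb (i : 'I_d) (z : Rd) : sin (z ord0 i / L) ^+ 2 = 2^-1 * (1 - cos (dotv (b i) z)).
    rewrite dotv_delta one_sub_cosE (_ : 2 / L * z ord0 i / 2 = z ord0 i / L); last first.
      transitivity (2 / 2 * (z ord0 i / L)); first by ring.
      by rewrite divff ?mul1r// pnatr_eq0.
    by field.
  rewrite (_ : (fun _ => _) = fun z => \sum_(i <- index_enum 'I_d) \sum_(j <- index_enum 'I_d)
     4^-1 * ((1 - cos (dotv (b i) z)) * (1 - cos (dotv (b j) z)) * cos (dotv xi z + a))).
    apply: vague_conv_sum => // i; apply: vague_conv_sum => // j; apply: vague_convZ => //.
    exact: (vague_conv3 mX M_fin A_pos Ecos Esin c00).
  apply/funext => z; rewrite (exprM _ 2 2) enorm_sqr /dotv expr2 big_distrl/= big_distrl/=.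
  apply: eq_bigr => i _; rewrite big_distrr/= big_distrl/=; apply: eq_bigr => j _.
  by rewrite !mxE -!expr2 !hb; field.
- rewrite (_ : (fun _ => _) = fun z => enorm (sinv L z) ^+ 4 * p z + enorm (sinv L z) ^+ 4 * q z).
    exact: vague_convD.
  by apply/funext => z; rewrite mulrDr.
- rewrite (_ : (fun _ => _) = fun z => c * (enorm (sinv L z) ^+ 4 * p z)).
    exact: vague_convZ.
  by apply/funext => z; rewrite mulrCA.
Qed.

Lemma trig_approximation (g : Rd -> R) (K L e : R) : continuous g -> (forall s, `|g s| <= K) -> 0 < e ->
  exists2 p, trig p & forall z, `|g (sinv L z) - p z| <= e.
Proof.
move=> cg gK e0; have K0 : 0 <= K by apply: le_trans (gK 0).
(* Each coordinate will cost [e' + C / N <= 2 e']; [d.+1] avoids a division by 0. *)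
pose e' := e / (2 * d.+1%:R).
have e'0 : 0 < e' by rewrite divr_gt0// mulr_gt0.
have [dl dl0 Hdl] := uniform_continuity_box 1 cg e'0.
(* With this [C] the trivial bound [2 K] is at most [C (a - v_i)^2] once [|a - v_i| >= dl]. *)
pose C := 2 * K / dl ^+ 2.
have C0 : 0 <= C by rewrite divr_ge0 ?sqr_ge0// mulr_ge0.
have gH (v : Rd) i a : (forall j, `|v ord0 j| <= 1) -> `|a| <= 1 ->
    `|g (upd v i a) - g v| <= e' + C * (a - v ord0 i) ^+ 2.
  move=> v1 a1; have [h|h] := ltP `|a - v ord0 i| dl.
    apply: (@le_trans _ _ e'); last by rewrite lerDl mulr_ge0 ?sqr_ge0.
    by apply: Hdl => // j; rewrite mxE; case: eqP => [->//|_]; rewrite subrr normr0.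
  apply: (@le_trans _ _ (2 * K)).
    apply: le_trans (ler_normB _ _) _; have := gK (upd v i a); have := gK v; lra.
  rewrite -[leLHS]add0r; apply: lerD; first exact: ltW.
  rewrite /C mulrAC ler_pdivlMr ?exprn_gt0// ler_wpM2l ?mulr_ge0//.
  by rewrite -[leRHS](real_normK (num_real _)) lerXn2r// nnegrE ltW.
pose N := (Num.truncn (2 * d.+1%:R * C / e)).+1.
have N0 : (0 < N)%N by [].
exists (bern_multi g L N (enum 'I_d) 0); first exact: trig_bern_multi.
move=> z; rewrite (@bern_multi_indep _ _ _ _ _ _ _ (sinv L z)); last first.
  by move=> j; rewrite mem_enum.
rewrite distrC; apply: le_trans (bern_multi_close N0 C0 gH _ _ _) _.
- exact: enum_uniq.
- exact: normr_sinv.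
- by move=> j _; rewrite mxE.
rewrite size_enum_ord.
have hN : 2 * d.+1%:R * C / e <= N%:R by exact/ltW/truncnS_gt.
have hC : C / N%:R <= e'.
  rewrite ler_pdivrMr ?ltr0n// /e' mulrAC ler_pdivlMr ?mulr_gt0//.
  by rewrite ler_pdivrMr// in hN; lra.
apply: (@le_trans _ _ (d.+1%:R * (e' + e'))).
  apply: ler_pM; rewrite ?ler_nat// ?lerD2l//.
  by apply: addr_ge0; [exact: ltW|exact: divr_ge0].
have E : 2 * d.+1%:R * e' = e by rewrite /e' mulrC divfK// gt_eqF// mulr_gt0.
by rewrite -[leRHS]E mulrDr -mulrA -[2]/(1 + 1) mulrDl mul1r.
Qed.

Variables (f : Rd -> R) (K r : R).
Hypotheses (cf : continuous f) (fK : forall z, `|f z| <= K) (r0 : 0 < r).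
Hypothesis fz : forall z, enorm z <= r -> f z = 0.
Let K0 : 0 <= K. Proof. exact: le_trans (fK 0). Qed.

Lemma continuous_scale_rV (L : R) : continuous (fun s : Rd => L *: s).
Proof.
move=> s; apply: (cvg_rV (F := nbhs s)) => j; under eq_fun do rewrite mxE; rewrite mxE.
by apply: cvgM; [exact: cvg_cst|exact: coord_continuous].
Qed.

Lemma dominated_vanishing (h : Rd -> R) : measurable_fun setT h -> (forall z, `|h z| <= K) ->
  (forall z, enorm z <= r -> h z = 0) -> dominated h.
Proof.
move=> mh hK hz; apply: (@dominated_le _ _ _ (fun z => K * tail r z)) => //.
  by apply: dominatedZ; exact: dominated_tail.
move=> z; rewrite /tail; case: (leP r (enorm z)) => [_|/ltW zr]; first by rewrite mulr1.
by rewrite hz// normr0 mulr0.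
Qed.

(** [f(L s)] vanishes for [|s| <= r / L], so it equals [|s|^4 g(s)] with [g] continuous. A uniform
    approximation of [g] by trigonometric polynomials then has an error controlled by [|s|^4], as
    [vague_conv_closure] requires. *)
Lemma vague_conv_periodized L : 0 < L -> vague_conv (fun z => f (L *: sinv L z)).
Proof.
move=> L0; pose c := r / L; have c_gt0 : 0 < c by rewrite divr_gt0.
(* The maximum with [c] keeps the denominator away from 0 and changes nothing where [f (L *: s)] is
   nonzero. *)
pose g (s : Rd) : R := f (L *: s) * (Num.max (enorm s) c ^+ 4)^-1.
have mpos s : 0 < Num.max (enorm (s : Rd)) c by rewrite lt_max c_gt0 orbT.
have cg : continuous g.
  move=> s; apply: (@cvgM _ _ (nbhs s)).
    apply: cvg_continuous_rV => //; exact: continuous_scale_rV.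
  have cm : Num.max (enorm t) c @[t --> s] --> Num.max (enorm s) c.
    have H := @continuous_max R Rd (@enorm R d) (fun=> c) s (@continuous_enorm R d s) (cvg_cst c).
    exact: (H (nbhs_filter s)).
  apply: cvgV; first by rewrite expf_neq0// gt_eqF.
  exact: (cvgM cm (cvgM cm (cvgM cm cm))).
have gK s : `|g s| <= K / c ^+ 4.
  rewrite normrM ler_pM// normfV lef_pV2 ?posrE ?normr_gt0 ?exprn_gt0//; last by rewrite expf_neq0// gt_eqF.
  by rewrite ger0_norm ?exprn_ge0 ?(ltW (mpos s))// lerXn2r ?nnegrE ?(ltW (mpos s)) ?(ltW c_gt0)// le_max lexx orbT.
have gE z : enorm (sinv L z) ^+ 4 * g (sinv L z) = f (L *: sinv L z).
  rewrite /g; have [h|h] := leP (enorm (sinv L z)) c.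
    rewrite fz ?mul0r ?mulr0//.
    rewrite (_ : enorm (L *: sinv L z) = L * enorm (sinv L z)); last first.
      by rewrite /enorm dotvZl dotvZr mulrA sqrtrM ?sqr_ge0// -expr2 sqrtr_sqr gtr0_norm.
    by rewrite mulrC -ler_pdivlMr.
  by rewrite mulrCA mulfV ?mulr1// expf_neq0// gt_eqF// (lt_trans c_gt0).
apply: (@vague_conv_closure _ _ _ _ _ _ mX _ M_fin _ c00 _ (fun z => enorm (sinv L z) ^+ 4 * 1)).
- apply: dominated_vanishing.
  + apply: (measurableT_comp (continuous_measurable_rV cf)).
    apply: (measurableT_comp (f := fun s : Rd => L *: s)); last exact: measurable_sinv.
    apply: measurable_fun_mx => i j; under eq_fun do rewrite mxE.
    by apply: measurable_funM => //; exact: measurable_coord.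
  + by move=> z.
  + move=> z zr; apply: fz; apply: le_trans zr; apply: le_trans (enorm_sinv z L0).
    by rewrite /enorm dotvZl dotvZr mulrA sqrtrM ?sqr_ge0// -expr2 sqrtr_sqr gtr0_norm.
- by apply: vague_conv_sin4; exact: trig_cst.
move=> e e0; have [p tp Hp] := trig_approximation L cg gK e0.
exists (fun z => enorm (sinv L z) ^+ 4 * p z); first exact: vague_conv_sin4.
move=> z; rewrite -gE -mulrBr normrM mulr1 [leRHS]mulrC.
by rewrite ger0_norm ?exprn_ge0 ?enorm_ge0// ler_wpM2l ?exprn_ge0 ?enorm_ge0.
Qed.

(* Tested against [|s|^4 p], [s_i = sin (z_i / L)], the Gaussian part disappears, and
   by Weierstrass every continuous function of [s] vanishing near [0] is a uniform
   limit of such products; then [L -> oo]. *)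
Lemma vague_convergence : vague_conv f.
Proof.
have df : dominated f by apply: dominated_vanishing => //; exact: continuous_measurable_rV.
split => //; apply/cvgrPdist_le => e e0.
have [C HC] := tail_mean_bounded mX M_fin A_pos Ecos c00 r0.
have C0 : 0 <= Num.max C (J (tail r)).
  rewrite le_max; apply/orP; right; apply: Rintegral_ge0 => z _.
  by rewrite /even_part /tail divr_ge0// addr_ge0.
set C' := Num.max C (J (tail r)) in C0.
(* Four errors of size [e / 6] are planned, one from each tail, for the limit and for the means; the
   periodized function takes the remaining [e / 3]. *)
pose e1 := e / (6 * (C' + 1)); pose e2 := e / (12 * (K + 1)).
have e10 : 0 < e1 by rewrite divr_gt0// mulr_gt0// ltr_wpDl.
have e20 : 0 < e2 by rewrite divr_gt0// mulr_gt0// ltr_wpDl.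
have [a [a0 Ia Ja]] := tail_small mX M_fin A_pos Ecos c00 e20.
have [dl dl0 Hdl] := uniform_continuity_box a cf e10.
(* For [|x| <= a] the error of the periodized coordinate is at most [a^3 / L^2], which this [L]
   makes smaller than [dl]. *)
pose L := 1 + a ^+ 3 / dl.
have q0 : 0 <= a ^+ 3 / dl by rewrite divr_ge0 ?exprn_ge0// ltW.
have L1 : 1 <= L by rewrite lerDl.
have L0 : 0 < L by exact: lt_le_trans ltr01 L1.
have [dp cp] := vague_conv_periodized L0.
set p := (fun z => _) in dp cp.
have dt1 : dominated (tail r : Rd -> R) by exact: dominated_tail.
have dt2 : dominated (tail a : Rd -> R) by exact: dominated_tail.
have d1 : dominated (fun z : Rd => e1 * tail r z) by exact: dominatedZ.
have d2 : dominated (fun z : Rd => (2 * K) * tail a z) by exact: dominatedZ.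
have fp z : `|f z - p z| <= e1 * tail r z + (2 * K) * tail a z.
  have t0 b : 0 <= tail b z by exact: ler0n.
  have [zr|rz] := leP (enorm z) r.
    rewrite /p !fz//; last first.
      apply: le_trans zr; apply: le_trans (enorm_sinv z L0).
      by rewrite /enorm dotvZl dotvZr mulrA sqrtrM ?sqr_ge0// -expr2 sqrtr_sqr gtr0_norm.
    rewrite subrr normr0; apply: addr_ge0; apply: mulr_ge0 => //; [exact: ltW|exact: mulr_ge0].
  have -> : tail r z = 1 by rewrite /tail ltW.
  rewrite mulr1; have [az|za] := leP a (enorm z).
    rewrite /tail az mulr1 -[leLHS]add0r lerD//; first exact: ltW.
    by apply: le_trans (ler_normB _ _) _; have := fK z; have := fK (L *: sinv L z); rewrite /p; lra.
  rewrite /tail (lt_geF za) mulr0 addr0 distrC; apply: Hdl => i.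
    by apply: le_trans (coord_le_enorm _ _) _; exact: ltW.
  rewrite !mxE; set x := z ord0 i.
  have xa : `|x| <= a by apply: le_trans (coord_le_enorm _ _) _; exact: ltW.
  have -> : L * sin (x / L) - x = - (L * (x / L - sin (x / L))) by rewrite mulrBr mulrCA mulfV ?gt_eqF//; ring.
  rewrite normrN normrM (gtr0_norm L0).
  apply: (@le_lt_trans _ _ (L * `|x / L| ^+ 3)); first by rewrite ler_pM2l// sub_sin_le.
  rewrite normrM normfV (gtr0_norm L0).
  have -> : L * (`|x| / L) ^+ 3 = `|x| ^+ 3 / L ^+ 2 by field; rewrite gt_eqF.
  rewrite ltr_pdivrMr ?exprn_gt0//.
  have x3 : `|x| ^+ 3 <= a ^+ 3 by rewrite lerXn2r// nnegrE ltW.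
  have LL : L <= L ^+ 2 by rewrite expr2 ler_peMr// ltW.
  have dL : dl * L = dl + a ^+ 3 by rewrite /L mulrDr mulr1 mulrCA mulfV ?mulr1// gt_eqF.
  have := ler_wpM2l (ltW dl0) LL; lra.
have dk := dominatedD d1 d2.
have Jfp := levy_mean_close M_fin df dp dk fp.
rewrite (levy_meanD M_fin d1 d2) !(levy_meanZ M_fin)// in Jfp.
have E1 : e1 * C' <= e / 6.
  have h1 : 0 < 6 * (C' + 1) by rewrite mulr_gt0// ltr_wpDl.
  rewrite /e1 mulrAC ler_pdivrMr//; have := mulr_ge0 (ltW e0) C0; lra.
have E2 : 2 * K * e2 <= e / 6.
  have h1 : 0 < 12 * (K + 1) by rewrite mulr_gt0// ltr_wpDl.
  rewrite /e2 mulrA ler_pdivrMr//; have := mulr_ge0 (ltW e0) K0; lra.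
have J1 : e1 * J (tail r) <= e / 6.
  by apply: le_trans E1; rewrite ler_pM2l// /C' le_max lexx orbT.
have J2 : 2 * K * J (tail a) <= e / 6.
  by apply: le_trans E2; rewrite ler_wpM2l// mulr_ge0.
have e30 : 0 < e / 3 by rewrite divr_gt0.
move/cvgrPdist_le : cp => /(_ _ e30); apply: filterS => n hn.
have Ifp := scaled_mean_close P mX c00 n df dp dk fp.
rewrite (scaled_meanD P mX c0 n d1 d2) !(scaled_meanZ P mX)// in Ifp.
have I1 : e1 * I n (tail r) <= e / 6.
  by apply: le_trans E1; rewrite ler_pM2l// /C' le_max HC.
have I2 : 2 * K * I n (tail a) <= e / 6.
  by apply: le_trans E2; rewrite ler_wpM2l// mulr_ge0.
move: hn Jfp Ifp; rewrite !ler_norml => /andP[? ?] /andP[? ?] /andP[? ?].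
by apply/andP; split; lra.
Qed.

End vague_convergence.

(** * Convolution estimates for the Levy density *)

Section density.
Import HBNNSimple.

(** Approximation by simple functions from below and monotone convergence on both sides, since the
    density is known through the values [M A]. *)
Lemma density_integral dT (T : measurableType dT) (R : realType) (mu M : {measure set T -> \bar R})
    (rho : T -> \bar R) (F : T -> \bar R) :
  measurable_fun setT rho -> (forall x, 0 <= rho x)%E ->
  (forall A, measurable A -> M A = (\int[mu]_(x in A) rho x)%E) ->
  measurable_fun setT F -> (forall x, 0 <= F x)%E ->
  (\int[M]_x F x = \int[mu]_x (F x * rho x))%E.
Proof.
move=> mrho rho0 Mrho mF F0; pose h := nnsfun_approx measurableT mF.
have h0 n x : 0 <= h n x by [].
have mh n : measurable_fun setT (h n) by [].
have hF x : (h n x)%:E @[n --> \oo] --> F x by exact: cvg_nnsfun_approx.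
have hnd x m n : (m <= n)%N -> h m x <= h n x by move=> mn; exact/lefP/nd_nnsfun_approx.
have FM : (F = fun x => limn (fun n => (h n x)%:E)).
  by apply/funext => x; apply/esym/cvg_lim.
have Frho : ((fun x => F x * rho x) = fun x => limn (fun n => (h n x)%:E * rho x))%E.
  apply/funext => x; apply/esym/cvg_lim => //; have [->|r0] := eqVneq (rho x) 0%E.
    by rewrite mule0; under eq_fun do rewrite mule0; exact: cvg_cst.
  have hle n : ((h n x)%:E <= F x)%E.
    apply: (lee_cvg_le (cvg_cst (h n x)%:E) (v := fun m => (h (n + m)%N x)%:E)) => [|m].
      by apply: (cvg_comp (addn n) (fun k => (h k x)%:E) (cvg_addnl n)); exact: hF.
    by rewrite lee_fin hnd// leq_addr.
  have rp : (0 < rho x)%E by rewrite lt_def r0 rho0.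
  have [rf|] := boolP (rho x \is a fin_num); first exact: cvgeZr.
  (* Here [rho x] is infinite and multiplication by it is discontinuous at 0: [F x = 0] keeps all
     approximants at 0, while [F x > 0] makes the products eventually infinite. *)
  rewrite ge0_fin_numE// -leNgt leye_eq => /eqP ->.
  have [Fx0|Fx0] := eqVneq (F x) 0%E.
    rewrite Fx0 mul0e (_ : (fun _ => _) = fun=> 0%E); first exact: cvg_cst.
    apply/funext => n; have := hle n; rewrite Fx0 => hn.
    by rewrite (_ : (h n x)%:E = 0%E) ?mul0e//; apply/eqP; rewrite eq_le hn lee_fin h0.
  have Fp : (0 < F x)%E by rewrite lt_def Fx0 F0.
  have [m hm] : exists m, 0 < h m x.
    apply: contrapT => /forallNP H; have := hF x.
    rewrite (_ : (fun _ => _) = fun=> 0%E); last first.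
      by apply/funext => n; congr EFin; apply/eqP; rewrite eq_le h0 andbT leNgt; apply/negP/H.
    by move=> /(cvg_unique _ (cvg_cst _)) F00; rewrite -F00// eqxx in Fx0.
  rewrite gt0_muley//; apply: cvg_near_cst; exists m => // n /= mn.
  by rewrite gt0_muley// lte_fin (lt_le_trans hm)// hnd.
rewrite {1}FM Frho monotone_convergence//; last 3 first.
- by move=> n; exact/measurable_EFinP.
- by move=> n x _; rewrite lee_fin.
- by move=> x _ m n mn; rewrite lee_fin hnd.
rewrite monotone_convergence//; last 3 first.
- by move=> n; apply: emeasurable_funM => //; exact/measurable_EFinP.
- by move=> n x _; rewrite mule_ge0 ?lee_fin.
- by move=> x _ m n mn; rewrite lee_wpmul2r ?lee_fin// hnd.
congr (limn _); apply/funext => n.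
pose ind y x : R := y * \1_(h n @^-1` [set y]) x.
have mind y : measurable_fun setT (fun x => (ind y x)%:E).
  apply/measurable_EFinP; apply: measurable_funM => //.
have ind0 y x : (0 <= (ind y x)%:E)%E.
  rewrite lee_fin /ind indicE; case: (boolP (_ \in _)) => [/set_mem hx|_]; last by rewrite mulr0.
  by rewrite mulr1 -hx.
have hE x : (h n x)%:E = (\sum_(y \in range (h n)) (ind y x)%:E)%E.
  by rewrite fsumEFin//; congr EFin; exact: fimfunE.
under eq_integral do rewrite hE.
rewrite ge0_integral_fsum//.
transitivity (\int[mu]_x (\sum_(y \in range (h n)) (ind y x)%:E * rho x))%E; last first.
  by apply: eq_integral => x _; rewrite hE ge0_mule_fsuml.
rewrite ge0_integral_fsum//; last 2 first.
- by move=> y; exact: emeasurable_funM.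
- by move=> y x _; rewrite mule_ge0.
apply: eq_fsbigr => y; rewrite inE => -[t _ yt].
have y0 : 0 <= y by rewrite -yt.
have mA : measurable (h n @^-1` [set y]) by rewrite -[X in measurable X]setTI; exact: mh.
have -> : (\int[M]_x (ind y x)%:E = y%:E * M (h n @^-1` [set y]))%E.
  under eq_integral do rewrite EFinM.
  rewrite ge0_integralZl//; last by apply/measurable_EFinP; exact: measurable_indic.
  by rewrite integral_indic// setIT.
rewrite Mrho// integral_mkcond -ge0_integralZl//; last 2 first.
- by apply/(measurable_restrictT _ mA); exact: measurable_funTS.
- by move=> x _; rewrite patchE; case: ifP.
apply: eq_integral => x _; rewrite /ind EFinM -muleA patchE indicE; congr (_ * _)%E.
by case: ifP => _; rewrite ?mul1e ?mul0e.
Qed.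

End density.

(** * Comparison and convolution of the Levy density *)

Section levy_density.
Context (R : realType) (d : nat).
Local Notation Rd := 'rV[R]_d.
Local Notation leb := (lebesgue_rV R d).
Variable nu : Rd -> R.
Hypothesis d_gt0 : (0 < d)%N.
Hypothesis mnu : measurable_fun setT nu.
Hypothesis nu_gt0 : forall z, z != 0 -> 0 < nu z.
Variable M : {measure set Rd -> \bar R}.
Hypothesis M0 : M [set 0] = 0%E.
Hypothesis Mnu : forall A, measurable A -> M A = (\int[leb]_(x in A) (nu x)%:E)%E.
Hypothesis M_fin : (\int[M]_z (trunc_sq z)%:E < +oo)%E.
Hypothesis A11 : forall r : R, 0 < r <= 1 / 2 -> exists2 C1 : R, 1 <= C1 &
  forall x y, r <= enorm y -> enorm y <= enorm x ->
    enorm x <= enorm y + 1 -> C1^-1 * nu y <= nu x <= C1 * nu y.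
Hypothesis A12 : exists2 C2 : R, 1 <= C2 &
  forall x y, 1 / 2 <= enorm y -> enorm y <= enorm x -> nu x <= C2 * nu y.
Hypothesis A13 : exists2 C3 : R, 1 <= C3 & forall x y, 1 <= enorm (y - x) ->
  (\int[leb]_(z in [set z | (1 / 2 < enorm (z - x))%R /\ (1 / 2 < enorm (z - y))%R])
    (nu (x - z) * nu (z - y))%:E <= (C3 * nu (x - y))%:E)%E.

Lemma enorm_gt0_neq0 (z : Rd) : 0 < enorm z -> z != 0.
Proof. by move=> z0; apply: contraTneq z0 => ->; rewrite enorm0 ltxx. Qed.

Lemma nu_far z a : 0 < a -> a <= enorm z -> 0 < nu z.
Proof. by move=> a0 az; apply: nu_gt0; apply: enorm_gt0_neq0; exact: lt_le_trans az. Qed.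

(** The sign of [nu] at the origin is unknown. The function [nu'] is 0 there, which alters neither
    side because [M] does not charge the origin and [F 0 = 0]. *)
Lemma levy_integral (F : Rd -> \bar R) : measurable_fun setT F -> (forall z, 0 <= F z)%E ->
  F 0 = 0%E -> (\int[M]_z F z = \int[leb]_z (F z * (nu z)%:E))%E.
Proof.
move=> mF F0 F00; pose nu' z : R := nu z * \1_(~` [set 0]) z.
have m0 : measurable (~` [set (0 : Rd)]) by apply: measurableC; exact: measurable_set1_rV.
have mnu' : measurable_fun setT nu' by apply: measurable_funM => //; exact: measurable_indic.
have nu'0 z : 0 <= nu' z.
  rewrite /nu' indicE; case: (boolP (_ \in _)) => [/set_mem z0|_]; last by rewrite mulr0.
  by rewrite mulr1 ltW// nu_gt0//; apply/eqP.
rewrite (@density_integral _ _ _ leb M (EFin \o nu'))//.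
- apply: eq_integral => z _; have [->|z0] := eqVneq z 0; first by rewrite F00 !mul0e.
  by rewrite /nu' /= indicE mem_set ?mulr1//; exact/eqP.
- exact/measurable_EFinP.
move=> A mA; have -> : M A = M (A `\` [set 0]).
  have m1 := @measurable_set1_rV R d 0.
  rewrite (measureDI M mA m1) (@subset_measure0 _ _ _ M (A `&` [set 0]) [set 0])//.
    by rewrite adde0.
  exact: measurableI.
rewrite Mnu; last by apply: measurableD => //; exact: measurable_set1_rV.
rewrite [LHS]integral_mkcond [RHS]integral_mkcond; apply: eq_integral => z _.
rewrite !patchE /= /nu' indicE; have [->|z0] := eqVneq z 0.
  rewrite memNset; last by move=> [_]; apply.
  by rewrite [_ \in ~` _]memNset ?mulr0; [case: ifP|move=> H; exact: H].
rewrite [z \in ~` _]mem_set ?mulr1; last exact/eqP.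
rewrite (_ : (z \in A `\` [set 0]) = (z \in A))//.
apply/idP/idP => [/set_mem[Az _]|/set_mem Az]; apply/mem_set => //.
by split => //; exact/eqP.
Qed.

Definition far (a : R) : set Rd := [set z | a <= enorm z].

Lemma measurable_far a : measurable (far a).
Proof.
rewrite -[X in measurable X]setTI; apply: measurable_fun_ler => //; exact: measurable_enorm.
Qed.

Lemma nu_far_finite a : 0 < a -> (\int[leb]_(z in far a) (nu z)%:E < +oo)%E.
Proof.
move=> a0; rewrite -(Mnu (measurable_far a)).
have h1 := @dominated_integrable R d M M_fin _ (dominated_tail d a0).
have : (\int[M]_z (tail a z)%:E < +oo)%E.
  have /integrableP[_] := h1; apply: le_lt_trans; apply: ge0_le_integralP => z _.
    by rewrite lee_fin ler0n.
  by rewrite /= lee_fin ler_norm.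
rewrite (_ : (fun z => _) = fun z => (\1_(far a) z)%:E).
  by rewrite integral_indic ?setIT//; exact: measurable_far.
apply/funext => z; rewrite indicE /tail; congr (_%:R)%:E; congr nat_of_bool.
by apply/idP/idP; rewrite inE.
Qed.

(* The Levy density made bounded near the origin; [1/2] is the radius beyond which
   (A1)(2) and (A1)(3) control [nu]. *)
Definition kappa (z : Rd) : R := if 1 / 2 <= enorm z then nu z else 1.

Lemma measurable_kappa : measurable_fun setT kappa.
Proof.
apply: measurable_fun_ifT => //; apply: measurable_fun_ler => //; exact: measurable_enorm.
Qed.

Lemma kappa_gt0 z : 0 < kappa z.
Proof. by rewrite /kappa; case: ifP => // h; apply: (nu_far (a := 1 / 2)). Qed.

Lemma kappa_nu z : 1 / 2 <= enorm z -> kappa z = nu z.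
Proof. by rewrite /kappa => ->. Qed.

Let h12 : ((0 : R) < 1 / 2) && (1 / 2 <= 1 / 2 :> R). Proof. by rewrite lexx divr_gt0. Qed.

(** A reference point on the sphere where [kappa] changes its definition; its existence uses
    [d_gt0]. *)
Let y0 : Rd := (1 / 2) *: delta_mx ord0 (Ordinal d_gt0).

Let y0E : enorm y0 = 1 / 2.
Proof.
rewrite /enorm /y0 dotvZl dotvC dotv_delta !mxE !eqxx mulr1 -expr2 sqrtr_sqr ger0_norm//.
Qed.

Lemma kappa_bounded : exists2 K : R, 1 <= K & forall z, kappa z <= K.
Proof.
have [C C1 HC] := A12; exists (1 + C * nu y0).
  by rewrite lerDl mulr_ge0 ?(le_trans ler01 C1)// ltW// (nu_far (a := 1 / 2))// y0E.
move=> z; rewrite /kappa; case: ifP => h.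
  by apply: le_trans (HC z y0 _ _) _; rewrite ?y0E// lerDr.
by rewrite lerDl mulr_ge0 ?(le_trans ler01 C1)// ltW// (nu_far (a := 1 / 2))// y0E.
Qed.

(** The radius [3/2 = 1/2 + 1] is what one use of [A11] reaches from [y0]. *)
Lemma kappa_lower : exists2 k : R, 0 < k <= 1 & forall z, enorm z <= 3 / 2 -> k <= kappa z.
Proof.
have [C C1 HC] := A11 h12.
have C0 : 0 < C by exact: lt_le_trans C1.
have n0 : 0 < nu y0 by rewrite (nu_far (a := 1 / 2))// y0E.
exists (Num.min 1 (C^-1 * nu y0)); first by rewrite lt_min ltr01 mulr_gt0 ?invr_gt0//= ge_min lexx.
move=> z z32; rewrite /kappa; case: ifP => h; last by rewrite ge_min lexx.
rewrite ge_min; apply/orP; right.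
have := HC z y0; rewrite y0E => /(_ (lexx _) h) /(_ _)/andP[]//; lra.
Qed.

(** For [|x| <= 3/2], [kappa x] is bounded below and [kappa y] above; for larger [|x|] both points
    have norm at least [1/2] and [A11] compares the values of [nu]. *)
Lemma kappa_near : exists2 C : R, 1 <= C & forall x y, enorm (x - y) <= 1 -> kappa y <= C * kappa x.
Proof.
have [K K1 HK] := kappa_bounded; have [k /andP[k0 k1] Hk] := kappa_lower.
have [C C1 HC] := A11 h12.
have C0 : 0 < C by exact: lt_le_trans C1.
have Kk0 : 0 <= K / k by rewrite divr_ge0 ?(le_trans ler01 K1)// ltW.
exists (C + K / k); first by lra.
move=> x y xy; have kx := ltW (kappa_gt0 x).
have [x32|x32] := leP (enorm x) (3 / 2).
  apply: le_trans (HK y) _; apply: (@le_trans _ _ (K / k * kappa x)).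
    by rewrite mulrAC ler_pdivlMr// ler_pM2l ?Hk// (lt_le_trans ltr01).
  by rewrite ler_wpM2r// lerDr ltW.
have d1 : enorm x <= enorm y + 1.
  have -> : x = (x - y) + y by rewrite subrK.
  by apply: le_trans (enormD _ _) _; rewrite addrC lerD2l.
have d2 : enorm y <= enorm x + 1.
  have -> : y = - (x - y) + x by rewrite opprB subrK.
  by apply: le_trans (enormD _ _) _; rewrite addrC enormN lerD2l.
have y12 : 1 / 2 <= enorm y by lra.
have x12 : 1 / 2 <= enorm x by lra.
rewrite !kappa_nu//; rewrite kappa_nu// in kx.
apply: (@le_trans _ _ (C * nu x)); last by rewrite ler_wpM2r// lerDl.
have [h|/ltW h] := leP (enorm y) (enorm x).
  have /andP[h1 _] := HC x y y12 h d1.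
  by rewrite ler_pdivrMl// in h1.
by have /andP[] := HC y x x12 h d2.
Qed.

(** [A11] at equal norms; it takes the place of evenness of [nu], which is not assumed pointwise. *)
Lemma kappa_opp : exists2 C : R, 1 <= C & forall x, kappa (- x) <= C * kappa x.
Proof.
have [C C1 HC] := A11 h12.
exists C => // x; rewrite /kappa enormN; case: ifP => h; last by rewrite mulr1.
by have := HC (- x) x h; rewrite enormN lexx lerDl ler01 => /(_ isT isT) /andP[].
Qed.

(** Boxes rather than balls, their Lebesgue measure being a product of lengths. *)
Definition box (y : Rd) (a : R) : set Rd := [set z | forall i, `]y ord0 i - a, y ord0 i + a[%classic (z ord0 i)].

Lemma lebesgue_box y a : 0 < a -> leb (box y a) = ((a *+ 2) ^+ d)%:E.
Proof.
move=> a0; rewrite /box (@lebesgue_rV_box R d (fun i => `]y ord0 i - a, y ord0 i + a[%classic))//; last first.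
rewrite (eq_bigr (fun=> (a *+ 2)%:E)) => [|i _]; last first.
  rewrite lebesgue_measure_itv/= lte_fin ltrD2l gtrN// -EFinD; congr EFin; rewrite mulr2n; ring.
by elim: {+}d => [|n IH]; rewrite ?big_ord0// big_ord_recl IH exprS EFinM.
Qed.

Lemma measurable_box y a : measurable (box y a).
Proof.
rewrite (_ : box y a = \bigcap_(i : 'I_d) [set z | `]y ord0 i - a, y ord0 i + a[%classic (z ord0 i)]).
  apply: fin_bigcap_measurable => [|i _]; first exact: finite_finset.
  by rewrite -[X in measurable X]setTI; exact: (@measurable_coord R 1 d ord0 i measurableT _ (measurable_itv _)).
by apply/seteqP; split => z /= H; [move=> i _; exact: H|move=> i; exact: H].
Qed.

Lemma box_near y z : enorm (z - y) < 1 -> box y 1 z.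
Proof.
move=> h i; rewrite /= in_itv/= -ltr_distl; apply: le_lt_trans h.
by apply: le_trans (coord_le_enorm _ i); rewrite !mxE.
Qed.

(** For [|y| < 1], [kappa] is bounded and [nu] has finite mass on [far a]. For [|y| >= 1] there are
    three regions: [|z| <= 1], where [kappa (y - z)] is comparable with [kappa y]; [|z - y| <= 1/2],
    where [nu z] is, on a set of finite volume; and the rest, where [A13] applies. *)
Lemma kappa_conv (a : R) : 0 < a -> exists2 C : R, 0 <= C &
  forall y, (\int[leb]_(z in far a) (kappa (y - z) * nu z)%:E <= (C * kappa y)%:E)%E.
Proof.
move=> a0.
have [K K1 HK] := kappa_bounded; have [k /andP[k0 k1] Hk] := kappa_lower.
have [C C1 HC] := kappa_near; have [C3 C31 HC3] := A13.
have [K0 C0 C30] : [/\ 0 < K, 0 < C & 0 < C3] by split; apply: lt_le_trans ltr01 _.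
have nf := nu_far_finite a0; have n0 : (0 <= \int[leb]_(z in far a) (nu z)%:E)%E.
  by apply: integral_ge0 => z /= az; rewrite lee_fin ltW// (nu_far a0).
pose N := fine (\int[leb]_(z in far a) (nu z)%:E).
have NE : (\int[leb]_(z in far a) (nu z)%:E = N%:E)%E by rewrite fineK// ge0_fin_numE.
have N0 : 0 <= N by exact: fine_ge0.
have kp z := ltW (kappa_gt0 z).
have p1 : 0 <= K / k * N by rewrite mulr_ge0// divr_ge0// ltW.
have p2 : 0 <= C * N by rewrite mulr_ge0// ltW.
have p3 : 0 <= K * C * 2 ^+ d by rewrite mulr_ge0 ?exprn_ge0// mulr_ge0// ltW.
exists (K / k * N + C * N + K * C * (2 ^+ d) + C3).
  by rewrite !addr_ge0// ltW.
move=> y; have kky := mulr_ge0 (mulr_ge0 (mulr_ge0 (ltW K0) (ltW C0)) (exprn_ge0 d (ler0n R 2))) (kp y).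
have mn : measurable_fun setT (fun z => (nu z)%:E) by exact/measurable_EFinP.
have [y1|y1] := ltP (enorm y) 1.
  apply: (@le_trans _ _ (\int[leb]_(z in far a) (K%:E * (nu z)%:E))%E).
    apply: ge0_le_integralP => z az; have nz := ltW (nu_far a0 az).
      by rewrite lee_fin mulr_ge0.
    by rewrite -EFinM lee_fin ler_wpM2r.
  rewrite ge0_integralZl//; last 4 first.
  - exact: measurable_far.
  - exact: measurable_funTS.
  - by move=> z az; rewrite lee_fin ltW// (nu_far a0).
  - by rewrite lee_fin ltW.
  rewrite NE -EFinM lee_fin; apply: (@le_trans _ _ (K / k * N * kappa y)).
    have : K * N * k <= K * N * kappa y.
      by rewrite ler_wpM2l ?mulr_ge0 ?(ltW K0)// Hk//; lra.
    by rewrite (_ : K / k * N * kappa y = (K * N * kappa y) / k); [rewrite ler_pdivlMr|ring].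
  by rewrite ler_wpM2r// -!addrA lerDl !addr_ge0// ltW.
have far2 z : 1 / 2 < enorm (z - y) -> 1 / 2 <= enorm (y - z).
  by rewrite -enormN opprB => /ltW.
pose S : set Rd := [set z | (1 / 2 < enorm (z - y))%R /\ (1 / 2 < enorm (z - 0))%R].
have mS : measurable S.
  have me (b : Rd) : measurable_fun setT (fun z : Rd => enorm (z - b)).
    apply: (measurableT_comp (@measurable_enorm R d)).
    by apply: measurable_funB_rV.
  apply: measurableI; rewrite -[X in measurable X]setTI;
    exact: measurable_fun_ltr.
pose G1 (z : Rd) : \bar R := ((C * kappa y)%:E * ((nu z)%:E * (\1_(far a) z)%:E))%E.
pose G2 (z : Rd) : \bar R := ((K * C * kappa y) * \1_(box y 1) z)%:E.
pose G3 (z : Rd) : \bar R := ((nu (y - z) * nu (z - 0)) * \1_S z)%:E.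
have mG1 : measurable_fun setT (fun z => (nu z)%:E * (\1_(far a) z)%:E)%E.
  apply: emeasurable_funM => //; apply/measurable_EFinP; apply: measurable_indic.
  exact: measurable_far.
have G10 z : (0 <= (nu z)%:E * (\1_(far a) z)%:E)%E.
  rewrite -EFinM lee_fin indicE; case: (boolP (_ \in _)) => [/set_mem az|_]; last by rewrite mulr0.
  by rewrite mulr1 ltW// (nu_far a0).
have mG2 : measurable_fun setT G2.
  apply/measurable_EFinP; apply: measurable_funM => //; apply: measurable_indic; exact: measurable_box.
have mG3 : measurable_fun setT G3.
  apply/measurable_EFinP; apply: measurable_funM; last exact: measurable_indic.
  apply: measurable_funM; apply: (measurableT_comp mnu); exact: measurable_funB_rV.
have G20 z : (0 <= G2 z)%E by rewrite lee_fin mulr_ge0// !mulr_ge0// ltW.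
have G30 z : (0 <= G3 z)%E.
  rewrite lee_fin indicE; case: (boolP (_ \in _)) => [/set_mem [h1 h2]|_]; last by rewrite mulr0.
  rewrite mulr1 mulr_ge0// ltW// (nu_far (a := 1 / 2))//; [exact: far2|exact: ltW].
have C1k0 : (0 <= (C * kappa y)%:E)%E by rewrite lee_fin mulr_ge0// ltW.
apply: (@le_trans _ _ (\int[leb]_z (G1 z + (G2 z + G3 z)))%E).
  rewrite integral_mkcond; apply: ge0_le_integralP => z _.
    rewrite patchE; case: ifPn => // /set_mem az.
    by rewrite lee_fin mulr_ge0// ltW// (nu_far a0).
  rewrite patchE; case: ifPn => [|_]; last first.
    by apply: adde_ge0; [rewrite mule_ge0|exact: adde_ge0].
  move=> /set_mem az; have nz := ltW (nu_far a0 az).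
  have [z1|z1] := leP (enorm z) 1.
    apply: (@le_trans _ _ (G1 z)); last by rewrite leeDl// adde_ge0.
    rewrite /G1 indicE mem_set// mule1 -EFinM lee_fin ler_wpM2r// HC//.
    by rewrite opprB addrC subrK.
  have [zy|zy] := leP (enorm (z - y)) (1 / 2).
    apply: (@le_trans _ _ (G2 z)); last first.
      by rewrite addeCA leeDl// adde_ge0// mule_ge0.
    rewrite /G2 indicE mem_set; last by apply: box_near; lra.
    rewrite mulr1 lee_fin -mulrA ler_pM//; rewrite -[nu z]kappa_nu; last by lra.
    by apply: HC; rewrite -enormN opprB; lra.
  apply: (@le_trans _ _ (G3 z)); last first.
    by rewrite addeA leeDr// adde_ge0// mule_ge0.
  rewrite /G3 indicE mem_set; last by split => //; rewrite subr0; lra.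
  by rewrite mulr1 subr0 kappa_nu// far2.
rewrite ge0_integralD//; last 4 first.
- by move=> z _; rewrite mule_ge0.
- by apply: emeasurable_funM.
- by move=> z _; exact: adde_ge0.
- exact: emeasurable_funD.
rewrite ge0_integralD// ge0_integralZl//.
have -> : (\int[leb]_z ((nu z)%:E * (\1_(far a) z)%:E) = N%:E)%E.
  rewrite -NE [RHS]integral_mkcond; apply: eq_integral => z _.
  by rewrite patchE indicE; case: ifP => _; rewrite ?mule1 ?mule0.
have -> : (\int[leb]_z G2 z = (K * C * kappa y)%:E * ((1 *+ 2) ^+ d)%:E)%E.
  rewrite /G2; under eq_integral do rewrite EFinM.
  rewrite ge0_integralZl//; last 2 first.
  - by apply/measurable_EFinP; apply: measurable_indic; exact: measurable_box.
  - by rewrite lee_fin mulr_ge0// mulr_ge0// ltW.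
  rewrite integral_indic//; last exact: measurable_box.
  by congr (_ * _)%E; rewrite setIT; exact: lebesgue_box.
have h3 : (\int[leb]_z G3 z <= (C3 * kappa y)%:E)%E.
  rewrite (kappa_nu (z := y)); last by lra.
  have := HC3 y 0; rewrite sub0r enormN subr0 => /(_ y1); apply: le_trans.
  rewrite [leRHS]integral_mkcond; apply: ge0_le_integralP => z _ //.
  rewrite patchE /G3 indicE; case: ifP => _; rewrite ?mulr1 ?mulr0//.
rewrite -!EFinM; apply: (@le_trans _ _ ((C * kappa y * N)%:E + ((K * C * kappa y * (1 *+ 2) ^+ d)%:E + (C3 * kappa y)%:E))%E).
  by rewrite leeD2l// leeD2l.
rewrite -!EFinD lee_fin.
have := mulr_ge0 p1 (kp y).
by rewrite !mulrDl; lra.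
Qed.

End levy_density.

(** * Bounds of the ground state *)

(** Small-time means at [y] converge to a limit that depends on [y] and is at most [c]; their
    maximum with [c] still dominates them and converges to [c] itself, as [dynkin] demands. The
    minimum serves [levy_system_lower] in the same way. *)
Lemma cvg_max_cst (R : realType) (u : nat -> R) (l c : R) : u n @[n --> \oo] --> l -> l <= c ->
  Num.max c (u n) @[n --> \oo] --> c.
Proof.
move=> ul lc; apply/cvgrPdist_le => e e0; move/cvgrPdist_le : ul => /(_ e e0).
apply: filterS => n; rewrite ler_norml => /andP[h1 h2].
rewrite distrC ger0_norm ?subr_ge0 ?le_max ?lexx//.
by rewrite lerBlDl ge_max; apply/andP; split; lra.
Qed.

Lemma cvg_min_cst (R : realType) (u : nat -> R) (l c : R) : u n @[n --> \oo] --> l -> c <= l ->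
  Num.min c (u n) @[n --> \oo] --> c.
Proof.
move=> ul lc; apply/cvgrPdist_le => e e0; move/cvgrPdist_le : ul => /(_ e e0).
apply: filterS => n; rewrite ler_norml => /andP[h1 h2].
rewrite ger0_norm ?subr_ge0 ?ge_min ?lexx//.
by rewrite lerBlDl -lerBlDr le_min; apply/andP; split; lra.
Qed.

Section ground_state_estimates.
Context (disp : measure_display) (Omega : measurableType disp) (R : realType).
Context (d : nat) (P : probability Omega R) (X : R -> Omega -> 'rV[R]_d).
Local Notation Rd := 'rV[R]_d.
Local Notation leb := (lebesgue_rV R d).
Hypothesis norm_levy : normalized_levy P X.
Let mX t : measurable_fun setT (X t). Proof. exact: measurable_Xt norm_levy t. Qed.

Variables (M : {measure set Rd -> \bar R}) (A : 'M[R]_d).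
Hypothesis M_fin : (\int[M]_z (trunc_sq z)%:E < +oo)%E.
Hypothesis A_pos : forall xi, 0 <= dotv (xi *m A) xi.
Hypothesis Ecos : forall (t : R) (xi : Rd), 0 <= t ->
  \int[P]_w cos (dotv xi (X t w)) = expR (- (t * levy_symbol M A xi)).
Hypothesis Esin : forall (t : R) (xi : Rd), 0 <= t -> \int[P]_w sin (dotv xi (X t w)) = 0.

Variable nu : Rd -> R.
Hypothesis d_gt0 : (0 < d)%N.
Hypothesis mnu : measurable_fun setT nu.
Hypothesis nu_gt0 : forall z, z != 0 -> 0 < nu z.
Hypothesis M0 : M [set 0] = 0%E.
Hypothesis Mnu : forall A, measurable A -> M A = (\int[leb]_(x in A) (nu x)%:E)%E.
Hypothesis A11 : forall r : R, 0 < r <= 1 / 2 -> exists2 C1 : R, 1 <= C1 &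
  forall x y, r <= enorm y -> enorm y <= enorm x ->
    enorm x <= enorm y + 1 -> C1^-1 * nu y <= nu x <= C1 * nu y.
Hypothesis A12 : exists2 C2 : R, 1 <= C2 &
  forall x y, 1 / 2 <= enorm y -> enorm y <= enorm x -> nu x <= C2 * nu y.
Hypothesis A13 : exists2 C3 : R, 1 <= C3 & forall x y, 1 <= enorm (y - x) ->
  (\int[leb]_(z in [set z | (1 / 2 < enorm (z - x))%R /\ (1 / 2 < enorm (z - y))%R])
    (nu (x - z) * nu (z - y))%:E <= (C3 * nu (x - y))%:E)%E.

Variables (Up Um phi : Rd -> R) (Mp T beta : R).
Hypotheses (mUp : measurable_fun setT Up) (Up0 : forall x, 0 <= Up x).
Hypotheses (mUm : measurable_fun setT Um) (Um0 : forall x, 0 <= Um x).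
Hypotheses (cphi : continuous phi) (phi_gt0 : forall x, 0 < phi x) (phiM : forall x, phi x <= Mp).
Hypotheses (T_gt0 : 0 < T) (kato : forall y, (\int[P]_w XI X Um y (T + T) w <= (1 / 2)%:E)%E).
Hypothesis kato_loc : forall k y, (\int[P]_w XI X (cut Up k) y (T + T) w < +oo)%E.
Hypothesis abs_cont : forall t (N : set Rd), 0 < t -> measurable N ->
  lebesgue_rV R d N = 0%E -> forall x, P [set w | N (x + X t w)] = 0%E.
Hypothesis eig_ae : forall t, 0 < t -> {ae lebesgue_rV R d, forall x,
  (\int[P]_w (Wt X Up Um x t w * (phi (x + X t w))%:E) = (phi x)%:E)%E}.
Hypothesis beta0 : 0 < beta.
Hypothesis confine : forall K : R, exists r : R, forall x, r <= enorm x -> K <= Up x /\ Um x = 0.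

Local Notation Q := (fun y => Up y + beta).
Local Notation G rho x := (kgreen P X Up beta rho T x).
Local Notation tau rho := (exit_at X rho T).
Local Notation h n := (T / n.+1%:R).
Local Notation I := (scaled_mean P X T).
Let phi0 x : 0 <= phi x. Proof. exact: ltW. Qed.
Let h0 n : 0 < h n. Proof. by rewrite divr_gt0. Qed.
Let TT0 : 0 < T + T. Proof. by rewrite addr_gt0. Qed.
Let Mp_gt0 : 0 < Mp. Proof. exact: lt_le_trans (phi_gt0 0) (phiM 0). Qed.
Lemma in_ball rho x w t : t < tau rho w -> 0 <= t -> enorm (x + X t w - x) <= rho.
Proof.
by move=> tt t0; rewrite addrAC subrr add0r; exact: (before_exit norm_levy (ltW T_gt0) t0 tt).
Qed.

(** Before the exit the path stays in the closed ball, where [Um] vanishes, so the weight is that of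
    the nonnegative potential [Up + beta]. *)
Lemma bw_outside rho x u w : (forall y, enorm (y - x) <= rho -> Um y = 0) ->
  0 <= u -> u <= tau rho w ->
  (bw X Up Um phi beta x u w = killed X Q x u w * (phi (x + X u w))%:E)%E.
Proof.
move=> Umx u0 ut.
have e : XI X Um x u w = 0%E.
  rewrite /XI -integral_itv_bndo_bndc; last first.
    exact: measurable_funTS (measurable_gX norm_levy mUm x w).
  apply: integral0_eq => v /=; rewrite in_itv/= => /andP[v0 vu].
  by rewrite Umx//; apply: in_ball => //; exact: lt_le_trans ut.
rewrite -(bw_killed norm_levy mUp Up0 beta0 phi x w u0).
by rewrite /bw /Wt e (XI0 X).
Qed.

Lemma local_identity rho x : (forall y, enorm (y - x) <= rho -> Um y = 0) ->
  ((phi x)%:E = beta%:E * \int[P]_w \int[@lebesgue_measure R]_(u in `[0%R, tau rho w])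
       (killed X Q x u w * (phi (x + X u w))%:E) +
     \int[P]_w (killed X Q x (tau rho w) w * (phi (x + X (tau rho w) w))%:E))%E.
Proof.
move=> Umx.
rewrite (exit_identity norm_levy mUp Up0 mUm Um0 cphi phi0 phiM TT0 kato kato_loc abs_cont
  eig_ae beta0 rho T_gt0 T_gt0 (lexx _) x) /occupation.
have t0 w : 0 <= tau rho w by exact/exitT_ge0/ltW.
apply: (f_equal2 adde); last by apply: eq_integral => w _; exact: (bw_outside Umx).
apply: (f_equal2 mule); first by [].
apply: eq_integral => w _; apply: eq_integral => u.
by rewrite inE/= in_itv/= => /andP[u0 ut]; exact: (bw_outside Umx).
Qed.

Lemma Kop_scaled n (f : Rd -> R) (K : R) (y : Rd) : measurable_fun setT f -> (forall z, `|f z| <= K) ->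
  Kop P X (h n) f y = (h n * I n (fun z => f (y + z)))%:E.
Proof.
move=> mf fK; rewrite /scaled_mean mulrA mulfV ?gt_eqF// mul1r /Kop fineK//.
apply: integrable_fin_num => //; apply: measurable_bounded_integrable => //.
- by rewrite (le_lt_trans (probability_le1 P measurableT))// ltry.
- by apply: (measurableT_comp mf); exact: (measurable_addX norm_levy).
by exists K; split; [exact: num_real|move=> L KL w _; exact: le_trans (fK _) (ltW KL)].
Qed.

Lemma measurable_scaled n (f : Rd -> R) : measurable_fun setT f -> (forall z, 0 <= f z) ->
  measurable_fun setT (fun y : Rd => I n (fun z => f (y + z))).
Proof.
move=> mf f0.
rewrite (_ : (fun _ => _) = fun y : Rd => (h n)^-1 * fine (Kop P X (h n) f y))//.
apply: measurable_funM => //.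
exact: (measurableT_comp (fine_measurable measurableT) (measurable_Kop norm_levy (h n) mf f0)).
Qed.

Lemma scaled_ge0 n (f : Rd -> R) : (forall z, 0 <= f z) -> 0 <= I n f.
Proof.
by move=> f0; rewrite mulr_ge0 ?invr_ge0 ?(ltW (h0 n))//; apply: Rintegral_ge0.
Qed.

Lemma continuous_shift_rV (f : Rd -> R) (y : Rd) : continuous f -> continuous (fun z => f (y + z)).
Proof.
move=> cf z; apply: (@cvg_continuous_rV R d f Rd (nbhs z) (nbhs_filter z) (fun z => y + z)) => //.
by apply: (@cvg_addl_rV R d Rd (nbhs z) (nbhs_filter z)); exact: cvg_id.
Qed.

Lemma vague_at (f : Rd -> R) (K r : R) (y : Rd) : continuous f -> (forall z, `|f z| <= K) -> 0 < r ->
  (forall z, enorm z <= r -> f (y + z) = 0) ->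
  I n (fun z => f (y + z)) @[n --> \oo] --> levy_mean M (fun z => f (y + z)).
Proof.
move=> cf fK r0 fz.
by have [_] := vague_convergence mX M_fin A_pos Ecos Esin T_gt0 (@continuous_shift_rV f y cf) (fun z => fK (y + z)) r0 fz.
Qed.

Lemma levy_mean_leb (f : Rd -> R) (K r : R) : measurable_fun setT f -> (forall z, 0 <= f z) ->
  (forall z, f z <= K) -> 0 < r -> (forall z, enorm z <= r -> f z = 0) ->
  (levy_mean M f)%:E = (\int[leb]_z ((even_part f z) * nu z)%:E)%E.
Proof.
move=> mf f0 fK r0 fz.
have df : dominated f.
  apply: (dominated_vanishing (K := K) r0) => // z.
  by rewrite ger0_norm.
have [me _] := dominated_even df.
rewrite /levy_mean /Rintegral fineK; last first.
  exact: (integrable_fin_num measurableT (dominated_integrable M_fin (dominated_even df))).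
rewrite (levy_integral mnu nu_gt0 M0 Mnu); first by apply: eq_integral => z _; rewrite EFinM.
- exact/measurable_EFinP.
- by move=> z; rewrite lee_fin /even_part divr_ge0// addr_ge0.
- by rewrite /even_part oppr0 fz ?enorm0 ?(ltW r0)// addr0 mul0r.
Qed.

(** A continuous minorant of [phi] that vanishes off the unit ball and is positive at 0: the target
    of long jumps in the lower bound. *)
Definition bump (z : Rd) : R := Num.min (phi z) (Num.max 0 (1 - enorm z)).

Lemma continuous_bump : continuous bump.
Proof.
move=> z; have ce := @continuous_enorm R d z.
have c1 : {for z, continuous (fun z : Rd => 1 - enorm z)}.
  by apply: (@cvgB _ _ _ (nbhs z)); [exact: cvg_cst|exact: ce].
have c2 := @continuous_max R Rd (fun=> 0) (fun z : Rd => 1 - enorm z) z (cvg_cst (0 : R)) c1.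
have cp : {for z, continuous phi} := @cphi z.
have c3 : {for z, continuous (fun y : Rd => Num.max 0 (1 - enorm y))} by exact: (c2 (nbhs_filter z)).
have H := @continuous_min R Rd phi _ z cp c3.
exact: H.
Qed.

Theorem ground_state_lower : exists c r : R, [/\ 0 < c, 0 < r & forall x, r <= enorm x ->
  (c%:E * G 1 x * (nu x)%:E <= (phi x)%:E)%E].
Proof.
have b_ge0 z : 0 <= bump z by rewrite le_min phi0 le_max lexx.
have b_le1 z : bump z <= 1.
  by rewrite ge_min ge_max ler01 lerBlDr lerDl enorm_ge0 orbT.
have b_phi z : bump z <= phi z by rewrite ge_min lexx.
have b_far z : 1 <= enorm z -> bump z = 0.
  move=> z1; apply/eqP; rewrite eq_le b_ge0 andbT ge_min; apply/orP; right.
  by rewrite ge_max lexx subr_le0.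
have b_norm z : `|bump z| <= 1 by rewrite ger0_norm.
have mb : measurable_fun setT bump by exact: continuous_measurable_rV continuous_bump.
have b0 : 0 < bump 0 by rewrite lt_min phi_gt0 lt_max enorm0 subr0 ltr01 orbT.
have [dl dl0 Hdl] := uniform_continuity_box 1 continuous_bump (divr_gt0 b0 (ltr0n R 2)).
have b_near (v : Rd) : (forall i, `|v ord0 i| < dl) -> bump 0 / 2 <= bump v.
  move=> vd; have := Hdl 0 v.
  have h1 i : `|(0 : Rd) ord0 i| <= 1 by rewrite mxE normr0.
  have h2 i : `|v ord0 i - (0 : Rd) ord0 i| < dl by rewrite mxE subr0.
  by move=> /(_ h1 h2); rewrite ler_norml => /andP[]; lra.
have [C C1 HC] := kappa_near d_gt0 nu_gt0 A11 A12.
have [C' C'1 HC'] := kappa_opp A11.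
have C0 : 0 < C by exact: lt_le_trans C1.
(* The cube of half-side [a] about [y] lies in the closed unit ball about [y], and [bump (y - z)]
   stays above [bump 0 / 2] on it. *)
pose a := Num.min dl (1 / d%:R).
have dR : 0 < d%:R :> R by rewrite ltr0n.
have a0 : 0 < a by rewrite lt_min dl0 divr_gt0.
(* The divisor 4 is 2 from the even part times 2 from [b_near]; [C ^+ 2] pays for the passage from
   [nu x] to [nu z] through [y]; the last factor is the volume of the cube. *)
pose c := bump 0 / 4 * (C ^+ 2)^-1 * (a *+ 2) ^+ d.
have c0 : 0 < c.
  by rewrite mulr_gt0 ?exprn_gt0 ?pmulrn_lgt0// mulr_gt0 ?invr_gt0 ?exprn_gt0// divr_gt0.
have [r Hr] := confine 0.
(* With [|x| >= 3] a point [y] of the ball has [|y| >= 2] and a point [z] of the cube about it has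
   [|z| >= 1], so [kappa] is [nu] there; [r + 1] makes [Um] vanish on the ball. *)
exists c, (Num.max 3 (r + 1)); split => //; first by rewrite lt_max ltr0n.
move=> x; rewrite ge_max => /andP[x3 xr].
have far_ball y : enorm (y - x) <= 1 -> enorm x - 1 <= enorm y.
  move=> yx; have : enorm x <= enorm (y - x) + enorm y.
    have {1}-> : x = - (y - x) + y by rewrite opprB subrK.
    by apply: le_trans (enormD _ _) _; rewrite enormN.
  lra.
have Umx y : enorm (y - x) <= 1 -> Um y = 0.
  by move=> /far_ball h; have [] := Hr y; lra.
have vz y : enorm (y - x) <= 1 -> forall z, enorm z <= 1 / 2 -> bump (y + z) = 0.
  move=> /far_ball hy z hz; apply: b_far.
  have : enorm y <= enorm (y + z) + enorm z.
    have {1}-> : y = (y + z) + - z by rewrite addrK.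
    by apply: le_trans (enormD _ _) _; rewrite enormN.
  lra.
have h12 : 0 < 1 / 2 :> R by rewrite divr_gt0.
have Nlow y : enorm (y - x) <= 1 -> c * nu x <= levy_mean M (fun z => bump (y + z)).
  move=> yx; have hy := far_ball y yx.
  have mby : measurable_fun setT (fun z => bump (y + z)).
    by apply: (measurableT_comp mb); exact: measurable_funD_rV.
  rewrite -lee_fin (levy_mean_leb mby (fun z => b_ge0 (y + z)) (fun z => b_le1 (y + z)) h12 (vz y yx)).
  have nux : kappa nu x = nu x by rewrite kappa_nu//; lra.
  apply: (@le_trans _ _ (\int[leb]_(z in box y a) (bump 0 / 4 * (C ^+ 2)^-1 * nu x)%:E)%E).
    rewrite integral_cst; last exact: measurable_box.
    rewrite [X in (_ <= _ * X)%E](_ : _ = ((a *+ 2) ^+ d)%:E); last exact: lebesgue_box.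
    by rewrite -EFinM lee_fin le_eqVlt; apply/orP; left; apply/eqP; rewrite /c; ring.
  have n0 z : enorm z <= 1 / 2 \/ 0 <= nu z.
    have [|/ltW h] := leP (enorm z) (1 / 2); [by left|right].
    exact/ltW/(nu_far nu_gt0 h12 h).
  have pos z : 0 <= even_part (fun z0 => bump (y + z0)) z * nu z.
    case: (n0 z) => [h|h]; last by rewrite mulr_ge0// divr_ge0// addr_ge0.
    by rewrite /even_part !vz ?enormN// addr0 !mul0r.
  rewrite integral_mkcond; apply: ge0_le_integralP => z _; rewrite patchE.
  - case: ifPn => // _; rewrite lee_fin -nux mulr_ge0 ?(ltW (kappa_gt0 nu_gt0 _))//.
    by rewrite mulr_ge0 ?invr_ge0 ?sqr_ge0// divr_ge0.
  - case: ifPn => [/set_mem bz|_]; last by rewrite lee_fin; exact: pos.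
    have yz i : `|y ord0 i - z ord0 i| < a.
      by rewrite distrC ltr_distl; have := bz i; rewrite /= in_itv.
    have yz1 : enorm (y - z) <= 1.
      apply: le_trans (enorm_le_sum _) _.
      apply: (@le_trans _ _ (\sum_(i < d) 1 / d%:R)); last first.
        by rewrite sumr_const card_ord -[leLHS]mulr_natr divfK// gt_eqF.
      apply: ler_sum => i _; rewrite !mxE; apply: le_trans (ltW (yz i)) _.
      by rewrite /a ge_min lexx orbT.
    rewrite lee_fin.
    have hz : 1 / 2 <= enorm z.
      have : enorm y <= enorm (y - z) + enorm z by have {1}-> : y = (y - z) + z by [rewrite subrK]; exact: enormD.
      lra.
    have nz : nu x <= C ^+ 2 * nu z.
      rewrite -nux -(kappa_nu nu hz) expr2 -mulrA.
      apply: le_trans (HC y x yx) _; rewrite ler_pM2l//.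
      by apply: HC; rewrite -enormN opprB.
    have nz0 : 0 <= nu z by exact/ltW/(nu_far nu_gt0 h12 hz).
    apply: (@le_trans _ _ (bump 0 / 4 * nu z)).
      rewrite -mulrA ler_wpM2l//; first by rewrite divr_ge0.
      by rewrite ler_pdivrMl ?exprn_gt0.
    rewrite ler_wpM2r// /even_part.
    have : bump 0 / 2 <= bump (y - z).
      apply: b_near => i; rewrite !mxE; apply: lt_le_trans (yz i) _.
      by rewrite /a ge_min lexx.
    by have := b_ge0 (y + z); lra.
have nux0 : 0 <= nu x by apply/ltW/(nu_far nu_gt0 h12); lra.
pose g n y : \bar R := (Num.min (c * nu x) (I n (fun z => bump (y + z))))%:E.
have key : ((c * nu x)%:E * G 1 x <=
    \int[P]_w (killed X Q x (tau 1 w) w * (bump (x + X (tau 1 w) w))%:E))%E.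
  apply: (@levy_system_lower _ _ _ _ _ _ norm_levy Up beta 1 T T mUp Up0 beta0 T_gt0 T_gt0
     bump 1 x continuous_bump b_ge0 b_le1 ler01 ltr01 (c * nu x) g (c * nu x) ler01).
  - move=> y yx; have := vz y yx 0; rewrite addr0 enorm0; apply; exact: ltW.
  - move=> n; apply/measurable_EFinP; apply: measurable_minr => //; exact: measurable_scaled.
  - by move=> n y; rewrite lee_fin le_min mulr_ge0 ?(ltW c0)//= scaled_ge0.
  - by move=> n y _; rewrite lee_fin ge_min lexx.
  - move=> y yx; apply: cvg_EFin; first exact: nearW.
    apply: (cvg_min_cst _ (Nlow y yx)).
    exact: (vague_at continuous_bump b_norm h12 (vz y yx)).
  - move=> n y yx; rewrite (Kop_scaled n y mb b_norm) -EFinM lee_fin ler_pM2l//.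
    by rewrite ge_min lexx orbT.
rewrite muleAC -EFinM; apply: (le_trans key).
rewrite [leRHS](local_identity Umx); apply: (@le_trans _ _ (\int[P]_w (killed X Q x (tau 1 w) w * (phi (x + X (tau 1 w) w))%:E))%E).
  apply: ge0_le_integralP => w _; first by rewrite mule_ge0 ?killed_ge0 ?lee_fin.
  by apply: lee_wpmul2l; [exact: killed_ge0|rewrite lee_fin].
apply: leeDr; apply: mule_ge0; first by rewrite lee_fin ltW.
by apply: integral_ge0 => w _; apply: integral_ge0 => u _; rewrite mule_ge0 ?killed_ge0 ?lee_fin.
Qed.

(** * Upper bound of the ground state *)

Lemma one_sub_cos_lower (u : R) : `|u| <= 1 -> u ^+ 2 / 4 <= 1 - cos u.
Proof.
move=> u1; rewrite one_sub_cosE; set v := u / 2.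
have -> : u ^+ 2 / 4 = v ^+ 2 by rewrite /v; field.
have v2 : `|v| <= 1 / 2 by rewrite /v normrM (ger0_norm (_ : 0 <= 2^-1))//; lra.
have v0 := normr_ge0 v.
have h3 : `|v| ^+ 3 <= `|v| / 4.
  rewrite exprS mulrC [leRHS]mulrC ler_wpM2r//.
  have -> : 4^-1 = (1 / 2 : R) ^+ 2 by field.
  by rewrite lerXn2r ?nnegrE// divr_ge0.
have hs : 3 / 4 * `|v| <= `|sin v|.
  have := sub_sin_le v; have := lerB_dist v (sin v); lra.
have : (3 / 4 * `|v|) ^+ 2 <= `|sin v| ^+ 2.
  by rewrite lerXn2r ?nnegrE// mulr_ge0.
rewrite exprMn !real_normK ?num_real// => h.
have := sqr_ge0 v; lra.
Qed.

(* A bounded smooth substitute for [|z - x|^2], whose mean under the process is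
   explicit. *)
Definition cosine_gap (x z : Rd) : R := \sum_(i < d) (1 - cos ((z - x) ord0 i)).

Lemma cosine_gap_lower x z : enorm (z - x) <= 1 -> enorm (z - x) ^+ 2 / 4 <= cosine_gap x z.
Proof.
move=> zx; rewrite enorm_sqr /dotv mulr_suml; apply: ler_sum => i _.
by apply: one_sub_cos_lower; apply: le_trans (coord_le_enorm _ _) zx.
Qed.

Lemma integrable_trig (f : R -> R) (xi : Rd) t : continuous f -> (forall u, `|f u| <= 1) -> 
  P.-integrable setT (EFin \o (fun w => f (dotv xi (X t w)))).
Proof.
move=> cf f1; apply: measurable_bounded_integrable => //.
- by rewrite (le_lt_trans (probability_le1 P measurableT))// ltry.
- apply: (measurableT_comp (f := f)); first exact: continuous_measurable_fun.
  exact: (measurableT_comp (measurable_dotv xi) (mX t)).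
by exists 1; split; [exact: num_real|move=> L L1 w _; exact: le_trans (f1 _) (ltW L1)].
Qed.

(** After expansion of [cos (a + u)] the sine term has mean 0, and what remains is [cos a] times
    [1 - exp(-h psi)], at most [h psi]. *)
Lemma Kop_one_sub_cos n (x y : Rd) i : 
  (Kop P X (h n) (fun z : Rd => (1 - cos ((z - x) ord0 i))%R) y <=
   (1 - cos ((y - x) ord0 i))%R%:E + (h n)%:E * (levy_symbol M A (delta_mx ord0 i : Rd))%:E)%E.
Proof.
set e := (delta_mx ord0 i : Rd); set a := (y - x) ord0 i.
pose u w := dotv e (X (h n) w).
have ie w : (y + X (h n) w - x) ord0 i = a + u w.
  by rewrite /u -[e]scale1r dotv_delta mul1r /a !mxE addrAC.
have ic := integrable_trig e (h n) (@continuous_cos R) (@cos_max R).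
have is_ := integrable_trig e (h n) (@continuous_sin R) (@sin_max R).
have i1 : P.-integrable setT (EFin \o cst (1 : R)).
  apply: measurable_bounded_integrable; [by []| |exact: measurable_cst|exact: bounded_cst].
  by rewrite (le_lt_trans (probability_le1 P measurableT))// ltry.
have ig : P.-integrable setT (EFin \o (fun w => 1 - cos (u w))).
  exact: (integrableB measurableT i1 ic).
have e1 w : 1 - cos (a + u w) = (1 - cos a) * cst 1 w + (cos a * (1 - cos (u w)) + sin a * sin (u w)).
  by rewrite cosD /=; ring.
have E : \int[P]_w (1 - cos (a + u w)) = (1 - cos a) + cos a * (1 - expR (- (h n * levy_symbol M A e))).
  under eq_Rintegral => w _ do rewrite e1.
  have j1 := integrableZl measurableT (1 - cos a) i1.
  have j2 := integrableZl measurableT (cos a) ig.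
  have j3 := integrableZl measurableT (sin a) is_.
  rewrite (RintegralD measurableT j1 (integrableD measurableT j2 j3)).
  rewrite (RintegralD measurableT j2 j3) (RintegralZl _ measurableT i1) (RintegralZl _ measurableT ig)
    (RintegralZl _ measurableT is_) (Esin e (ltW (h0 n))) (mean_one_sub_cos mX Ecos e (ltW (h0 n))).
  rewrite mulr0 addr0 Rintegral_cst// mul1r [X in fine X](_ : _ = 1%E) ?mulr1//.
  exact: probability_setT.
have q0 : 0 <= h n * levy_symbol M A e by rewrite mulr_ge0 ?(ltW (h0 n))// levy_symbol_ge0.
have := one_sub_expR q0 => /andP[_ q1].
have q2 : 0 <= 1 - expR (- (h n * levy_symbol M A e)) by rewrite subr_ge0 -[leRHS]expR0 ler_expR oppr_le0.
rewrite /Kop; under eq_integral do rewrite ie.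
rewrite [X in (X <= _)%E](_ : _ = (\int[P]_w (1 - cos (a + u w)))%:E); last first.
  rewrite /Rintegral fineK//; apply: integrable_fin_num => //.
  have j := integrableD measurableT (integrableZl measurableT (1 - cos a) i1)
    (integrableD measurableT (integrableZl measurableT (cos a) ig) (integrableZl measurableT (sin a) is_)).
  apply: (@eq_ind _ _ (fun F => P.-integrable setT F) j).
  by apply/funext => w; rewrite /= e1 !EFinD !EFinM.
rewrite E -EFinM -EFinD lee_fin lerD2l.
apply: le_trans q1; rewrite -[leRHS]mul1r; apply: ler_wpM2r => //; exact: cos_le1.
Qed.

Lemma continuous_one_sub_cos (x : Rd) i : continuous (fun z : Rd => 1 - cos ((z - x) ord0 i)).
Proof.
move=> z; apply: (@cvgB _ _ _ (nbhs z)); first exact: cvg_cst.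
apply: (@continuous_comp _ _ _ (fun z : Rd => (z - x) ord0 i) (@cos R)); last exact: continuous_cos.
rewrite (_ : (fun z : Rd => (z - x) ord0 i) = fun z : Rd => z ord0 i - x ord0 i).
  by apply: (@cvgB _ _ _ (nbhs z)); [exact: coord_continuous|exact: cvg_cst].
by apply/funext => z'; rewrite !mxE.
Qed.

(** The bound [levy_symbol] on the increment rate holds for every step and every point, so the
    sequence required by [dynkin] is constant. *)
Lemma exit_one_sub_cos rho x i : 0 <= rho -> 
  (\int[P]_w (killed X Q x (tau rho w) w * (1 - cos ((x + X (tau rho w) w - x) ord0 i))%R%:E) <=
   (levy_symbol M A (delta_mx ord0 i : Rd))%:E * G rho x)%E.
Proof.
move=> r0; set e := (delta_mx ord0 i : Rd).
pose f (z : Rd) : R := 1 - cos ((z - x) ord0 i).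
have cf : continuous f.
  exact: continuous_one_sub_cos.
have f0 z : 0 <= f z by exact: one_sub_cos_ge0.
have f2 z : f z <= 2.
  by have := cos_geN1 ((z - x) ord0 i); rewrite /f; lra.
have s0 := levy_symbol_ge0 M A_pos e.
apply: (@dynkin _ _ _ _ _ _ norm_levy Up beta rho T T mUp Up0 beta0 T_gt0 T_gt0 kato_loc
   f 2 x cf f0 f2 r0 (fun _ => cst (levy_symbol M A e)%:E) (levy_symbol M A e)) => //.
- by rewrite /f subrr mxE cos0 subrr.
- by move=> y _; exact: cvg_cst.
- by move=> n y _; exact: Kop_one_sub_cos.
Qed.

(** The threshold [2/3] is twice [1/3]: from a point of the ball of radius [1/3], a jump of size at
    most [1/3] ends where the cutoff vanishes. *)
Definition cutoff (v : Rd) : R := Num.max 0 (Num.min 1 (3 * enorm v - 2)).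

Lemma cutoff_ge0 v : 0 <= cutoff v. Proof. by rewrite le_max lexx. Qed.

Lemma cutoff_le1 v : cutoff v <= 1.
Proof. by rewrite ge_max ler01 ge_min lexx. Qed.

Lemma cutoff_near v : enorm v <= 2 / 3 -> cutoff v = 0.
Proof.
move=> v3; apply/eqP; rewrite eq_le cutoff_ge0 andbT ge_max lexx ge_min; apply/orP; right; lra.
Qed.

Lemma cutoff_far v : 1 <= enorm v -> cutoff v = 1.
Proof.
move=> v1; apply/eqP; rewrite eq_le cutoff_le1 le_max le_min lexx/=; apply/orP; right; lra.
Qed.

Lemma continuous_cutoff : continuous cutoff.
Proof.
move=> z; have ce := @continuous_enorm R d z.
have c1 : {for z, continuous (fun z : Rd => 3 * enorm z - 2)}.
  apply: (@cvgB _ _ _ (nbhs z)); last exact: cvg_cst.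
  by apply: (@cvgM _ _ (nbhs z)); [exact: cvg_cst|exact: ce].
have c2 := @continuous_min R Rd (fun=> 1) (fun z : Rd => 3 * enorm z - 2) z (cvg_cst (1 : R)) c1.
have c3 : {for z, continuous (fun y : Rd => Num.min 1 (3 * enorm y - 2))} by exact: (c2 (nbhs_filter z)).
have H := @continuous_max R Rd (fun=> 0) _ z (cvg_cst (0 : R)) c3.
exact: (H (nbhs_filter z)).
Qed.

Definition far_phi (x z : Rd) : R := phi z * cutoff (z - x).

Lemma continuous_far_phi x : continuous (far_phi x).
Proof.
move=> z; apply: (@cvgM _ _ (nbhs z)); first exact: cphi.
rewrite (_ : (fun z : Rd => cutoff (z - x)) = fun z : Rd => cutoff (- x + z)); last first.
  by apply/funext => y; rewrite addrC.
have -> : z - x = - x + z by rewrite addrC.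
exact: (@continuous_shift_rV cutoff (- x) continuous_cutoff z).
Qed.

Lemma far_phi_ge0 x z : 0 <= far_phi x z.
Proof. by rewrite mulr_ge0// cutoff_ge0. Qed.

Lemma far_phi_le x z : far_phi x z <= phi z.
Proof. by rewrite -[leRHS]mulr1 ler_wpM2l// cutoff_le1. Qed.

Lemma far_phi_near x y z : enorm (y - x) <= 1 / 3 -> enorm z <= 1 / 3 -> far_phi x (y + z) = 0.
Proof.
move=> yx z3; rewrite /far_phi cutoff_near ?mulr0//.
by rewrite addrAC; apply: le_trans (enormD _ _) _; lra.
Qed.

(** [kappa_conv] handles the term with [y - z]; the one with [y + z] is reflected by [kappa_opp]
    before and after the convolution, whence [C' ^+ 2]. The shift [s] is integrated against the
    finite mass [N]. *)
Lemma far_conv : exists2 C : R, 0 <= C & forall S s y, 0 <= S -> 0 <= s ->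
  (forall z, phi z <= S * (kappa nu z + s)) ->
  (\int[leb]_(z in far (1 / 3)) ((phi (y + z)%R + phi (y - z)%R) / 2 * nu z)%:E <=
   (C * S * (kappa nu y + s))%:E)%E.
Proof.
have r3 : 0 < 1 / 3 :> R by rewrite divr_gt0.
have [Ck Ck0 Hk] := kappa_conv d_gt0 mnu nu_gt0 Mnu M_fin A11 A12 A13 r3.
have [C' C'1 HC'] := kappa_opp A11.
have Nf := nu_far_finite Mnu M_fin r3.
have nf z : far (1 / 3) z -> 0 <= nu z by move=> fz; exact/ltW/(nu_far nu_gt0 r3 fz).
have N0 : (0 <= \int[leb]_(z in far (1 / 3)) (nu z)%:E)%E.
  by apply: integral_ge0 => z fz; rewrite lee_fin nf.
have NE : (\int[leb]_(z in far (1 / 3)) (nu z)%:E =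
    (fine (\int[leb]_(z in far (1 / 3)) (nu z)%:E))%:E)%E by rewrite fineK// ge0_fin_numE.
set N := fine _ in NE; have N0' : 0 <= N by rewrite fine_ge0.
have k0 z : 0 <= kappa nu z by exact/ltW/(kappa_gt0 nu_gt0).
have mk : measurable_fun setT (kappa nu) by exact: measurable_kappa.
exists (C' ^+ 2 * Ck + Ck + N) => [|S s y S0 s0 Hphi].
  by rewrite !addr_ge0// mulr_ge0// sqr_ge0.
have C'0 : 0 <= C' by exact: le_trans C'1.
pose f1 z := kappa nu (- y - z) * nu z.
pose f2 z := kappa nu (y - z) * nu z.
have mf1 : measurable_fun (far (1 / 3)) (EFin \o f1).
  apply/measurable_EFinP; apply: measurable_funM; last exact: measurable_funTS.
  by apply: measurable_funTS; apply: (measurableT_comp mk); exact: measurable_funB_rV.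
have mf2 : measurable_fun (far (1 / 3)) (EFin \o f2).
  apply/measurable_EFinP; apply: measurable_funM; last exact: measurable_funTS.
  by apply: measurable_funTS; apply: (measurableT_comp mk); exact: measurable_funB_rV.
have mn : measurable_fun (far (1 / 3)) (EFin \o nu).
  by apply/measurable_EFinP; exact: measurable_funTS.
have mfar := measurable_far (R := R) (d := d) (1 / 3).
have f10 z : far (1 / 3) z -> (0 <= (f1 z)%:E)%E.
  by move=> fz; rewrite lee_fin mulr_ge0// nf.
have f20 z : far (1 / 3) z -> (0 <= (f2 z)%:E)%E.
  by move=> fz; rewrite lee_fin mulr_ge0// nf.
have n0 z : far (1 / 3) z -> (0 <= (nu z)%:E)%E by move=> fz; rewrite lee_fin nf.
have a0 : 0 <= S / 2 * C' by rewrite mulr_ge0// divr_ge0.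
have b0 : 0 <= S / 2 by rewrite divr_ge0.
have c0 : 0 <= S * s by rewrite mulr_ge0.
apply: (@le_trans _ _ (\int[leb]_(z in far (1 / 3)) ((S / 2 * C')%:E * (f1 z)%:E +
    ((S / 2)%:E * (f2 z)%:E + (S * s)%:E * (nu z)%:E)))%E).
  apply: ge0_le_integralP => z fz; have nz := nf z fz.
    by rewrite lee_fin mulr_ge0// divr_ge0// addr_ge0.
  rewrite -!EFinM -!EFinD lee_fin.
  have h1 := Hphi (y + z); have h2 := Hphi (y - z).
  have h3 : kappa nu (y + z) <= C' * kappa nu (- y - z).
    by have := HC' (- y - z); rewrite opprB opprK addrC.
  have h4 : phi (y + z) <= S * (C' * kappa nu (- y - z) + s).
    by apply: le_trans h1 _; rewrite ler_wpM2l// lerD2r.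
  apply: (@le_trans _ _ ((S * (C' * kappa nu (- y - z) + s) + S * (kappa nu (y - z) + s)) / 2 * nu z)).
    by rewrite ler_wpM2r// ler_wpM2r ?invr_ge0// lerD.
  by rewrite /f1 /f2 le_eqVlt; apply/orP; left; apply/eqP; field.
have i1 := ge0_integralZl_EFin leb mfar f10 mf1 a0.
have i2 := ge0_integralZl_EFin leb mfar f20 mf2 b0.
have i3 := ge0_integralZl_EFin leb mfar n0 mn c0.
rewrite ge0_integralD; [|exact: mfar| | | |]; last 4 first.
- by move=> z fz; apply: mule_ge0; [rewrite lee_fin|exact: f10].
- by apply: emeasurable_funM => //; exact: measurable_cst.
- by move=> z fz; apply: adde_ge0; apply: mule_ge0; rewrite ?lee_fin//; [exact: f20|exact: n0].
- by apply: emeasurable_funD; apply: emeasurable_funM => //; exact: measurable_cst.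
rewrite ge0_integralD; [|exact: mfar| | | |]; last 4 first.
- by move=> z fz; apply: mule_ge0; [rewrite lee_fin|exact: f20].
- by apply: emeasurable_funM => //; exact: measurable_cst.
- by move=> z fz; apply: mule_ge0; [rewrite lee_fin|exact: n0].
- by apply: emeasurable_funM => //; exact: measurable_cst.
rewrite i1 i2 i3 NE.
have e1 : ((S / 2 * C')%:E * \int[leb]_(z in far (1 / 3)) (f1 z)%:E <=
    (S * C' ^+ 2 * Ck * kappa nu y)%:E)%E.
  apply: (@le_trans _ _ ((S / 2 * C')%:E * (Ck * kappa nu (- y))%:E)%E).
    by apply: lee_wpmul2l; [rewrite lee_fin|exact: Hk].
  rewrite -EFinM lee_fin.
  apply: (@le_trans _ _ (S / 2 * C' * (Ck * (C' * kappa nu y)))).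
    by rewrite ler_wpM2l// ler_wpM2l.
  have : 0 <= S * C' ^+ 2 * Ck * kappa nu y by rewrite !mulr_ge0// sqr_ge0.
  set q := S * C' ^+ 2 * Ck * kappa nu y.
  have -> : S / 2 * C' * (Ck * (C' * kappa nu y)) = q / 2 by rewrite /q; field.
  lra.
have e2 : ((S / 2)%:E * \int[leb]_(z in far (1 / 3)) (f2 z)%:E <= (S * Ck * kappa nu y)%:E)%E.
  apply: (@le_trans _ _ ((S / 2)%:E * (Ck * kappa nu y)%:E)%E).
    by apply: lee_wpmul2l; [rewrite lee_fin|exact: Hk].
  rewrite -EFinM lee_fin.
  have : 0 <= S * Ck * kappa nu y by rewrite !mulr_ge0.
  set q := S * Ck * kappa nu y.
  have -> : S / 2 * (Ck * kappa nu y) = q / 2 by rewrite /q; field.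
  lra.
apply: (le_trans (leeD e1 (leeD e2 (lexx _)))).
rewrite -EFinM -!EFinD lee_fin -subr_ge0.
rewrite [leRHS](_ : _ = S * (C' ^+ 2 * Ck * s + Ck * s + N * kappa nu y)); last by ring.
by rewrite mulr_ge0// !addr_ge0// !mulr_ge0// sqr_ge0.
Qed.

(** [dynkin] for [far_phi x]: from inside the ball only jumps longer than [1/3] see this function,
    and their rate against [phi] is bounded by [far_conv]. *)
Lemma exit_far : exists2 C : R, 0 <= C & forall S s x, 0 <= S -> 0 <= s ->
  (forall z, phi z <= S * (kappa nu z + s)) ->
  (\int[P]_w (killed X Q x (tau (1 / 3) w) w * (far_phi x (x + X (tau (1 / 3) w) w))%:E) <=
   (C * S * (kappa nu x + s))%:E * G (1 / 3) x)%E.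
Proof.
have r3 : 0 < 1 / 3 :> R by rewrite divr_gt0.
have [C C0 HC] := far_conv.
have [Cn Cn1 Hn] := kappa_near d_gt0 nu_gt0 A11 A12.
have [Ct HCt] := tail_mean_bounded mX M_fin A_pos Ecos T_gt0 r3.
exists (C * Cn) => [|S s x S0 s0 Hphi].
  by rewrite mulr_ge0// (le_trans _ Cn1).
have k0 z : 0 <= kappa nu z by exact/ltW/(kappa_gt0 nu_gt0).
pose c := C * Cn * S * (kappa nu x + s).
have c0 : 0 <= c by rewrite !mulr_ge0 ?addr_ge0// (le_trans _ Cn1).
have fM z : far_phi x z <= Mp by exact: le_trans (far_phi_le x z) _.
have cf := @continuous_far_phi x.
have mf : measurable_fun setT (far_phi x) by exact: continuous_measurable_rV.
have fN z : `|far_phi x z| <= Mp by rewrite ger0_norm ?far_phi_ge0.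
pose g n y : \bar R := (Num.max c (I n (fun z => far_phi x (y + z))))%:E.
have mfy (y : Rd) : measurable_fun setT (fun z => far_phi x (y + z)).
  by apply: (measurableT_comp mf); exact: measurable_funD_rV.
have fz y : enorm (y - x) <= 1 / 3 -> forall z, enorm z <= 1 / 3 -> far_phi x (y + z) = 0.
  by move=> yx z; exact: far_phi_near.
apply: (@dynkin _ _ _ _ _ _ norm_levy Up beta (1 / 3) T T mUp Up0 beta0 T_gt0 T_gt0 kato_loc
   (far_phi x) Mp x cf (far_phi_ge0 x) fM (ltW r3) g (Num.max c (Mp * Ct)) c).
- by rewrite /far_phi subrr cutoff_near ?mulr0// enorm0 divr_ge0.
- move=> n; apply/measurable_EFinP; apply: measurable_maxr => //.
  by apply: measurable_scaled => //; exact: far_phi_ge0.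
- by move=> n y; rewrite lee_fin le_max c0.
- move=> n y yx; rewrite lee_fin ge_max le_max lexx/= le_max; apply/orP; right.
  apply: (@le_trans _ _ (Mp * I n (tail (1 / 3)))); last by rewrite ler_wpM2l// (ltW Mp_gt0).
  have dt : dominated (tail (R := R) (d := d) (1 / 3)) by exact: dominated_tail.
  rewrite -(scaled_meanZ P mX T n Mp dt).
  apply: (scaled_mean_le P mX T_gt0).
  + by apply: (dominated_vanishing (K := Mp) r3) => //; exact: fz.
  + exact: dominatedZ.
  + move=> z; rewrite /tail; have [h|h] := leP (1 / 3) (enorm z); first by rewrite mulr1.
    by rewrite mulr0 (fz y yx)// ltW.
- move=> y yx; apply: cvg_EFin; first exact: nearW.
  apply: (cvg_max_cst (vague_at cf fN r3 (fz y yx))).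
  rewrite -lee_fin (levy_mean_leb (mfy y) (fun z => far_phi_ge0 x _) (fun z => fM _) r3 (fz y yx)).
  apply: (@le_trans _ _ (\int[leb]_(z in far (1 / 3)) ((phi (y + z)%R + phi (y - z)%R) / 2 * nu z)%:E)%E).
    rewrite [leRHS]integral_mkcond; apply: ge0_le_integralP => z _.
      rewrite lee_fin /even_part; have [h|h] := leP (enorm z) (1 / 3).
        by rewrite !(fz y yx) ?enormN// addr0 !mul0r.
      rewrite mulr_ge0// ?divr_ge0 ?addr_ge0 ?far_phi_ge0//.
      exact/ltW/(nu_far nu_gt0 r3 (ltW h)).
    rewrite patchE; case: ifPn => [/set_mem h|/negP h].
      rewrite lee_fin ler_wpM2r//; first exact/ltW/(nu_far nu_gt0 r3 h).
      by rewrite /even_part ler_wpM2r ?invr_ge0// lerD ?far_phi_le.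
    have zs : enorm z <= 1 / 3.
      by rewrite leNgt; apply/negP => h'; apply: h; rewrite inE; exact: ltW.
    by rewrite lee_fin /even_part !(fz y yx) ?enormN// addr0 !mul0r.
  apply: (le_trans (HC S s y S0 s0 Hphi)); rewrite lee_fin /c.
  have yx1 : enorm (x - y) <= 1 by rewrite enormB; lra.
  have -> : C * Cn * S * (kappa nu x + s) = C * S * (Cn * kappa nu x + Cn * s) by ring.
  rewrite ler_wpM2l ?mulr_ge0// lerD//; first exact: Hn.
  by rewrite -[leLHS]mul1r ler_wpM2r.
- move=> n y yx; rewrite (Kop_scaled n y mf fN) -EFinM -EFinD lee_fin.
  have -> : far_phi x y = 0 by have := fz y yx 0; rewrite addr0 enorm0; apply; exact: ltW.
  by rewrite add0r ler_wpM2l ?(ltW (h0 n))// le_max lexx orbT.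
Qed.

Lemma exit_gap rho x : 0 <= rho ->
  (\int[P]_w (killed X Q x (tau rho w) w * (cosine_gap x (x + X (tau rho w) w))%:E) <=
   (\sum_(i < d) levy_symbol M A (delta_mx ord0 i : Rd))%:E * G rho x)%E.
Proof.
move=> r0.
have mi i : measurable_fun setT (fun w =>
    (killed X Q x (tau rho w) w * (1 - cos ((x + X (tau rho w) w - x) ord0 i))%R%:E)%E).
  apply: emeasurable_funM; first exact: (measurable_killed_at_exit norm_levy rho T mUp Up0 beta0 x).
  apply/measurable_EFinP.
  have cf : continuous (fun z : Rd => 1 - cos ((z - x) ord0 i)).
    exact: continuous_one_sub_cos.
  exact: (measurable_exit_value norm_levy rho T x cf).
under eq_integral => w _.
  rewrite /cosine_gap -sumEFin ge0_sume_distrr; last by move=> i _; rewrite lee_fin one_sub_cos_ge0.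
  over.
rewrite ge0_integral_sum//; last first.
  by move=> i w _; apply: mule_ge0; [exact: killed_ge0|rewrite lee_fin one_sub_cos_ge0].
rewrite -sumEFin ge0_sume_distrl; last by move=> i _; rewrite lee_fin levy_symbol_ge0.
by apply: lee_sum => i _; exact: exit_one_sub_cos.
Qed.

(** The weight decreases in time, so its final value is at most its average; survival until [T] is
    thereby charged to the occupation. *)
Lemma killed_at_end rho x w : tau rho w = T ->
  (killed X Q x (tau rho w) w <=
   (T^-1)%:E * \int[@lebesgue_measure R]_(u in `[0%R, tau rho w]) killed X Q x u w)%E.
Proof.
move=> ->.
have mk := measurable_killedt norm_levy mUp Up0 beta0 x w.
have k0 u : (0 <= killed X Q x u w)%E by exact: killed_ge0.
have i0 : 0 <= T^-1 by rewrite invr_ge0 ltW.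
rewrite -(ge0_integralZl_EFin _ _ _ _ i0)//; last exact: measurable_funTS.
have -> : killed X Q x T w = (\int[@lebesgue_measure R]_(u in `[0%R, T]) ((T^-1)%:E * killed X Q x T w))%E.
  rewrite integral_cst//= lebesgue_itvcc ?(ltW T_gt0)// subr0 muleAC -EFinM mulVf ?gt_eqF//.
  by rewrite mul1e.
apply: ge0_le_integralP => u /=; first by move=> _; apply: mule_ge0; rewrite ?lee_fin.
rewrite in_itv/= => /andP[_ uT]; apply: lee_wpmul2l; first by rewrite lee_fin.
exact: (killed_decr norm_levy).
Qed.

(* The constant does not depend on [S] and [s], which lets the estimate improve
   itself where [kgreen] is small. *)
Lemma upper_step : exists C r : R, [/\ 0 <= C, 0 < r & forall S s x, 0 <= S -> 0 <= s ->
  (forall z, phi z <= S * (kappa nu z + s)) -> r <= enorm x ->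
  ((phi x)%:E <= (C * S * (kappa nu x + s))%:E * G (1 / 3) x)%E].
Proof.
have r3 : 0 < 1 / 3 :> R by rewrite divr_gt0.
have [Cf Cf0 Hf] := exit_far.
have [Cn Cn1 Hn] := kappa_near d_gt0 nu_gt0 A11 A12.
have Cn0 : 0 <= Cn by exact: le_trans Cn1.
pose Cp := \sum_(i < d) levy_symbol M A (delta_mx ord0 i : Rd).
have Cp0 : 0 <= Cp by apply: sumr_ge0 => i _; exact: levy_symbol_ge0.
have [r Hr] := confine 0.
(* The terms pay, in this order, for the occupation before the exit, for exits at distance between
   [1/3] and 1, for longer ones, and for survival until [T]. *)
exists (beta * Cn + (36 * Cn * Cp + (Cf + Cn * T^-1))), (Num.max 1 (r + 1)).
have iT : 0 <= T^-1 by rewrite invr_ge0 ltW.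
have b0 : 0 <= beta by exact: ltW.
split; first by rewrite !addr_ge0// !mulr_ge0//.
  by rewrite lt_max ltr01.
move=> S s x S0 s0 Hphi; rewrite ge_max => /andP[_ xr].
have k0 z : 0 <= kappa nu z by exact/ltW/(kappa_gt0 nu_gt0).
pose a := kappa nu x + s; have a0 : 0 <= a by rewrite addr_ge0.
have Umx y : enorm (y - x) <= 1 / 3 -> Um y = 0.
  move=> yx; have : enorm x <= enorm (y - x) + enorm y.
    have {1}-> : x = - (y - x) + y by rewrite opprB subrK.
    by apply: le_trans (enormD _ _) _; rewrite enormN.
  by move=> h; have [] := Hr y; lra.
have near y : enorm (y - x) <= 1 -> phi y <= Cn * S * a.
  move=> yx; apply: le_trans (Hphi y) _.
  have -> : Cn * S * a = S * (Cn * kappa nu x + Cn * s) by rewrite /a; ring.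
  rewrite ler_wpM2l// lerD//; first by apply: Hn; rewrite enormB.
  by rewrite -[leLHS]mul1r ler_wpM2r.
have D0 : 0 <= Cn * S * a by rewrite !mulr_ge0.
set D := Cn * S * a in near D0.
have t0 w : 0 <= tau (1 / 3) w by exact/exitT_ge0/ltW.
pose occ w : \bar R := (\int[@lebesgue_measure R]_(u in `[0%R, tau (1 / 3) w]) killed X Q x u w)%E.
have occ0 w : (0 <= occ w)%E by apply: integral_ge0 => u _; exact: killed_ge0.
have GE : G (1 / 3) x = (\int[P]_w occ w)%E by [].
have mtau : measurable_fun setT (tau (1 / 3) : _ -> measurableTypeR R).
  exact: (measurable_exit_at norm_levy).
have mocc : measurable_fun setT occ.
  have k : measurable_fun setT (fun w => (tau (1 / 3) w : measurableTypeR R, w)).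
    by apply: measurable_fun_pair.
  have mQ : measurable_fun setT Q by apply: measurable_funD.
  have Q0 y : 0 <= Q y by rewrite addr_ge0.
  exact: (measurableT_comp (measurable_integral0 (measurable_killed norm_levy x mQ Q0)
    (fun _ => killed_ge0 _ _ _ _ _)) k).
have mkill := measurable_killed_at_exit norm_levy (1 / 3) T mUp Up0 beta0 x.
have cgap : continuous (cosine_gap x).
  move=> z; apply: (@cvg_sumr R Rd (nbhs z) (nbhs_filter z)) => i.
  exact: continuous_one_sub_cos.
have mgap := measurable_exit_value norm_levy (1 / 3) T x cgap.
have mfar := measurable_exit_value norm_levy (1 / 3) T x (continuous_far_phi (x := x)).
have gap0 z : 0 <= cosine_gap x z by apply: sumr_ge0 => i _; exact: one_sub_cos_ge0.
pose gp w : \bar R := (killed X Q x (tau (1 / 3) w) w * (cosine_gap x (x + X (tau (1 / 3) w) w))%:E)%E.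
pose fr w : \bar R := (killed X Q x (tau (1 / 3) w) w * (far_phi x (x + X (tau (1 / 3) w) w))%:E)%E.
have gp0 w : (0 <= gp w)%E by apply: mule_ge0; [exact: killed_ge0|rewrite lee_fin].
have fr0 w : (0 <= fr w)%E by apply: mule_ge0; [exact: killed_ge0|rewrite lee_fin far_phi_ge0].
have mgp : measurable_fun setT gp by apply: emeasurable_funM => //; exact/measurable_EFinP.
have mfr : measurable_fun setT fr by apply: emeasurable_funM => //; exact/measurable_EFinP.
have D36 : 0 <= 36 * D by rewrite mulr_ge0.
have DT : 0 <= D * T^-1 by rewrite mulr_ge0.
(* Three positions at the exit: beyond distance 1, where the cutoff is 1; between [1/3] and 1, where
   the cosine gap is at least [(1/9) / 4 = 1/36]; within [1/3], which means that time [T] was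
   reached. *)
have point w : (killed X Q x (tau (1 / 3) w) w * (phi (x + X (tau (1 / 3) w) w))%:E <=
    (36 * D)%:E * gp w + (fr w + (D * T^-1)%:E * occ w))%E.
  set y := x + X (tau (1 / 3) w) w; set k := killed X Q x (tau (1 / 3) w) w.
  have kk : (0 <= k)%E by exact: killed_ge0.
  have yxE : y - x = X (tau (1 / 3) w) w by rewrite /y addrAC subrr add0r.
  have nn1 : (0 <= (36 * D)%:E * gp w)%E by rewrite mule_ge0 ?lee_fin.
  have nn2 : (0 <= (D * T^-1)%:E * occ w)%E by rewrite mule_ge0 ?lee_fin.
  have [h1|h1] := leP 1 (enorm (y - x)).
    apply: (@le_trans _ _ (fr w)).
      by rewrite /fr -/y -/k /far_phi cutoff_far// mulr1.
    by apply: (le_trans (leeDl _ nn2)); exact: leeDr.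
  have [h3|h3] := leP (1 / 3) (enorm (y - x)).
    apply: (@le_trans _ _ ((36 * D)%:E * gp w)%E); last by apply: leeDl; exact: adde_ge0.
    rewrite /gp -/y -/k muleCA -EFinM; apply: lee_wpmul2l => //; rewrite lee_fin.
    apply: le_trans (near y (ltW h1)) _.
    have := cosine_gap_lower (ltW h1).
    have : (1 / 3) ^+ 2 <= enorm (y - x) ^+ 2 by rewrite lerXn2r ?nnegrE ?enorm_ge0// ltW.
    have -> : (1 / 3) ^+ 2 = 1 / 9 :> R by field.
    move=> h4 h5; have -> : 36 * D * cosine_gap x y = D * (36 * cosine_gap x y) by ring.
    rewrite -[leLHS]mulr1 ler_wpM2l//; lra.
  have tT : tau (1 / 3) w = T.
    apply/eqP; rewrite eq_le exitT_leT ?(ltW T_gt0)//= leNgt; apply/negP => tl.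
    have := at_exit norm_levy (ltW T_gt0) tl; rewrite -yxE; lra.
  apply: (@le_trans _ _ ((D * T^-1)%:E * occ w)%E); last first.
    by apply: (le_trans (leeDr _ (fr0 w))); exact: leeDr.
  apply: (@le_trans _ _ (k * D%:E)%E).
    by apply: lee_wpmul2l => //; rewrite lee_fin; apply: near; exact: ltW.
  rewrite (muleC k) (EFinM D) -(muleA D%:E); apply: lee_wpmul2l; first by rewrite lee_fin.
  exact: killed_at_end.
rewrite (local_identity Umx).
have occ_part : (\int[P]_w \int[@lebesgue_measure R]_(u in `[0%R, tau (1 / 3) w])
     (killed X Q x u w * (phi (x + X u w))%:E) <= D%:E * G (1 / 3) x)%E.
  rewrite GE -(ge0_integralZl_EFin P measurableT (fun w _ => occ0 w) mocc D0).
  apply: ge0_le_integralP => w _.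
    by apply: integral_ge0 => u _; apply: mule_ge0; [exact: killed_ge0|rewrite lee_fin].
  have mk := measurable_killedt norm_levy mUp Up0 beta0 x w.
  apply: (@le_trans _ _ (\int[@lebesgue_measure R]_(u in `[0%R, tau (1 / 3) w])
      (D%:E * killed X Q x u w))%E); last first.
    rewrite ge0_integralZl_EFin; [exact: lexx|exact: measurable_itv| |exact: measurable_funTS mk|exact: D0].
    by move=> u _; exact: killed_ge0.
  rewrite -[leLHS]integral_itv_bndo_bndc; last first.
    apply: measurable_funTS; apply: emeasurable_funM => //; apply/measurable_EFinP.
    exact: (measurableT_comp (continuous_measurable_rV cphi) (measurable_addXw norm_levy x w)).
  rewrite -[leRHS]integral_itv_bndo_bndc; last first.
    by apply: measurable_funTS; apply: emeasurable_funM => //; exact: measurable_cst.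
  apply: ge0_le_integralP => u /=; first by move=> _; apply: mule_ge0; [exact: killed_ge0|rewrite lee_fin].
  rewrite in_itv/= => /andP[u0 ut]; rewrite muleC; apply: lee_wpmul2r; first exact: killed_ge0.
  rewrite lee_fin; apply: near; apply: le_trans (in_ball x ut u0) _; lra.
have exit_part : (\int[P]_w (killed X Q x (tau (1 / 3) w) w * (phi (x + X (tau (1 / 3) w) w))%:E) <=
    (36 * D * Cp)%:E * G (1 / 3) x + ((Cf * S * a)%:E * G (1 / 3) x + (D * T^-1)%:E * G (1 / 3) x))%E.
  apply: (@le_trans _ _ (\int[P]_w ((36 * D)%:E * gp w + (fr w + (D * T^-1)%:E * occ w)))%E).
    apply: ge0_le_integralP => w _; last exact: point.
    by apply: mule_ge0; [exact: killed_ge0|rewrite lee_fin].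
  have m1 : measurable_fun setT (fun w => (36 * D)%:E * gp w)%E.
    by apply: emeasurable_funM => //; exact: measurable_cst.
  have m2 : measurable_fun setT (fun w => (D * T^-1)%:E * occ w)%E.
    by apply: emeasurable_funM => //; exact: measurable_cst.
  have n1 w : (0 <= (36 * D)%:E * gp w)%E by rewrite mule_ge0 ?lee_fin.
  have n2 w : (0 <= (D * T^-1)%:E * occ w)%E by rewrite mule_ge0 ?lee_fin.
  have m3 : measurable_fun setT (fun w => fr w + (D * T^-1)%:E * occ w)%E by exact: emeasurable_funD.
  rewrite (ge0_integralD P measurableT (fun w _ => n1 w) m1 (fun w _ => adde_ge0 (fr0 w) (n2 w)) m3).
  rewrite (ge0_integralD P measurableT (fun w _ => fr0 w) mfr (fun w _ => n2 w) m2).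
  rewrite (ge0_integralZl_EFin P measurableT (fun w _ => gp0 w) mgp D36).
  rewrite (ge0_integralZl_EFin P measurableT (fun w _ => occ0 w) mocc DT) -GE.
  apply: leeD; last by apply: leeD => //; exact: Hf.
  rewrite (EFinM (36 * D)) -(muleA (36 * D)%:E).
  by apply: lee_wpmul2l; [rewrite lee_fin|exact: exit_gap (ltW r3)].
have G0 : (0 <= G (1 / 3) x)%E by exact: kgreen_ge0.
apply: (@le_trans _ _ ((beta * D)%:E * G (1 / 3) x + ((36 * D * Cp)%:E * G (1 / 3) x +
    ((Cf * S * a)%:E * G (1 / 3) x + (D * T^-1)%:E * G (1 / 3) x)))%E).
  apply: leeD => //; rewrite EFinM -muleA; apply: lee_wpmul2l => //; by rewrite lee_fin.
have c1 : 0 <= Cf * S * a by rewrite !mulr_ge0.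
have c2 : 0 <= 36 * D * Cp by rewrite !mulr_ge0.
have c3 : 0 <= beta * D by rewrite !mulr_ge0.
rewrite -ge0_muleDl ?lee_fin// -EFinD -ge0_muleDl ?lee_fin ?addr_ge0//.
rewrite -EFinD -ge0_muleDl ?lee_fin ?addr_ge0// -EFinD.
rewrite le_eqVlt; apply/orP; left; apply/eqP; congr (_%:E * _)%E.
by rewrite /D /a; ring.
Qed.

Lemma killed_le_expR rho x K t w : (forall y, enorm (y - x) <= rho -> K <= Q y) -> 0 <= t -> t <= tau rho w ->
  (killed X Q x t w <= (expR (- (K * t)))%:E)%E.
Proof.
move=> KQ t0 tt.
have KX : ((K * t)%:E <= XI X Q x t w)%E.
  have -> : (K * t)%:E = (\int[@lebesgue_measure R]_(u in `[0%R, t]) K%:E)%E.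
    by rewrite integral_cst//= lebesgue_itvcc// subr0.
  have mq : measurable_fun setT Q by apply: measurable_funD.
  rewrite /XI -integral_itv_bndo_bndc; last exact: measurable_cst.
  rewrite -[leRHS]integral_itv_bndo_bndc; last first.
    exact: measurable_funTS (measurable_gX norm_levy mq x w).
  have [K0|/ltW K0] := leP 0 K.
    apply: ge0_le_integralP => u /=; first by rewrite lee_fin.
    rewrite in_itv/= => /andP[u0 ut]; rewrite lee_fin; apply: KQ.
    exact: in_ball (lt_le_trans ut tt) u0.
  apply: (@le_trans _ _ 0%E).
    by rewrite integral_itv_bndo_bndc ?integral_cst//= ?lebesgue_itvcc// subr0 -EFinM lee_fin mulr_le0_ge0.
  by apply: integral_ge0 => u _; rewrite lee_fin addr_ge0// ltW.
have -> : (expR (- (K * t)))%:E = expeR (- (K * t)%:E)%E by [].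
by rewrite /killed lee_expeR leeN2.
Qed.

(** On the ball the potential is at least [K]. The first [dl = e/2] units of time contribute at most
    [e/2]; afterwards [exp(-K u) <= 1 / (K dl)], which over a time [T] contributes [e/2] by the
    choice of [K]. *)
Lemma kgreen_small (e : R) : 0 < e -> exists r : R, forall x, r <= enorm x -> (G (1 / 3) x <= e%:E)%E.
Proof.
move=> e0; pose dl := e / 2; have dl0 : 0 < dl by rewrite divr_gt0.
pose K := 2 * T / (dl * e).
have K0 : 0 < K by rewrite divr_gt0 ?mulr_gt0.
have [r Hr] := confine K.
exists (r + 1) => x xr.
have KQ y : enorm (y - x) <= 1 / 3 -> K <= Q y.
  move=> yx; have : enorm x <= enorm (y - x) + enorm y.
    have {1}-> : x = - (y - x) + y by rewrite opprB subrK.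
    by apply: le_trans (enormD _ _) _; rewrite enormN.
  by move=> h; have [|h2 _] := Hr y; [lra|move: beta0; lra].
have t0 w : 0 <= tau (1 / 3) w by exact/exitT_ge0/ltW.
have c0 : 0 <= (K * dl)^-1 by rewrite invr_ge0 mulr_ge0// ltW.
have mT := measurable_itv (R := R) `[0, T].
have md := measurable_itv (R := R) `[0, dl].
have bound w : (\int[@lebesgue_measure R]_(u in `[0%R, tau (1 / 3) w]) killed X Q x u w <= e%:E)%E.
  apply: (@le_trans _ _ (\int[@lebesgue_measure R]_(u in `[0%R, T])
      ((\1_(`[0, dl]%classic) u)%:E + ((K * dl)^-1)%:E))%E).
    rewrite integral_mkcond [leRHS]integral_mkcond; apply: ge0_le_integralP => u _.
      by rewrite patchE; case: ifPn => // _; exact: killed_ge0.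
    rewrite !patchE; case: ifPn => [/set_mem|_]; last first.
      by case: ifPn => // _; rewrite adde_ge0 ?lee_fin.
    rewrite /= in_itv/= => /andP[u0 ut].
    rewrite mem_set; last first.
      by rewrite /= in_itv/= u0 (le_trans ut)// exitT_leT// ltW.
    have [ud|du] := leP u dl.
      rewrite indicE mem_set; last by rewrite /= in_itv/= u0.
      apply: (@le_trans _ _ 1%E); last by apply: leeDl; rewrite lee_fin.
      by apply: killed_le1 => y; rewrite addr_ge0// ltW.
    apply: le_trans (killed_le_expR KQ u0 ut) _.
    apply: (@le_trans _ _ ((K * dl)^-1)%:E); last by apply: leeDr; rewrite lee_fin.
    have Kd : 0 < K * dl by rewrite mulr_gt0.
    rewrite lee_fin expRN lef_pV2 ?posrE ?expR_gt0//.
    apply: (@le_trans _ _ (K * u)); first by rewrite ler_pM2l// ltW.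
    by apply: le_trans (expR_ge1Dx _); lra.
  rewrite ge0_integralD//; last first.
    by apply/measurable_EFinP; apply: measurable_funTS; exact: measurable_indic.
  rewrite integral_indic// integral_cst//= lebesgue_itvcc ?(ltW T_gt0)// subr0 -EFinM.
  apply: (@le_trans _ _ (dl%:E + ((K * dl)^-1 * T)%:E)%E).
    apply: leeD => //; apply: (@le_trans _ _ (@lebesgue_measure R `[0, dl]%classic)).
      by apply: le_measure; rewrite ?inE//; exact: measurableI.
    by rewrite lebesgue_itvcc ?(ltW dl0)// subr0.
  rewrite -EFinD lee_fin le_eqVlt; apply/orP; left; apply/eqP.
  rewrite /K /dl; field.
  by rewrite !gt_eqF.
apply: (@le_trans _ _ (\int[P]_w e%:E)%E).
  apply: ge0_le_integralP => w _; last exact: bound.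
  by apply: integral_ge0 => u _; exact: killed_ge0.
by rewrite (P_cst P).
Qed.

(** [A12] bounds [nu z] below by its value at one point [v] farther out. *)
Lemma kappa_below (r : R) : exists2 k : R, 0 < k & forall z, enorm z <= r -> k <= kappa nu z.
Proof.
have [C2 C21 HC2] := A12.
have C20 : 0 < C2 by exact: lt_le_trans C21.
pose v : Rd := const_mx (Num.max r 1).
have vr : Num.max r 1 <= enorm v.
  by have := coord_le_enorm v (Ordinal d_gt0); rewrite mxE; apply: le_trans; exact: ler_norm.
have v1 : 1 <= enorm v by apply: le_trans vr; rewrite le_max lexx orbT.
have nv : 0 < nu v by apply: (nu_far nu_gt0 (ltr01)) v1.
exists (Num.min 1 (nu v / C2)); first by rewrite lt_min ltr01 divr_gt0.
move=> z zr; have [h|h] := leP (1 / 2) (enorm z).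
  rewrite kappa_nu// ge_min; apply/orP; right.
  rewrite ler_pdivrMr// mulrC; apply: HC2 => //.
  by apply: le_trans zr _; apply: le_trans vr; rewrite le_max lexx.
rewrite /kappa (negbTE (_ : ~~ (1 / 2 <= enorm z))); last by rewrite -ltNge.
by rewrite ge_min lexx.
Qed.

Lemma ground_state_decay : exists2 S : R, 0 <= S & forall z, phi z <= S * kappa nu z.
Proof.
have [C [r [C0 r0 step]]] := upper_step.
have C10 : 0 < C + 1 by rewrite ltr_wpDl.
(* Where [kgreen] is below this value, [upper_step] improves the constant [S] to [S / 2]. *)
have e0 : 0 < (2 * (C + 1))^-1 by rewrite invr_gt0 mulr_gt0.
have [r1 Hr1] := kgreen_small e0.
have [k k0 Hk] := kappa_below (Num.max r r1).
have kp z : 0 < kappa nu z by exact: kappa_gt0.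
exists (Mp / k) => [|z]; first by rewrite divr_ge0// ltW.
have main s : 0 < s -> forall z, phi z <= Mp / k * (kappa nu z + s).
  (* The shift [s > 0] bounds the quotient, so its supremum is finite and can be absorbed. *)
  move=> s0; pose F y := phi y / (kappa nu y + s).
  have dp y : 0 < kappa nu y + s by rewrite addr_gt0.
  have F0 y : 0 <= F y by rewrite divr_ge0// ltW.
  have hF : has_sup (range F).
    split; first by exists (F 0), 0.
    exists (Mp / s) => _ [y _ <-]; rewrite /F ler_pM ?invr_ge0 ?(ltW (dp y))//.
    by rewrite lef_pV2 ?posrE// lerDr ltW.
  pose S := sup (range F).
  have FS y : F y <= S by apply: (sup_upper_bound hF); exists y.
  have S0 : 0 <= S by apply: le_trans (FS 0).
  have phiS y : phi y <= S * (kappa nu y + s) by rewrite -ler_pdivrMr//; exact: FS.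
  have F2 y : F y <= Num.max (S / 2) (Mp / k).
    rewrite le_max; have [yr|yr] := leP (enorm y) (Num.max r r1).
      apply/orP; right; rewrite /F ler_pM ?invr_ge0 ?(ltW (dp y))//.
      rewrite lef_pV2 ?posrE//; apply: le_trans (Hk y yr) _; by rewrite lerDl ltW.
    apply/orP; left; move: yr; rewrite gt_max => /andP[yr yr1].
    have := step S s y S0 (ltW s0) phiS (ltW yr).
    have c0 : 0 <= C * S * (kappa nu y + s) by rewrite !mulr_ge0// ltW.
    move=> h; have {h} : ((phi y)%:E <= (C * S * (kappa nu y + s))%:E * (2 * (C + 1))^-1%:E)%E.
      by apply: (le_trans h); apply: lee_wpmul2l; rewrite ?lee_fin//; exact: Hr1 (ltW yr1).
    rewrite -EFinM lee_fin /F ler_pdivrMr// => le; apply: le_trans le _.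
    rewrite mulrAC ler_wpM2r ?(ltW (dp y))//.
    rewrite ler_pdivrMr ?mulr_gt0//.
    have -> : S / 2 * (2 * (C + 1)) = C * S + S by field.
    by rewrite lerDl.
  have : S <= Num.max (S / 2) (Mp / k).
    by apply: ge_sup => [|_ [y _ <-]]; [exists (F 0), 0|exact: F2].
  have Mk : 0 <= Mp / k by rewrite divr_ge0// ltW.
  rewrite le_max => Sle; have {Sle} SM : S <= Mp / k.
    by case/orP: Sle => // h; lra.
  by move=> y; apply: le_trans (phiS y) _; rewrite ler_wpM2r// ltW.
have Mk : 0 < Mp / k by rewrite divr_gt0.
(* The constant [Mp / k] is the same for all [s], so [s] may be chosen to make the excess equal to
   an arbitrary [e]. *)
apply/ler_addgt0Pr => e e1.
have := main (e / (Mp / k)) (divr_gt0 e1 Mk) z.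
by rewrite mulrDr [Mp / k * (e / _)]mulrC divfK ?gt_eqF.
Qed.

Theorem ground_state_upper : exists c r : R, [/\ 0 < c, 0 < r & forall x, r <= enorm x ->
  ((phi x)%:E <= c%:E * G (1 / 3) x * (nu x)%:E)%E].
Proof.
have [C [r [C0 r0 step]]] := upper_step.
have [S S0 HS] := ground_state_decay.
exists (C * S + 1), (Num.max r 1); split; first by rewrite ltr_wpDl// mulr_ge0.
  by rewrite lt_max r0.
move=> x; rewrite ge_max => /andP[xr x1].
have HS' z : phi z <= S * (kappa nu z + 0) by rewrite addr0.
apply: le_trans (step S 0 x S0 (lexx _) HS' xr) _.
rewrite addr0 kappa_nu; last by lra.
rewrite muleAC -EFinM; apply: lee_wpmul2r; first exact: kgreen_ge0.
rewrite lee_fin ler_wpM2r ?lerDl//.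
exact/ltW/(nu_far nu_gt0 ltr01 x1).
Qed.

End ground_state_estimates.

(** * Passage to the original process *)

Section null_sets.
Import HBNNSimple.
Context (disp : measure_display) (T : measurableType disp) (R : realType).
Variable mu : {measure set T -> \bar R}.
Variable N : set T.
Hypotheses (mN : measurable N) (N0 : mu N = 0%E).

(* Neither function need be measurable: the integral of a nonnegative function
   is a supremum over simple functions. *)
Lemma le_integral_off_null (f g : T -> \bar R) : (forall w, 0 <= f w)%E -> (forall w, 0 <= g w)%E ->
  (forall w, ~ N w -> (f w <= g w)%E) -> (\int[mu]_w f w <= \int[mu]_w g w)%E.
Proof.
move=> f0 g0 fg; rewrite (ge0_integralE mu)//.
apply: ge_ereal_sup => _ /= [h hf <-].
have mh : measurable_fun setT h by [].
rewrite -integralT_nnsfun.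
rewrite (ge0_negligible_integral mN)//=; last 2 first.
- exact/measurable_EFinP/mh.
- by move=> w _; rewrite lee_fin.
rewrite integral_mkcond; apply: ge0_le_integralP => w _.
  by rewrite patchE; case: ifP => // _; rewrite lee_fin.
rewrite patchE; case: ifPn => [/set_mem[_ Nw]|_]; last exact: g0.
by apply: le_trans (fg w Nw); have := hf w; rewrite patchE mem_set.
Qed.

Lemma eq_integral_off_null (f g : T -> \bar R) : (forall w, 0 <= f w)%E -> (forall w, 0 <= g w)%E ->
  (forall w, ~ N w -> f w = g w) -> (\int[mu]_w f w = \int[mu]_w g w)%E.
Proof.
move=> f0 g0 fg; apply/eqP; rewrite eq_le; apply/andP; split; apply: le_integral_off_null => // w Nw.
  by rewrite fg.
by rewrite fg.
Qed.

Lemma ae_eq_off_null (f g : T -> \bar R) : (forall w, ~ N w -> f w = g w) ->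
  ae_eq mu setT f g.
Proof.
move=> fg; exists N; split => // w /= Nw; apply: contrapT => h.
by apply: Nw => _; exact: fg.
Qed.

Lemma measure_eq_off_null (A B : set T) : measurable A -> measurable B ->
  (forall w, ~ N w -> (A w <-> B w)) -> mu A = mu B.
Proof.
move=> mA mB AB; rewrite -(setIT A) -(setIT B) -!integral_indic//.
apply: eq_integral_off_null => w; rewrite ?lee_fin// => Nw.
by rewrite !indicE; congr (_%:R%:E); congr nat_of_bool; apply/idP/idP; rewrite !inE => /(AB w Nw).
Qed.
End null_sets.

(** * Normalization of the paths *)

Section normalization.
Context (disp : measure_display) (Omega : measurableType disp) (R : realType).
Context (d : nat) (P : probability Omega R) (X : R -> Omega -> 'rV[R]_d).
Local Notation Rd := 'rV[R]_d.
Hypothesis lev : is_levy_process P X.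
Let mX t : 0 <= t -> measurable_fun setT (X t). Proof. by case: lev => + _ _ _ _; apply. Qed.

Definition bad_start : set Omega := [set w | 0 < enorm (X 0 w)].

Lemma measurable_bad_start : measurable bad_start.
Proof.
rewrite -[X in measurable X]setTI.
exact: (mX (lexx (0 : R)) measurableT (open_measurable_mx (@open_enorm_gt R d 0))).
Qed.

Lemma good_start w : ~ bad_start w -> X 0 w = 0.
Proof.
by move=> /negP; rewrite -leNgt => h; apply: enorm_eq0; apply/eqP; rewrite eq_le h enorm_ge0.
Qed.

Lemma bad_start_null : P bad_start = 0%E.
Proof.
apply: measure_negligible; first exact: measurable_bad_start.
case: lev => _ ae0 _ _ _; apply: negligibleS ae0 => w /= h0 X0.
by move: h0; rewrite /bad_start /= X0 enorm0 ltxx.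
Qed.

Definition restart (t : R) (w : Omega) : Rd := if 0 < enorm (X 0 w) then 0 else X t w.

(** Two repairs: paths that do not start at 0, a null set, are replaced by the zero path; and values
    at all times, negative ones included, are read off dyadic values, which gives joint
    measurability. *)
Definition normalized (t : R) (w : Omega) : Rd := pos (dy restart w) t.

Lemma normalizedE t w : 0 <= t -> ~ bad_start w -> normalized t w = X t w.
Proof.
move=> t0 gw; rewrite /normalized.
have -> : dy restart w = dy X w.
  by apply/funext => m; rewrite /dy /restart; case: ifPn => //.
by apply: pos_dy => //; case: lev => _ _ _ _ /(_ w)[+ _]; apply.
Qed.

Lemma normalized_bad t w : 0 <= t -> bad_start w -> normalized t w = 0.
Proof.
move=> t0 bw; rewrite /normalized.
have -> : dy restart w = dy (fun _ _ => 0) w.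
  by apply/funext => m; rewrite /dy /restart; case: ifPn => // /negP; case.
rewrite (@pos_dy R d Omega (fun _ _ => 0)) => //; exact: cvg_cst.
Qed.

Lemma normalized0 w : normalized 0 w = 0.
Proof.
have [bw|gw] := pselect (bad_start w); first exact: normalized_bad.
by rewrite normalizedE// good_start.
Qed.

Lemma measurable_restart t : 0 <= t -> measurable_fun setT (restart t).
Proof.
move=> t0; apply: measurable_fun_ifT => //.
- apply: measurable_fun_ltr => //.
  exact: (measurableT_comp (measurable_enorm (R := R) (d := d)) (mX (lexx _))).
- exact: mX.
Qed.

Lemma measurable_normalized t : measurable_fun setT (normalized t).
Proof.
have md : measurable_fun setT (fun w => (t : measurableTypeR R, dy restart w)).
  apply: measurable_fun_pair => //; apply: measurable_fun_path => i.
  by apply: measurable_restart; exact: dtime_ge0.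
exact: (measurableT_comp (measurable_pos (R := R) (d := d)) md).
Qed.

Let mincr (Y : R -> Omega -> Rd) s t (A : set Rd) : measurable_fun setT (Y s) -> measurable_fun setT (Y t) ->
  measurable A -> measurable (increment Y s t @^-1` A).
Proof.
move=> ms mt mA; rewrite -[X in measurable X]setTI.
exact: (measurable_funB_rV mt ms measurableT mA).
Qed.

Lemma normalized_is_levy : is_levy_process P normalized.
Proof.
have mb := measurable_bad_start; have b0 := bad_start_null.
have mn := measurable_normalized.
have inE_ s t (A : set Rd) w : 0 <= s -> 0 <= t -> ~ bad_start w ->
    (increment normalized s t @^-1` A) w <-> (increment X s t @^-1` A) w.
  by move=> s0 t0 gw; rewrite /increment /= !normalizedE.
have Pinc s t (A : set Rd) : 0 <= s -> 0 <= t -> measurable A ->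
    P (increment normalized s t @^-1` A) = P (increment X s t @^-1` A).
  move=> s0 t0 mA; apply: (measure_eq_off_null mb b0) => [||w gw]; last exact: inE_.
    exact: mincr.
  by apply: mincr => //; exact: mX.
case: (lev) => _ _ ind st cad; split.
- by move=> t _; exact: mn.
- by apply: aeW => w; exact: normalized0.
- move=> n t A t0 ndt mA.
  have tp i : 0 <= t i by apply: le_trans t0 _; exact: ndt.
  under eq_bigr => i _ do rewrite Pinc//.
  rewrite -(ind n t A t0 ndt mA); apply: (measure_eq_off_null mb b0).
  + apply: fin_bigcap_measurable => [|i _]; first exact: finite_II.
    exact: mincr.
  + apply: fin_bigcap_measurable => [|i _]; first exact: finite_II.
    by apply: mincr => //; exact: mX.
  + by move=> w gw; split => h i ni; have := h i ni; apply: (inE_ _ _ _ _ (tp _) (tp _) gw).1 ||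
      apply: (inE_ _ _ _ _ (tp _) (tp _) gw).2.
- move=> s t A s0 t0 mA; rewrite Pinc ?addr_ge0// (st _ _ _ s0 t0 mA).
  apply: (measure_eq_off_null mb b0) => [||w gw].
  + by rewrite -[X in measurable X]setTI; exact: mX.
  + by rewrite -[X in measurable X]setTI; exact: mn.
  + by rewrite /= normalizedE.
- move=> w; split => t t0.
  + have [bw|gw] := pselect (bad_start w).
      rewrite normalized_bad//; apply: cvg_near_cst; near=> s.
      by apply: normalized_bad => //; apply: (le_trans t0); near: s; exact: nbhs_right_ge.
    rewrite normalizedE//; have [h _] := cad w.
    apply: cvg_trans (h t t0); apply: near_eq_cvg; near=> s.
    by rewrite normalizedE//; apply: (le_trans t0); near: s; exact: nbhs_right_ge.
  + have [bw|gw] := pselect (bad_start w).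
      apply/cvg_ex; exists 0; apply: cvg_near_cst; near=> s.
      by apply: normalized_bad => //; near: s; exact: nbhs_left_ge.
    have [_ /(_ t t0) /cvg_ex[l hl]] := cad w; apply/cvg_ex; exists l.
    apply: cvg_trans hl; apply: near_eq_cvg; near=> s.
    by rewrite normalizedE//; near: s; exact: nbhs_left_ge.
Unshelve. all: by end_near. Qed.

(** The dyadic values of [normalized] are those of [restart], so reading them off a second time
    changes nothing. *)
Lemma normalized_levyP : normalized_levy P normalized.
Proof.
split; [exact: normalized_is_levy|exact: normalized0|move=> t w].
rewrite {1}/normalized; congr (pos _ t); apply/funext => m.
have [bw|gw] := pselect (bad_start w); last first.
  rewrite /dy normalizedE ?dtime_ge0//= /restart ifF//; exact/negP.
by rewrite /dy normalized_bad ?dtime_ge0//= /restart ifT.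
Qed.

End normalization.

(** * The truncated and the true Green operator *)

Section green_comparison.
Context (disp : measure_display) (Omega : measurableType disp) (R : realType).
Context (d : nat) (P : probability Omega R) (X : R -> Omega -> 'rV[R]_d).
Local Notation Rd := 'rV[R]_d.
Hypothesis lev : is_levy_process P X.
Local Notation Y := (normalized X).
Local Notation bad := (bad_start X).
Let nl : normalized_levy P Y. Proof. exact: normalized_levyP. Qed.

Variables (W Up : Rd -> R) (beta T : R) (x : Rd).
Hypotheses (mUp : measurable_fun setT Up) (Up0 : forall y, 0 <= Up y).
Hypotheses (beta0 : 0 < beta) (T_gt0 : 0 < T).
Hypothesis WU : forall y, eball x 1 y -> W y = Up y + beta.
Local Notation Q := (fun y => Up y + beta).
Local Notation leb := (@lebesgue_measure R).
Let mQ : measurable_fun setT Q. Proof. by apply: measurable_funD. Qed.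
Let Q0 y : 0 <= Q y. Proof. by rewrite addr_ge0// ltW. Qed.

(** The time set of [green_operator]. For a fixed path it is an interval, hence measurable; joint
    measurability with [w] is not claimed. *)
Definition life w : set R := [set t : R | (0 <= t)%R /\ (t%:E < exit_time X (eball x 1) x w)%E].

Lemma life_in_ball w t s : life w t -> 0 <= s -> s <= t -> eball x 1 (x + X s w).
Proof.
move=> [t0 te] s0 st; apply: contrapT => h; move: te; rewrite ltNge => /negP; apply.
by apply: (@le_trans _ _ s%:E); [apply: ereal_inf_lbound; exists s|rewrite lee_fin].
Qed.

Lemma life_down w t s : life w t -> 0 <= s -> s <= t -> life w s.
Proof. by move=> [t0 te] s0 st; split => //; apply: le_lt_trans te; rewrite lee_fin. Qed.

Lemma measurable_life w : measurable (life w : set (measurableTypeR R)).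
Proof.
apply: is_interval_measurable => a b [a0 ae] lb z /andP[az zb].
by apply: (life_down lb) => //; exact: le_trans az.
Qed.

Lemma fk_killed w t : ~ bad w -> life w t -> fk_weight X W x t w = killed Y Q x t w.
Proof.
move=> gw lt; rewrite /fk_weight /killed /XI; congr (expeR (- _)).
apply: eq_integral => u; rewrite inE/= in_itv/= => /andP[u0 ut].
by rewrite WU ?(normalizedE lev)//; exact: (life_in_ball lt).
Qed.

Lemma fk_weight_ge0 (V : Rd -> R) y t w : (0 <= fk_weight X V y t w)%E.
Proof. exact: expeR_ge0. Qed.

Local Notation green := (green_operator P X W (eball x 1) (cst 1%R) x).

(** Before the dyadic exit from radius [1/3] the path lies in a closed ball inside the open unit
    ball, so the true exit has not yet occurred. *)
Lemma green_lower : (kgreen P Y Up beta (1 / 3) T x <= green)%E.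
Proof.
apply: (le_integral_off_null (measurable_bad_start lev) (bad_start_null lev)).
- by move=> w; apply: integral_ge0 => u _; exact: killed_ge0.
- by move=> w; apply: integral_ge0 => t _; rewrite mule1 fk_weight_ge0.
move=> w gw.
have mk := measurable_killedt nl mUp Up0 beta0 x w.
rewrite -integral_itv_bndo_bndc; last exact: measurable_funTS.
rewrite integral_mkcond [leRHS]integral_mkcond; apply: ge0_le_integralP => t _.
  by rewrite patchE; case: ifP => // _; exact: killed_ge0.
rewrite patchE; case: ifPn => [|_]; last first.
  by rewrite patchE; case: ifP => // _; rewrite mule1 fk_weight_ge0.
move=> /set_mem; rewrite /= in_itv/= => /andP[t0 tt].
have lt : life w t.
  split => //; apply: (@lt_le_trans _ _ (exit_at Y (1 / 3) T w)%:E); first by rewrite lte_fin.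
  apply: le_ereal_inf_tmp => _ [u [u0 ub] <-]; rewrite lee_fin leNgt; apply/negP => ut.
  apply: ub; rewrite /eball /= addrAC subrr add0r -(normalizedE lev u0 gw).
  by have := before_exit nl (ltW T_gt0) u0 ut; lra.
by rewrite patchE mem_set// mule1 fk_killed.
Qed.

Let q : R := expR (- (beta * T)).
Let q1 : q < 1. Proof. by rewrite -expR0 ltr_expR oppr_lt0 mulr_gt0. Qed.
Let q0 : 0 <= q. Proof. exact: expR_ge0. Qed.

Lemma killed_shift t w : 0 <= t -> (killed Y Q x (t + T) w <= q%:E * killed Y Q x t w)%E.
Proof.
move=> t0; have qE : q%:E = expeR (- (beta * T)%:E)%E by [].
have Tt : t <= t + T by rewrite lerDl ltW.
rewrite /killed !(XI_addc nl mUp) ?addr_ge0// ?(ltW T_gt0)//.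
have h : (XI Y Up x t w <= XI Y Up x (t + T) w)%E by exact: (XI_le nl).
have n0 := XI_ge0 Y Up0 x t w; have n1 := XI_ge0 Y Up0 x (t + T) w.
rewrite qE; case: (XI Y Up x t w) h n0 => [a| |]//; last first.
  by rewrite leye_eq => /eqP -> _ /=; rewrite mule0.
case: (XI Y Up x (t + T) w) n1 => [b| |]//=.
move=> _; rewrite lee_fin => ab _; rewrite -EFinM lee_fin -expRD ler_expR; lra.
Qed.

(* The weight decreases at least by the factor [q] on each interval of length [T],
   so the first one carries a fixed proportion of the occupation. *)
Lemma life_occupation w : ~ bad w ->
  (\int[leb]_(t in life w) killed Y Q x t w <=
   ((1 - q)^-1)%:E * \int[leb]_(t in `[0%R, exit_at Y 1 T w]) killed Y Q x t w)%E.
Proof.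
move=> gw; pose f t := if t \in life w then killed Y Q x t w else 0%E.
have mk := measurable_killedt nl mUp Up0 beta0 x w.
have f0 t : (0 <= f t)%E by rewrite /f; case: ifP => // _; exact: killed_ge0.
have mf : measurable_fun setT (f : measurableTypeR R -> \bar R).
  have := (measurable_restrictT (fun t : measurableTypeR R => killed Y Q x t w) (measurable_life w)).1.
  by apply; exact: measurable_funTS.
have kf t : (0 <= killed Y Q x t w <= 1)%E by rewrite killed_ge0/= killed_le1.
pose A n := (\int[leb]_(t in `[0%R, (n%:R * T)%R]) f t)%E.
pose occ := (\int[leb]_(t in `[0%R, exit_at Y 1 T w]) killed Y Q x t w)%E.
have nT n : 0 <= n%:R * T by rewrite mulr_ge0 ?ler0n// ltW.
(* A path that has stayed in the open ball up to [t] is there at all dyadic times up to [t], so [t]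
   does not exceed the dyadic exit time. *)
have A1 : (A 1%N <= occ)%E.
  rewrite /A /occ integral_mkcond [leRHS]integral_mkcond; apply: ge0_le_integralP => t _.
    by rewrite patchE; case: ifP.
  rewrite patchE; case: ifPn => [/set_mem|_]; last first.
    by rewrite patchE; case: ifP => // _; exact: killed_ge0.
  rewrite /= in_itv/= mul1r => /andP[t0 tT]; rewrite /f; case: ifPn => [/set_mem lt|_]; last first.
    by rewrite patchE; case: ifP => // _; exact: killed_ge0.
  rewrite patchE mem_set//= in_itv/= t0/=.
  apply: (alive_le_exitT (ltW T_gt0) tT) => m mt.
  rewrite /dy (normalizedE lev (dtime_ge0 R m) gw).
  have := life_in_ball lt (dtime_ge0 R m) mt.
  by rewrite /eball /= addrAC subrr add0r.
have occ0 : (0 <= occ)%E by apply: integral_ge0 => t _; exact: killed_ge0.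
have occf : occ \is a fin_num.
  rewrite ge0_fin_numE//; apply: (@le_lt_trans _ _ (\int[leb]_(t in `[0%R, exit_at Y 1 T w]) 1%:E)%E).
    by apply: ge0_le_integralP => t _; have /andP[] := kf t.
  rewrite integral_cst//= lebesgue_itvcc ?subr0 ?mul1e ?ltry//.
  exact/exitT_ge0/ltW.
have oE : occ = (fine occ)%:E by rewrite fineK.
have o0 : 0 <= fine occ by rewrite fine_ge0.
have i0 : 0 < 1 - q by rewrite subr_gt0.
(* Induction on [A (n + 1) <= occ + q * A n]; the fixed point of this recursion is
   [occ / (1 - q)]. *)
have step n : (A n <= (fine occ / (1 - q))%:E)%E.
  elim: n => [|n IH].
    rewrite /A mul0r set_itv1 integral_set1 lee_fin divr_ge0// ltW//.
  have split1 : A n.+1 = (A 1%N + \int[leb]_(t in `[(1%:R * T)%R, (n.+1%:R * T)%R]) f t)%E.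
    by apply: ge0_integral_itvD => //; rewrite ler_pM2r// ler_nat.
  have shift1 : (\int[leb]_(t in `[(1%:R * T)%R, (n.+1%:R * T)%R]) f t =
      \int[leb]_(t in `[0%R, (n%:R * T)%R]) f (t + T)%R)%E.
    by rewrite (@ge0_integral_shift R T 0 (n%:R * T) f mf f0) add0r -[n.+1%:R]natr1 mulrDl !mul1r.
  have shift2 : (\int[leb]_(t in `[0%R, (n%:R * T)%R]) f (t + T)%R <= q%:E * A n)%E.
    apply: (@le_trans _ _ (\int[leb]_(t in `[0%R, (n%:R * T)%R]) (q%:E * f t))%E); last first.
      rewrite ge0_integralZl_EFin; [exact: lexx|exact: measurable_itv|by []|exact: measurable_funTS|exact: q0].
    apply: ge0_le_integralP => t /=; first by [].
    rewrite in_itv/= => /andP[t0 tn]; rewrite /f; case: ifPn => [/set_mem lt|_]; last first.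
      have qe0 : (0 <= q%:E)%E by rewrite lee_fin; exact: q0.
      apply: (mule_ge0 qe0); case: ifP => _; [exact: killed_ge0|exact: lexx].
    have Tt : t <= t + T by rewrite lerDl ltW.
    by rewrite mem_set; [exact: killed_shift|exact: (life_down lt)].
  rewrite split1 shift1; apply: (le_trans (leeD A1 (le_trans shift2 (lee_wpmul2l _ IH)))).
    by rewrite lee_fin.
  rewrite oE -EFinM -EFinD lee_fin le_eqVlt; apply/orP; left; apply/eqP; field.
  by rewrite gt_eqF.
have cup : (\bigcup_n `[0%R, (n%:R * T)%R]%classic = [set t : R | 0 <= t]).
  apply/seteqP; split => t /=; first by move=> [n _ /=]; rewrite in_itv/= => /andP[].
  move=> t0; exists (Num.truncn (t / T)).+1 => //=; rewrite in_itv/= t0/=.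
  by rewrite -ler_pdivrMr// ltW// truncnS_gt.
have ndF : {homo (fun n => `[0%R, (n%:R * T)%R]%classic : set (measurableTypeR R)) :
    n m / (n <= m)%N >-> (n <= m)%O}.
  move=> n m nm; apply/subsetPset => t /=; rewrite !in_itv/= => /andP[-> tn].
  by apply: le_trans tn _; rewrite ler_pM2r// ler_nat.
have lim := ge0_nondecreasing_set_cvg_integral (mu := leb) ndF (fun n => measurable_itv _)
  (fun n => measurable_funTS mf) (fun _ t _ => f0 t).
have lifeE : (\int[leb]_(t in life w) killed Y Q x t w =
    \int[leb]_(t in \bigcup_n `[0%R, (n%:R * T)%R]%classic) f t)%E.
  rewrite cup integral_mkcond [RHS]integral_mkcond; apply: eq_integral => t _.
  rewrite !patchE /f; have [/set_mem [t0 _]|] := boolP (t \in life w); first by rewrite mem_set.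
  by case: ifP.
rewrite lifeE -/occ oE -EFinM mulrC.
by apply: (lee_cvg_le lim (cvg_cst _)); exact: step.
Qed.

Lemma green_upper : (green <= ((1 - q)^-1)%:E * kgreen P Y Up beta 1 T x)%E.
Proof.
have i0 : 0 <= (1 - q)^-1 by rewrite invr_ge0 subr_ge0 ltW.
have occ0 w : (0 <= \int[leb]_(t in `[0%R, exit_at Y 1 T w]) killed Y Q x t w)%E.
  by apply: integral_ge0 => u _; exact: killed_ge0.
rewrite /kgreen -ge0_integralZl_EFin//; last first.
  have k : measurable_fun setT (fun w => (exit_at Y 1 T w : measurableTypeR R, w)).
    by apply: measurable_fun_pair => //; exact: (measurable_exit_at nl).
  exact: (measurableT_comp (measurable_integral0 (measurable_killed nl x mQ Q0)
    (fun _ => killed_ge0 _ _ _ _ _)) k).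
apply: (le_integral_off_null (measurable_bad_start lev) (bad_start_null lev)).
- by move=> w; apply: integral_ge0 => t _; rewrite mule1 fk_weight_ge0.
- by move=> w; rewrite mule_ge0 ?lee_fin.
move=> w gw; apply: le_trans (life_occupation gw).
rewrite le_eqVlt; apply/orP; left; apply/eqP; apply: eq_integral => t /set_mem lt.
by rewrite mule1 fk_killed.
Qed.

End green_comparison.

(** The integral of [f] is defined through [f^+] and [f^-], another decomposition than [u] and [v].
    Rearranged as an equality of sums of nonnegative functions it can be integrated, and only finite
    terms are then subtracted; the integral of [u] may be infinite. *)
Lemma integral_split (R : realType) (f u v : R -> R) (c t : R) :
  measurable_fun setT (f : measurableTypeR R -> R) ->
  measurable_fun setT (u : measurableTypeR R -> R) -> measurable_fun setT (v : measurableTypeR R -> R) ->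
  (forall s, 0 <= u s) -> (forall s, 0 <= v s) -> (forall s, f s = u s - v s + c) -> 0 <= t ->
  (\int[@lebesgue_measure R]_(s in `[0%R, t]) (v s)%:E < +oo)%E ->
  (\int[@lebesgue_measure R]_(s in `[0%R, t]) (f s)%:E =
   \int[@lebesgue_measure R]_(s in `[0%R, t]) (u s)%:E + (c * t)%:E
   - \int[@lebesgue_measure R]_(s in `[0%R, t]) (v s)%:E)%E.
Proof.
move=> mf mu mv u0 v0 fE t0 vfin.
set leb := @lebesgue_measure R; pose D : set R := `[0, t]%classic.
have mD : measurable (D : set (measurableTypeR R)) by exact: measurable_itv.
have cst_int (k : R) : (\int[leb]_(s in D) k%:E = (k * t)%:E)%E.
  by rewrite integral_cst//= lebesgue_itvcc// subr0.
have p0 s : 0 <= f^\+ s by exact: funrpos_ge0.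
have n0 s : 0 <= f^\- s by exact: funrneg_ge0.
have mp : measurable_fun setT (f^\+ : measurableTypeR R -> R) by exact: measurable_funrpos.
have mn : measurable_fun setT (f^\- : measurableTypeR R -> R) by exact: measurable_funrneg.
have mE (g : R -> R) : measurable_fun setT (g : measurableTypeR R -> R) ->
    measurable_fun D (fun s : measurableTypeR R => (g s)%:E).
  by move=> mg; apply/measurable_EFinP; exact: measurable_funTS.
have add (g k : R -> R) : measurable_fun setT (g : measurableTypeR R -> R) ->
    measurable_fun setT (k : measurableTypeR R -> R) -> (forall s, 0 <= g s) -> (forall s, 0 <= k s) ->
    (\int[leb]_(s in D) (g s + k s)%:E = \int[leb]_(s in D) (g s)%:E + \int[leb]_(s in D) (k s)%:E)%E.
  move=> mg mk g0 k0; under eq_integral do rewrite EFinD.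
  rewrite (ge0_integralD leb mD _ (mE g mg) _ (mE k mk))//.
    by move=> s _; rewrite lee_fin.
  by move=> s _; rewrite lee_fin.
pose c1 := Num.max c 0; pose c2 := Num.max (- c) 0.
have c10 : 0 <= c1 by rewrite le_max lexx orbT.
have c20 : 0 <= c2 by rewrite le_max lexx orbT.
have cE : c = c1 - c2.
  exact: esym (congr1 (fun f => f tt) (funrposBneg (fun _ : unit => c))).
have pnE s : f s = f^\+ s - f^\- s by rewrite -[in LHS](funrposBneg f).
have ptw s : f^\+ s + v s + c2 = u s + f^\- s + c1.
  by have := pnE s; rewrite {1}fE cE; lra.
have mc (k : R) : measurable_fun setT (cst k : measurableTypeR R -> R) by exact: measurable_cst.
have E1 : (\int[leb]_(s in D) (f^\+ s)%:E + \int[leb]_(s in D) (v s)%:E + (c2 * t)%:E =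
    \int[leb]_(s in D) (u s)%:E + \int[leb]_(s in D) (f^\- s)%:E + (c1 * t)%:E)%E.
  rewrite -!cst_int -add// -(add u)//.
  have a1 := add (fun s => f^\+ s + v s) (cst c2) (measurable_funD mp mv) (mc c2)
    (fun s => addr_ge0 (p0 s) (v0 s)) (fun _ => c20).
  have a2 := add (fun s => u s + f^\- s) (cst c1) (measurable_funD mu mn) (mc c1)
    (fun s => addr_ge0 (u0 s) (n0 s)) (fun _ => c10).
  rewrite /= in a1 a2; rewrite -a1 -a2; apply: eq_integral => s _; by rewrite ptw.
have nfin : (\int[leb]_(s in D) (f^\- s)%:E < +oo)%E.
  apply: (@le_lt_trans _ _ (\int[leb]_(s in D) (v s + c2)%:E)%E).
    apply: ge0_le_integralP => s _; rewrite lee_fin//.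
    rewrite /funrneg fE ge_max addr_ge0// andbT cE; have := u0 s; lra.
  by rewrite (add v (cst c2))// cst_int lte_add_pinfty// ltry.
have ge0 (g : R -> R) : (forall s, 0 <= g s) -> (0 <= \int[leb]_(s in D) (g s)%:E)%E.
  by move=> g0; apply: integral_ge0 => s _; rewrite lee_fin.
have -> : (\int[leb]_(s in D) (f s)%:E = \int[leb]_(s in D) (f^\+ s)%:E - \int[leb]_(s in D) (f^\- s)%:E)%E.
  rewrite (integralE leb D) (_ : (fun s => (f s)%:E) = EFin \o f)//.
  by rewrite funerpos funerneg.
rewrite -/D; move: E1 nfin vfin; rewrite -/D.
have := ge0 _ p0; have := ge0 _ u0; have := ge0 _ n0; have := ge0 _ v0.
case: (\int[leb]_(s in D) (v s)%:E)%E => [b| |]//; case: (\int[leb]_(s in D) (f^\- s)%:E)%E => [a| |]//.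
case: (\int[leb]_(s in D) (u s)%:E)%E => [e| |]//; case: (\int[leb]_(s in D) (f^\+ s)%:E)%E => [g| |]//.
move=> _ _ _ _; rewrite -!EFinD => -[E1] _ _; congr (_%:E).
by rewrite cE mulrBl; lra.
Qed.

(** * Transfer of the hypotheses to the normalized process *)

Section transfer.
Context (disp : measure_display) (Omega : measurableType disp) (R : realType).
Context (d : nat) (P : probability Omega R) (X : R -> Omega -> 'rV[R]_d).
Local Notation Rd := 'rV[R]_d.
Local Notation leb := (@lebesgue_measure R).
Hypothesis lev : is_levy_process P X.
Local Notation Y := (normalized X).
Local Notation bad := (bad_start X).
Let nl : normalized_levy P Y. Proof. exact: normalized_levyP. Qed.
Let mb := measurable_bad_start lev.
Let b0 := bad_start_null lev.

Lemma mean_normalized (f : Rd -> R) t : 0 <= t -> measurable_fun setT f ->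
  \int[P]_w f (Y t w) = fine 'E_P[fun w => f (X t w)].
Proof.
move=> t0 mf; rewrite unlock /Rintegral; congr fine.
apply: ae_eq_integral => //.
- by apply/measurable_EFinP; apply: (measurableT_comp mf); exact: (measurable_Xt nl).
- apply/measurable_EFinP; apply: (measurableT_comp mf); by case: lev => + _ _ _ _; apply.
- by apply: (ae_eq_off_null mb b0) => w gw; rewrite (normalizedE lev).
Qed.

Lemma symmetric_mean_sin t xi : symmetric_process P X -> 0 <= t ->
  ('E_P[fun w => sin (dotv xi (X t w))] = 0)%E.
Proof.
move=> sym t0; rewrite unlock.
have mX : measurable_fun setT (X t) by case: lev => + _ _ _ _; apply.
have mNX : measurable_fun setT (fun w => - X t w).
  exact: (measurableT_comp (measurable_opp_rV (R := R) (d := d)) mX).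
pose F (z : Rd) := (sin (dotv xi z))%:E.
have ms : measurable_fun setT (fun z : Rd => sin (dotv xi z)).
  apply: (measurableT_comp (f := sin)); last exact: measurable_dotv.
  by apply: continuous_measurable_fun; exact: continuous_sin.
have mF : measurable_fun setT F by exact/measurable_EFinP.
have int (Z : Omega -> Rd) : measurable_fun setT Z -> P.-integrable setT (F \o Z).
  move=> mZ; apply: measurable_bounded_integrable => //.
  - by rewrite (le_lt_trans (probability_le1 P measurableT))// ltry.
  - exact: (measurableT_comp ms mZ).
  by exists 1; split; [exact: num_real|move=> L L1 w _; exact: le_trans (sin_max _) (ltW L1)].
have e1 := integral_pushforward mX mF (int _ mX) measurableT.
have e2 := integral_pushforward mNX mF (int _ mNX) measurableT.
have e3 : (\int[pushforward P (fun w => (- X t w)%R)]_z F z = \int[pushforward P (X t)]_z F z)%E.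
  by apply: eq_measure_integral => A mA _; exact: sym.
rewrite e1 e2 !preimage_setT /= in e3.
have e4 : (\int[P]_w (F \o (fun w => (- X t w)%R)) w = - \int[P]_w (F \o X t) w)%E.
  rewrite -integralN/=; last first.
    have := int _ mX => /integrableP[_ h]; rewrite fin_num_adde_defr//.
    exact: (integrable_pos_fin_num measurableT (int _ mX)).
  by apply: eq_integral => w _; rewrite /F /= dotvNr sinN.
have fin : (\int[P]_w (F \o X t) w)%E \is a fin_num by exact: (integrable_fin_num measurableT (int _ mX)).
move: e3; rewrite e4 -/F.
rewrite /comp /F in fin *; move: fin; case: (\int[P]_w _)%E => // r _ [h]; congr (_%:E); lra.
Qed.

Lemma kato_small (W : Rd -> R) (e : R) : kato_class P X W -> 0 < e ->
  exists2 t0, 0 < t0 & forall t x, 0 < t -> t < t0 ->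
    (\int[P]_w \int[leb]_(s in `[0%R, t]) `|W (x + X s w)|%:E <= e%:E)%E.
Proof.
move=> [mW /fine_cvgP[[a /= a0 Ha] /cvgrPdist_lt /(_ e)]] H e0.
have [b /= b0' Hb] := H e0.
exists (Num.min a b) => [|t x t0]; first by rewrite lt_min a0 b0'.
rewrite lt_min => /andP[ta tb].
have bt (r : R) : t < r -> ball (0 : R) r t by move=> tr; rewrite /ball /= sub0r normrN gtr0_norm.
have := Ha t (bt a ta) t0; have := Hb t (bt b tb) t0; set S := ereal_sup _ => /= h fS.
apply: (@le_trans _ _ S); first by apply: ereal_sup_ubound; exists x.
rewrite -(fineK fS) lee_fin; move: h; rewrite sub0r normrN => /(le_lt_trans (ler_norm _)) /ltW //.
Qed.

(** The constant [c] absorbs the shift of the potential by the eigenvalue, at a cost linear in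
    [t]. *)
Lemma kato_XI (W g : Rd -> R) (c t e : R) (x : Rd) : 0 <= t -> 0 <= c ->
  measurable_fun setT W -> measurable_fun setT g -> (forall z, 0 <= g z) ->
  (forall z, g z <= `|W z| + c) ->
  (\int[P]_w \int[leb]_(s in `[0%R, t]) `|W (x + X s w)|%:E <= e%:E)%E ->
  (\int[P]_w XI Y g x t w <= (e + c * t)%:E)%E.
Proof.
move=> t0 c0 mW mg g0 gW We; pose aW z := `|W z|.
have maW : measurable_fun setT aW by exact: measurableT_comp.
have aW0 z : 0 <= aW z by exact: normr_ge0.
apply: (@le_trans _ _ (\int[P]_w (XI Y aW x t w + (c * t)%:E))%E).
  apply: ge0_le_integralP => w _; first exact: XI_ge0.
  have -> : (c * t)%:E = (\int[leb]_(u in `[0%R, t]) c%:E)%E.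
    by rewrite integral_cst//= lebesgue_itvcc// subr0.
  rewrite /XI -ge0_integralD; [|exact: measurable_itv| | | |]; last 4 first.
  - by move=> u _; rewrite lee_fin.
  - exact: measurable_funTS (measurable_gX nl maW x w).
  - by move=> u _; rewrite lee_fin.
  - exact: measurable_cst.
  by apply: ge0_le_integralP => u _; rewrite -?EFinD lee_fin.
have ct : 0 <= c * t by rewrite mulr_ge0.
rewrite ge0_integralD; [|exact: measurableT| | | |]; last 4 first.
- by move=> w _; exact: XI_ge0.
- exact: (measurable_XIw nl maW aW0 x t).
- by move=> w _; rewrite lee_fin.
- exact: measurable_cst.
rewrite (P_cst P) EFinD; apply: leeD; last exact: lexx.
apply: le_trans We.
apply: (le_integral_off_null mb b0).
- by move=> w; exact: XI_ge0.
- by move=> w; apply: integral_ge0.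
move=> w gw; rewrite le_eqVlt; apply/orP; left; apply/eqP.
apply: eq_integral => u; rewrite inE/= in_itv/= => /andP[u0 ut].
by rewrite /aW (normalizedE lev).
Qed.

Lemma normalized_abs_cont t (N : set Rd) p : is_transition_density P X p ->
  0 < t -> measurable N -> lebesgue_rV R d N = 0%E -> forall x, P [set w | N (x + Y t w)] = 0%E.
Proof.
move=> dens t0 mN N0 x; have [mp p0 pE] := dens t t0.
have mX : measurable_fun setT (X t) by case: lev => + _ _ _ _; apply; exact: ltW.
rewrite (measure_eq_off_null mb b0 (B := [set w | N (x + X t w)])).
- apply: (etrans (pE x N mN)); apply: null_set_integral => //.
  apply/measurable_EFinP; apply: measurable_funTS; apply: (measurableT_comp mp).
  exact: measurable_funB_rV.
- by rewrite -[X in measurable X]setTI; exact: (measurable_addX nl x t).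
- rewrite -[X in measurable X]setTI.
  exact: (measurable_funD_rV (measurable_cst x) mX).
- by move=> w gw /=; rewrite (normalizedE lev)// ltW.
Qed.

(** Off a null set the integral of [Um] is finite, so [int V = int Up - int Um + c t]: shifting the
    potential by [c] compensates the eigenvalue factor. *)
Lemma normalized_eigen (V phi : Rd -> R) (c t : R) x : measurable_fun setT V ->
  measurable_fun setT phi -> (forall z, 0 <= phi z) -> 0 <= t ->
  let Up := (fun z => V z - c)^\+ in let Um := (fun z => V z - c)^\- in
  (\int[P]_w XI Y Um x t w < +oo)%E ->
  feynman_kac P X V t phi x = (expR (- (c * t)) * phi x)%:E ->
  (\int[P]_w (Wt Y Up Um x t w * (phi (x + Y t w))%:E) = (phi x)%:E)%E.
Proof.
move=> mV mphi phi0 t0 Up Um fin fk.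
have mU : measurable_fun setT (fun z => V z - c) by exact: measurable_funB.
have mUp : measurable_fun setT Up by exact: measurable_funrpos.
have mUm : measurable_fun setT Um by exact: measurable_funrneg.
have Up0 z : 0 <= Up z by exact: funrpos_ge0.
have Um0 z : 0 <= Um z by exact: funrneg_ge0.
have mXI := measurable_XIw nl mUm Um0 x t.
pose N := bad `|` [set w | XI Y Um x t w = +oo%E].
have mNi : measurable [set w | XI Y Um x t w = +oo%E].
  rewrite -[X in measurable X]setTI; exact: (mXI measurableT _ (emeasurable_set1 +oo%E)).
have mN : measurable N by apply: measurableU.
have N0 : P N = 0%E.
  have i : P.-integrable setT (XI Y Um x t).
    apply/integrableP; split => //.
    by under eq_integral do rewrite gee0_abs ?XI_ge0//.
  have := integrable_ae measurableT i; case=> B [mB B0 HB].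
  apply/eqP; rewrite -measure_le0; apply: le_trans (measureU2 _ mb mNi) _.
  rewrite [X in (X + _ <= _)%E](_ : _ = 0%E); last exact: b0.
  rewrite add0e -[leRHS]B0; apply: le_measure; rewrite ?inE// => w /= h; apply: HB => /=.
  by move=> /(_ I); rewrite h.
pose F w := ((expR (- (c * t)))%:E * (Wt Y Up Um x t w * (phi (x + Y t w))%:E))%E.
have W0 w : (0 <= Wt Y Up Um x t w * (phi (x + Y t w))%:E)%E.
  by rewrite mule_ge0 ?Wt_ge0 ?lee_fin.
have F0 w : (0 <= F w)%E by rewrite mule_ge0 ?lee_fin ?expR_ge0.
have FE : (\int[P]_w F w = feynman_kac P X V t phi x)%E.
  apply: (eq_integral_off_null mN N0) => // w.
    by rewrite mule_ge0 ?expeR_ge0 ?lee_fin.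
  move=> /not_orP[gw ninf]; rewrite /F muleA -(normalizedE lev t0 gw); congr (_ * _)%E.
  have mpath (g : Rd -> R) : measurable_fun setT g ->
      measurable_fun setT (fun s : measurableTypeR R => g (x + Y s w)).
    by move=> mg; apply: (measurableT_comp mg); exact: (measurable_addXw nl).
  have UmX : (XI Y Um x t w < +oo)%E by rewrite ltey; apply/eqP.
  have VE s : V (x + Y s w) = Up (x + Y s w) - Um (x + Y s w) + c.
    have := congr1 (fun f => f (x + Y s w)) (funrposBneg (fun z => V z - c)).
    by move=> /= h; rewrite -[LHS](subrK c) -h.
  have := @integral_split R (fun s => V (x + Y s w)) (fun s => Up (x + Y s w)) (fun s => Um (x + Y s w))
    c t (mpath _ mV) (mpath _ mUp) (mpath _ mUm) (fun s => Up0 _) (fun s => Um0 _) VE t0 UmX.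
  rewrite /fk_weight /Wt.
  have -> : (\int[leb]_(s in `[0%R, t]) (V (x + X s w))%:E =
      \int[leb]_(s in `[0%R, t]) (V (x + Y s w))%:E)%E.
    by apply: eq_integral => s; rewrite inE/= in_itv/= => /andP[s0 _]; rewrite (normalizedE lev).
  move=> ->; rewrite -/(XI Y Up x t w) -/(XI Y Um x t w).
  have := XI_ge0 Y Up0 x t w; have := XI_ge0 Y Um0 x t w; move: UmX.
  case: (XI Y Um x t w) => [a| |]//; case: (XI Y Up x t w) => [b| |]//= _ _ _.
    by rewrite -!EFinM -!expRD; congr (_%:E); congr expR; lra.
  by rewrite !mule0.
have mW : measurable_fun setT (fun w => Wt Y Up Um x t w * (phi (x + Y t w))%:E)%E.
  apply: emeasurable_funM; last first.
    by apply/measurable_EFinP; apply: (measurableT_comp mphi); exact: (measurable_addX nl).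
  apply: emeasurable_funM; apply: (measurableT_comp (@measurable_expeR R)) => //.
  exact: (measurableT_comp (@oppe_measurable _ _) (measurable_XIw nl mUp Up0 x t)).
have := FE; rewrite fk /F ge0_integralZl_EFin//.
move=> h; have : ((expR (c * t))%:E * ((expR (- (c * t)))%:E * \int[P]_w (Wt Y Up Um x t w * (phi (x + Y t w))%:E)) =
  (expR (c * t))%:E * (expR (- (c * t)) * phi x)%:E)%E by rewrite h.
by rewrite muleA -!EFinM mulrA -expRD subrr expR0 mul1e mul1r.
Qed.

End transfer.

Lemma sin_multiples_eq0 (R : realType) (a : R) : (forall t, 0 <= t -> sin (t * a) = 0) -> a = 0.
Proof.
move=> sin0; apply/eqP/contraT => a_neq0.
have a0 : 0 < `|a| by rewrite normr_gt0.
have t0 : 0 <= pi / 2 / `|a| :> R by rewrite !divr_ge0 ?pi_ge0// ltW.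
have := sin0 _ t0; have [a1|a1] := ger0P a.
  by rewrite divfK// sin_pihalf => /eqP; rewrite oner_eq0.
by rewrite invrN mulrN mulNr divfK// sinN sin_pihalf => /eqP; rewrite oppr_eq0 oner_eq0.
Qed.

Theorem theorem2p4 (R : realType) (d : nat) (d_ge1 : (1 <= d)%N)
    (disp : measure_display) (Omega : measurableType disp)
    (P : probability Omega R) (X : R -> Omega -> 'rV[R]_d)
    (nu : 'rV[R]_d -> R) (V : 'rV[R]_d -> R)
    (lam : nat -> R) (phi : nat -> 'rV[R]_d -> R) :
  regular_jump_levy_process P X nu ->
  X_kato_potential P X V -> confining V ->
  feynman_kac_eigenbasis P X V lam phi ->
  forall eta : R, 0 <= eta -> 0 < lam 0%N + eta ->
  exists C8 C9 r : R, [/\ 0 < C8, 0 < C9, 0 < r &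
    forall x : 'rV[R]_d, r <= enorm x ->
      (C8%:E * green_operator P X (fun y => V y + eta)%R (eball x 1) (cst 1%R) x
         * (nu x)%:E <= (phi 0%N x)%:E)%E /\
      ((phi 0%N x)%:E <=
       C9%:E * green_operator P X (fun y => V y + eta)%R (eball x 1) (cst 1%R) x
         * (nu x)%:E)%E].
Proof.
move=> [lev [sym [[mnu [M [[M0 M_fin [b [A [_ A_pos LK]]]] Mnu]]] nu_gt0] A11 A12 A13]
  [_ [p dens _]] _] [mV kVm kVloc] conf [_ eig _ cont_bd phi_gt0] eta eta0 beta0.
set beta := lam 0%N + eta in beta0.
set c := lam 0%N.
pose Y := normalized X.
have nl : normalized_levy P Y := normalized_levyP lev.
(* By symmetry the mean of the sine vanishes; its exponential factor is positive, so
   [sin (t * im) = 0] for every [t >= 0], which forces the imaginary exponent to be 0. *)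
have Msym xi : \int[M]_z (dotv xi z * \1_(eball 0 1) z - sin (dotv xi z)) - dotv b xi = 0.
  set im := _ - _.
  have sin0 t : 0 <= t -> sin (t * im) = 0.
    move=> t0; have [_] := LK t xi t0; rewrite (symmetric_mean_sin lev xi sym t0) -/im => -[/eqP].
    by rewrite eq_sym oppr_eq0 mulf_eq0 gt_eqF ?expR_gt0//= => /eqP.
  exact: sin_multiples_eq0 sin0.
have mtrig (f : R -> R) xi : continuous f -> measurable_fun setT (fun z : 'rV[R]_d => f (dotv xi z)).
  move=> cf; apply: (measurableT_comp (f := f)); last exact: measurable_dotv.
  exact: continuous_measurable_fun.
have Ecos (t : R) (xi : 'rV[R]_d) : 0 <= t ->
    \int[P]_w cos (dotv xi (Y t w)) = expR (- (t * levy_symbol M A xi)).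
  move=> t0; rewrite (mean_normalized lev t0 (mtrig _ xi (@continuous_cos R))).
  by have [-> _] := LK t xi t0; rewrite Msym mulr0 cos0 mulr1.
have Esin (t : R) (xi : 'rV[R]_d) : 0 <= t -> \int[P]_w sin (dotv xi (Y t w)) = 0.
  move=> t0; rewrite (mean_normalized lev t0 (mtrig _ xi (@continuous_sin R))).
  by rewrite (symmetric_mean_sin lev xi sym t0).
pose U z := V z - c.
pose Up := U^\+; pose Um := U^\-.
have mU : measurable_fun setT U by exact: measurable_funB.
have mUp : measurable_fun setT Up by exact: measurable_funrpos.
have mUm : measurable_fun setT Um by exact: measurable_funrneg.
have Up0 z : 0 <= Up z by exact: funrpos_ge0.
have Um0 z : 0 <= Um z by exact: funrneg_ge0.
have c_ge0 : 0 <= `|c| by [].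
have cabs : - `|c| <= c <= `|c| by rewrite -ler_norml.
have [t0 t00 Ht0] := kato_small kVm (divr_gt0 ltr01 (ltr0n R 4)).
(* [T + T] stays below the time at which the Kato bound of [V^-] is [1/4], and the shift by [c] adds
   at most another [1/4]. *)
pose T := Num.min (t0 / 4) (8 * (`|c| + 1))^-1.
have c1 : 0 < 8 * (`|c| + 1) by rewrite mulr_gt0// ltr_wpDl.
have T_gt0 : 0 < T by rewrite lt_min divr_gt0// invr_gt0.
have TTt : T + T < t0.
  have : T <= t0 / 4 by rewrite ge_min lexx.
  lra.
have cT : `|c| * (T + T) <= 1 / 4.
  have h : T <= (8 * (`|c| + 1))^-1 by rewrite ge_min lexx orbT.
  have : T * (8 * (`|c| + 1)) <= 1 by rewrite -ler_pdivlMr// div1r.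
  by have := ltW T_gt0; lra.
have UmV z : Um z <= `|V^\- z| + `|c|.
  rewrite ger0_norm ?funrneg_ge0// /Um /funrneg /U ge_max addr_ge0 ?le_max ?lexx ?orbT// andbT.
  have : - V z <= Num.max (- V z) 0 by rewrite le_max lexx.
  by case/andP: cabs; lra.
have UpV z : Up z <= V^\+ z + `|c|.
  rewrite /Up /funrpos /U ge_max addr_ge0 ?le_max ?lexx ?orbT// andbT.
  have : V z <= Num.max (V z) 0 by rewrite le_max lexx.
  by case/andP: cabs; lra.
have kato y : (\int[P]_w XI Y Um y (T + T) w <= (1 / 2)%:E)%E.
  have TT0 : 0 < T + T by rewrite addr_gt0.
  apply: le_trans (kato_XI lev (ltW TT0) c_ge0 (measurable_funrneg mV) mUm Um0 UmV (Ht0 _ y TT0 TTt)) _.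
  by rewrite lee_fin; lra.
have kato_fin y t : (\int[P]_w XI Y Um y t w < +oo)%E.
  exact: (XI_expectation_lt nl mUm Um0 (addr_gt0 T_gt0 T_gt0) kato).
have kato_loc k y : (\int[P]_w XI Y (cut Up k) y (T + T) w < +oo)%E.
  (* The radius [k.+1] is positive also for [k = 0], and the larger ball contains the support of
     [cut Up k]. *)
  have [_ kl] := kVloc; have kB := kl 0 k.+1%:R (ltr0Sn R k).
  have [t1 t10 Ht1] := kato_small kB ltr01.
  have s0 : 0 < t1 / 2 by rewrite divr_gt0.
  have st : t1 / 2 < t1 by lra.
  have mc : measurable_fun setT (cut Up k) by exact: measurable_cut.
  have c0 z : 0 <= cut Up k z by rewrite /cut mulr_ge0.
  have cV z : cut Up k z <= `|V^\+ z * \1_(eball 0 k.+1%:R) z| + `|c|.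
    rewrite /cut !indicE; have [/set_mem zk|_] := boolP (z \in eball 0 k%:R); last first.
      by rewrite mulr0 addr_ge0.
    rewrite [z \in eball 0 k.+1%:R]mem_set; last first.
      by apply: lt_le_trans zk _; rewrite ler_nat.
    by rewrite !mulr1 (ger0_norm (funrpos_ge0 V z)).
  have [mVB _] := kB.
  have bound z := kato_XI lev (ltW s0) c_ge0 mVB mc c0 cV (Ht1 _ z s0 st).
  exact: (XI_expectation_lt nl mc c0 s0 bound).
have [cphi [Mp HMp]] := cont_bd 0%N.
have phiM x : phi 0%N x <= Mp by apply: le_trans (ler_norm _) (HMp x).
have mphi : measurable_fun setT (phi 0%N) by exact: continuous_measurable_rV.
have abs_cont t N t1 mN N0 := normalized_abs_cont lev dens t1 mN N0 : forall x, P [set w | N (x + Y t w)] = 0%E.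
have eig_ae t : 0 < t -> {ae lebesgue_rV R d, forall x,
    (\int[P]_w (Wt Y Up Um x t w * (phi 0%N (x + Y t w))%:E) = (phi 0%N x)%:E)%E}.
  move=> tp; apply: filterS (eig 0%N t tp) => x fk.
  exact: (normalized_eigen lev mV mphi (fun z => ltW (phi_gt0 z)) (ltW tp) (kato_fin x t) fk).
have confine (K : R) : exists r : R, forall x, r <= enorm x -> K <= Up x /\ Um x = 0.
  have [r Hr] := conf (Num.max K 0 + c); exists r => x /Hr; rewrite -lerBrDr -/(U x) ge_max => /andP[KU U0].
  split; first by rewrite /Up /funrpos le_max KU.
  by rewrite /Um /funrneg max_r// oppr_le0.
have [cl [rl [cl0 rl0 lower]]] := ground_state_lower nl M_fin A_pos Ecos Esin d_ge1 mnu nu_gt0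
  M0 Mnu A11 A12 mUp Up0 mUm Um0 cphi phi_gt0 phiM T_gt0 kato kato_loc abs_cont eig_ae beta0 confine.
have [cu [ru [cu0 ru0 upper]]] := ground_state_upper nl M_fin A_pos Ecos Esin d_ge1 mnu nu_gt0
  M0 Mnu A11 A12 A13 mUp Up0 mUm Um0 cphi phi_gt0 phiM T_gt0 kato kato_loc abs_cont eig_ae beta0 confine.
have [r0 Hr0] := confine 0.
have q1 : 0 < 1 - expR (- (beta * T)) by rewrite subr_gt0 -expR0 ltr_expR oppr_lt0 mulr_gt0.
set q := 1 - _ in q1.
(* The factor [q = 1 - exp(-beta T)] pays for replacing the whole lifetime by its part before [T].
   For [|x| >= r0 + 1] one has [V + eta = Up + beta] on the unit ball about [x]. *)
exists (cl * q), cu, (Num.max (Num.max rl ru) (Num.max 1 (r0 + 1))); split => //.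
- by rewrite mulr_gt0.
- by rewrite !lt_max rl0.
move=> x; rewrite !ge_max => /andP[/andP[xl xu] /andP[x1 x0]].
have nux : 0 <= nu x by apply/ltW/(nu_far nu_gt0 ltr01 x1).
have WU y : eball x 1 y -> V y + eta = Up y + beta.
  rewrite /eball /= => yx; have : enorm x <= enorm (y - x) + enorm y.
    have {1}-> : x = - (y - x) + y by rewrite opprB subrK.
    by apply: le_trans (enormD _ _) _; rewrite enormN.
  move=> h; have [|_ Umy] := Hr0 y; first by lra.
  have : Up y - Um y = U y := congr1 (fun f => f y) (funrposBneg U).
  rewrite Umy subr0 => ->.
  by rewrite /U /beta -/c; ring.
split.
- apply: le_trans (lower x xl); apply: lee_wpmul2r => //; rewrite EFinM -muleA.
  apply: lee_wpmul2l; first by rewrite lee_fin ltW.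
  have := green_upper lev mUp Up0 beta0 T_gt0 WU; rewrite -/q => h.
  apply: (@le_trans _ _ (q%:E * ((q^-1)%:E * kgreen P Y Up beta 1 T x))%E).
    by apply: lee_wpmul2l; [rewrite lee_fin ltW|exact: h].
  by rewrite muleA -EFinM mulfV ?gt_eqF// mul1e.
- apply: le_trans (upper x xu) _; apply: lee_wpmul2r => //.
  by apply: lee_wpmul2l; [rewrite lee_fin ltW|exact: (green_lower lev mUp Up0 beta0 T_gt0 WU)].
Qed.
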